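(* Let $0<a<\infty$, $I=(-a,a)$, and let $F$ denote one of $L^p$ ($1\le p\le\infty$) or $C^k$ ($k\in\mathbb{N}_0$). Assume that $q\in F_{loc}(I)$. Then the operator $\mathbf{T}$ given by $\mathbf{T}u(x)=u(x)+\int_{-x}^xK(x,t)u(t)\,dt$, extended to functionals by $\langle\mathbf{T}u,\phi\rangle=\langle u,\mathbf{T}^\square\phi\rangle$, is continuous and invertible on $(W_c^2(I;F))'$ as well as on $(F_c(I))'$. Moreover, $\mathbf{T}$ is a transmutation operator on $(F_c(I))'$: for every $u\in(F_c(I))'$, $$\left(\frac{d^2}{dx^2}-q\right)\mathbf{T}u=\mathbf{T}\frac{d^2}{dx^2}u$$ as elements of $(W_c^2(I;F))'$.
   Context: All functions are complex valued. $F_{loc}(I)$ is the set of functions on $I$ belonging to $F(J)$ for each compact $J\subset I$ (i.e. $L^p_{loc}(I)$ or $C^k(I)$). $F_c(I)$ is the set of functions in $F(I)$ with compact support in $I$, with the inductive limit topology: $\psi_n\to\psi$ in $F_c(I)$ iff there is a compact $J\subset I$ containing the supports of all $\psi_n$ and $\psi_n\to\psi$ in $F(J)$. $W^2(I;F)=\{\phi\in W^{1,1}(I):\phi''\in F(I)\}$; for compact $J\subset I$, $W^2(J;F)$ has norm $\|\phi\|_{W^{1,1}(J)}+\|\phi''\|_{F(J)}$, and $W_c^2(I;F)$ (the compactly supported elements) has the analogous inductive limit topology. A prime denotes the dual space of continuous linear functionals, with pointwise convergence; $(F_c(I))'\subset(W_c^2(I;F))'$ by restriction. For $u\in(F_c(I))'$,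 the functionals $u''$ and $qu$ in $(W^2_c(I;F))'$ are defined by $\langle u'',\phi\rangle=\langle u,\phi''\rangle$ and $\langle qu,\phi\rangle=\langle u,q\phi\rangle$, $\phi\in W_c^2(I;F)$. The kernel $K$: let $H$ be the unique continuous solution of $H(u,v)=\frac12\int_0^uq(s)\,ds+\int_0^u\int_0^vq(\alpha+\beta)H(\alpha,\beta)\,d\beta\,d\alpha$ on $\{(u,v):|u|+|v|<a\}$, and $K(x,t)=H\left(\frac{x+t}2,\frac{x-t}2\right)$ for $(x,t)\in I\times I$. The transpose of $\mathbf{T}$ is, for compactly supported $\psi$, $$\mathbf{T}^\square\psi(x)=\psi(x)-\int_{-a}^{-|x|}K(t,x)\psi(t)\,dt+\int_{|x|}^aK(t,x)\psi(t)\,dt .$$ *)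

(* Defs.v *)
From mathcomp Require Import all_boot all_order all_algebra.
From mathcomp Require Import complex.
From mathcomp Require Import all_classical all_reals all_analysis.

Set Implicit Arguments.
Unset Strict Implicit.
Unset Printing Implicit Defensive.

Import Order.TTheory GRing.Theory Num.Theory.
Import numFieldNormedType.Exports.

Local Open Scope classical_set_scope.
Local Open Scope ring_scope.

(* [R[i]^o] is [R[i]] with the topology given by its own norm. *)

Section ComplexFunctions.
Variable R : realType.
Local Notation C := (complex R).
Local Notation mu := (@lebesgue_measure R).
Implicit Types (D J : set R) (f g : R -> C).

Definition re f : R -> R := fun x => complex.Re (f x).
Definition im f : R -> R := fun x => complex.Im (f x).

(* The norm of [R[i]] takes its (real) values in [R[i]]. *)
Definition cabs (z : C) : R := complex.Re `|z|.

Definition cint D f : C :=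
  Complex (\int[mu]_(x in D) re f x) (\int[mu]_(x in D) im f x).

(* The oriented integral, from [b] to [c]. *)
Definition oint (b c : R) f : C :=
  if b <= c then cint [set` `[b, c]] f else - cint [set` `[c, b]] f.

Definition cmeasurable D f : Prop :=
  measurable_fun D (re f) /\ measurable_fun D (im f).

Definition cLnorm (p : \bar R) D f : \bar R :=
  ('N[mu]_p [EFin \o ((cabs \o f) \_ D)])%E.

Definition inLp (p : \bar R) D f : Prop :=
  cmeasurable D f /\ (cLnorm p D f < +oo)%E.

Definition cderiv f : R -> C := fun x => Complex (derive1 (re f) x) (derive1 (im f) x).

(* [C^k] on an open set [D]. *)
Definition inCk (k : nat) D f : Prop :=
  (forall (j : nat) x, (j < k)%N -> D x ->
     derivable (re (iter j cderiv f)) x 1 /\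
     derivable (im (iter j cderiv f)) x 1) /\
  (forall x, D x -> {for x, continuous (iter k cderiv f : R -> C^o)}).

Definition vanishes_off J f : Prop := forall x, ~ J x -> f x = 0.

(* A function with compact support in [D] is extended by 0 to [R]. *)
Definition compact_support D f : Prop :=
  exists J, [/\ compact J, J `<=` D & vanishes_off J f].

End ComplexFunctions.

Inductive fspace (R : realType) : Type :=
  | Lp (p : \bar R) of (1 <= p)%E
  | Ck of nat.
Arguments Lp {R} p _.
Arguments Ck {R} _.

(* A space of compactly supported functions, with the (semi)norms on functions
   restricted to [J] which define its inductive limit topology.  Elements of
   L^p are represented by functions: a functional continuous for the
   convergence below takes the same value on functions equal a.e. *)
Record test_space (R : realType) := TestSpace {
  test_fun :> set (R -> complex R) ;
  test_norm : set R -> (R -> complex R) -> \bar R }.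

Section Spaces.
Variable R : realType.
Local Notation C := (complex R).
Local Notation mu := (@lebesgue_measure R).
Variables (I : set R) (F : fspace R).
Implicit Types (J : set R) (f g h : R -> C).

(* For [Ck], [D] is an open set. *)
Definition inF (D : set R) f : Prop :=
  match F with Lp p _ => inLp p D f | Ck k => inCk k D f end.

Definition inFloc f : Prop :=
  match F with
  | Lp p _ => forall J, compact J -> J `<=` I -> inLp p J f
  | Ck k => inCk k I f
  end.

(* The maximum starts at 0 so that the C^k norm over an empty [J] is 0. *)
Definition normF J f : \bar R :=
  match F with
  | Lp p _ => cLnorm p J f
  | Ck k => \big[maxe/0%E]_(j < k.+1)
      ereal_sup [set (cabs (iter j (@cderiv R) f x))%:E | x in J]
  end.

Definition Fc : test_space R :=
  TestSpace [set f | inF I f /\ compact_support I f] normF.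

(* [g] is the weak derivative of [f] on [I], tested against C^1_c(I). *)
Definition is_wderiv f g : Prop :=
  forall eta, inCk 1 I eta -> compact_support I eta ->
    cint I (fun x => f x * cderiv eta x) = - cint I (fun x => g x * eta x).

(* First weak derivative (in L^1(I)) and second weak derivative (in F_c(I)):
   choices of a representative, unique up to a null set, and unique
   on [I] for the second one when F is C^k. *)
Definition wderiv f : R -> C :=
  xget (fun=> 0) [set g | inLp 1%E I g /\ is_wderiv f g].

Definition wderiv2 f : R -> C :=
  xget (fun=> 0) [set h | test_fun Fc h /\ is_wderiv (wderiv f) h].

(* Elements of W^{1,1}(I) are taken to be their continuous representatives. *)
Definition inW11 f : Prop :=
  [/\ forall x, I x -> {for x, continuous (f : R -> C^o)},
      inLp 1%E I f
    & exists g, inLp 1%E I g /\ is_wderiv f g].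

Definition inW2 f : Prop :=
  inW11 f /\ exists h, inF I h /\ is_wderiv (wderiv f) h.

Definition normW2 J f : \bar R :=
  (cLnorm 1%E J f + cLnorm 1%E J (wderiv f) + normF J (wderiv2 f))%E.

Definition W2c : test_space R :=
  TestSpace [set f | inW2 f /\ compact_support I f] normW2.

End Spaces.

Section Dual.
Variable R : realType.
Local Notation C := (complex R).
Variables (I : set R) (E : test_space R).

Definition test_cvg (psi : nat -> R -> C) (psi0 : R -> C) : Prop :=
  exists J : set R, [/\ compact J, J `<=` I,
    vanishes_off J psi0, forall n, vanishes_off J (psi n)
  & (fun n => test_norm E J (fun x => psi n x - psi0 x)) @ \oo --> 0%E].

(* The value of a functional at a function; it is 0, by convention, at the
   functions which are not in the test space. *)
Definition pairing (l : E -> C) (f : R -> C) : C := oapp l 0 (insub f).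

Definition linear_functional (l : E -> C) : Prop :=
  forall (c : C) (f g : R -> C), test_fun E f -> test_fun E g ->
    pairing l (fun x => c * f x + g x) = c * pairing l f + pairing l g.

Definition continuous_functional (l : E -> C) : Prop :=
  forall (psi : nat -> R -> C) (psi0 : R -> C),
    (forall n, test_fun E (psi n)) -> test_fun E psi0 -> test_cvg psi psi0 ->
    (fun n => pairing l (psi n) : C^o) @ \oo --> (pairing l psi0 : C^o).

(* The dual of [E], with the topology of pointwise convergence. *)
Definition test_dual : set {ptws E -> C^o} :=
  [set l | linear_functional l /\ continuous_functional l].

Definition continuous_invertible (T : {ptws E -> C^o} -> {ptws E -> C^o}) :
    Prop :=
  [/\ set_fun test_dual test_dual T,
      {within test_dual, continuous T}
    & exists S : {ptws E -> C^o} -> {ptws E -> C^o},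
      [/\ set_fun test_dual test_dual S,
          {within test_dual, continuous S},
          (forall l, test_dual l -> S (T l) = l)
        & (forall l, test_dual l -> T (S l) = l)]].

(* The functional defined by the function [f]. *)
Definition regular (f : R -> C) : {ptws E -> C^o} :=
  fun phi => cint I (fun x => f x * val phi x).

End Dual.
Arguments test_dual {R} I E.
Arguments regular {R} I {E}.

Section Transmutation.
Variable R : realType.
Local Notation C := (complex R).

Definition goursat_domain (a : R) : set (R * R) :=
  [set p | `|p.1| + `|p.2| < a].

Definition goursat_solution (a : R) (q : R -> C) (H : R * R -> C) : Prop :=
  (forall p, goursat_domain a p ->
     {for p, continuous (H : R * R -> C^o)}) /\
  (forall u v, goursat_domain a (u, v) ->
     H (u, v) = 2^-1 * oint 0 u q +
       oint 0 u (fun al => oint 0 v (fun be => q (al + be) * H (al, be)))).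

Definition kernel_of (H : R * R -> C) (x t : R) : C :=
  H ((x + t) / 2, (x - t) / 2).

Definition transmut (K : R -> R -> C) (u : R -> C) : R -> C :=
  fun x => u x + oint (- x) x (fun t => K x t * u t).

Definition transmutT (a : R) (K : R -> R -> C) (psi : R -> C) : R -> C :=
  fun x => psi x - oint (- a) (- `|x|) (fun t => K t x * psi t)
                 + oint `|x| a (fun t => K t x * psi t).

Definition transmut_dual (a : R) (K : R -> R -> C) (E : test_space R)
    (l : {ptws E -> C^o}) : {ptws E -> C^o} :=
  fun phi => pairing l (transmutT a K (val phi)).

(* [transmut_dual] makes sense on functionals on [E], and extends [transmut]. *)
Definition extends_to_functionals (a : R) (K : R -> R -> C) (I : set R)
    (E : test_space R) : Prop :=
  (forall phi, test_fun E phi -> test_fun E (transmutT a K phi)) /\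
  (forall f : R -> C,
     (forall J, compact J -> J `<=` I -> inLp 1%E J f) ->
     (forall phi, test_fun E phi -> inLp 1%E I (fun x => f x * phi x)) ->
     transmut_dual a K (regular I f) = regular I (transmut K f)
       :> {ptws E -> C^o}).

Definition dual_deriv2 (I : set R) (F : fspace R) (u : {ptws Fc I F -> C^o}) :
    {ptws W2c I F -> C^o} :=
  fun phi => pairing u (wderiv2 I F (val phi)).

Definition dual_mul (I : set R) (F : fspace R) (q : R -> C)
    (u : {ptws Fc I F -> C^o}) : {ptws W2c I F -> C^o} :=
  fun phi => pairing u (fun x => q x * val phi x).

End Transmutation.

(* Main.v *)
(* On functions supported in [-b, b], b < a, the operator and its transpose are
   the identity plus integral operators whose kernels are bounded and live on
   |t| <= |x| <= b.  Such operators are contractions of a weighted L^1, so the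
   transpose T' is invertible on L^1 functions supported in [-b, b].

   Goursat's equation, in d'Alembert form, gives (Tu)'' = T u'' + q Tu in
   integrated form for u affine plus a double primitive.  Testing T' against
   such u, and against the u obtained by solving a Volterra equation, shows
   that if phi = (|x|/2) * h with h supported in [-b, b] and orthogonal to the
   affine functions, then (T' phi)'' = T' (h - q phi), and that conversely
   phi = T' psi and h = T' m force psi'' = m + q psi.  By the lemma of
   du Bois-Reymond these phi are exactly the elements of W^2_c supported in
   [-b, b], with h = phi'', so T' and its inverse preserve W^2_c.

   The L^p bounds for T' and its inverse follow from the L^1 bound, because the
   integral part maps L^1 to bounded functions; the C^k bounds are direct for
   k <= 1 and follow from the formula for (T' phi)'' by induction in steps of 2.
   All statements on functionals are then transposed. *)

Require Import Defs.
From mathcomp Require Import all_boot all_order all_algebra.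
From mathcomp Require Import complex.
From mathcomp Require Import all_classical all_reals all_analysis.
From mathcomp Require Import measurable_realfun ess_sup_inf ring lra.

Set Implicit Arguments.
Unset Strict Implicit.
Unset Printing Implicit Defensive.

Import Order.TTheory GRing.Theory Num.Theory.
Import numFieldNormedType.Exports.

Local Open Scope classical_set_scope.
Local Open Scope complex_scope.
Local Open Scope ring_scope.

(** Since [q] may be no better than integrable, the kernel is merely continuous and its wave
    equation cannot be differentiated. The relation between T and the second derivative is therefore
    kept as an integral identity, and the second derivative of [T' phi] is read off from pairings
    rather than from a formula. A second obstacle is that nothing is controlled up to the ends of
    [I]. All estimates are made on one ball at a time, with [q] cut off outside [[-b, b]] and the
    kernel extended by constants, so that every integral runs over the whole line with an indicator
    in the integrand. This suffices because convergence of test functions takes place in a fixed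
    compact set: constants may depend on [b]. Equations obtained almost everywhere are made exact by
    the fact that integral operators do not see null sets and that the transposed ones produce
    continuous functions. The C^k recursion gains two derivatives at once, so it cannot start from
    C^0 alone; for k = 1 the derivative of the kernel in its second variable is extracted from
    Goursat's equation, which is possible as [q] is then continuous. *)

Local Notation "'ind' b" := ((nat_of_bool b)%:R) (at level 10, b at level 9).

(** * Complex numbers and integrals *)

Section ComplexNumbers.
Variable R : realType.
Local Notation C := (complex R).
Implicit Types (z w : C) (x y : R).

Lemma cplxP z w : complex.Re z = complex.Re w -> complex.Im z = complex.Im w -> z = w.
Proof. by case: z w => a b [c d] /= -> ->. Qed.

Lemma cReD z w : complex.Re (z + w) = complex.Re z + complex.Re w.
Proof. by case: z w => a b [c d]. Qed.
Lemma cImD z w : complex.Im (z + w) = complex.Im z + complex.Im w.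
Proof. by case: z w => a b [c d]. Qed.
Lemma cReN z : complex.Re (- z) = - complex.Re z. Proof. by case: z. Qed.
Lemma cImN z : complex.Im (- z) = - complex.Im z. Proof. by case: z. Qed.
Lemma cReM z w : complex.Re (z * w) =
  complex.Re z * complex.Re w - complex.Im z * complex.Im w.
Proof. by case: z w => a b [c d]. Qed.
Lemma cImM z w : complex.Im (z * w) =
  complex.Re z * complex.Im w + complex.Im z * complex.Re w.
Proof. by case: z w => a b [c d]. Qed.

Lemma cRe_real x : complex.Re (x%:C : C) = x. Proof. by []. Qed.
Lemma cIm_real x : complex.Im (x%:C : C) = 0. Proof. by []. Qed.

Definition CplxE := (cReD, cImD, cReN, cImN, cReM, cImM, cRe_real, cIm_real).

Lemma realC_inv2 : (2^-1 : C) = (2^-1 : R)%:C.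
Proof.
by rewrite -[RHS]/((@real_complex R) _) fmorphV rmorph_nat.
Qed.

Lemma cabsE z : cabs z = Num.sqrt (complex.Re z ^+ 2 + complex.Im z ^+ 2).
Proof. by case: z. Qed.

Lemma normC_cabs z : `|z| = (cabs z)%:C.
Proof. by apply: cplxP => //; rewrite cabsE normc_def. Qed.

Lemma cabs_ge0 z : 0 <= cabs z. Proof. by rewrite cabsE sqrtr_ge0. Qed.

Lemma cabsM z w : cabs (z * w) = cabs z * cabs w.
Proof. by rewrite /cabs normrM !normC_cabs /= mulr0 subr0. Qed.

Lemma cabsD z w : cabs (z + w) <= cabs z + cabs w.
Proof. by have := ler_normD z w; rewrite !normC_cabs -rmorphD lecR. Qed.

Lemma cabsN z : cabs (- z) = cabs z. Proof. by rewrite /cabs normrN. Qed.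

Lemma cabsB z w : cabs (z - w) <= cabs z + cabs w.
Proof. by rewrite -[cabs w]cabsN; exact: cabsD. Qed.

Lemma cabs0 : cabs (0 : C) = 0. Proof. by rewrite /cabs normr0. Qed.

Lemma cabs_eq0 z : (cabs z == 0) = (z == 0).
Proof. by rewrite -(normr_eq0 z) normC_cabs fmorph_eq0. Qed.

Lemma cabs_real x : cabs (x%:C : C) = `|x|.
Proof. by rewrite cabsE /= expr0n addr0 sqrtr_sqr. Qed.

Lemma natC n : (n%:R : C) = (n%:R : R)%:C. Proof. by rewrite rmorph_nat. Qed.

Lemma cabs_nat n : cabs (n%:R : C) = n%:R.
Proof. by rewrite natC cabs_real ger0_norm. Qed.

Lemma normRe_le z : `|complex.Re z| <= cabs z.
Proof. by rewrite cabsE -sqrtr_sqr ler_wsqrtr // lerDl sqr_ge0. Qed.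

Lemma normIm_le z : `|complex.Im z| <= cabs z.
Proof. by rewrite cabsE -sqrtr_sqr ler_wsqrtr // lerDr sqr_ge0. Qed.

Lemma cabs_leD z : cabs z <= `|complex.Re z| + `|complex.Im z|.
Proof.
rewrite cabsE -(@ler_pXn2r _ 2) ?nnegrE ?sqrtr_ge0 ?addr_ge0 //.
rewrite sqr_sqrtr ?addr_ge0 ?sqr_ge0 //.
rewrite -(real_normK (num_real (complex.Re z))) -(real_normK (num_real (complex.Im z))).
have := normr_ge0 (complex.Re z); have := normr_ge0 (complex.Im z); nra.
Qed.

Lemma cvgC_split (T : Type) (F : set_system T) {FF : Filter F} (f : T -> C) z :
  ((f : T -> C^o) @ F --> (z : C^o)) <->
  ((fun t => complex.Re (f t)) @ F --> complex.Re z /\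
   (fun t => complex.Im (f t)) @ F --> complex.Im z).
Proof.
split=> [/cvgrPdist_lt h|[/cvgrPdist_lt hr /cvgrPdist_lt hi]].
  split; apply/cvgrPdist_lt => e e0.
    have := h (e%:C); rewrite ltcR => /(_ e0); apply: filterS => t.
    rewrite normC_cabs ltcR -cReN -cReD; exact/le_lt_trans/normRe_le.
  have := h (e%:C); rewrite ltcR => /(_ e0); apply: filterS => t.
  rewrite normC_cabs ltcR -cImN -cImD; exact/le_lt_trans/normIm_le.
apply/cvgrPdist_lt => e e0.
(* In the order of [R[i]] a positive element is real, so the complex radius [e] can be replaced by
   its real part. *)
have [er0 eE] : 0 < complex.Re e /\ e = (complex.Re e)%:C.
  by case: e e0 => x y; rewrite ltcE /= => /andP[/eqP -> ?].
have e2 : 0 < complex.Re e / 2 by rewrite divr_gt0.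
apply: filterS (filterI (hr _ e2) (hi _ e2)) => t /= [h1 h2].
rewrite eE normC_cabs ltcR; apply: le_lt_trans (cabs_leD _) _.
by rewrite !CplxE [ltRHS]splitr ltrD.
Qed.

End ComplexNumbers.

(** * Measurability of complex-valued functions *)

Section ComplexMeasurable.
Context {R : realType} {d : measure_display} {T : measurableType d}.
Local Notation C := (complex R).
Local Notation mu := (@lebesgue_measure R).
Implicit Types f g : T -> C.

(** Stated on an arbitrary measurable type, unlike [cmeasurable], so that it also covers kernels on
    [R * R] for Fubini's theorem. *)
Definition cmf f : Prop :=
  measurable_fun setT (fun x => complex.Re (f x)) /\
  measurable_fun setT (fun x => complex.Im (f x)).

Lemma cmf_cst (z : C) : cmf (fun=> z).
Proof. by split; exact: measurable_cst. Qed.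

Lemma cmfD f g : cmf f -> cmf g -> cmf (fun x => f x + g x).
Proof.
move=> [f1 f2] [g1 g2]; split.
  by under eq_fun do rewrite cReD; exact: measurable_funD.
by under eq_fun do rewrite cImD; exact: measurable_funD.
Qed.

Lemma cmfN f : cmf f -> cmf (fun x => - f x).
Proof.
move=> [f1 f2]; split.
  by under eq_fun do rewrite cReN; exact: measurableT_comp.
by under eq_fun do rewrite cImN; exact: measurableT_comp.
Qed.

Lemma cmfB f g : cmf f -> cmf g -> cmf (fun x => f x - g x).
Proof. by move=> hf hg; apply: cmfD => //; exact: cmfN. Qed.

Lemma cmfM f g : cmf f -> cmf g -> cmf (fun x => f x * g x).
Proof.
move=> [f1 f2] [g1 g2]; split.
  by under eq_fun do rewrite cReM; apply: measurable_funB; exact: measurable_funM.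
by under eq_fun do rewrite cImM; apply: measurable_funD; exact: measurable_funM.
Qed.

Lemma cmf_realC (f : T -> R) : measurable_fun setT f -> cmf (fun x => (f x)%:C).
Proof. by move=> mf; split => //=; exact: measurable_cst. Qed.

Lemma measurable_bool_nat (b : T -> bool) : measurable_fun setT b ->
  measurable_fun setT (fun x => (b x)%:R : R).
Proof.
move=> mb; have -> : (fun x => (b x)%:R : R) = (fun x => if b x then 1 else 0).
  by apply/funext => x; case: (b x).
by apply: measurable_fun_ifT => //; exact: measurable_cst.
Qed.

Lemma cmf_bool (b : T -> bool) : measurable_fun setT b ->
  cmf (fun x => (b x)%:R).
Proof.
move=> mb; under eq_fun do rewrite natC.
by apply: cmf_realC; exact: measurable_bool_nat.
Qed.

Lemma cmf_cabs f : cmf f -> measurable_fun setT (fun x => cabs (f x)).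
Proof.
move=> [f1 f2]; under eq_fun do rewrite cabsE.
apply: (@measurableT_comp _ _ _ _ _ _ (@Num.sqrt R)).
  by apply: continuous_measurable_fun; exact: sqrt_continuous.
by apply: measurable_funD; exact: measurable_funX.
Qed.

Lemma cmf_lim (fn : nat -> T -> C) f : (forall n, cmf (fn n)) ->
  (forall x, (fun n => fn n x : C^o) @ \oo --> (f x : C^o)) -> cmf f.
Proof.
move=> mfn h; split.
  apply: (@measurable_fun_cvg _ _ _ _ (fun n x => complex.Re (fn n x))).
    by move=> n; case: (mfn n).
  by move=> x _; have /cvgC_split[] := h x.
apply: (@measurable_fun_cvg _ _ _ _ (fun n x => complex.Im (fn n x))).
  by move=> n; case: (mfn n).
by move=> x _; have /cvgC_split[] := h x.
Qed.

End ComplexMeasurable.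

Lemma cmf_comp {R : realType} {d d' : measure_display} {T : measurableType d}
    {T' : measurableType d'} (f : T' -> complex R) (g : T -> T') :
  cmf f -> measurable_fun setT g -> cmf (fun x => f (g x)).
Proof.
move=> [f1 f2] mg; split; first exact: (measurableT_comp f1 mg).
exact: (measurableT_comp f2 mg).
Qed.

Section MeasurableIntegral.
Context {R : realType} {d : measure_display} {T : measurableType d}.
Local Notation C := (complex R).
Local Notation mu := (@lebesgue_measure R).

(** The real integral is [fine] of a difference of two nonnegative integrals, each measurable in the
    parameter by Tonelli; slices that are not integrable still get a measurable value. *)
Lemma measurable_fun_Rintegral (f : T * R -> R) : measurable_fun setT f ->
  measurable_fun setT (fun x => \int[mu]_y f (x, y)).
Proof.
move=> mf; apply: (@measurableT_comp _ _ _ _ _ _ (@fine R)) => //.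
have mE : measurable_fun setT (EFin \o f) by exact/measurable_EFinP.
under eq_fun do rewrite integralE.
apply: emeasurable_funB.
  have := measurable_fun_fubini_tonelli_F (m2 := mu) (EFin \o f)^\+%E
    (measurable_funepos mE) (funepos_ge0 _).
  congr measurable_fun; apply/funext => x; apply: eq_integral => y _.
  by rewrite !funeposE.
have := measurable_fun_fubini_tonelli_F (m2 := mu) (EFin \o f)^\-%E
  (measurable_funeneg mE) (funeneg_ge0 _).
congr measurable_fun; apply/funext => x; apply: eq_integral => y _.
by rewrite !funenegE.
Qed.

(** All integrals are taken over the whole line, and intervals enter as factors [ind (...)]:
    linearity, Fubini and changes of variable are then stated once. *)
Definition Int (f : R -> C) : C := cint setT f.

Lemma cmf_Int (f : T -> R -> C) : cmf (fun p : T * R => f p.1 p.2) ->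
  cmf (fun x => Int (f x)).
Proof.
move=> [f1 f2]; split => /=.
  exact: (measurable_fun_Rintegral f1).
exact: (measurable_fun_Rintegral f2).
Qed.

End MeasurableIntegral.

(** * Integrable complex functions on the line *)

Section ComplexIntegral.
Context {R : realType}.
Local Notation C := (complex R).
Local Notation mu := (@lebesgue_measure R).
Implicit Types f g : R -> C.

Lemma aeS (P Q : R -> Prop) : (forall x, P x -> Q x) ->
  {ae mu, forall x, P x} -> {ae mu, forall x, Q x}.
Proof. by move=> h; apply: (@filterS _ _ (ae_filter_ringOfSetsType mu)) => x; exact: h. Qed.

Lemma aeI (P Q : R -> Prop) :
  {ae mu, forall x, P x} -> {ae mu, forall x, Q x} -> {ae mu, forall x, P x /\ Q x}.
Proof. by move=> hP hQ; exact: (@filterI _ _ (ae_filter_ringOfSetsType mu)). Qed.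

Lemma aeT (P : R -> Prop) : (forall x, P x) -> {ae mu, forall x, P x}.
Proof. by move=> h; apply: (@filterE _ _ (ae_filter_ringOfSetsType mu)). Qed.

Definition rL1 (f : R -> R) : Prop := mu.-integrable setT (EFin \o f).

Definition L1 f := rL1 (re f) /\ rL1 (im f).

Lemma rL1_dom (f g : R -> R) : measurable_fun setT f ->
  (forall x, `|f x| <= g x) -> rL1 g -> rL1 f.
Proof.
move=> mf h ig; apply: (le_integrable _ _ _ ig) => //.
  exact/measurable_EFinP.
by move=> x _ /=; rewrite lee_fin (le_trans (h x)) ?ler_norm.
Qed.

Lemma rL1_meas (f : R -> R) : rL1 f -> measurable_fun setT f.
Proof. by move=> /measurable_int /measurable_EFinP. Qed.

Lemma rL1D (f g : R -> R) : rL1 f -> rL1 g -> rL1 (fun x => f x + g x).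
Proof. by move=> hf hg; exact: (integrableD measurableT hf hg). Qed.

Lemma rL1B (f g : R -> R) : rL1 f -> rL1 g -> rL1 (fun x => f x - g x).
Proof. by move=> hf hg; exact: (integrableB measurableT hf hg). Qed.

Lemma rL1Z (c : R) (f : R -> R) : rL1 f -> rL1 (fun x => c * f x).
Proof. by move=> hf; exact: (integrableZl measurableT _ hf). Qed.

Lemma rL1_norm (f : R -> R) : rL1 f -> rL1 (fun x => `|f x|).
Proof. by move=> /integrable_abse. Qed.

Lemma L1_cmf f : L1 f -> cmf f.
Proof. by move=> [/rL1_meas ? /rL1_meas]. Qed.

Lemma L1_dom f (g : R -> R) : cmf f -> (forall x, cabs (f x) <= g x) ->
  rL1 g -> L1 f.
Proof.
move=> [f1 f2] h ig; split.
  by apply: rL1_dom ig => // x; apply: le_trans (h x); exact: normRe_le.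
by apply: rL1_dom ig => // x; apply: le_trans (h x); exact: normIm_le.
Qed.

Lemma L1_cabs f : L1 f -> rL1 (fun x => cabs (f x)).
Proof.
move=> hf; have [h1 h2] := hf.
apply: (@rL1_dom _ (fun x => `|re f x| + `|im f x|)).
- exact/cmf_cabs/L1_cmf.
- by move=> x; rewrite ger0_norm ?cabs_ge0 // cabs_leD.
- by apply: rL1D; exact: rL1_norm.
Qed.

Lemma L1P f : L1 f <-> cmf f /\ rL1 (fun x => cabs (f x)).
Proof.
split=> [h|[h1 h2]]; first by split; [exact: L1_cmf|exact: L1_cabs].
exact: L1_dom h2.
Qed.

Lemma L1D f g : L1 f -> L1 g -> L1 (fun x => f x + g x).
Proof.
move=> hf hg; apply: (@L1_dom _ (fun x => cabs (f x) + cabs (g x))).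
- by apply: cmfD; exact: L1_cmf.
- by move=> x; exact: cabsD.
- by apply: rL1D; exact: L1_cabs.
Qed.

Lemma L1Mb f g (M : R) : cmf f -> (forall x, cabs (f x) <= M) -> L1 g ->
  L1 (fun x => f x * g x).
Proof.
move=> hf hM hg; apply: (@L1_dom _ (fun x => M * cabs (g x))).
- by apply: cmfM => //; exact: L1_cmf.
- by move=> x; rewrite cabsM ler_wpM2r ?cabs_ge0.
- by apply: rL1Z; exact: L1_cabs.
Qed.

Lemma L1Z (c : C) f : L1 f -> L1 (fun x => c * f x).
Proof. by move=> hf; apply: (@L1Mb _ _ (cabs c)) => //; exact: cmf_cst. Qed.

Lemma L1N f : L1 f -> L1 (fun x => - f x).
Proof. by move=> /(L1Z (-1)); under eq_fun do rewrite mulN1r. Qed.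

Lemma L1B f g : L1 f -> L1 g -> L1 (fun x => f x - g x).
Proof. by move=> hf hg; apply: L1D => //; exact: L1N. Qed.

Lemma L1_0 : L1 (fun=> 0).
Proof. by split; exact: integrable0. Qed.

Lemma L1bool f (b : R -> bool) : measurable_fun setT b -> L1 f ->
  L1 (fun x => (b x)%:R * f x).
Proof.
move=> mb; apply: (@L1Mb _ _ 1); first exact: cmf_bool.
by move=> x; rewrite cabs_nat; case: (b x).
Qed.

Lemma RintD (f g : R -> R) : rL1 f -> rL1 g ->
  \int[mu]_x (f x + g x) = \int[mu]_x f x + \int[mu]_x g x.
Proof. by move=> hf hg; rewrite RintegralD. Qed.

Lemma RintB (f g : R -> R) : rL1 f -> rL1 g ->
  \int[mu]_x (f x - g x) = \int[mu]_x f x - \int[mu]_x g x.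
Proof. by move=> hf hg; rewrite RintegralB. Qed.

Lemma RintZ (c : R) (f : R -> R) : rL1 f ->
  \int[mu]_x (c * f x) = c * \int[mu]_x f x.
Proof. by move=> hf; rewrite RintegralZl. Qed.

Lemma Rint_le (f g : R -> R) : rL1 f -> rL1 g -> (forall x, f x <= g x) ->
  \int[mu]_x f x <= \int[mu]_x g x.
Proof. by move=> hf hg h; apply: le_Rintegral. Qed.

Lemma Rint_ae (f g : R -> R) : measurable_fun setT f -> measurable_fun setT g ->
  {ae mu, forall x, f x = g x} -> \int[mu]_x f x = \int[mu]_x g x.
Proof.
move=> hf hg h; congr fine; apply: ae_eq_integral => //; try exact/measurable_EFinP.
by apply: aeS h => x hx _ /=; rewrite hx.
Qed.

Lemma IntD f g : L1 f -> L1 g -> Int (fun x => f x + g x) = Int f + Int g.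
Proof.
move=> [f1 f2] [g1 g2]; apply: cplxP; rewrite !CplxE /= /re /im.
  by rewrite -RintD //; apply: eq_Rintegral => x _; rewrite cReD.
by rewrite -RintD //; apply: eq_Rintegral => x _; rewrite cImD.
Qed.

Lemma IntZ (c : C) f : L1 f -> Int (fun x => c * f x) = c * Int f.
Proof.
move=> [f1 f2]; apply: cplxP; rewrite !CplxE /= /re /im.
  rewrite -!RintZ // -RintB; try exact: rL1Z.
  by apply: eq_Rintegral => x _; rewrite cReM.
rewrite -!RintZ // -RintD; try exact: rL1Z.
by apply: eq_Rintegral => x _; rewrite cImM.
Qed.

Lemma IntZr (c : C) f : L1 f -> Int (fun x => f x * c) = Int f * c.
Proof. by move=> hf; under eq_fun do rewrite mulrC; rewrite IntZ // mulrC. Qed.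

Lemma IntN f : L1 f -> Int (fun x => - f x) = - Int f.
Proof.
by move=> hf; rewrite -mulN1r -IntZ //; congr Int; apply/funext => x; rewrite mulN1r.
Qed.

Lemma IntB f g : L1 f -> L1 g -> Int (fun x => f x - g x) = Int f - Int g.
Proof. by move=> hf hg; rewrite IntD ?IntN //; exact: L1N. Qed.

Lemma Int0 : Int (fun=> 0 : C) = 0.
Proof. by apply: cplxP; rewrite /= /re /im /= Rintegral_cst // mul0r. Qed.

Lemma Int_ae f g : cmf f -> cmf g -> {ae mu, forall x, f x = g x} -> Int f = Int g.
Proof.
move=> [f1 f2] [g1 g2] h; apply: cplxP; apply: Rint_ae => //.
  by apply: aeS h => x; rewrite /re => ->.
by apply: aeS h => x; rewrite /im => ->.
Qed.

(** Multiplying by the unimodular [u] that makes the integral real and nonnegative, then comparing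
    real parts, gives the sharp constant 1; estimating real and imaginary parts separately would
    not. *)
Lemma cabs_Int f : L1 f -> cabs (Int f) <= \int[mu]_x cabs (f x).
Proof.
move=> hf; set z := Int f; have [->|z0] := eqVneq z 0.
  by rewrite cabs0; apply: Rintegral_ge0 => x _; exact: cabs_ge0.
have cz : cabs z != 0 by rewrite cabs_eq0.
pose u := z^* / (cabs z)%:C.
have u1 : cabs u = 1.
  apply: (@complexI R); rewrite -normC_cabs normrM normfV norm_conjC [`|z|]normC_cabs.
  by rewrite [`|_%:C|]normC_cabs cabs_real ger0_norm ?cabs_ge0 // divff // fmorph_eq0.
have uz : u * z = (cabs z)%:C.
  rewrite /u mulrAC -normCKC normC_cabs expr2 mulfK //.
  by rewrite fmorph_eq0.
have -> : cabs z = complex.Re (Int (fun x => u * f x)) by rewrite IntZ // uz.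
apply: Rint_le; first by case: (L1Z u hf).
  exact: L1_cabs.
move=> x; apply: le_trans (ler_norm _) _; apply: le_trans (normRe_le _) _.
by rewrite cabsM u1 mul1r.
Qed.

Lemma cintE (D : set R) f : cint D f = Int (fun x => (x \in D)%:R * f x).
Proof.
apply: cplxP; rewrite /= Rintegral_mkcond; apply: eq_Rintegral => x _.
  rewrite /re /restrict /patch natC; case: ifP => _; first by rewrite mul1r.
  by rewrite mul0r.
rewrite /im /restrict /patch natC; case: ifP => _; first by rewrite mul1r.
by rewrite mul0r.
Qed.

End ComplexIntegral.

Section MeasurabilityRules.
Context {R : realType} {d : measure_display} {T : measurableType d}.
Local Notation C := (complex R).
Implicit Types f g : T -> R.

Lemma measD f g : measurable_fun setT f -> measurable_fun setT g ->
  measurable_fun setT (fun x => f x + g x).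
Proof. exact: measurable_funD. Qed.

Lemma measN f : measurable_fun setT f -> measurable_fun setT (fun x => - f x).
Proof. exact: measurable_funN. Qed.

Lemma measM f g : measurable_fun setT f -> measurable_fun setT g ->
  measurable_fun setT (fun x => f x * g x).
Proof. exact: measurable_funM. Qed.

Lemma meas_norm f : measurable_fun setT f -> measurable_fun setT (fun x => `|f x|).
Proof. exact: measurableT_comp. Qed.

Lemma meas_comp {d'} {T' : measurableType d'} (f : T' -> R) (g : T -> T') :
  measurable_fun setT f -> measurable_fun setT g ->
  measurable_fun setT (fun x => f (g x)).
Proof. exact: measurableT_comp. Qed.

Lemma meas_le f g : measurable_fun setT f -> measurable_fun setT g ->
  measurable_fun setT (fun x => f x <= g x).
Proof. exact: measurable_fun_ler. Qed.

Lemma meas_lt f g : measurable_fun setT f -> measurable_fun setT g ->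
  measurable_fun setT (fun x => f x < g x).
Proof. exact: measurable_fun_ltr. Qed.

Lemma meas_and (b c : T -> bool) : measurable_fun setT b -> measurable_fun setT c ->
  measurable_fun setT (fun x => b x && c x).
Proof. exact: measurable_and. Qed.

Lemma meas_not (b : T -> bool) : measurable_fun setT b ->
  measurable_fun setT (fun x => ~~ b x).
Proof. exact: measurable_neg. Qed.

Lemma meas_if (b : T -> bool) f g : measurable_fun setT b ->
  measurable_fun setT f -> measurable_fun setT g ->
  measurable_fun setT (fun x => if b x then f x else g x).
Proof. exact: measurable_fun_ifT. Qed.

Lemma cmf_comp2 (k : R -> R -> C) f g : cmf (fun p : R * R => k p.1 p.2) ->
  measurable_fun setT f -> measurable_fun setT g -> cmf (fun x => k (f x) (g x)).
Proof.
move=> hk mf mg; apply: (cmf_comp (g := fun x => (f x, g x)) hk).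
exact: measurable_fun_pair.
Qed.

Lemma meas_comp2 (k : R -> R -> R) f g : measurable_fun setT (fun p : R * R => k p.1 p.2) ->
  measurable_fun setT f -> measurable_fun setT g ->
  measurable_fun setT (fun x => k (f x) (g x)).
Proof.
move=> hk mf mg; apply: (meas_comp (g := fun x => (f x, g x)) hk).
exact: measurable_fun_pair.
Qed.

End MeasurabilityRules.

(** The head symbol of the goal selects the rule; hypotheses on kernels of two variables are
    composed with whatever functions stand in the two arguments. *)
Ltac meas1 :=
  match goal with
  | H : ?P |- ?P => exact H
  | H : L1 ?f |- cmf ?f => exact (L1_cmf H)
  | H : rL1 ?f |- measurable_fun _ ?f => exact (rL1_meas H)
  | H : measurable_fun _ ?f |- measurable_fun _ ?f => exact H
  | H : measurable_fun _ _ |- measurable_fun _ (?k ?x) =>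
      exact: (meas_comp2 (k := k) H (measurable_cst x) (@measurable_id _ _ setT))
  | H : cmf _ |- cmf (?k ?x) =>
      exact: (cmf_comp2 (k := k) H (measurable_cst x) (@measurable_id _ _ setT))
  | |- measurable_fun _ (fun x => Num.max (@?f x) (@?g x)) => apply: measurable_maxr
  | |- measurable_fun _ (fun x => Num.min (@?f x) (@?g x)) => apply: measurable_minr
  | |- cmf (fun _ => ?z) => exact (cmf_cst z)
  | |- measurable_fun _ (fun _ => ?z) => exact (measurable_cst z)
  | |- measurable_fun _ (fun x => x) => exact: measurable_id
  | |- measurable_fun _ (fun p => p.1) => exact: measurable_fst
  | |- measurable_fun _ (fun p => p.2) => exact: measurable_snd
  | |- measurable_fun _ (fun p => (@?f p).1) => apply: (measurableT_comp (f := fst))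
  | |- measurable_fun _ (fun p => (@?f p).2) => apply: (measurableT_comp (f := snd))
  | |- measurable_fun _ fst => exact: measurable_fst
  | |- measurable_fun _ snd => exact: measurable_snd
  | |- measurable_fun _ (fun x => - (@?f x)) => apply: measN
  | |- measurable_fun _ (fun x => (@?f x) + (@?g x)) => apply: measD
  | |- measurable_fun _ (fun x => (@?f x) * (@?g x)) => apply: measM
  | |- measurable_fun _ (fun x => @Order.le _ _ (@?f x) (@?g x)) => apply: meas_le
  | |- measurable_fun _ (fun x => @Order.lt _ _ (@?f x) (@?g x)) => apply: meas_lt
  | |- measurable_fun _ (@GRing.opp _) => exact: (measN (@measurable_id _ _ setT))
  | |- measurable_fun _ (@Num.norm _ _) => exact: (meas_norm (@measurable_id _ _ setT))
  | |- measurable_fun _ (@Order.le _ _ ?u) => exact: (meas_le (measurable_cst u) (@measurable_id _ _ setT))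
  | |- measurable_fun _ (@Order.lt _ _ ?u) => exact: (meas_lt (measurable_cst u) (@measurable_id _ _ setT))
  | |- measurable_fun _ (fun x => (@?f x) && (@?g x)) => apply: meas_and
  | |- measurable_fun _ (fun x => ~~ (@?f x)) => apply: meas_not
  | |- measurable_fun _ (fun x => `|(@?f x)|) => apply: meas_norm
  | |- measurable_fun _ (fun x => @GRing.natmul _ _ (nat_of_bool (@?f x))) => apply: measurable_bool_nat
  | |- measurable_fun _ (fun x => cabs (@?f x)) => apply: cmf_cabs
  | |- cmf (fun x => (@?f x) + (@?g x)) => apply: cmfD
  | |- cmf (fun x => (@?f x) * (@?g x)) => apply: cmfM
  | |- cmf (fun x => - (@?f x)) => apply: cmfN
  | |- cmf (fun x => @GRing.natmul _ _ (nat_of_bool (@?f x))) => apply: cmf_bool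
  | |- cmf (fun x => (@?f x)%:C) => apply: cmf_realC
  | |- cmf (fun x => Int (@?f x)) => apply: cmf_Int
  | H : cmf _ |- cmf (fun x => ?k (@?f x) (@?g x)) => apply: (cmf_comp2 (k := k) H)
  | H : measurable_fun _ _ |- measurable_fun _ (fun x => ?k (@?f x) (@?g x)) => apply: (meas_comp2 (k := k) H)
  | H : cmf ?f |- cmf (fun x => ?f (@?g x)) => apply: (cmf_comp H)
  | H : L1 ?f |- cmf (fun x => ?f (@?g x)) => apply: (cmf_comp (L1_cmf H))
  | H : measurable_fun _ ?f |- measurable_fun _ (fun x => ?f (@?g x)) => apply: (meas_comp H)
  | H : rL1 ?f |- measurable_fun _ (fun x => ?f (@?g x)) => apply: (meas_comp (rL1_meas H))
  | |- cmf _ => exact: (cmf_realC (@measurable_id _ _ setT))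
  end.
Ltac meas := repeat (meas1; cbn [fst snd]).

(** * Fubini's theorem and affine changes of variable *)

Section Fubini.
Context {R : realType}.
Local Notation C := (complex R).
Local Notation mu := (@lebesgue_measure R).

Lemma rL1E (f : R -> R) : measurable_fun setT f -> (forall x, 0 <= f x) ->
  (\int[mu]_x (f x)%:E < +oo)%E -> rL1 f.
Proof.
move=> mf f0 h; apply/integrableP; split; first exact/measurable_EFinP.
apply: le_lt_trans h; rewrite le_eqVlt; apply/orP; left; apply/eqP.
by apply: eq_integral => x _ /=; rewrite ger0_norm.
Qed.

Lemma rL1_fin (f : R -> R) : rL1 f ->
  (\int[mu]_x (f x)%:E)%E = (\int[mu]_x f x)%:E.
Proof. by move=> hf; rewrite /Rintegral fineK // integrable_fin_num. Qed.

(** Domination by a product [g x * h y] reduces integrability on the plane to integrability in each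
    variable; all later exchanges of integrals use this form. *)
Lemma prod_integrable (F : R -> R -> R) (g h : R -> R) :
  measurable_fun setT (fun p : R * R => F p.1 p.2) ->
  (forall x y, `|F x y| <= g x * h y) -> rL1 g -> rL1 h ->
  (mu \x mu)%E.-integrable setT (EFin \o (fun p : R * R => F p.1 p.2)).
Proof.
move=> mF hF ig ih; apply/integrable12ltyP; first exact/measurable_EFinP.
have b x : (\int[mu]_y `|F x y|%:E <= (`|g x| * \int[mu]_y `|h y|)%:E)%E.
  rewrite EFinM -rL1_fin; last exact: rL1_norm.
  rewrite -ge0_integralZl_EFin //; last first.
    by apply/measurable_EFinP; meas.
  apply: ge0_le_integral => //.
  - by apply/measurable_EFinP; meas.
  - by apply: emeasurable_funM => //; apply/measurable_EFinP; meas.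
  - by move=> y _; rewrite lee_fin (le_trans (hF x y)) // -normrM ler_norm.
apply: (@le_lt_trans _ _ (\int[mu]_x (`|g x| * \int[mu]_y `|h y|)%:E)%E).
  apply: ge0_le_integral => //.
  - by move=> x _; apply: integral_ge0.
  - apply: (measurable_fun_fubini_tonelli_F (m2 := mu) (fun p : R * R => `|F p.1 p.2|%:E)) => //.
    by apply/measurable_EFinP; meas.
  - by apply/measurable_EFinP; meas.
  - by move=> x _; exact: b.
rewrite rL1_fin ?ltry //.
have := rL1Z (\int[mu]_y `|h y|) (rL1_norm ig).
by under eq_fun do rewrite mulrC.
Qed.

Lemma Rint_fubini (F : R -> R -> R) (g h : R -> R) :
  measurable_fun setT (fun p : R * R => F p.1 p.2) ->
  (forall x y, `|F x y| <= g x * h y) -> rL1 g -> rL1 h ->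
  \int[mu]_x (\int[mu]_y F x y) = \int[mu]_y (\int[mu]_x F x y).
Proof.
move=> mF hF ig ih; have hI := prod_integrable mF hF ig ih.
have := Fubini hI => /= E.
rewrite /Rintegral.
transitivity (fine (\int[mu]_x \int[mu]_y (F x y)%:E)%E); last rewrite E.
  congr fine; apply: eq_integral => x _; rewrite fineK // integrable_fin_num //.
  apply: (rL1_dom (g := fun y => `|g x| * `|h y|)).
  - by meas.
  - by move=> y; rewrite (le_trans (hF x y)) // -normrM ler_norm.
  - by apply: rL1Z; exact: rL1_norm.
congr fine; apply: eq_integral => y _; rewrite fineK // integrable_fin_num //.
apply: (rL1_dom (g := fun x => `|h y| * `|g x|)).
- by meas.
- by move=> x; rewrite (le_trans (hF x y)) // mulrC -normrM ler_norm.
- by apply: rL1Z; exact: rL1_norm.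
Qed.

Lemma Int_fubini (f : R -> R -> C) (g h : R -> R) :
  cmf (fun p : R * R => f p.1 p.2) ->
  (forall x y, cabs (f x y) <= g x * h y) -> rL1 g -> rL1 h ->
  Int (fun x => Int (f x)) = Int (fun y => Int (fun x => f x y)).
Proof.
move=> [m1 m2] hf ig ih; apply: cplxP.
  apply: (Rint_fubini (F := fun x y => complex.Re (f x y)) m1 _ ig ih) => x y.
  by apply: le_trans (hf x y); exact: normRe_le.
apply: (Rint_fubini (F := fun x y => complex.Im (f x y)) m2 _ ig ih) => x y.
by apply: le_trans (hf x y); exact: normIm_le.
Qed.

Lemma L1_Int (f : R -> R -> C) (g h : R -> R) :
  cmf (fun p : R * R => f p.1 p.2) ->
  (forall x y, cabs (f x y) <= g x * h y) -> rL1 g -> rL1 h ->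
  L1 (fun x => Int (f x)).
Proof.
move=> mf hf ig ih.
have lf x : L1 (f x).
  apply: (L1_dom (g := fun y => g x * h y)) => //; last exact: rL1Z.
  exact: (cmf_comp2 mf).
apply: (L1_dom (g := fun x => (\int[mu]_y h y) * g x)); first by meas.
  move=> x; apply: le_trans (cabs_Int (lf x)) _.
  rewrite mulrC -RintZ //; apply: Rint_le => //; [exact: L1_cabs|exact: rL1Z].
exact: rL1Z.
Qed.

(** Both sides are measures in [A], so uniqueness of Lebesgue measure leaves half-open intervals; a
    negative [c] moves the closed end to the other side without changing the length. *)
Lemma lebesgue_affine (c t : R) (A : set R) : c != 0 -> measurable A ->
  mu A = (`|c|%:E * mu ((fun x => (c * x + t)%R) @^-1` A))%E.
Proof.
move=> c0 mA.
have mg : @measurable_fun _ _ (measurableTypeR R) (measurableTypeR R) setT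
    (fun x : R => c * x + t) by meas.
pose nu := mscale (NngNum (normr_ge0 c))
  (measure_function_pushforward__canonical__measure_function_Measure mu mg).
rewrite (@lebesgue_measure_unique R [the measure _ _ of nu]) //.
move=> _ /ocitvP[->|[[x y] /= xy ->]]; first by rewrite !measure0.
rewrite /= /nu /mscale /= /pushforward lebesgue_measure_itv /= lte_fin xy.
have [c_gt0|] := ltP 0 c.
  rewrite (_ : _ @^-1` _ = `](x - t) / c, (y - t) / c]%classic); last first.
    apply/seteqP; split => z /=; rewrite !in_itv /=.
      by rewrite ltr_pdivrMr // ler_pdivlMr //; lra.
    by rewrite ltr_pdivrMr // ler_pdivlMr //; lra.
  rewrite lebesgue_measure_itv /= lte_fin ltr_pM2r ?invr_gt0 // ltrD2r xy.
  rewrite -EFinB -EFinB -EFinM gtr0_norm // -mulrBl mulrCA divff // mulr1.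
  by congr EFin; lra.
rewrite le_eqVlt (negbTE c0) /= => c_lt0.
rewrite (_ : _ @^-1` _ = `[(y - t) / c, (x - t) / c[%classic); last first.
  apply/seteqP; split => z /=; rewrite !in_itv /=.
    by rewrite ltr_ndivlMr // ler_ndivrMr //; lra.
  by rewrite ltr_ndivlMr // ler_ndivrMr //; lra.
rewrite lebesgue_measure_itv /= lte_fin ltr_nM2r ?invr_lt0 // ltrD2r xy.
rewrite -EFinB -EFinB -EFinM ltr0_norm // -mulrBl mulrCA mulNr divff // mulrN1.
by congr EFin; lra.
Qed.

Lemma ge0_integral_affine (c t : R) (f : R -> \bar R) : c != 0 ->
  measurable_fun setT f -> (forall x, 0 <= f x)%E ->
  (\int[mu]_x f x = `|c|%:E * \int[mu]_x f (c * x + t)%R)%E.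
Proof.
move=> c0 mf f0.
have mg : @measurable_fun _ _ (measurableTypeR R) (measurableTypeR R) setT
    (fun x : R => c * x + t) by meas.
pose nu := mscale (NngNum (normr_ge0 c))
  (measure_function_pushforward__canonical__measure_function_Measure mu mg).
rewrite (@eq_measure_integral _ _ _ _ [the measure _ _ of nu]); last first.
  by move=> A mA _; exact: lebesgue_affine.
rewrite ge0_integral_mscale //= ge0_integral_pushforward //.
Qed.

Lemma rL1_affine (c t : R) (f : R -> R) : c != 0 -> rL1 f ->
  rL1 (fun x => f (c * x + t)).
Proof.
move=> c0 hf; have mf := rL1_meas hf.
have c1 : 0 < `|c| by rewrite normr_gt0.
apply/integrableP; split.
  by apply/measurable_EFinP; apply: (meas_comp mf); meas.
rewrite -(@lte_pmul2l _ `|c|%:E) ?lte_fin //.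
have := @ge0_integral_affine c t (fun x => `|f x|%:E) c0 => /= <- //.
  by rewrite mulry gtr0_sg // mul1e rL1_fin ?ltry //; exact: rL1_norm.
by apply/measurable_EFinP; meas.
Qed.

Lemma Rint_affine (c t : R) (f : R -> R) : c != 0 -> rL1 f ->
  \int[mu]_x f x = `|c| * \int[mu]_x f (c * x + t).
Proof.
move=> c0 hf; have mf := rL1_meas hf; have hf' := rL1_affine t c0 hf.
have c1 : 0 < `|c| by rewrite normr_gt0.
have p1 (g : R -> R) : rL1 g -> rL1 (fun x => Num.max (g x) 0).
  move=> hg; apply: (rL1_dom _ _ (rL1_norm hg)).
    by meas.
  by move=> x; case: (leP (g x) 0) => [|/ltW] h; rewrite ?normr0.
have key (g : R -> R) : rL1 g -> (forall x, 0 <= g x) ->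
    \int[mu]_x g x = `|c| * \int[mu]_x g (c * x + t).
  move=> hg g0; apply/EFin_inj; rewrite EFinM -!rL1_fin //; last exact: rL1_affine.
  apply: ge0_integral_affine => //.
  by apply/measurable_EFinP; meas.
have E (g : R -> R) : rL1 g -> \int[mu]_x g x =
    \int[mu]_x Num.max (g x) 0 - \int[mu]_x Num.max (- g x) 0.
  move=> hg; rewrite -RintB; [|exact: p1|apply: (p1 (fun x => - g x))]; last first.
    by have := rL1Z (-1) hg; under eq_fun do rewrite mulN1r.
  by apply: eq_Rintegral => x _; case: (leP (g x) 0); case: (leP (- g x) 0); lra.
have nf : rL1 (fun x => - f x).
  by have := rL1Z (-1) hf; under eq_fun do rewrite mulN1r.
rewrite E // [in RHS]E // mulrBr.
rewrite (key _ (p1 _ hf)) ?(key _ (p1 _ nf)) // => x; by rewrite le_max lexx orbT.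
Qed.

Lemma L1_affine (c t : R) (f : R -> C) : c != 0 -> L1 f -> L1 (fun x => f (c * x + t)).
Proof.
move=> c0 [f1 f2]; split; [exact: (rL1_affine t c0 f1)|exact: (rL1_affine t c0 f2)].
Qed.

Lemma Int_affine (c t : R) (f : R -> C) : c != 0 -> L1 f ->
  Int f = `|c|%:C * Int (fun x => f (c * x + t)).
Proof.
move=> c0 [f1 f2]; apply: cplxP; rewrite !CplxE /=.
  rewrite mul0r subr0; exact: (Rint_affine t c0 f1).
rewrite mul0r addr0; exact: (Rint_affine t c0 f2).
Qed.

End Fubini.

(** * Contractions of L^1 *)

Section L1Complete.
Context {R : realType}.
Local Notation C := (complex R).
Local Notation mu := (@lebesgue_measure R).

(** Completeness of L^1 for absolutely convergent series. The sum [W] of the absolute values is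
    integrable by monotone convergence, hence finite almost everywhere; there the series converges,
    and [W] dominates its partial sums. Where [W] is infinite the limit is set to 0. *)
Lemma rL1_series (f : nat -> R -> R) (S : R) : (forall n, rL1 (f n)) ->
  (forall n, \sum_(k < n) \int[mu]_x `|f k x| <= S) ->
  exists g, rL1 g /\
    (fun n => \int[mu]_x `|(\sum_(k < n) f k x) - g x|) @ \oo --> (0 : R).
Proof.
move=> hf hS.
pose W x : \bar R := (\sum_(n <oo) `|f n x|%:E)%E.
have mfE n : measurable_fun setT (fun x => `|f n x|%:E).
  by apply/measurable_EFinP; apply: meas_norm; exact: rL1_meas.
have mW : measurable_fun setT W.
  by apply: ge0_emeasurable_sum => // n x _ _; rewrite lee_fin.
have W0 x : (0 <= W x)%E by apply: nneseries_ge0 => n _ _; rewrite lee_fin.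
have iW : mu.-integrable setT W.
  apply/integrableP; split => //.
  under eq_integral do rewrite gee0_abs //.
  rewrite /W integral_nneseries //.
  apply: (@le_lt_trans _ _ S%:E); last exact: ltry.
  apply: lime_le.
    by apply: is_cvg_nneseries => n _ _; apply: integral_ge0.
  apply: nearW => n; rewrite big_mkord.
  under eq_bigr do rewrite (rL1_fin (rL1_norm (hf _))).
  by rewrite sumEFin lee_fin.
have mWb : measurable_fun setT (fun x => (W x < +oo)%E).
  by apply: measurable_fun_lte => //; exact: measurable_cst.
have le_W n x : ((\sum_(k < n) `|f k x|)%:E <= W x)%E.
  rewrite -sumEFin -(big_mkord xpredT (fun k => `|f k x|%:E)).
  by apply: nneseries_lim_ge => k _; rewrite lee_fin.
have cv x : (W x < +oo)%E -> cvgn (series (f ^~ x)).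
  move=> Wx; apply: (@normed_cvg _ R^o).
  rewrite (_ : [normed _] = fun n => \sum_(k < n) `|f k x|); last first.
    by apply/funext => n; rewrite /normed_series_of /= /series /= big_mkord.
  apply: nondecreasing_is_cvgn.
    by apply/nondecreasing_seqP => n; rewrite big_ord_recr /= lerDl.
  exists (fine (W x)) => _ [n _ <-].
  by rewrite -lee_fin fineK ?ge0_fin_numE.
pose g x := if (W x < +oo)%E then limn (series (f ^~ x)) else 0.
have cg x : (W x < +oo)%E -> series (f ^~ x) @ \oo --> g x.
  by move=> Wx; rewrite /g Wx; exact: cv.
have msum n : measurable_fun setT (fun x => \sum_(k < n) f k x).
  by apply: measurable_sum => k; exact: rL1_meas.
have mg : measurable_fun setT g.
  apply: (@measurable_fun_cvg _ _ _ _
    (fun n x => if (W x < +oo)%E then \sum_(k < n) f k x else 0)).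
    by move=> n; apply: meas_if => //; exact: measurable_cst.
  move=> x _; have [Wx|Wx] := boolP (W x < +oo)%E.
    have := cg _ Wx; rewrite /series /=.
    by under eq_fun do rewrite big_mkord.
  by rewrite /g (negbTE Wx); exact: cvg_cst.
have [] := @dominated_convergence _ _ _ mu setT measurableT
  (fun n x => (\sum_(k < n) f k x)%:E) (fun x => (g x)%:E) W.
- by move=> n; apply/measurable_EFinP; exact: msum.
- by apply/measurable_EFinP; exact: mg.
- have := integrable_ae measurableT iW; apply: aeS => x /(_ I) Wx _.
  apply: cvg_EFin; first exact: nearW.
  have := cg _ (_ : (W x < +oo)%E); rewrite -ge0_fin_numE // => /(_ Wx).
  rewrite /series /=; by under eq_fun do rewrite big_mkord.
- exact: iW.
- apply: aeT => x n _; apply: le_trans (le_W n x).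
  by rewrite abse_EFin lee_fin ler_norm_sum.
move=> ig h _; exists g; split => //.
apply: (@cvg_trans _ (fine \o (fun n => \int[mu]_x `|(\sum_(k < n) f k x)%:E - (g x)%:E|)%E @ \oo)).
  by apply: near_eq_cvg; apply: nearW => n /=; congr fine.
by apply: fine_cvg.
Qed.

Lemma Rint_norm_eq0 (f : R -> R) : rL1 f -> \int[mu]_x `|f x| <= 0 ->
  {ae mu, forall x, f x = 0}.
Proof.
move=> hf h; have h0 : (\int[mu]_x `|(f x)%:E| = 0)%E.
  have := rL1_fin (rL1_norm hf) => /= ->; congr EFin; apply/eqP.
  by rewrite eq_le h; apply: Rintegral_ge0.
have := proj1 (ae_eq_integral_abs mu measurableT (measurable_int _ hf)) h0.
by apply: aeS => x /(_ I) /= [].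
Qed.

Lemma L1_eq0 (f : R -> C) : L1 f -> \int[mu]_x cabs (f x) <= 0 ->
  {ae mu, forall x, f x = 0}.
Proof.
move=> hf h.
have := @Rint_norm_eq0 (fun x => cabs (f x)) (L1_cabs hf).
under eq_Rintegral do rewrite ger0_norm ?cabs_ge0 //.
by move=> /(_ h); apply: aeS => x /eqP; rewrite cabs_eq0 => /eqP.
Qed.

Lemma L1_series (f : nat -> R -> C) (S : R) : (forall n, L1 (f n)) ->
  (forall n, \sum_(k < n) \int[mu]_x cabs (f k x) <= S) ->
  exists g, L1 g /\
    (fun n => \int[mu]_x cabs ((\sum_(k < n) f k x) - g x)) @ \oo --> (0 : R).
Proof.
move=> hf hS.
have [|n|g1 [ig1 c1]] := @rL1_series (fun n => re (f n)) S; first by move=> n; case: (hf n).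
  apply: le_trans (hS n); apply: ler_sum => k _; apply: Rint_le.
  - by apply: rL1_norm; case: (hf k).
  - exact: L1_cabs.
  - by move=> x; exact: normRe_le.
have [|n|g2 [ig2 c2]] := @rL1_series (fun n => im (f n)) S; first by move=> n; case: (hf n).
  apply: le_trans (hS n); apply: ler_sum => k _; apply: Rint_le.
  - by apply: rL1_norm; case: (hf k).
  - exact: L1_cabs.
  - by move=> x; exact: normIm_le.
have lg : L1 (fun x => Complex (g1 x) (g2 x)) by split.
have ls n : L1 (fun x => \sum_(k < n) f k x).
  elim: n => [|n IH]; first by under eq_fun do rewrite big_ord0; exact: L1_0.
  by under eq_fun do rewrite big_ord_recr; apply: L1D.
have sre n x : complex.Re (\sum_(k < n) f k x) = \sum_(k < n) re (f k) x.
  by elim: n => [|n IH]; rewrite ?big_ord0 // !big_ord_recr cReD IH.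
have sim n x : complex.Im (\sum_(k < n) f k x) = \sum_(k < n) im (f k) x.
  by elim: n => [|n IH]; rewrite ?big_ord0 // !big_ord_recr cImD IH.
exists (fun x => Complex (g1 x) (g2 x)); split => //.
have r1 n : rL1 (fun x => `|(\sum_(k < n) re (f k) x) - g1 x|).
  apply/rL1_norm/rL1B => //; case: (ls n) => + _.
  by rewrite /re; under eq_fun do rewrite sre.
have r2 n : rL1 (fun x => `|(\sum_(k < n) im (f k) x) - g2 x|).
  apply/rL1_norm/rL1B => //; case: (ls n) => _.
  by rewrite /im; under eq_fun do rewrite sim.
apply: (@squeeze_cvgr _ _ _ _ (fun=> 0) (fun n =>
  (\int[mu]_x `|(\sum_(k < n) re (f k) x) - g1 x|) +
  (\int[mu]_x `|(\sum_(k < n) im (f k) x) - g2 x|))).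
- apply: nearW => n; apply/andP; split.
    by apply: Rintegral_ge0 => x _; exact: cabs_ge0.
  rewrite -RintD //; apply: Rint_le; [|exact: rL1D|].
    by apply: L1_cabs; exact: L1B.
  by move=> x; apply: le_trans (cabs_leD _) _; rewrite cReD cImD cReN cImN sre sim.
- exact: cvg_cst.
- by have h := cvgD c1 c2; rewrite addr0 in h; exact: h.
Qed.

End L1Complete.

Section Neumann.
Context {R : realType}.
Local Notation C := (complex R).
Local Notation mu := (@lebesgue_measure R).

(** The two-sided bounds on [om] make the weighted norm equivalent to that of L^1, so completeness
    is still available while the factor [2^-1] holds in the weighted norm only. *)
Record L1_contraction (om : R -> R) (A : (R -> C) -> R -> C) : Prop := Contraction {
  ctr_meas : measurable_fun setT om ;
  ctr_bnd : exists c D, [/\ 0 < c, forall x, c <= om x & forall x, om x <= D] ;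
  ctr_L1 : forall w, L1 w -> L1 (A w) ;
  ctr_sub : forall v w, L1 v -> L1 w ->
    A (fun x => v x - w x) = (fun x => A v x - A w x) ;
  ctr_half : forall w, L1 w ->
    \int[mu]_x (om x * cabs (A w x)) <= 2^-1 * \int[mu]_x (om x * cabs (w x)) }.

Variables (om : R -> R) (A : (R -> C) -> R -> C).
Hypothesis hA : L1_contraction om A.

Let wn (f : R -> C) : R := \int[mu]_x (om x * cabs (f x)).

Let rw (f : R -> C) : L1 f -> rL1 (fun x => om x * cabs (f x)).
Proof.
move=> hf; have [c [D [c0 hc hD]]] := ctr_bnd hA; have mo := ctr_meas hA.
have mf := L1_cmf hf.
apply: (rL1_dom (g := fun x => D * cabs (f x))).
- by meas.
- move=> x; rewrite normrM !ger0_norm ?cabs_ge0 ?(le_trans (ltW c0)) //.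
  by rewrite ler_wpM2r ?cabs_ge0.
- by apply: rL1Z; exact: L1_cabs.
Qed.

Let om_ge0 x : 0 <= om x.
Proof. by have [c [D [c0 hc hD]]] := ctr_bnd hA; exact: le_trans (ltW c0) (hc x). Qed.

Let wn_tri (f g : R -> C) : L1 f -> L1 g -> wn (fun x => f x + g x) <= wn f + wn g.
Proof.
move=> hf hg; rewrite /wn -RintD; [|exact: rw|exact: rw].
apply: Rint_le; [by apply: rw; exact: L1D|by apply: rL1D; exact: rw|].
by move=> x; rewrite -mulrDr ler_wpM2l // cabsD.
Qed.

Let wnN (f : R -> C) : wn (fun x => - f x) = wn f.
Proof. by apply: eq_Rintegral => x _; rewrite cabsN. Qed.

Let wn_ge0 f : 0 <= wn f.
Proof. by apply: Rintegral_ge0 => x _; rewrite mulr_ge0 ?cabs_ge0. Qed.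

Let wn_lower : exists2 c, 0 < c & forall f, L1 f -> c * \int[mu]_x cabs (f x) <= wn f.
Proof.
have [c [D [c0 hc hD]]] := ctr_bnd hA; exists c => // f hf.
rewrite -RintZ; last exact: L1_cabs.
apply: Rint_le; [by apply: rL1Z; exact: L1_cabs|exact: rw|].
by move=> x; rewrite ler_wpM2r ?cabs_ge0.
Qed.

Let wn_upper : exists2 D, 0 < D & forall f, L1 f -> wn f <= D * \int[mu]_x cabs (f x).
Proof.
have [c [D [c0 hc hD]]] := ctr_bnd hA; exists D.
  exact: lt_le_trans c0 (le_trans (hc 0) (hD 0)).
move=> f hf; rewrite -RintZ; last exact: L1_cabs.
apply: Rint_le; [exact: rw|by apply: rL1Z; exact: L1_cabs|].
by move=> x; rewrite ler_wpM2r ?cabs_ge0.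
Qed.

Lemma contraction_eq0 w : L1 w -> {ae mu, forall x, w x = - A w x} ->
  {ae mu, forall x, w x = 0}.
Proof.
move=> hw h; apply: L1_eq0 => //.
have [c c0 hc] := wn_lower; have := hc _ hw.
have hAw := ctr_L1 hA hw.
have E : wn w = wn (A w).
  rewrite -(wnN (A w)); apply: Rint_ae; [exact: rL1_meas (rw hw)|exact: rL1_meas (rw (L1N hAw))|].
  by apply: aeS h => x ->.
have := ctr_half hA hw; rewrite -/(wn _) -/(wn _) -E => h1 h2.
have w0 : wn w <= 0 by have := wn_ge0 w; lra.
by rewrite -(pmulr_rle0 _ c0); exact: le_trans h2 w0.
Qed.

(** In the weighted norm, [w] is at most the norm of [h] plus half of its own; [D / c] is the price
    of passing to the plain norm. *)
Lemma contraction_bound : exists2 D, 0 < D & forall w h, L1 w -> L1 h ->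
  {ae mu, forall x, w x = h x - A w x} ->
  \int[mu]_x cabs (w x) <= D * \int[mu]_x cabs (h x).
Proof.
have [c c0 hc] := wn_lower; have [D D0 hD] := wn_upper.
exists (2 * D / c) => [|w h hw hh E]; first by rewrite divr_gt0 // mulr_gt0.
have hAw := ctr_L1 hA hw.
have h1 : wn w <= wn h + wn (A w).
  rewrite -(wnN (A w)); apply: le_trans (wn_tri hh (L1N hAw)).
  rewrite le_eqVlt; apply/orP; left; apply/eqP.
  apply: Rint_ae; [exact: rL1_meas (rw hw)|exact: rL1_meas (rw (L1B hh hAw))|].
  by apply: aeS E => x ->.
have := ctr_half hA hw; rewrite -/(wn _) -/(wn _) => h2.
rewrite mulrAC ler_pdivlMr // mulrC; apply: le_trans (hc _ hw) _.
by have := hD _ hh; rewrite -mulrA; lra.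
Qed.

(** Neumann series of [- A]. Its partial sums satisfy [s n.+1 = h - A (s n)] at every point, but
    their limit is only an L^1 limit, whence an equation almost everywhere. *)
Lemma contraction_solve h : L1 h ->
  exists w, L1 w /\ {ae mu, forall x, w x = h x - A w x}.
Proof.
move=> hh.
have A0 : A (fun=> 0) = fun=> 0.
  have := ctr_sub hA (@L1_0 R) (@L1_0 R).
  by under eq_fun do rewrite subr0; move=> ->; apply/funext => x; rewrite subrr.
pose w n := iter n (fun v => (fun x => - A v x)) h.
have lw n : L1 (w n) by elim: n => [//|n IH]; apply/L1N/(ctr_L1 hA).
have nw n : wn (w n) <= 2^-1 ^+ n * wn h.
  elim: n => [|n IH]; first by rewrite expr0 mul1r.
  rewrite /= wnN; apply: le_trans (ctr_half hA (lw n)) _.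
  by rewrite exprS -mulrA ler_wpM2l // invr_ge0.
have [c c0 hc] := wn_lower.
have sumw n : \sum_(k < n) wn (w k) <= 2 * wn h.
  apply: (@le_trans _ _ ((2 - 2 * 2^-1 ^+ n) * wn h)); last first.
    rewrite ler_wpM2r // gerBl mulr_ge0 // exprn_ge0 // invr_ge0 //.
  elim: n => [|n IH]; first by rewrite big_ord0 expr0 mulr1 subrr mul0r.
  rewrite big_ord_recr /=; apply: le_trans (lerD IH (nw n)) _.
  by rewrite exprS mulrA divff // mul1r -mulrDl ler_wpM2r //; lra.
have [n|v [lv cv]] := @L1_series R w (c^-1 * (2 * wn h)) lw.
  rewrite -(ler_pM2l c0) mulrA divff ?gt_eqF // mul1r; apply: le_trans (sumw n).
  by rewrite mulr_sumr; apply: ler_sum => k _; exact: hc.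
pose s n x := \sum_(k < n) w k x.
have ls n : L1 (s n).
  elim: n => [|n IH]; rewrite /s; first by under eq_fun do rewrite big_ord0; exact: L1_0.
  by under eq_fun do rewrite big_ord_recr; apply: L1D.
have sS n : s n.+1 = fun x => h x - A (s n) x.
  elim: n => [|n IH].
    have -> : s 0%N = fun=> 0 by apply/funext => x; rewrite /s big_ord0.
    by rewrite A0; apply/funext => x; rewrite /s big_ord1 subr0.
  have s1 k : s k.+1 = fun x => s k x + w k x.
    by apply/funext => x; rewrite /s big_ord_recr.
  have sN : s n.+1 = fun x => s n x - (- w n x).
    by rewrite s1; apply/funext => x; rewrite opprK.
  have wN : w n = fun x => 0 - - w n x by apply/funext => x; rewrite sub0r opprK.
  have AN : A (fun x => - w n x) = fun x => - A (w n) x.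
    by rewrite [in RHS]wN (ctr_sub hA (@L1_0 R) (L1N (lw n))) A0; apply/funext => x;
      rewrite sub0r opprK.
  rewrite [in RHS]sN (ctr_sub hA (ls n) (L1N (lw n))) AN s1 IH.
  by apply/funext => x; rewrite /=; ring.
exists v; split => //.
have lAv := ctr_L1 hA lv.
pose e x := v x - (h x - A v x).
have le : L1 e by apply: L1B => //; exact: L1B.
suff : {ae mu, forall x, e x = 0}.
  by apply: aeS => x /eqP; rewrite subr_eq0 => /eqP.
apply: L1_eq0 => //; rewrite -(pmulr_rle0 _ c0); apply: le_trans (hc _ le) _.
have [D D0 hD] := wn_upper.
(* By the recursion for the partial sums, the residual [e] of the limit is a combination of
   [s n.+1 - v] and [A (s n - v)], both of which tend to 0 in norm. *)
have bnd n : wn e <= D * (\int[mu]_x cabs (s n.+1 x - v x) + \int[mu]_x cabs (s n x - v x)).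
  have l1 := L1B (ls n.+1) lv; have l2 := L1B (ls n) lv.
  have eE : e = fun x => - (s n.+1 x - v x) + - A (fun y => s n y - v y) x.
    by rewrite (ctr_sub hA (ls n) lv) sS; apply/funext => x; rewrite /e; ring.
  rewrite eE; apply: le_trans (wn_tri (L1N l1) (L1N (ctr_L1 hA l2))) _.
  rewrite !wnN mulrDr lerD //; first exact: hD.
  apply: le_trans (hD _ l2); apply: le_trans (ctr_half hA l2) _.
  by rewrite -/(wn _) ler_piMl // invf_le1 ?ler1n.
have : (fun n => D * (\int[mu]_x cabs (s n.+1 x - v x) + \int[mu]_x cabs (s n x - v x)))
    @ \oo --> D * (0 + 0).
  apply: cvgM; first exact: cvg_cst.
  by apply: cvgD => //; rewrite (cvg_shiftS (fun n => \int[mu]_x cabs (s n x - v x))).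
rewrite addr0 mulr0 => cv0; rewrite -(cvg_lim _ cv0) //.
by apply: limr_ge; [exact: cvgP cv0|exact: nearW].
Qed.

End Neumann.

(** * Integrals over intervals *)

Section IntervalIntegrals.
Context {R : realType}.
Local Notation C := (complex R).
Local Notation mu := (@lebesgue_measure R).

Lemma Rint_itvE (u v : R) (f : R -> R) :
  \int[mu]_(x in `[u, v]) f x = \int[mu]_x (ind (u <= x <= v) * f x).
Proof.
rewrite Rintegral_mkcond; apply: eq_Rintegral => x _.
rewrite /patch; have -> : (x \in [set` `[u, v]]) = (u <= x <= v).
  by apply/idP/idP; rewrite inE /= in_itv.
by case: (u <= x <= v); rewrite ?mul1r ?mul0r.
Qed.

Lemma cint_itvE (u v : R) (f : R -> C) :
  cint [set` `[u, v]] f = Int (fun x => ind (u <= x <= v) * f x).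
Proof.
rewrite cintE; congr Int; apply/funext => x; congr (_%:R * _); congr nat_of_bool.
by apply/idP/idP; rewrite inE /= in_itv.
Qed.

Lemma rL1_itv_bounded (u v M : R) (f : R -> R) : measurable_fun setT f ->
  (forall x, u <= x <= v -> `|f x| <= M) -> rL1 (fun x => ind (u <= x <= v) * f x).
Proof.
move=> mf hf.
have h1 : rL1 (fun x => ind (u <= x <= v)).
  apply: rL1E; [by meas|by move=> x; case: (_ <= _ <= _)|].
  have -> : (fun x => (ind (u <= x <= v) : R)%:E) = (fun x => (\1_([set` `[u, v]] : set R) x)%:E).
    apply/funext => x; rewrite indicE; congr (_%:R)%:E; congr nat_of_bool.
    by apply/idP/idP; rewrite inE /= in_itv.
  rewrite integral_indic // setIT; have /= -> := @lebesgue_measure_itv R `[u, v].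
  by case: ifP => _; rewrite ?ltry // -EFinB ltry.
apply: (rL1_dom (g := fun x => M * ind (u <= x <= v))); last exact: rL1Z.
  by meas.
move=> x; have [h|h] := boolP (u <= x <= v); last by rewrite mul0r normr0 mulr0.
by rewrite mul1r mulr1 hf.
Qed.

Lemma L1_itv_bounded (u v M : R) (f : R -> C) : cmf f ->
  (forall x, u <= x <= v -> cabs (f x) <= M) -> L1 (fun x => ind (u <= x <= v) * f x).
Proof.
move=> mf hf; apply/L1P; split; first by meas.
have := @rL1_itv_bounded u v M (fun x => cabs (f x)) (cmf_cabs mf).
have -> : (fun x => cabs (ind (u <= x <= v) * f x)) = (fun x => ind (u <= x <= v) * cabs (f x)).
  by apply/funext => x; rewrite cabsM cabs_nat.
by apply => x /hf; rewrite ger0_norm ?cabs_ge0.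
Qed.

Lemma rL1_itv (u v : R) : rL1 (fun x => ind (u <= x <= v)).
Proof.
have := @rL1_itv_bounded u v 1 (fun=> 1) (measurable_cst _).
under eq_fun do rewrite mulr1; apply => x _; by rewrite normr1.
Qed.

Lemma Rint_itv1 (u v : R) : u <= v -> \int[mu]_x (ind (u <= x <= v)) = v - u.
Proof.
move=> uv; have := Rint_itvE u v (fun=> 1); under [in RHS]eq_Rintegral do rewrite mulr1.
move=> <-; rewrite Rintegral_cst // mul1r; have /= -> := @lebesgue_measure_itv R `[u, v]; rewrite lte_fin.
by case: ltgtP uv => //= -> _; rewrite subrr.
Qed.

Lemma norm_itv (x r : R) : (`|x| <= r) = (- r <= x <= r).
Proof. by rewrite ler_norml. Qed.

Lemma FTC_itv (f F : R -> R) (u v : R) : u <= v ->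
  (forall x, u <= x <= v -> {for x, continuous f}) ->
  (forall x, u <= x <= v -> derivable F x 1 /\ derive1 F x = f x) ->
  \int[mu]_x (ind (u <= x <= v) * f x) = F v - F u.
Proof.
rewrite le_eqVlt => /predU1P[<-|uv] cf dF.
  rewrite subrr -Rint_itvE set_itv1 Rintegral_set1 //.
rewrite -Rint_itvE /Rintegral (@continuous_FTC2 R f F u v) //.
- apply: continuous_in_subspaceT => x; rewrite inE /= in_itv /=; exact: cf.
- split.
  + move=> x; rewrite in_itv /= => /andP[/ltW h1 /ltW h2].
    by have [] := dF x; rewrite ?h1.
  + apply: cvg_at_right_filter; apply: differentiable_continuous.
    by apply/derivable1_diffP; have [] := dF u; rewrite ?lexx ?ltW.
  + apply: cvg_at_left_filter; apply: differentiable_continuous.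
    by apply/derivable1_diffP; have [] := dF v; rewrite ?lexx ?ltW.
- move=> x; rewrite in_itv /= => /andP[/ltW h1 /ltW h2].
  by have [] := dF x; rewrite ?h1.
Qed.

Lemma Rint_exp (c u v : R) : c != 0 -> u <= v ->
  \int[mu]_x (ind (u <= x <= v) * expR (c * x)) = (expR (c * v) - expR (c * u)) / c.
Proof.
move=> c0 uv.
rewrite mulrBl; apply: (@FTC_itv (fun x => expR (c * x)) (fun x => expR (c * x) / c)) => // x _.
  apply: (@continuous_comp _ _ _ (fun x => c * x) (@expR R)); last exact: continuous_expR.
  exact: mulrl_continuous.
have h : is_derive x 1 (fun x => expR (c * x) / c) (expR (c * x)).
  apply: is_derive_eq; rewrite /GRing.scale /=; by field.
by split=> //; rewrite derive1E; case: h.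
Qed.

Lemma meas_exp d (T : measurableType d) (f : T -> R) : measurable_fun setT f ->
  measurable_fun setT (fun x => expR (f x)).
Proof. exact: measurableT_comp. Qed.

Lemma Rint_neg (f : R -> R) : rL1 f -> \int[mu]_x f x = \int[mu]_x f (- x).
Proof.
move=> hf; rewrite (@Rint_affine R (-1) 0) ?oppr_eq0 ?oner_eq0 //.
rewrite normrN1 mul1r; apply: eq_Rintegral => x _; by rewrite mulN1r addr0.
Qed.

End IntervalIntegrals.

(** * Exponential weights for Volterra kernels *)

Section VolterraContraction.
Context {R : realType}.
Local Notation C := (complex R).
Local Notation mu := (@lebesgue_measure R).

(** An inequality, because the point 0 is counted in both halves. *)
Lemma Rint_even_le (P : R -> bool) (g : R -> R) :
  measurable_fun setT P -> measurable_fun setT g -> (forall x, 0 <= g x) ->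
  rL1 (fun x => ind ((0 <= x) && P x) * g x) ->
  rL1 (fun x => ind (P `|x|) * g `|x|) /\
  \int[mu]_x (ind (P `|x|) * g `|x|) <=
    2 * \int[mu]_x (ind ((0 <= x) && P x) * g x).
Proof.
move=> mP mg g0 h.
pose f x := ind ((0 <= x) && P x) * g x.
have hf : rL1 f by [].
have h' : rL1 (fun x => f (- x)).
  have := @rL1_affine R (-1) 0 f; rewrite oppr_eq0 oner_eq0 => /(_ isT h).
  by under eq_fun do rewrite mulN1r addr0.
have le x : ind (P `|x|) * g `|x| <= f x + f (- x).
  rewrite /f; have [x0|x0] := leP 0 x.
    rewrite ger0_norm // lerDl; have [n0|] := leP 0 (- x); last by rewrite mul0r.
    by rewrite mulr_ge0.
  by rewrite ltr0_norm // (_ : 0 <= - x) ?mul0r ?add0r ?lexx //; lra.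
have m1 : measurable_fun setT (fun x : R => ind (P `|x|) * g `|x|).
  apply: measM; last by apply: (meas_comp mg); meas.
  apply: measurable_bool_nat.
  by apply: (measurableT_comp mP); meas.
have i1 : rL1 (fun x => ind (P `|x|) * g `|x|).
  apply: (rL1_dom (g := fun x => f x + f (- x))) => //; last exact: rL1D.
  by move=> x; rewrite ger0_norm // mulr_ge0.
split=> //; apply: le_trans (Rint_le i1 (rL1D hf h') le) _.
by rewrite RintD // -(Rint_neg hf); lra.
Qed.

Lemma Rint_exp_tail (lam r b : R) : 0 < lam -> 0 <= r ->
  rL1 (fun x => ind (r <= `|x| <= b) * expR (- lam * `|x|)) /\
  \int[mu]_x (ind (r <= `|x| <= b) * expR (- lam * `|x|)) <= 2 / lam * expR (- lam * r).
Proof.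
move=> l0 r0.
have E x : ind ((0 <= x) && (r <= x <= b)) * expR (- lam * x) =
    ind (r <= x <= b) * expR (- lam * x).
  case: (leP 0 x) => //= x0; suff -> : (r <= x) = false by [].
  by apply/negbTE; rewrite -ltNge; exact: lt_le_trans x0 r0.
have mg : measurable_fun setT (fun x : R => expR (- lam * x)).
  by apply: meas_exp; meas.
have [] := @Rint_even_le (fun x => r <= x <= b) (fun x => expR (- lam * x)).
- by meas.
- exact: mg.
- by move=> x; exact: expR_ge0.
- under eq_fun do rewrite E.
  apply: (@rL1_itv_bounded _ _ _ 1) => // x /andP[rx _].
  rewrite ger0_norm ?expR_ge0 // -expR0 ler_expR mulNr oppr_le0 mulr_ge0 ?(ltW l0) //.
  exact: le_trans rx.
move=> h1 h2; split=> //; apply: le_trans h2 _; rewrite -mulrA ler_wpM2l //.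
under eq_Rintegral do rewrite E.
have [rb|br] := leP r b.
  rewrite Rint_exp // ?oppr_eq0 ?gt_eqF // invrN mulrN -mulNr opprB.
  rewrite mulrC ler_pM2l ?invr_gt0 // gerBl expR_ge0 //.
rewrite (_ : \int[mu]_x _ = 0); first by rewrite mulr_ge0 ?expR_ge0 ?invr_ge0 ?ltW.
have z x : ind (r <= x <= b) * expR (- lam * x) = 0.
  rewrite (_ : (r <= x <= b) = false) ?mul0r //.
  by apply/negP => /andP[h3 h4]; have := le_lt_trans (le_trans h3 h4) br; rewrite ltxx.
by under eq_Rintegral do rewrite z; rewrite Rintegral_cst // mul0r.
Qed.

Lemma Rint_exp_head (lam r : R) : 0 < lam -> 0 <= r ->
  rL1 (fun x => ind (`|x| <= r) * expR (lam * `|x|)) /\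
  \int[mu]_x (ind (`|x| <= r) * expR (lam * `|x|)) <= 2 / lam * expR (lam * r).
Proof.
move=> l0 r0.
have mg : measurable_fun setT (fun x : R => expR (lam * x)).
  by apply: meas_exp; meas.
have [] := @Rint_even_le (fun x => x <= r) (fun x => expR (lam * x)).
- by meas.
- exact: mg.
- by move=> x; exact: expR_ge0.
- apply: (@rL1_itv_bounded _ _ _ (expR (lam * r))) => // x /andP[_ rx].
  by rewrite ger0_norm ?expR_ge0 // ler_expR ler_pM2l.
move=> h1 h2; split=> //; apply: le_trans h2 _; rewrite -mulrA ler_wpM2l //.
rewrite Rint_exp ?gt_eqF // mulrC ler_pM2l ?invr_gt0 // gerBl expR_ge0 //.
Qed.

(** Schur's test in L^1: Tonelli moves the weight onto the kernel, and the bound on the weighted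
    column integrals is the contraction factor. The majorant [rho], uniform in [t], supplies the
    product bound for Fubini. *)
Lemma contraction_dominated (om : R -> R) (A : (R -> C) -> R -> C)
    (kap : R -> R -> R) (rho : R -> R) :
  measurable_fun setT om ->
  (exists c D, [/\ 0 < c, forall x, c <= om x & forall x, om x <= D]) ->
  (forall v w, L1 v -> L1 w -> A (fun x => v x - w x) = (fun x => A v x - A w x)) ->
  (forall w, L1 w -> cmf (A w)) ->
  measurable_fun setT (fun p : R * R => kap p.1 p.2) ->
  (forall x t, 0 <= kap x t <= rho x) -> rL1 rho ->
  (forall w x, L1 w -> cabs (A w x) <= \int[mu]_t (kap x t * cabs (w t))) ->
  (forall t, \int[mu]_x (om x * kap x t) <= 2^-1 * om t) ->
  L1_contraction om A.
Proof.
move=> mom bom Asub Ameas mk hk irho hA hom.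
have [c [D [c0 cle leD]]] := bom.
have om0 x : 0 <= om x by exact: le_trans (ltW c0) (cle x).
have D0 : 0 <= D by exact: le_trans (om0 0) (leD 0).
have k0 x t : 0 <= kap x t by case/andP: (hk x t).
have rho0 x : 0 <= rho x by have /andP[/le_trans] := hk x 0; apply.
have i1 w x : L1 w -> rL1 (fun t => kap x t * cabs (w t)).
  move=> lw; have mw := L1_cmf lw.
  apply: (rL1_dom (g := fun t => rho x * cabs (w t))); first by meas.
    move=> t; rewrite ger0_norm ?mulr_ge0 ?cabs_ge0 //.
    by rewrite ler_wpM2r ?cabs_ge0 //; case/andP: (hk x t).
  by apply: rL1Z; exact: L1_cabs.
have i2 w : L1 w -> rL1 (fun x => \int[mu]_t (kap x t * cabs (w t))).
  move=> lw; have mw := L1_cmf lw.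
  apply: (rL1_dom (g := fun x => (\int[mu]_t cabs (w t)) * rho x)); last exact: rL1Z.
    by apply: (@measurable_fun_Rintegral _ _ _ (fun p : R * R => kap p.1 p.2 * cabs (w p.2))); meas.
  move=> x; rewrite ger0_norm; last first.
    by apply: Rintegral_ge0 => t _; rewrite mulr_ge0 ?cabs_ge0.
  rewrite mulrC -RintZ; last exact: L1_cabs.
  apply: Rint_le; [exact: i1|by apply: rL1Z; exact: L1_cabs|].
  by move=> t; rewrite ler_wpM2r ?cabs_ge0 //; case/andP: (hk x t).
have l1A w : L1 w -> L1 (A w).
  move=> lw; apply: (L1_dom (Ameas _ lw) _ (i2 _ lw)) => x; exact: hA.
split=> // w lw; have mw := L1_cmf lw.
have romD f : rL1 f -> (forall x, 0 <= f x) -> rL1 (fun x => om x * f x).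
  move=> hf f0; apply: (rL1_dom (g := fun x => D * f x)); [|move=> x|exact: rL1Z].
    by have mf := rL1_meas hf; meas.
  by rewrite ger0_norm ?mulr_ge0 // ler_wpM2r.
have e1 : \int[mu]_x (om x * cabs (A w x)) <=
    \int[mu]_x (\int[mu]_t (om x * (kap x t * cabs (w t)))).
  have E x : \int[mu]_t (om x * (kap x t * cabs (w t))) =
    om x * \int[mu]_t (kap x t * cabs (w t)) by rewrite RintZ //; exact: i1.
  under [in leRHS]eq_Rintegral do rewrite E.
  apply: Rint_le.
  - by apply: romD => [|x]; [apply/L1_cabs/l1A|exact: cabs_ge0].
  - apply: romD => [|x]; first exact: i2.
    by apply: Rintegral_ge0 => t _; rewrite mulr_ge0 ?cabs_ge0.
  - by move=> x; rewrite ler_wpM2l // hA.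
apply: le_trans e1 _.
rewrite (@Rint_fubini R (fun x t => om x * (kap x t * cabs (w t)))
  (fun x => D * rho x) (fun t => cabs (w t))); last 4 first.
- by meas.
- move=> x t; rewrite ger0_norm ?mulr_ge0 ?cabs_ge0 // mulrA.
  rewrite ler_wpM2r ?cabs_ge0 // ler_pM //; by case/andP: (hk x t).
- exact: rL1Z.
- exact: L1_cabs.
have E t : \int[mu]_x (om x * (kap x t * cabs (w t))) =
    cabs (w t) * \int[mu]_x (om x * kap x t).
  rewrite -RintZ; first by apply: eq_Rintegral => x _; ring.
  apply: romD => [|x] //; apply: (rL1_dom _ _ irho); first by meas.
  by move=> x; rewrite ger0_norm //; case/andP: (hk x t).
under eq_Rintegral do rewrite E.
have i3 : rL1 (fun t => om t * cabs (w t)).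
  by apply: romD => [|t]; [exact: L1_cabs|exact: cabs_ge0].
rewrite -RintZ //; apply: Rint_le; last 2 first.
- exact: rL1Z.
- by move=> t; rewrite mulrA mulrC ler_wpM2r ?cabs_ge0.
apply: (rL1_dom _ _ (rL1Z 2^-1 i3)).
  apply: measM; first by meas.
  have := @measurable_fun_Rintegral R _ _ (fun p : R * R => om p.2 * kap p.2 p.1).
  by apply; meas; apply: (meas_comp2 mk); meas.
move=> t; rewrite ger0_norm.
  by rewrite mulrA mulrC ler_wpM2r ?cabs_ge0.
by rewrite mulr_ge0 ?cabs_ge0 //; apply: Rintegral_ge0 => x _; rewrite mulr_ge0.
Qed.

End VolterraContraction.

(** * Integral operators with triangular kernels *)

Section KernelOperators.
Context {R : realType}.
Local Notation C := (complex R).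
Local Notation mu := (@lebesgue_measure R).

Definition kop (k : R -> R -> C) (u : R -> C) : R -> C := fun x => Int (fun t => k x t * u t).
Definition kopT (k : R -> R -> C) (u : R -> C) : R -> C := fun t => Int (fun x => k x t * u x).

Lemma ind_le1 (c : bool) : (ind c : R) <= 1.
Proof. by case: c. Qed.

(** Dominated convergence. It splits an unbounded [rho] into a bounded part and a part of small
    integral. *)
Lemma rL1_tail (rho : R -> R) (e : R) : rL1 rho -> (forall x, 0 <= rho x) -> 0 < e ->
  exists2 N, 0 < N & \int[mu]_x (ind (N < rho x) * rho x) <= e.
Proof.
move=> ir r0 e0; have mr := rL1_meas ir.
have [] := @dominated_convergence _ _ _ mu setT measurableT
  (fun n x => (ind ((n%:R : R) < rho x) * rho x)%:E) (fun=> 0%E) (fun x => (rho x)%:E).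
- by move=> n; apply/measurable_EFinP; meas.
- exact: measurable_cst.
- apply: aeT => x _; apply: cvg_near_cst.
  near=> n; rewrite (_ : _ < _ = false) ?mul0r //; apply/negbTE; rewrite -leNgt.
  by near: n; exact: nbhs_infty_ger.
- exact: ir.
- apply: aeT => x n _; rewrite lee_fin ger0_norm ?mulr_ge0 //.
  by rewrite ler_piMl //; case: (_ < _).
move=> _ _; rewrite integral_cst // mul0e => h.
have ifin n : rL1 (fun x => ind ((n%:R : R) < rho x) * rho x).
  apply: (rL1_dom _ _ ir); first by meas.
  by move=> x; rewrite ger0_norm ?mulr_ge0 // ler_piMl //; case: (_ < _).
have h' : (fun n => \int[mu]_x (ind ((n%:R : R) < rho x) * rho x)) @ \oo --> (0 : R).
  exact: fine_cvg h.
have /cvgrPdist_lt/(_ _ e0)[N _ HN] := h'.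
exists N.+1%:R => //; have := HN N.+1 (leqnSn N); rewrite sub0r normrN => /ltW.
by apply: le_trans; exact: ler_norm.
Unshelve. all: by end_near. Qed.

(** The operator moves mass outwards, from [t] to points with [|x| >= |t|], so a weight decreasing
    in [|x|] shrinks it. A fast exponential handles a bounded [rho]; the part of [rho] above the
    level [N] is small in L^1 and contributes at most [4^-1] at any rate. The weight is frozen
    beyond [b] to stay bounded below. *)
Lemma volterra_contraction (b : R) (rho : R -> R) (A : (R -> C) -> R -> C) :
  0 <= b -> rL1 rho -> (forall x, 0 <= rho x) ->
  (forall v w, L1 v -> L1 w -> A (fun x => v x - w x) = (fun x => A v x - A w x)) ->
  (forall w, L1 w -> cmf (A w)) ->
  (forall w x, L1 w ->
     cabs (A w x) <= rho x * \int[mu]_t (ind (`|t| <= `|x| <= b) * cabs (w t))) ->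
  exists om, L1_contraction om A.
Proof.
move=> b0 ir r0 Asub Ameas hA; have mr := rL1_meas ir.
have [N N0 hN] := @rL1_tail rho 4^-1 ir r0 ltac:(by rewrite invr_gt0).
(* Then [N * (2 / lam) = 4^-1], the contribution of the part of [rho] below [N]. *)
pose lam := 8 * N; have l0 : 0 < lam by rewrite mulr_gt0.
pose om (x : R) := expR (- lam * Num.min `|x| b).
have mom : measurable_fun setT om by apply: meas_exp; meas.
exists om; apply: (@contraction_dominated _ _ _
  (fun x t => rho x * ind (`|t| <= `|x| <= b)) rho) => //.
- exists (expR (- lam * b)), 1; split; [exact: expR_gt0| |].
    by move=> x; rewrite ler_expR !mulNr lerN2 ler_pM2l // ge_min lexx orbT.
  by move=> x; rewrite -expR0 ler_expR mulNr oppr_le0 mulr_ge0 ?(ltW l0) // le_min normr_ge0.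
- by meas.
- move=> x t; rewrite mulr_ge0 //= ler_piMr //; by case: (_ <= _ <= _).
- move=> w x lw; apply: le_trans (hA w x lw) _.
  rewrite -RintZ; last by have := L1_cabs lw; have mw := L1_cmf lw => h;
    apply: (rL1_dom _ _ h); [meas|move=> t; rewrite ger0_norm ?mulr_ge0 ?cabs_ge0 // ler_piMl ?cabs_ge0 //; case: (_ <= _ <= _)].
  by rewrite le_eqVlt; apply/orP; left; apply/eqP; apply: eq_Rintegral => t _; ring.
move=> t; have [tb|tb] := leP `|t| b; last first.
  rewrite (_ : \int[mu]_x _ = 0); first by rewrite mulr_ge0 // ?invr_ge0 // expR_ge0.
  have z x : om x * (rho x * ind (`|t| <= `|x| <= b)) = 0.
    rewrite (_ : (_ <= _ <= _) = false) ?mulr0 //; apply/negP => /andP[h1 h2].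
    by have := le_lt_trans (le_trans h1 h2) tb; rewrite ltxx.
  by under eq_Rintegral do rewrite z; rewrite Rintegral_cst // mul0r.
have [e1 e2] := @Rint_exp_tail R lam `|t| b l0 (normr_ge0 t).
have ir1 : rL1 (fun x => ind (N < rho x) * rho x).
  apply: (rL1_dom _ _ ir); first by meas.
  by move=> x; rewrite ger0_norm ?mulr_ge0 // ler_piMl //; case: (_ < _).
apply: (@le_trans _ _ (\int[mu]_x (N * (ind (`|t| <= `|x| <= b) * expR (- lam * `|x|)) +
   expR (- lam * `|t|) * (ind (N < rho x) * rho x)))).
  apply: Rint_le.
  - apply: (rL1_dom _ _ ir); first by meas.
    move=> x; rewrite ger0_norm ?mulr_ge0 ?expR_ge0 //.
    rewrite mulrC -mulrA ler_piMr // mulr_ile1 ?expR_ge0 //; first by case: (_ <= _ <= _).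
    by rewrite -expR0 ler_expR mulNr oppr_le0 mulr_ge0 ?(ltW l0) // le_min normr_ge0.
  - by apply: rL1D; exact: rL1Z.
  move=> x; rewrite /om; have [h|h] := boolP (`|t| <= `|x| <= b); last first.
    by rewrite !(mulr0, mul0r) add0r !mulr_ge0 // expR_ge0.
  have /andP[h1 h2] := h; rewrite (min_l h2) mul1r mulr1.
  have [h3|h3] := ltP N (rho x); last first.
    by rewrite mul0r mulr0 addr0 mulrC ler_wpM2r // expR_ge0.
  rewrite mul1r ler_wpDl // ?mulr_ge0 ?(ltW N0) ?expR_ge0 //.
  by rewrite ler_wpM2r // ler_expR !mulNr lerN2 ler_pM2l.
rewrite RintD; [|exact: rL1Z|exact: rL1Z]; rewrite !RintZ //.
rewrite /om (min_l tb).
have h1 : N * \int[mu]_x (ind (`|t| <= `|x| <= b) * expR (- lam * `|x|)) <=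
    4^-1 * expR (- lam * `|t|).
  apply: le_trans (ler_wpM2l (ltW N0) e2) _; rewrite mulrA ler_wpM2r ?expR_ge0 //.
  by rewrite /lam; have -> : N * (2 / (8 * N)) = 4^-1 by field; rewrite gt_eqF.
have h2 : expR (- lam * `|t|) * \int[mu]_x (ind (N < rho x) * rho x) <=
    4^-1 * expR (- lam * `|t|).
  by rewrite mulrC ler_wpM2r ?expR_ge0.
have := expR_ge0 (- lam * `|t|); lra.
Qed.

Variables (b M : R) (k : R -> R -> C).
Hypothesis b0 : 0 <= b.
Hypothesis mk : cmf (fun p : R * R => k p.1 p.2).
Hypothesis kM : forall x t, cabs (k x t) <= M * ind (`|t| <= `|x| <= b).

Let M0 : 0 <= M.
Proof.
have := kM 0 0; rewrite normr0 lexx b0 /= mulr1; apply: le_trans; exact: cabs_ge0.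
Qed.

Let ind_le (x t : R) : (ind (`|t| <= `|x| <= b) : R) <= ind (`|x| <= b) * ind (`|t| <= b).
Proof.
have [/andP[h1 h2]|_] := boolP (`|t| <= `|x| <= b); last by rewrite mulr_ge0.
by rewrite h2 (le_trans h1 h2) mulr1.
Qed.

Lemma kernel_bound x t : cabs (k x t) <= M * ind (`|x| <= b).
Proof.
apply: le_trans (kM x t) _; rewrite ler_wpM2l //; apply: le_trans (ind_le x t) _.
by rewrite ler_piMr //; case: (`|t| <= b).
Qed.

Lemma kernel_boundT x t : cabs (k x t) <= M * ind (`|t| <= b).
Proof.
apply: le_trans (kM x t) _; rewrite ler_wpM2l //; apply: le_trans (ind_le x t) _.
by rewrite ler_piMl //; case: (`|x| <= b).
Qed.

Lemma rL1_ball : rL1 (fun x => M * ind (`|x| <= b)).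
Proof. by apply: rL1Z; under eq_fun do rewrite norm_itv; exact: rL1_itv. Qed.

Lemma kop_integrand u x : L1 u -> L1 (fun t => k x t * u t).
Proof.
move=> hu; apply: (@L1Mb _ _ _ M) => //; first by meas.
move=> t; apply: le_trans (kernel_bound x t) _.
by rewrite ler_piMr // ind_le1.
Qed.

Lemma kopT_integrand u t : L1 u -> L1 (fun x => k x t * u x).
Proof.
move=> hu; apply: (@L1Mb _ _ _ M) => //.
  by apply: (cmf_comp2 mk); meas.
move=> x; apply: le_trans (kernel_bound x t) _.
by rewrite ler_piMr // ind_le1.
Qed.

Lemma kop_L1 u : L1 u -> L1 (kop k u).
Proof.
move=> hu; apply: (@L1_Int _ _ (fun x => M * ind (`|x| <= b)) (fun t => cabs (u t))).
- by meas.
- by move=> x t; rewrite cabsM ler_wpM2r ?cabs_ge0 // kernel_bound.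
- exact: rL1_ball.
- exact: L1_cabs.
Qed.

Lemma kopT_L1 u : L1 u -> L1 (kopT k u).
Proof.
move=> hu; apply: (@L1_Int _ (fun t x => k x t * u x)
  (fun x => M * ind (`|x| <= b)) (fun t => cabs (u t))).
- by apply: cmfM; [apply: (cmf_comp2 mk)|]; meas.
- by move=> x t; rewrite cabsM ler_wpM2r ?cabs_ge0 // kernel_boundT.
- exact: rL1_ball.
- exact: L1_cabs.
Qed.

Lemma kop_sub v w : L1 v -> L1 w -> kop k (fun x => v x - w x) = (fun x => kop k v x - kop k w x).
Proof.
move=> hv hw; apply/funext => x; rewrite /kop -IntB; [|exact: kop_integrand|exact: kop_integrand].
by congr Int; apply/funext => t; ring.
Qed.

Lemma kopT_lin c v w : L1 v -> L1 w ->
  kopT k (fun x => c * v x + w x) = (fun x => c * kopT k v x + kopT k w x).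
Proof.
move=> hv hw; apply/funext => x; rewrite /kopT -IntZ; last exact: kopT_integrand.
rewrite -IntD; [|by apply: L1Z; exact: kopT_integrand|exact: kopT_integrand].
by congr Int; apply/funext => t; ring.
Qed.

Lemma kopT_sub v w : L1 v -> L1 w ->
  kopT k (fun x => v x - w x) = (fun x => kopT k v x - kopT k w x).
Proof.
move=> hv hw; apply/funext => x; rewrite /kopT -IntB; [|exact: kopT_integrand|exact: kopT_integrand].
by congr Int; apply/funext => t; ring.
Qed.

Lemma kop_le u x : L1 u -> cabs (kop k u x) <= M * \int[mu]_t (ind (`|t| <= `|x| <= b) * cabs (u t)).
Proof.
move=> hu; apply: le_trans (cabs_Int (kop_integrand x hu)) _.
have mu' := L1_cmf hu.
have h : rL1 (fun t => ind (`|t| <= `|x| <= b) * cabs (u t)).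
  apply: (rL1_dom _ _ (L1_cabs hu)); first by meas.
  move=> t; rewrite ger0_norm ?mulr_ge0 ?cabs_ge0 // ler_piMl ?cabs_ge0 //; by case: (_ <= _ <= _).
rewrite -RintZ //; apply: Rint_le; [by apply: L1_cabs; exact: kop_integrand|exact: rL1Z|].
by move=> t; rewrite cabsM mulrA ler_wpM2r ?cabs_ge0.
Qed.

Lemma kopT_le u t : L1 u -> cabs (kopT k u t) <= M * ind (`|t| <= b) * \int[mu]_x (cabs (u x)).
Proof.
move=> hu; apply: le_trans (cabs_Int (kopT_integrand t hu)) _.
have mu' := L1_cmf hu.
rewrite -RintZ; last exact: L1_cabs.
apply: Rint_le; [by apply: L1_cabs; exact: kopT_integrand|by apply: rL1Z; exact: L1_cabs|].
by move=> x; rewrite cabsM ler_wpM2r ?cabs_ge0 // kernel_boundT.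
Qed.

Lemma kop_dual psi u : L1 psi -> L1 u ->
  Int (fun x => psi x * kop k u x) = Int (fun t => kopT k psi t * u t).
Proof.
move=> hp hu.
have E1 x : psi x * kop k u x = Int (fun t => psi x * (k x t * u t)).
  by rewrite IntZ //; exact: kop_integrand.
have E2 t : kopT k psi t * u t = Int (fun x => psi x * (k x t * u t)).
  rewrite -IntZr; last exact: kopT_integrand.
  by congr Int; apply/funext => x; ring.
under eq_fun do rewrite E1; under [in RHS]eq_fun do rewrite E2.
apply: (@Int_fubini _ _ (fun x => M * cabs (psi x)) (fun t => cabs (u t))).
- by meas.
- move=> x t; rewrite !cabsM mulrA ler_wpM2r ?cabs_ge0 // mulrC ler_wpM2r ?cabs_ge0 //.
  apply: le_trans (kernel_bound x t) _; by rewrite ler_piMr // ind_le1.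
- by apply: rL1Z; exact: L1_cabs.
- exact: L1_cabs.
Qed.

(** The transpose moves mass inwards, so here the weight increases with [|x|], frozen beyond [b] to
    stay bounded. With [lam = 4 * M + 1] the factor is [2 * M / lam <= 2^-1], and the summand 1
    keeps [lam] positive when [M = 0]. *)
Lemma kopT_contraction : exists om, L1_contraction om (kopT k).
Proof.
pose lam := 4 * M + 1; have l0 : 0 < lam by rewrite ltr_wpDl // mulr_ge0.
pose om (x : R) := expR (lam * Num.min `|x| b).
have mom : measurable_fun setT om by apply: meas_exp; meas.
exists om; apply: (@contraction_dominated _ _ _
  (fun x t => M * ind (`|x| <= `|t| <= b)) (fun x => M * ind (`|x| <= b))) => //.
- exists 1, (expR (lam * b)); split => //.
    by move=> x; rewrite -expR0 ler_expR mulr_ge0 ?(ltW l0) // le_min normr_ge0.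
  by move=> x; rewrite ler_expR ler_pM2l // ge_min lexx orbT.
- exact: kopT_sub.
- by move=> w lw; apply: L1_cmf; exact: kopT_L1.
- by meas.
- move=> x t; rewrite mulr_ge0 //= ler_wpM2l //.
  have [/andP[h1 h2]|_] := boolP (`|x| <= `|t| <= b); last by [].
  by rewrite (le_trans h1 h2).
- exact: rL1_ball.
- move=> w x lw; have mw := L1_cmf lw; apply: le_trans (cabs_Int (kopT_integrand x lw)) _.
  apply: Rint_le.
  + by apply: L1_cabs; exact: kopT_integrand.
  + apply: (rL1_dom _ _ (rL1Z M (L1_cabs lw))); first by meas.
    move=> t; rewrite ger0_norm ?mulr_ge0 ?cabs_ge0 // ler_wpM2r ?cabs_ge0 //.
    by rewrite ler_piMr //; case: (_ <= _ <= _).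
  + by move=> t; rewrite cabsM ler_wpM2r ?cabs_ge0.
move=> t; have [e1 e2] := @Rint_exp_head R lam `|t| l0 (normr_ge0 t).
have [tb|tb] := leP `|t| b; last first.
  have z x : om x * (M * ind ((`|x| <= `|t|) && false)) = 0.
    by rewrite andbF !mulr0.
  under eq_Rintegral do rewrite z; rewrite Rintegral_cst // mul0r.
  by rewrite mulr_ge0 // ?invr_ge0 // expR_ge0.
have E x : om x * (M * ind ((`|x| <= `|t|) && true)) =
    M * (ind (`|x| <= `|t|) * expR (lam * `|x|)).
  rewrite andbT /om; have [h|h] := leP `|x| `|t|; last by rewrite mul0r !mulr0.
  by rewrite (min_l (le_trans h tb)) mulr1 mul1r mulrC.
under eq_Rintegral do rewrite E.
rewrite RintZ // /om (min_l tb).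
apply: le_trans (ler_wpM2l M0 e2) _; rewrite mulrA ler_wpM2r ?expR_ge0 //.
by rewrite mulrA ler_pdivrMr // /lam; lra.
Qed.

End KernelOperators.

(** * Goursat's equation and the wave equation *)

Section MildEquation.
Context {R : realType}.
Local Notation C := (complex R).
Local Notation mu := (@lebesgue_measure R).

Variables (b M : R) (q : R -> C) (H : R -> R -> C).
Hypothesis b0 : 0 <= b.
Hypothesis L1q : L1 q.
Hypothesis mH : cmf (fun p : R * R => H p.1 p.2).
Hypothesis HM : forall u v, cabs (H u v) <= M.
Hypothesis goursat : forall u v, 0 <= u -> 0 <= v -> u + v <= b ->
  H u v = 2^-1 * Int (fun s => ind (0 <= s <= u) * q s) +
    Int (fun al => ind (0 <= al <= u) *
      Int (fun be => ind (0 <= be <= v) * (q (al + be) * H al be))).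

Let M0 : 0 <= M. Proof. by apply: le_trans (HM 0 0); exact: cabs_ge0. Qed.

(** The kernel for [x >= 0], where the orientation sign is 1. On the triangle kept by the indicator,
    Goursat's equation is available at every point. *)
Definition kplus (x t : R) : C :=
  ind (`|t| <= x <= b) * H ((x + t) / 2) ((x - t) / 2).

Lemma cmf_kplus : cmf (fun p : R * R => kplus p.1 p.2).
Proof. by rewrite /kplus; meas. Qed.

Lemma kplus_bound x t : cabs (kplus x t) <= M * ind (`|t| <= b).
Proof.
rewrite /kplus cabsM cabs_nat mulrC; have [/andP[h1 h2]|_] := boolP (_ <= _ <= _).
  by rewrite (le_trans h1 h2) ler_wpM2r.
by rewrite mulr0 mulr_ge0.
Qed.

Let L1_kplus x : L1 (kplus x).
Proof.
have m := cmf_kplus; apply: (L1_dom _ (kplus_bound x)); first by meas.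
by under eq_fun do rewrite norm_itv; apply/rL1Z/rL1_itv.
Qed.

Let S : R := \int[mu]_t (M * ind (`|t| <= b)).

Let int_kplus_bounded (f : R -> C) (D x : R) : 0 <= D -> cmf f ->
  (forall t, cabs (f t) <= D) ->
  L1 (fun t => kplus x t * f t) /\ cabs (Int (fun t => kplus x t * f t)) <= D * S.
Proof.
move=> D0 mf fD; have l1 : L1 (fun t => kplus x t * f t).
  have := L1Mb mf fD (L1_kplus x); by under eq_fun do rewrite mulrC.
have r1 : rL1 (fun t => M * ind (`|t| <= b)).
  by under eq_fun do rewrite norm_itv; apply/rL1Z/rL1_itv.
split=> //; apply: le_trans (cabs_Int l1) _; rewrite -RintZ //.
apply: Rint_le; [exact: L1_cabs|exact: rL1Z|move=> t].
by rewrite cabsM mulrC ler_pM ?cabs_ge0 // kplus_bound.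
Qed.

(* d'Alembert form of Goursat's equation: the value at (x,t) is the integral
   of [q K] over the backward characteristic cone. *)
Lemma mild_kernel x t : 0 <= x <= b ->
  kplus x t = Int (fun y => 2^-1 * ind (0 <= y <= x) * q y *
    (ind (`|y - t| <= x - y) +
     Int (fun tau => kplus y tau * ind (`|tau - t| <= x - y)))).
Proof.
(* Outside the triangle both sides vanish: a point of the backward cone of [(x, t)] with
   [|tau| <= y] would give [|t| <= x]. *)
move=> /andP[x0 xb]; have [tx|tx] := leP `|t| x; last first.
  rewrite {1}/kplus leNgt tx /= mul0r -[LHS](@Int0 R); congr Int; apply/funext => y.
  have [/andP[y0 yx]|_] := boolP (0 <= y <= x); last by rewrite mulr0 !mul0r.
  rewrite (_ : (`|y - t| <= x - y) = false) ?add0r; last first.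
    apply/negP; rewrite ler_norml => h; move: tx; rewrite ltr_normr => /orP[]; lra.
  rewrite (_ : (fun tau => _) = fun=> 0) ?Int0 ?mulr0 //; apply/funext => tau.
  have [h|h] := boolP (`|tau - t| <= x - y); last by rewrite mulr0.
  rewrite mulr1 /kplus (_ : (`|tau| <= y) = false) ?mul0r //.
  apply/negP => h2; move: h h2 tx; rewrite !ler_norml => h h2.
  by rewrite ltr_normr => /orP[]; lra.
have /andP[t1 t2] : - x <= t <= x by rewrite -ler_norml.
rewrite {1}/kplus tx xb mul1r goursat; [|lra..].
set u := (x + t) / 2; set v := (x - t) / 2.
(* The new variable [y = al + be] is the argument of [q], which has to be integrated last. *)
have E1 al : ind (0 <= al <= u) *
      Int (fun be => ind (0 <= be <= v) * (q (al + be) * H al be)) =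
    Int (fun y => ind (0 <= al <= u) * (ind (0 <= y - al <= v) * (q y * H al (y - al)))).
  have lq : L1 (fun be => q (al + be)).
    have := @L1_affine R 1 al q (oner_neq0 _) L1q.
    by under eq_fun do rewrite mul1r addrC.
  have l1 : L1 (fun be => ind (0 <= be <= v) * (q (al + be) * H al be)).
    apply: L1bool; first by meas.
    have := @L1Mb R (H al) (fun be => q (al + be)) M _ _ lq.
    under eq_fun do rewrite mulrC; apply; first by meas.
    by move=> be; exact: HM.
  rewrite (@Int_affine R 1 (- al) _ (oner_neq0 _) l1) normr1 mul1r -IntZ; last first.
    exact: (L1_affine (- al) (oner_neq0 _) l1).
  congr Int; apply/funext => y; rewrite mul1r (addrC y) addrA subrr add0r.
  by rewrite (addrC (- al)).
under [X in _ + Int X]eq_fun do rewrite E1.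
rewrite (@Int_fubini _ _ (fun al => M * ind (0 <= al <= u)) (fun y => cabs (q y))); last 4 first.
- by meas.
- move=> al y; rewrite !cabsM !cabs_nat.
  have [_|_] := boolP (0 <= al <= u); last by rewrite mulr0 !mul0r.
  rewrite mul1r mulr1; have [_|_] := boolP (_ <= _ <= v); last first.
    by rewrite mul0r mulr_ge0 ?cabs_ge0.
  by rewrite mul1r mulrC ler_wpM2r ?cabs_ge0.
- by apply/rL1Z/rL1_itv.
- exact: L1_cabs.
have mk := cmf_kplus.
(* Substituting [al = (y + tau) / 2], with Jacobian [2^-1], returns to the coordinates of [K] and
   turns the rectangle into the triangle intersected with the cone. *)
have E2 y : Int (fun al => ind (0 <= al <= u) * (ind (0 <= y - al <= v) * (q y * H al (y - al)))) =
    2^-1 * ind (0 <= y <= x) * q y * Int (fun tau => kplus y tau * ind (`|tau - t| <= x - y)).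
  have l1 : L1 (fun al => ind (0 <= al <= u) * (ind (0 <= y - al <= v) * (q y * H al (y - al)))).
    apply: (@L1_itv_bounded _ _ _ (cabs (q y) * M)); first by meas.
    move=> al _; rewrite !cabsM cabs_nat -[leRHS]mul1r.
    by rewrite ler_pM ?mulr_ge0 ?cabs_ge0 ?ind_le1 // ler_wpM2l ?cabs_ge0.
  rewrite (@Int_affine R 2^-1 (y / 2) _ _ l1) ?invr_eq0 ?pnatr_eq0 //.
  have [l2 _] : L1 (fun tau => kplus y tau * ind (`|tau - t| <= x - y)) /\ True.
    split=> //; have [] := @int_kplus_bounded (fun tau => ind (`|tau - t| <= x - y)) 1 y => //.
      by meas.
    by move=> tau; rewrite cabs_nat ind_le1.
  rewrite ger0_norm ?invr_ge0 // -realC_inv2 -!mulrA; congr (_ * _).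
  rewrite mulrA -IntZ //; congr Int; apply/funext => tau.
  rewrite (_ : y - (2^-1 * tau + y / 2) = (y - tau) / 2); last by lra.
  rewrite (_ : 2^-1 * tau + y / 2 = (y + tau) / 2); last by lra.
  rewrite /kplus.
  have -> : (`|tau| <= y <= b) = [&& 0 <= y + tau, 0 <= y - tau & y <= b].
    by rewrite ler_norml; apply/idP/idP; lra.
  have -> : (`|tau - t| <= x - y) = (y + tau <= x + t) && (y - tau <= x - t).
    by rewrite ler_norml; apply/idP/idP; lra.
  have -> : (0 <= (y + tau) / 2 <= u) = (0 <= y + tau) && (y + tau <= x + t).
    by rewrite /u; apply/idP/idP; lra.
  have -> : (0 <= (y - tau) / 2 <= v) = (0 <= y - tau) && (y - tau <= x - t).
    by rewrite /v; apply/idP/idP; lra.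
  have [h1|] := boolP (0 <= y + tau); last by rewrite !(mul0r, mulr0).
  have [h2|] := boolP (0 <= y - tau); last by rewrite !(mul0r, mulr0).
  have [h3|] := boolP (y + tau <= x + t); last by rewrite /= !(mul0r, mulr0).
  have [h4|] := boolP (y - tau <= x - t); last by rewrite /= !(mul0r, mulr0).
  have -> : y <= b by lra.
  have -> : 0 <= y <= x by lra.
  by rewrite /=; ring.
under [X in _ + Int X]eq_fun do rewrite E2.
have l3 : L1 (fun y => ind (0 <= y <= u) * q y) by apply: L1bool => //; meas.
have bN y : cabs (2^-1 * ind (0 <= y <= x) *
    Int (fun tau => kplus y tau * ind (`|tau - t| <= x - y))) <= S.
  rewrite !cabsM realC_inv2 cabs_real ger0_norm ?invr_ge0 // cabs_nat.
  have [] := @int_kplus_bounded (fun tau => ind (`|tau - t| <= x - y)) 1 y => //.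
  - by meas.
  - by move=> tau; rewrite cabs_nat ind_le1.
  move=> _; rewrite mul1r => h; apply: le_trans h; rewrite ler_piMl ?cabs_ge0 //.
  by rewrite mulr_ile1 ?ind_le1 // ?invr_ge0 // invf_le1 ?ler1n.
have l4 : L1 (fun y => 2^-1 * ind (0 <= y <= x) * q y *
    Int (fun tau => kplus y tau * ind (`|tau - t| <= x - y))).
  rewrite (_ : (fun y => _) = (fun y => 2^-1 * ind (0 <= y <= x) *
    Int (fun tau => kplus y tau * ind (`|tau - t| <= x - y)) * q y)); last first.
    by apply/funext => y; ring.
  by apply: (L1Mb _ bN L1q); meas.
rewrite -IntZ // -IntD //; last exact: L1Z.
congr Int; apply/funext => y; rewrite mulrDr; congr (_ + _).
(* The single integral of Goursat's equation runs over the part of the edge [tau = y] that lies in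
   the cone. *)
have -> : (0 <= y <= u) = (0 <= y <= x) && (`|y - t| <= x - y).
  by rewrite /u ler_norml; apply/idP/idP; lra.
by case: (0 <= y <= x); case: (_ <= x - y); rewrite /= !(mul0r,mulr0,mul1r,mulr1).
Qed.

End MildEquation.

(** * Explicit integrals of absolute values *)

Section RealKernels.
Context {R : realType}.
Local Notation C := (complex R).
Local Notation mu := (@lebesgue_measure R).

(** Explicit piecewise quadratic functions, such as [z * |z| / 2], are differentiated through it by
    a polynomial inequality, also at the corner. *)
Lemma derive_quadratic_remainder (F : R -> R) (x l D : R) :
  (forall h, `|F (x + h) - F x - l * h| <= D * h ^+ 2) ->
  derivable F x 1 /\ derive1 F x = l.
Proof.
move=> hF; have D0 : 0 <= D.
  by have := hF 1; rewrite expr1n !mulr1 => h; apply: le_trans h; exact: normr_ge0.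
have cv : (fun h => h^-1 *: (F (h *: 1 + x) - F x)) @ 0^' --> l.
  apply/cvgrPdist_lt => e e0.
  near=> h.
  have h0 : h != 0 by near: h; exact: nbhs_dnbhs_neq.
  have hs : `|h| < e / (D + 1).
    near: h; apply: nbhs_dnbhs; have : 0 < e / (D + 1) by rewrite divr_gt0 // ltr_wpDl.
    by move=> d0; near=> h; rewrite -[h]subr0 distrC; near: h; exact: (@cvgr_dist_lt _ _ _ _ _ id 0).
  rewrite distrC /GRing.scale /= mulr1 [h + x]addrC.
  have -> : h^-1 * (F (x + h) - F x) - l = h^-1 * (F (x + h) - F x - l * h).
    by rewrite !mulrBr [l * h]mulrC mulKf.
  rewrite normrM normfV mulrC ltr_pdivrMr ?normr_gt0 //.
  apply: le_lt_trans (hF h) _; rewrite -(real_normK (num_real h)) expr2 mulrA.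
  rewrite ltr_pM2r ?normr_gt0 // mulrC.
  rewrite ltr_pdivlMr ?ltr_wpDl // in hs.
  by apply: le_lt_trans hs; rewrite ler_wpM2l // lerDl.
have dF : derivable F x 1 by apply/cvg_ex; exists l; exact: cv.
by split => //; rewrite derive1E; exact: cvg_lim cv.
Unshelve. all: by end_near. Qed.

Lemma derive_sqr_half (r x : R) :
  derivable (fun y => (y - r) * `|y - r| / 2) x 1 /\
  derive1 (fun y => (y - r) * `|y - r| / 2) x = `|x - r|.
Proof.
apply: (@derive_quadratic_remainder _ x _ 1) => h.
have -> : x + h - r = (x - r) + h by ring.
set z := x - r; rewrite mul1r ler_norml.
have [h1|h1] := leP 0 z; have [h2|h2] := leP 0 (z + h); rewrite ?(ger0_norm h1) ?(ger0_norm h2) ?(ltr0_norm h1) ?(ltr0_norm h2); nra.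
Qed.

Lemma Int_real (f : R -> R) : Int (fun x => (f x)%:C) = (\int[mu]_x f x)%:C.
Proof.
by apply: cplxP => //=; rewrite (_ : im _ = fun=> 0) ?Rintegral_cst ?mul0r.
Qed.

Lemma arc_itv (s tau t : R) : (`|tau - t| <= s) = (tau - s <= t <= tau + s).
Proof. by rewrite ler_norml; apply/idP/idP; lra. Qed.

Lemma norm_continuous_at (r x : R) : {for x, continuous (fun t : R => `|t - r|)}.
Proof.
apply: (@continuous_comp _ _ _ (fun t : R => t - r) Num.norm); last exact: norm_continuous.
by apply: cvgB; [exact: cvg_id|exact: cvg_cst].
Qed.

(** The terms with [s * |tau - r|] are what an affine function would give; the square is the
    correction due to the corner at [r] when it lies inside the interval. *)
Lemma arc_abs (s tau r : R) : 0 <= s ->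
  \int[mu]_t (ind (`|tau - t| <= s) * `|t - r|) =
  s * `|tau - r| + (s * `|tau - r| + Num.max (s - `|tau - r|) 0 ^+ 2).
Proof.
move=> s0; under eq_Rintegral do rewrite arc_itv.
rewrite (@FTC_itv _ _ (fun y => (y - r) * `|y - r| / 2)); last first.
- by move=> x _; exact: derive_sqr_half.
- by move=> x _; exact: norm_continuous_at.
- lra.
have -> : tau + s - r = (tau - r) + s by ring.
have -> : tau - s - r = (tau - r) - s by ring.
set z := tau - r.
have [h1|h1] := leP 0 z; have [h2|h2] := leP 0 (z + s); have [h3|h3] := leP 0 (z - s);
 rewrite ?(ger0_norm h1) ?(ger0_norm h2) ?(ltr0_norm h1) ?(ltr0_norm h2)
   ?(ger0_norm h3) ?(ltr0_norm h3); case: leP => h4; nra.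
Qed.

Lemma arc_const (s tau : R) : 0 <= s -> \int[mu]_t (ind (`|tau - t| <= s)) = 2 * s.
Proof.
move=> s0; under eq_Rintegral do rewrite arc_itv.
by rewrite Rint_itv1; lra.
Qed.

Lemma arc_id (s tau : R) : 0 <= s -> \int[mu]_t (ind (`|tau - t| <= s) * t) = 2 * s * tau.
Proof.
move=> s0; under eq_Rintegral do rewrite arc_itv.
rewrite (@FTC_itv _ _ (fun y => y ^+ 2 / 2)); last first.
- move=> x _; apply: (@derive_quadratic_remainder _ x _ 1) => h.
  by rewrite mul1r ler_norml; nra.
- by move=> x _; exact: cvg_id.
- lra.
by field.
Qed.

(** Produces the quadratic correction of [arc_abs] as a weighted integral over radii; matching the
    two proves [wave_potential]. *)
Lemma ramp_int (s d : R) : 0 <= d ->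
  \int[mu]_z (ind (0 <= z <= s) * (s - z) * ind (d <= z)) = Num.max (s - d) 0 ^+ 2 / 2.
Proof.
move=> d0; have [ds|ds] := leP d s; last first.
  rewrite (max_idPr _) ?expr0n ?mul0r; last by lra.
  have z x : ind (0 <= x <= s) * (s - x) * ind (d <= x) = 0.
    have [h1|h1] := boolP (0 <= x <= s); last by rewrite !mul0r.
    by rewrite (_ : d <= x = false) ?mulr0 //; apply/negP; lra.
  by under eq_Rintegral do rewrite z; rewrite Rintegral_cst // mul0r.
have E x : ind (0 <= x <= s) * (s - x) * ind (d <= x) = ind (d <= x <= s) * (s - x).
  have -> : (d <= x <= s) = (0 <= x <= s) && (d <= x) by apply/idP/idP; lra.
  by case: (0 <= x <= s); case: (d <= x); rewrite /= !(mul0r,mulr0,mul1r,mulr1).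
under eq_Rintegral do rewrite E.
rewrite (@FTC_itv _ _ (fun y => - (s - y) ^+ 2 / 2)) //.
- by rewrite (max_idPl _) ?subrr; [field|lra].
- by move=> x _; apply: cvgB; [exact: cvg_cst|exact: cvg_id].
- move=> x _; apply: (@derive_quadratic_remainder _ x _ 1) => h.
  by rewrite mul1r ler_norml; nra.
Qed.

End RealKernels.

(** * The wave operator applied to potentials *)

Section Wave.
Context {R : realType}.
Local Notation C := (complex R).
Local Notation mu := (@lebesgue_measure R).

(* Half the integral over the interval of radius [s]: the solution of the wave
   equation with zero data and velocity [f]. *)
Definition wave (s : R) (f : R -> C) (tau : R) : C :=
  Int (fun t => 2^-1 * ind (`|tau - t| <= s) * f t).

(* [|x| / 2] is the fundamental solution of the second derivative. *)
Definition pot (w : R -> C) (x : R) : C := Int (fun r => (2^-1 * `|x - r|)%:C * w r).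

Definition supp_in (b : R) (w : R -> C) : Prop := forall x, b < `|x| -> w x = 0.

Variable b : R.
Hypothesis b0 : 0 <= b.
Variable w : R -> C.
Hypothesis lw : L1 w.
Hypothesis sw : supp_in b w.

Let mw := L1_cmf lw.

Lemma pot_dom (x r : R) : cabs ((2^-1 * `|x - r|)%:C * w r) <= (`|x| + b) * cabs (w r).
Proof.
rewrite cabsM; have [h|h] := leP `|r| b; last by rewrite sw // cabs0 !mulr0.
rewrite ler_wpM2r ?cabs_ge0 // cabs_real ger0_norm ?mulr_ge0 ?invr_ge0 //.
have := ler_normB x r; have := normr_ge0 (x - r); have := normr_ge0 x; lra.
Qed.

Lemma pot_integrand (x : R) : L1 (fun r => (2^-1 * `|x - r|)%:C * w r).
Proof.
apply: (L1_dom (g := fun r => (`|x| + b) * cabs (w r))); first by meas.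
  exact: pot_dom.
by apply/rL1Z/L1_cabs.
Qed.

Lemma pot_le (x : R) : cabs (pot w x) <= (`|x| + b) * \int[mu]_r cabs (w r).
Proof.
apply: le_trans (cabs_Int (pot_integrand x)) _; rewrite -RintZ; last exact: L1_cabs.
apply: Rint_le; [exact/L1_cabs/pot_integrand|exact/rL1Z/L1_cabs|exact: pot_dom].
Qed.

Lemma cmf_pot : cmf (pot w).
Proof. by rewrite /pot; meas. Qed.

Lemma cmf_wave : cmf (fun p : R * R => wave p.1 w p.2).
Proof. by rewrite /wave; meas. Qed.

Lemma wave_integrand (s tau : R) : L1 (fun t => 2^-1 * ind (`|tau - t| <= s) * w t).
Proof.
apply: (@L1Mb _ _ _ 1) => //; first by meas.
move=> t; rewrite cabsM realC_inv2 cabs_real cabs_nat ger0_norm ?invr_ge0 //.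
by rewrite mulr_ile1 ?invr_ge0 ?ind_le1 // invf_le1 ?ler1n.
Qed.

Lemma wave_le (s tau : R) : cabs (wave s w tau) <= \int[mu]_t cabs (w t).
Proof.
apply: le_trans (cabs_Int (wave_integrand s tau)) _.
apply: Rint_le; [exact/L1_cabs/wave_integrand|exact: L1_cabs|move=> t].
rewrite 2!cabsM realC_inv2 cabs_real cabs_nat ger0_norm ?invr_ge0 //.
by rewrite ler_piMl ?cabs_ge0 // mulr_ile1 ?invr_ge0 ?ind_le1 // invf_le1 ?ler1n.
Qed.

(** Taylor's formula in [s]. For [u] affine plus [pot w], the function [s -> wave s u tau] vanishes
    at 0, has derivative [u tau] there, and its second derivative is [wave s w tau]. The proof
    integrates kernels explicitly, so that an integrable [w] is enough. *)
Lemma wave_potential (c0 c1 : C) (s tau : R) : 0 <= s ->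
  wave s (fun x => c0 + c1 * x%:C + pot w x) tau =
  s%:C * (c0 + c1 * tau%:C + pot w tau) +
  Int (fun z => (ind (0 <= z <= s) * (s - z))%:C * wave z w tau).
Proof.
move=> s0.
have la : L1 (fun t => ind (`|tau - t| <= s) * (c0 + c1 * t%:C)).
  under eq_fun do rewrite arc_itv.
  apply: (@L1_itv_bounded _ _ _ (cabs c0 + cabs c1 * (`|tau| + s))); first by meas.
  move=> x; rewrite -arc_itv => h; apply: le_trans (cabsD _ _) _; rewrite lerD2l cabsM.
  rewrite ler_wpM2l ?cabs_ge0 // cabs_real.
  have := ler_normB tau (tau - x); rewrite opprB addrC subrK; lra.
have lp : L1 (fun t => ind (`|tau - t| <= s) * pot w t).
  under eq_fun do rewrite arc_itv.
  apply: (@L1_itv_bounded _ _ _ ((`|tau| + s + b) * \int[mu]_r cabs (w r))).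
    exact: cmf_pot.
  move=> x; rewrite -arc_itv => h; apply: le_trans (pot_le x) _.
  rewrite ler_wpM2r //; first by apply: Rintegral_ge0 => *; exact: cabs_ge0.
  have := ler_normB tau (tau - x); rewrite opprB addrC subrK; lra.
have -> : wave s (fun x => c0 + c1 * x%:C + pot w x) tau =
    2^-1 * Int (fun t => ind (`|tau - t| <= s) * (c0 + c1 * t%:C)) +
    2^-1 * Int (fun t => ind (`|tau - t| <= s) * pot w t).
  rewrite -!IntZ // -IntD; [|exact: L1Z|exact: L1Z].
  by congr Int; apply/funext => t; ring.
have Ea : Int (fun t => ind (`|tau - t| <= s) * (c0 + c1 * t%:C)) =
    2 * (s%:C * (c0 + c1 * tau%:C)).
  have r1 : rL1 (fun t => ind (`|tau - t| <= s)).
    by under eq_fun do rewrite arc_itv; exact: rL1_itv.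
  have r2 : rL1 (fun t => ind (`|tau - t| <= s) * t).
    under eq_fun do rewrite arc_itv.
    apply: (@rL1_itv_bounded _ _ _ (`|tau| + s)); first by meas.
    move=> x; rewrite -arc_itv => h.
    have := ler_normB tau (tau - x); rewrite opprB addrC subrK; lra.
  have l1 : L1 (fun t => (ind (`|tau - t| <= s) : R)%:C).
    by split => //; exact: integrable0.
  have l2 : L1 (fun t => (ind (`|tau - t| <= s) * t)%:C).
    by split => //; exact: integrable0.
  rewrite (_ : (fun t => _) = fun t => c0 * (ind (`|tau - t| <= s) : R)%:C +
      c1 * (ind (`|tau - t| <= s) * t)%:C); last first.
    by apply/funext => t; rewrite rmorphM natC /=; ring.
  rewrite IntD ?IntZ //; [|exact: L1Z|exact: L1Z].
  rewrite !Int_real arc_const // arc_id // !rmorphM rmorph_nat /=; ring.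
have Ep : Int (fun t => ind (`|tau - t| <= s) * pot w t) =
    Int (fun r => (2^-1 * (s * `|tau - r| + (s * `|tau - r| + Num.max (s - `|tau - r|) 0 ^+ 2)))%:C * w r).
  have E1 t : ind (`|tau - t| <= s) * pot w t =
      Int (fun r => ind (`|tau - t| <= s) * ((2^-1 * `|t - r|)%:C * w r)).
    by rewrite IntZ //; exact: pot_integrand.
  under eq_fun do rewrite E1.
  rewrite (@Int_fubini _ _ (fun t => ind (`|tau - t| <= s)) (fun r => (`|tau| + s + b) * cabs (w r))); last 4 first.
  - by meas.
  - move=> t r; rewrite cabsM cabs_nat.
    have [h|_] := boolP (`|tau - t| <= s); last by rewrite !mul0r.
    rewrite !mul1r; apply: le_trans (pot_dom t r) _; rewrite ler_wpM2r ?cabs_ge0 //.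
    have := ler_normB tau (tau - t); rewrite opprB addrC subrK; lra.
  - by under eq_fun do rewrite arc_itv; exact: rL1_itv.
  - by apply/rL1Z/L1_cabs.
  congr Int; apply/funext => r.
  have r1 : rL1 (fun t => ind (`|tau - t| <= s) * `|t - r|).
    under eq_fun do rewrite arc_itv.
    apply: (@rL1_itv_bounded _ _ _ (`|tau| + s + `|r|)); first by meas.
    move=> x; rewrite -arc_itv => h; rewrite normr_id.
    have := ler_normB tau (tau - x); rewrite opprB addrC subrK => h1.
    have := ler_normB x r; lra.
  rewrite (_ : (fun t => _) = fun t => (2^-1 * (ind (`|tau - t| <= s) * `|t - r|))%:C * w r); last first.
    by apply/funext => t; rewrite !rmorphM natC /=; ring.
  rewrite IntZr; last by split; [exact: rL1Z|exact: integrable0].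
  by rewrite Int_real RintZ // arc_abs.
have Ez : Int (fun z => (ind (0 <= z <= s) * (s - z))%:C * wave z w tau) =
    Int (fun r => (2^-1 * (Num.max (s - `|tau - r|) 0 ^+ 2 / 2))%:C * w r).
  have E1 z : (ind (0 <= z <= s) * (s - z))%:C * wave z w tau =
      Int (fun r => (ind (0 <= z <= s) * (s - z))%:C * (2^-1 * ind (`|tau - r| <= z) * w r)).
    by rewrite IntZ //; exact: wave_integrand.
  under eq_fun do rewrite E1.
  rewrite (@Int_fubini _ _ (fun z => s * ind (0 <= z <= s)) (fun r => cabs (w r))); last 4 first.
  - by meas.
  - move=> z r; rewrite mulrA !cabsM ler_wpM2r ?cabs_ge0 // cabs_real.
    have [h|_] := boolP (0 <= z <= s); last by rewrite !(mul0r, normr0, mulr0).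
    rewrite realC_inv2 cabs_real cabs_nat ger0_norm ?mul1r; last by lra.
    rewrite ger0_norm ?invr_ge0 // mulr1.
    have h1 : 2^-1 * ind (`|tau - r| <= z) <= 1 :> R.
      by rewrite mulr_ile1 ?invr_ge0 ?ind_le1 // invf_le1 ?ler1n.
    by apply: le_trans (ler_pM _ _ _ h1) _; rewrite ?mulr_ge0 ?invr_ge0 //; lra.
  - exact/rL1Z/rL1_itv.
  - exact: L1_cabs.
  congr Int; apply/funext => r.
  have r1 : rL1 (fun z => ind (0 <= z <= s) * (s - z) * ind (`|tau - r| <= z)).
    under eq_fun do rewrite -mulrA.
    apply: (@rL1_itv_bounded _ _ _ s); first by meas.
    move=> x h; rewrite ger0_norm ?mulr_ge0 //; last lra.
    by apply: (@le_trans _ _ (s - x)); [rewrite ler_piMr ?ind_le1 //|]; lra.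
  rewrite (_ : (fun z => _) = fun z => (2^-1 * (ind (0 <= z <= s) * (s - z) * ind (`|tau - r| <= z)))%:C * w r); last first.
    by apply/funext => z; rewrite !rmorphM realC_inv2 !natC /=; ring.
  rewrite IntZr; last by split; [exact: rL1Z|exact: integrable0].
  by rewrite Int_real RintZ // ramp_int.
rewrite Ea Ep Ez mulKf ?pnatr_eq0 //.
rewrite [s%:C * (_ + pot w tau)]mulrDr -[RHS]addrA; congr (_ + _).
rewrite /pot -IntZ; last exact: pot_integrand.
have ln r : Num.max (s - `|tau - r|) 0 <= s.
  by rewrite ge_max s0 andbT gerBl.
have l2 : L1 (fun r => (2^-1 * (Num.max (s - `|tau - r|) 0 ^+ 2 / 2))%:C * w r).
  apply: (@L1Mb _ _ _ (s ^+ 2)) => //.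
    apply: cmf_realC; apply: measM; first by meas.
    by apply: measM; [apply: measurable_funX|]; meas.
  move=> r; have m0 : 0 <= Num.max (s - `|tau - r|) 0 by rewrite le_max lexx orbT.
  rewrite cabs_real ger0_norm; last by rewrite !mulr_ge0 ?invr_ge0 ?exprn_ge0.
  by have := ln r; nra.
rewrite -IntD; [|by apply: L1Z; exact: pot_integrand|exact: l2].
rewrite -IntZ; last first.
  rewrite (_ : (fun r => _) = fun r => 2 * (s%:C * ((2^-1 * `|tau - r|)%:C * w r) +
    (2^-1 * (Num.max (s - `|tau - r|) 0 ^+ 2 / 2))%:C * w r)).
    by apply: L1Z; apply: L1D => //; apply: L1Z; exact: pot_integrand.
  apply/funext => r; rewrite mulrA -mulrDl mulrA; congr (_ * _).
  rewrite (natC R 2) -!rmorphM -!rmorphD -!rmorphM /=.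
  by congr (_%:C); field.
congr Int; apply/funext => r; rewrite !mulrA -mulrDl; congr (_ * _).
rewrite realC_inv2 -!rmorphM -!rmorphD /=.
by congr (_%:C); field.
Qed.

End Wave.

Lemma indRC (R : realType) (c : bool) (r : R) (z : complex R) :
  (ind c * r)%:C * z = ind c * (r%:C * z).
Proof. by rewrite mulrA natC -rmorphM. Qed.

(** * The second-order equation for Tu on the half-line *)

Section MildOperator.
Context {R : realType}.
Local Notation C := (complex R).
Local Notation mu := (@lebesgue_measure R).

Variables (b M : R) (q : R -> C) (H : R -> R -> C).
Hypothesis b0 : 0 <= b.
Hypothesis L1q : L1 q.
Hypothesis mH : cmf (fun p : R * R => H p.1 p.2).
Hypothesis HM : forall u v, cabs (H u v) <= M.
Hypothesis goursat : forall u v, 0 <= u -> 0 <= v -> u + v <= b ->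
  H u v = 2^-1 * Int (fun s => ind (0 <= s <= u) * q s) +
    Int (fun al => ind (0 <= al <= u) *
      Int (fun be => ind (0 <= be <= v) * (q (al + be) * H al be))).

Let kp := kplus b H.
Let M0 : 0 <= M. Proof. by apply: le_trans (HM 0 0); exact: cabs_ge0. Qed.
Let mk : cmf (fun p : R * R => kp p.1 p.2). Proof. exact: cmf_kplus. Qed.
Let kb x t : cabs (kp x t) <= M * ind (`|t| <= b). Proof. exact: kplus_bound. Qed.
Let rk : rL1 (fun t => M * ind (`|t| <= b)).
Proof. by under eq_fun do rewrite norm_itv; apply/rL1Z/rL1_itv. Qed.
Let S : R := \int[mu]_t (M * ind (`|t| <= b)).
Let S0 : 0 <= S. Proof. by apply: Rintegral_ge0 => t _; rewrite mulr_ge0. Qed.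

Let kL1 (f : R -> C) (D x : R) : 0 <= D -> cmf f ->
  (forall t, `|t| <= x <= b -> cabs (f t) <= D) ->
  L1 (fun t => kp x t * f t).
Proof.
move=> D0 mf fD; apply: (L1_dom (g := fun t => D * (M * ind (`|t| <= b)))); last exact: rL1Z.
  by meas.
move=> t; rewrite cabsM mulrC; have [h|h] := boolP (`|t| <= x <= b).
  by rewrite ler_pM ?cabs_ge0 ?fD.
by rewrite /kp /kplus (negbTE h) mul0r cabs0 mulr0 !mulr_ge0.
Qed.

Let kInt (f : R -> C) (D x : R) : 0 <= D -> cmf f ->
  (forall t, `|t| <= x <= b -> cabs (f t) <= D) ->
  cabs (Int (fun t => kp x t * f t)) <= D * S.
Proof.
move=> D0 mf fD; have l1 := kL1 D0 mf fD.
apply: le_trans (cabs_Int l1) _; rewrite -RintZ //.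
apply: Rint_le; [exact: L1_cabs|exact: rL1Z|move=> t].
rewrite cabsM mulrC; have [h|h] := boolP (`|t| <= x <= b).
  by rewrite ler_pM ?cabs_ge0 ?fD.
by rewrite /kp /kplus (negbTE h) mul0r cabs0 mulr0 !mulr_ge0.
Qed.

Let tplus (f : R -> C) y : C := f y + Int (fun tau => kp y tau * f tau).

(** Integrate [mild_kernel] against [f]: in the variable [t] the cone is the domain of
    [wave (x - y) f] at [tau], and the two terms of the kernel reassemble into [tplus], the operator
    itself. *)
Lemma mild_operator f x : L1 f -> 0 <= x <= b ->
  Int (fun t => kp x t * f t) =
  Int (fun y => ind (0 <= y <= x) * q y * tplus (wave (x - y) f) y).
Proof.
move=> lf hx; have mf := L1_cmf lf.
pose N y t := ind (`|y - t| <= x - y) + Int (fun tau => kp y tau * ind (`|tau - t| <= x - y)).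
have mN : cmf (fun p : R * R => N p.1 p.2) by rewrite /N; meas.
have NB y t : cabs (N y t) <= 1 + S.
  apply: le_trans (cabsD _ _) _; rewrite cabs_nat lerD ?ind_le1 //.
  rewrite -[S]mul1r; apply: kInt => //; first by meas.
  by move=> tau _; rewrite cabs_nat ind_le1.
have half : cabs (2^-1 : C) = 2^-1 :> R by rewrite realC_inv2 cabs_real ger0_norm ?invr_ge0.
have PB y t : cabs (2^-1 * ind (0 <= y <= x) * q y * N y t) <= cabs (q y) * (1 + S).
  rewrite 3!cabsM half cabs_nat ler_pM ?mulr_ge0 ?cabs_ge0 ?invr_ge0 //.
  by rewrite ler_piMl ?cabs_ge0 // mulr_ile1 ?invr_ge0 ?ind_le1 // invf_le1 ?ler1n.
have E1 t : kp x t * f t = Int (fun y => 2^-1 * ind (0 <= y <= x) * q y * N y t * f t).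
  rewrite {1}/kp (@mild_kernel _ _ _ _ _ L1q mH HM goursat) // IntZr //.
  apply: (L1_dom (g := fun y => (1 + S) * cabs (q y))); first by meas.
    by move=> y; rewrite [leRHS]mulrC; exact: PB.
  by apply/rL1Z/L1_cabs.
under eq_fun do rewrite E1.
rewrite (@Int_fubini _ _ (fun t => (1 + S) * cabs (f t)) (fun y => cabs (q y))); last 4 first.
- by meas; apply: (cmf_comp2 mN); meas.
- move=> t y; rewrite cabsM [leRHS]mulrAC ler_wpM2r ?cabs_ge0 // [leRHS]mulrC; exact: PB.
- by apply/rL1Z/L1_cabs.
- exact: L1_cabs.
congr Int; apply/funext => y.
have l1 : L1 (fun t => 2^-1 * ind (`|y - t| <= x - y) * f t) by exact: wave_integrand.
have l2 : L1 (fun t => 2^-1 * f t * Int (fun tau => kp y tau * ind (`|tau - t| <= x - y))).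
  rewrite (_ : (fun t => _) = fun t => Int (fun tau => kp y tau * ind (`|tau - t| <= x - y)) * (2^-1 * f t)); last by apply/funext => t; ring.
  apply: (@L1Mb _ _ _ S) => //; [by meas|move=> t|exact: L1Z].
  rewrite -[S]mul1r; apply: kInt => //; first by meas.
  by move=> tau _; rewrite cabs_nat ind_le1.
rewrite (_ : (fun t => _) = fun t => ind (0 <= y <= x) * q y *
  (2^-1 * ind (`|y - t| <= x - y) * f t +
   2^-1 * f t * Int (fun tau => kp y tau * ind (`|tau - t| <= x - y)))); last first.
  by apply/funext => t; rewrite /N; ring.
rewrite IntZ; last exact: L1D.
rewrite (IntD l1 l2) -/(wave (x - y) f y).
have -> : tplus (wave (x - y) f) y =
  wave (x - y) f y + Int (fun tau => kp y tau * wave (x - y) f tau) by [].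
suff -> : Int (fun t => 2^-1 * f t * Int (fun tau => kp y tau * ind (`|tau - t| <= x - y))) =
  Int (fun tau => kp y tau * wave (x - y) f tau) by [].
have E2 t : 2^-1 * f t * Int (fun tau => kp y tau * ind (`|tau - t| <= x - y)) =
    Int (fun tau => 2^-1 * f t * (kp y tau * ind (`|tau - t| <= x - y))).
  rewrite IntZ //; apply: (@kL1 _ 1) => //; first by meas.
  by move=> tau _; rewrite cabs_nat ind_le1.
under eq_fun do rewrite E2.
rewrite (@Int_fubini _ _ (fun t => cabs (f t)) (fun tau => M * ind (`|tau| <= b))); last 4 first.
- by meas.
- move=> t tau; rewrite 3!cabsM half cabs_nat.
  apply: ler_pM; rewrite ?mulr_ge0 ?cabs_ge0 ?invr_ge0 //.
    by rewrite ler_piMl ?cabs_ge0 // invf_le1 ?ler1n.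
  by apply: le_trans (kb y tau); rewrite ler_piMr ?cabs_ge0 ?ind_le1.
- exact: L1_cabs.
- exact: rk.
congr Int; apply/funext => tau; rewrite /wave -IntZ; last exact: wave_integrand.
by congr Int; apply/funext => t; ring.
Qed.

Variables (w : R -> C) (c0 c1 : C).
Hypothesis lw : L1 w.
Hypothesis sw : supp_in b w.

Let u x : C := c0 + c1 * x%:C + pot w x.
Let W : R := \int[mu]_x cabs (w x).
Let W0 : 0 <= W. Proof. by apply: Rintegral_ge0 => t _; exact: cabs_ge0. Qed.
Let mw := L1_cmf lw.
Let mp : cmf (pot w). Proof. exact: cmf_pot. Qed.
Let ma : cmf (fun p : R * R => wave p.1 w p.2). Proof. exact: cmf_wave. Qed.
Let mwave d (T : measurableType d) (f g : T -> R) : measurable_fun setT f ->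
  measurable_fun setT g -> cmf (fun x => wave (f x) w (g x)).
Proof. by move=> mf mg; exact: (cmf_comp2 (k := fun s tau => wave s w tau) ma). Qed.
Let mu' : cmf u. Proof. by rewrite /u; meas. Qed.

Let uB x : `|x| <= b -> cabs (u x) <= cabs c0 + cabs c1 * b + (b + b) * W.
Proof.
move=> xb; apply: le_trans (cabsD _ _) _; apply: lerD.
  apply: le_trans (cabsD _ _) _; rewrite lerD2l cabsM cabs_real.
  by rewrite ler_wpM2l ?cabs_ge0.
by apply: le_trans (pot_le lw sw x) _; rewrite ler_wpM2r // lerD2r.
Qed.

Let Du : R := cabs c0 + cabs c1 * b + (b + b) * W.
Let Du0 : 0 <= Du.
Proof. by rewrite !addr_ge0 // ?mulr_ge0 ?cabs_ge0 // addr_ge0. Qed.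

Let ramp s tau : C := Int (fun z => (ind (0 <= z <= s) * (s - z))%:C * wave z w tau).

Let ramp_L1 s tau : L1 (fun z => (ind (0 <= z <= s) * (s - z))%:C * wave z w tau).
Proof.
under eq_fun do rewrite indRC.
apply: (@L1_itv_bounded _ _ _ (s * W)); first by apply: cmfM; [|apply: mwave]; meas.
move=> z hz; rewrite cabsM cabs_real ler_pM ?cabs_ge0 //; last exact: wave_le.
by rewrite ger0_norm; lra.
Qed.

Let ramp_le s tau : 0 <= s <= b -> cabs (ramp s tau) <= b * b * W.
Proof.
move=> sb; apply: le_trans (cabs_Int (ramp_L1 s tau)) _.
apply: (@le_trans _ _ (\int[mu]_z ((b * W) * ind (0 <= z <= s)))).
  apply: Rint_le; [exact/L1_cabs/ramp_L1|exact/rL1Z/rL1_itv|move=> z].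
  rewrite cabsM cabs_real; have [hz|_] := boolP (0 <= z <= s); last first.
    by rewrite mul0r normr0 mul0r mulr0.
  rewrite mul1r mulr1 ler_pM ?cabs_ge0 //; last exact: wave_le.
  by rewrite ger0_norm; lra.
rewrite RintZ ?Rint_itv1; [|lra|exact: rL1_itv].
rewrite subr0 mulrAC ler_wpM2r // ler_wpM2l //; lra.
Qed.

Let mramp : cmf (fun p : R * R => ramp p.1 p.2).
Proof. by rewrite /ramp; meas; apply: mwave; meas. Qed.

(** Inserting [wave_potential] into [mild_operator] for [u] gives the term [(x - y) q(y) Tu(y)] and
    a rest that involves only [w], the second derivative of [u]. The rest is the double primitive of
    [mild_operator] for [w]. No derivative of the kernel is taken. *)
Lemma half_equation x : 0 <= x <= b ->
  Int (fun t => kp x t * u t) =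
  Int (fun z => (ind (0 <= z <= x) * (x - z))%:C *
    (Int (fun t => kp z t * w t) + q z * (u z + Int (fun t => kp z t * u t)))).
Proof.
move=> hx; have /andP[x0 xb] := hx.
(* [u] may grow at infinity. The cut-off makes it integrable and is invisible, since the cones that
   occur stay inside [[-b, b]]. *)
pose f t := ind (`|t| <= b) * u t.
have lf : L1 f.
  rewrite /f; under eq_fun do rewrite norm_itv.
  apply: (@L1_itv_bounded _ _ _ Du) => // y; rewrite -norm_itv; exact: uB.
have kf y : Int (fun t => kp y t * u t) = Int (fun t => kp y t * f t).
  congr Int; apply/funext => t; rewrite /f /kp /kplus.
  have [/andP[h1 h2]|_] := boolP (`|t| <= y <= b); last by rewrite !mul0r.
  by rewrite (le_trans h1 h2) !mul1r.
have arcf y tau : 0 <= y <= x -> `|tau| <= y -> wave (x - y) f tau = wave (x - y) u tau.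
  move=> hy ht; congr Int; apply/funext => t; rewrite /f.
  have [h|_] := boolP (`|tau - t| <= x - y); last by rewrite !(mulr0, mul0r).
  rewrite (_ : (`|t| <= b)) ?mul1r //.
  have := ler_normB tau (tau - t); rewrite opprB addrC subrK; lra.
have lku y : L1 (fun t => kp y t * u t).
  by apply: (@kL1 _ Du) => // t /andP[h1 h2]; apply: uB; exact: le_trans h1 h2.
have rampL y s : 0 <= s <= b -> L1 (fun tau => kp y tau * ramp s tau).
  move=> sb; apply: (@kL1 _ (b * b * W)); [by rewrite !mulr_ge0|by apply: (cmf_comp2 mramp); meas|].
  by move=> t _; exact: ramp_le.
have key y : 0 <= y <= x -> tplus (wave (x - y) f) y =
    (x - y)%:C * (u y + Int (fun t => kp y t * u t)) +
    (ramp (x - y) y + Int (fun tau => kp y tau * ramp (x - y) tau)).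
  move=> hy; rewrite /tplus arcf //; last by rewrite ger0_norm ?lexx //; lra.
  have s0 : 0 <= x - y by lra.
  rewrite (wave_potential lw sw) // -/(u y) -/(ramp (x - y) y).
  have -> : Int (fun tau => kp y tau * wave (x - y) f tau) =
      (x - y)%:C * Int (fun t => kp y t * u t) + Int (fun tau => kp y tau * ramp (x - y) tau).
    rewrite -IntZ // -IntD; [|exact: L1Z|by apply: rampL; lra].
    congr Int; apply/funext => tau.
    have [/andP[h1 h2]|h] := boolP (`|tau| <= y <= b).
      by rewrite arcf // (wave_potential lw sw) // -/(u tau) -/(ramp (x - y) tau); ring.
    by rewrite /kp /kplus (negbTE h) !mul0r mulr0 addr0.
  ring.
rewrite kf (mild_operator lf hx).
pose A y : C := ind (0 <= y <= x) * (x - y)%:C * q y * (u y + Int (fun t => kp y t * u t)).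
pose B y : C := ind (0 <= y <= x) * q y * (ramp (x - y) y + Int (fun tau => kp y tau * ramp (x - y) tau)).
have -> : (fun y => ind (0 <= y <= x) * q y * tplus (wave (x - y) f) y) = fun y => A y + B y.
  apply/funext => y; rewrite /A /B; have z (e1 e2 e3 e4 e5 : C) :
    ind false * e1 * e2 = ind false * e3 * e1 * e4 + ind false * e1 * e5.
    by rewrite !mul0r addr0.
  have [h|_] := boolP (0 <= y <= x); first by rewrite key //; ring.
  exact: z.
have Ib (g : R -> C) (D : R) : cmf g -> (forall y, 0 <= y <= x -> cabs (g y) <= D) -> 0 <= D ->
    L1 (fun y => ind (0 <= y <= x) * q y * g y).
  move=> mg gD D0; apply: (L1_dom (g := fun y => D * cabs (q y))); first by meas.
    move=> y; rewrite !cabsM cabs_nat; have [h|_] := boolP (0 <= y <= x).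
      by rewrite mul1r mulrC ler_wpM2r ?cabs_ge0 ?gD.
    by rewrite !mul0r mulr_ge0 ?cabs_ge0.
  exact/rL1Z/L1_cabs.
have kuB y : 0 <= y <= x -> cabs (u y + Int (fun t => kp y t * u t)) <= Du + Du * S.
  move=> hy; apply: le_trans (cabsD _ _) _; apply: lerD.
    by apply: uB; rewrite ger0_norm; lra.
  by apply: kInt => // t /andP[h1 h2]; apply: uB; exact: le_trans h1 h2.
have lA : L1 A.
  rewrite (_ : A = fun y => ind (0 <= y <= x) * q y * ((x - y)%:C * (u y + Int (fun t => kp y t * u t)))); last by apply/funext => y; rewrite /A; ring.
  apply: (Ib _ (b * (Du + Du * S))); [by meas| |by rewrite mulr_ge0 // addr_ge0 // mulr_ge0].
  move=> y hy; rewrite cabsM cabs_real ler_pM ?cabs_ge0 ?kuB //.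
  by rewrite ger0_norm; lra.
have lB : L1 B.
  apply: (Ib _ (b * b * W + b * b * W * S)); [by meas| |].
    move=> y hy; apply: le_trans (cabsD _ _) _; apply: lerD.
      by apply: ramp_le; lra.
    apply: kInt; [by rewrite !mulr_ge0|by apply: (cmf_comp2 mramp); meas|].
    by move=> t _; apply: ramp_le; lra.
  by rewrite addr_ge0 // !mulr_ge0.
rewrite (IntD lA lB).
pose Kw z := Int (fun t => kp z t * w t).
have mKw : cmf Kw by rewrite /Kw; meas.
have lKw : L1 (fun z => (ind (0 <= z <= x) * (x - z))%:C * Kw z).
  under eq_fun do rewrite indRC.
  apply: (@L1_itv_bounded _ _ _ (b * (M * W))); first by meas.
  move=> z hz; rewrite cabsM cabs_real ler_pM ?cabs_ge0 //.
    by rewrite ger0_norm; lra.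
  have l3 : L1 (fun t => kp z t * w t).
    apply: (@L1Mb _ _ _ M) => //; first by meas.
    by move=> t; apply: le_trans (kb z t) _; rewrite ler_piMr ?ind_le1.
  apply: le_trans (cabs_Int l3) _; rewrite -RintZ; last exact: L1_cabs.
  apply: Rint_le; [exact: L1_cabs|exact/rL1Z/L1_cabs|move=> t].
  rewrite cabsM ler_wpM2r ?cabs_ge0 //.
  by apply: le_trans (kb z t) _; rewrite ler_piMr ?ind_le1.
have -> : (fun z => (ind (0 <= z <= x) * (x - z))%:C *
    (Int (fun t => kp z t * w t) + q z * (u z + Int (fun t => kp z t * u t)))) =
    fun z => (ind (0 <= z <= x) * (x - z))%:C * Kw z + A z.
  by apply/funext => z; rewrite /A /Kw rmorphM natC /=; ring.
rewrite (IntD lKw lA) addrC.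
suff -> : Int B = Int (fun z => (ind (0 <= z <= x) * (x - z))%:C * Kw z) by [].
have mt : cmf (fun p : R * R => tplus (wave p.1 w) p.2).
  rewrite /tplus; apply: cmfD; first exact: ma.
  by apply: cmf_Int; apply: cmfM; [|apply: mwave]; meas.
have mtw d (T : measurableType d) (f1 g1 : T -> R) : measurable_fun setT f1 ->
    measurable_fun setT g1 -> cmf (fun x => tplus (wave (f1 x) w) (g1 x)).
  by move=> mf1 mg1; exact: (cmf_comp2 (k := fun s y => tplus (wave s w) y) mt).
have tB s y : cabs (tplus (wave s w) y) <= W + W * S.
  apply: le_trans (cabsD _ _) _; apply: lerD; first exact: wave_le.
  apply: kInt => //; first by apply: mwave; meas.
  by move=> t _; exact: wave_le.
have E1 z : (ind (0 <= z <= x) * (x - z))%:C * Kw z =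
    Int (fun y => (ind (0 <= z <= x) * (x - z))%:C * (ind (0 <= y <= z) * q y * tplus (wave (z - y) w) y)).
  have [hz|_] := boolP (0 <= z <= x); last first.
    by rewrite mul0r !mul0r; under [in RHS]eq_fun do rewrite mul0r; rewrite Int0.
  rewrite /Kw mild_operator //; last by lra.
  apply: esym; apply: IntZ; apply: (L1_dom (g := fun y => (W + W * S) * cabs (q y))).
  - by apply: cmfM; [by meas|by apply: mtw; meas].
  - move=> y; rewrite !cabsM cabs_nat mulrC ler_pM ?cabs_ge0 ?mulr_ge0 ?cabs_ge0 //.
    by rewrite ler_piMl ?cabs_ge0 ?ind_le1.
  - exact/rL1Z/L1_cabs.
under eq_fun do rewrite E1.
rewrite (@Int_fubini _ _ (fun z => (b * (W + W * S)) * ind (0 <= z <= x)) (fun y => cabs (q y))); last 4 first.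
- by apply: cmfM; [by meas|]; apply: cmfM; [by meas|by apply: mtw; meas].
- move=> z y; rewrite cabsM cabs_real; have [hz|_] := boolP (0 <= z <= x); last first.
    by rewrite mul0r normr0 mul0r mulr0 mul0r.
  rewrite mul1r mulr1 -[leRHS]mulrA ler_pM ?cabs_ge0 //; first by rewrite ger0_norm; lra.
  rewrite !cabsM cabs_nat mulrC ler_pM ?cabs_ge0 ?mulr_ge0 ?cabs_ge0 //.
  by rewrite ler_piMl ?cabs_ge0 ?ind_le1.
- exact/rL1Z/rL1_itv.
- exact: L1_cabs.
apply: esym; congr Int; apply/funext => y; rewrite /B.
have [hy|hy] := boolP (0 <= y <= x); last first.
  have z3 (e1 e2 : C) : 0 = ind false * e1 * e2 by rewrite !mul0r.
  apply: etrans _ (z3 _ _); rewrite -[RHS](@Int0 R); congr Int; apply/funext => z.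
  have z1 (e1 : R) (e2 : C) : (ind false * e1)%:C * e2 = 0 by rewrite !mul0r.
  have [h1|_] := boolP (0 <= z <= x); last exact: z1.
  have z2 (e1 e2 e3 : C) : e1 * (ind false * e2 * e3) = 0 by rewrite !mul0r mulr0.
  have [h2|_] := boolP (0 <= y <= z); last exact: z2.
  by case/negP: hy; lra.
(* For fixed [y], shifting [z] by [y] turns the ramp on [[y, x]] into the one on [[0, s]] that
   defines [ramp]. *)
pose s := x - y.
have l4 : L1 (fun z => (ind (0 <= z <= x) * (x - z))%:C *
    (ind (0 <= y <= z) * q y * tplus (wave (z - y) w) y)).
  under eq_fun do rewrite indRC.
  apply: (@L1_itv_bounded _ _ _ (b * (cabs (q y) * (W + W * S)))).
    by apply: cmfM; [by meas|]; apply: cmfM; [by meas|by apply: mtw; meas].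
  move=> z hz; rewrite cabsM cabs_real ler_pM ?cabs_ge0 //; first by rewrite ger0_norm; lra.
  rewrite !cabsM cabs_nat ler_pM ?cabs_ge0 ?mulr_ge0 ?cabs_ge0 //.
  by rewrite ler_piMl ?cabs_ge0 ?ind_le1.
rewrite (@Int_affine R 1 y _ (oner_neq0 _) l4) normr1 [LHS]mul1r [ind true * q y]mul1r.
have lr := ramp_L1 s y.
have E2 z : (ind (0 <= 1 * z + y <= x) * (x - (1 * z + y)))%:C *
    (ind (0 <= y <= 1 * z + y) * q y * tplus (wave (1 * z + y - y) w) y) =
    q y * ((ind (0 <= z <= s) * (s - z))%:C * tplus (wave z w) y).
  rewrite mul1r addrK /s (_ : x - (z + y) = x - y - z); last by ring.
  have -> : (0 <= z + y <= x) = (0 <= z + y) && (z <= x - y) by apply/idP/idP; lra.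
  have -> : (0 <= y <= z + y) = (0 <= z) by apply/idP/idP; lra.
  have [h1|_] := boolP (0 <= z); last by rewrite /= !(mul0r, mulr0).
  have -> : 0 <= z + y by lra.
  by rewrite [ind true * q y]mul1r; exact: mulrCA.
under eq_fun do rewrite E2.
have l5 : L1 (fun z => (ind (0 <= z <= s) * (s - z))%:C * tplus (wave z w) y).
  under eq_fun do rewrite indRC.
  apply: (@L1_itv_bounded _ _ _ (b * (W + W * S))).
    by apply: cmfM; [by meas|by apply: mtw; meas].
  move=> z hz; rewrite cabsM cabs_real ler_pM ?cabs_ge0 //; rewrite ger0_norm /s; move: hz; rewrite /s; lra.
rewrite (IntZ _ l5).
have l6 : L1 (fun z => (ind (0 <= z <= s) * (s - z))%:C * Int (fun tau => kp y tau * wave z w tau)).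
  have -> : (fun z => (ind (0 <= z <= s) * (s - z))%:C * Int (fun tau => kp y tau * wave z w tau)) =
    fun z => (ind (0 <= z <= s) * (s - z))%:C * tplus (wave z w) y -
      (ind (0 <= z <= s) * (s - z))%:C * wave z w y.
    by apply/funext => z; rewrite /tplus; ring.
  exact: L1B.
have -> : (fun z => (ind (0 <= z <= s) * (s - z))%:C * tplus (wave z w) y) =
  fun z => (ind (0 <= z <= s) * (s - z))%:C * wave z w y +
    (ind (0 <= z <= s) * (s - z))%:C * Int (fun tau => kp y tau * wave z w tau).
  by apply/funext => z; rewrite /tplus mulrDr.
rewrite (IntD lr l6).
rewrite -/s; apply: (congr1 (fun e => q y * (ramp s y + e))).
have E3 z : (ind (0 <= z <= s) * (s - z))%:C * Int (fun tau => kp y tau * wave z w tau) =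
    Int (fun tau => (ind (0 <= z <= s) * (s - z))%:C * (kp y tau * wave z w tau)).
  apply: esym; apply: IntZ; apply: (@kL1 _ W); [exact: W0|by apply: mwave; meas|].
  by move=> t _; exact: wave_le.
apply: (etrans (congr1 Int (funext E3))).
rewrite (@Int_fubini _ _ (fun z => (b * W) * ind (0 <= z <= s)) (fun tau => M * ind (`|tau| <= b))); last 4 first.
- by meas; apply: mwave; meas.
- move=> z tau; rewrite cabsM [cabs (kp y tau * _)]cabsM cabs_real; have [hz|_] := boolP (0 <= z <= s); last first.
    by rewrite mul0r normr0 mul0r !mulr0 mul0r.
  rewrite mul1r mulr1 -[leRHS]mulrA ler_pM ?mulr_ge0 ?cabs_ge0 //.
    by rewrite ger0_norm; move: hz; rewrite /s; lra.
  rewrite mulrC; apply: ler_pM; [exact: cabs_ge0|exact: cabs_ge0|exact: wave_le|exact: kb].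
- exact/rL1Z/rL1_itv.
- exact: rk.
congr Int; apply/funext => tau; rewrite /ramp -IntZ; last exact: ramp_L1.
by congr Int; apply/funext => z; ring.
Qed.

End MildOperator.

(** * The two-sided operator and its transpose *)

Section TwoSided.
Context {R : realType}.
Local Notation C := (complex R).
Local Notation mu := (@lebesgue_measure R).

Lemma ae_neq (c : R) : {ae mu, forall x : R, x != c}.
Proof.
exists [set c]; split; [by []|exact: lebesgue_measure_set1|].
by move=> x /= /negP; rewrite negbK => /eqP.
Qed.

Lemma Int_opp (f : R -> C) : L1 f -> Int f = Int (fun x => f (- x)).
Proof.
move=> lf; have n1 : (-1 : R) != 0 by rewrite oppr_eq0 oner_eq0.
rewrite (@Int_affine R (-1) 0 f n1 lf) normrN1 mul1r.
by congr Int; apply/funext => x; rewrite mulN1r addr0.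
Qed.

Lemma L1_opp (f : R -> C) : L1 f -> L1 (fun x => f (- x)).
Proof.
move=> lf; have n1 : (-1 : R) != 0 by rewrite oppr_eq0 oner_eq0.
have := @L1_affine R (-1) 0 f n1 lf.
by under eq_fun do rewrite mulN1r addr0.
Qed.

Definition sgnR (x : R) : R := if 0 <= x then 1 else -1.

Lemma meas_sgnR d (T : measurableType d) (f : T -> R) : measurable_fun setT f ->
  measurable_fun setT (fun x => sgnR (f x)).
Proof. by move=> mf; apply: meas_if; meas. Qed.

(* The kernel of the double primitive that vanishes with its derivative at 0. *)
Definition v0 (x s : R) : R :=
  if 0 <= x then ind (0 <= s <= x) * (x - s) else ind ((x <= s) && (s < 0)) * (s - x).

(** The kernel of [V0] is that of [pot] up to an affine function of [x]. The value of [sgnR] at 0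
    and the strict inequality in [v0] are matched, so the identity has no exceptional point. *)
Lemma v0E x s : v0 x s = 2^-1 * `|x - s| - 2^-1 * `|s| + x * (2^-1 * sgnR s).
Proof.
rewrite /v0 /sgnR; have [x0|x0] := leP 0 x; have [s0|s0] := leP 0 s.
- rewrite (ger0_norm s0); have [h|h] := leP s x.
    by rewrite ger0_norm ?subr_ge0 //= mul1r; lra.
  by rewrite ltr0_norm ?subr_lt0 //= mul0r; lra.
- by rewrite (ltr0_norm s0) /= mul0r ger0_norm; lra.
- by rewrite (ger0_norm s0) andbF mul0r ltr0_norm; lra.
- rewrite (ltr0_norm s0) andbT; have [h|h] := leP x s.
    by rewrite ler0_norm ?subr_le0 //= mul1r; lra.
  by rewrite gtr0_norm ?subr_gt0 //= mul0r; lra.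
Qed.

Lemma v0_bound x s : `|v0 x s| <= `|x| * ind (`|s| <= `|x|).
Proof.
rewrite /v0; have [x0|x0] := leP 0 x.
  have [/andP[h1 h2]|_] := boolP (0 <= s <= x); last by rewrite mul0r normr0 mulr_ge0.
  rewrite mul1r !ger0_norm ?h2 ?mulr1; lra.
have [/andP[h1 h2]|_] := boolP (_ && _); last by rewrite mul0r normr0 mulr_ge0.
by rewrite mul1r (ltr0_norm x0) (ltr0_norm h2) ger0_norm ?lerN2 ?h1 ?mulr1; lra.
Qed.

Lemma v0_le x s : `|v0 x s| <= `|x|.
Proof. by apply: le_trans (v0_bound x s) _; rewrite ler_piMr ?ind_le1. Qed.

Lemma meas_v0 d (T : measurableType d) (f g : T -> R) : measurable_fun setT f ->
  measurable_fun setT g -> measurable_fun setT (fun x => v0 (f x) (g x)).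
Proof. by move=> mf mg; apply: meas_if; meas. Qed.

Definition V0 (f : R -> C) (x : R) : C := Int (fun s => (v0 x s)%:C * f s).

Lemma V0_integrand f x : L1 f -> L1 (fun s => (v0 x s)%:C * f s).
Proof.
move=> lf; apply: (@L1Mb _ _ _ `|x|) => //.
  by apply: cmf_realC; apply: meas_v0; meas.
move=> s; rewrite cabs_real; apply: le_trans (v0_bound x s) _.
by rewrite ler_piMr ?ind_le1.
Qed.

Lemma cmf_V0 f : cmf f -> cmf (V0 f).
Proof.
move=> mf; apply: cmf_Int; apply: cmfM; last by meas.
by apply: cmf_realC; apply: meas_v0; meas.
Qed.

Lemma V0_le f x : L1 f -> cabs (V0 f x) <= `|x| * \int[mu]_s (ind (`|s| <= `|x|) * cabs (f s)).
Proof.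
move=> lf; have mf := L1_cmf lf; have l1 := V0_integrand x lf.
have r1 : rL1 (fun s => ind (`|s| <= `|x|) * cabs (f s)).
  apply: (rL1_dom _ _ (L1_cabs lf)); first by meas.
  by move=> s; rewrite ger0_norm ?mulr_ge0 ?cabs_ge0 // ler_piMl ?cabs_ge0 ?ind_le1.
apply: le_trans (cabs_Int l1) _; rewrite -RintZ //.
apply: Rint_le; [exact: L1_cabs|exact: rL1Z|move=> s].
by rewrite cabsM cabs_real mulrA ler_wpM2r ?cabs_ge0 // v0_bound.
Qed.

Lemma V0D f g x : L1 f -> L1 g -> V0 (fun s => f s + g s) x = V0 f x + V0 g x.
Proof.
move=> lf lg; rewrite /V0 -IntD; [|exact: V0_integrand|exact: V0_integrand].
by congr Int; apply/funext => s; rewrite mulrDr.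
Qed.

Lemma V0_pot b f x : L1 f -> supp_in b f ->
  V0 f x = pot f x - pot f 0 + x%:C * Int (fun s => (2^-1 * sgnR s)%:C * f s).
Proof.
move=> lf sf.
have ls : L1 (fun s => (2^-1 * sgnR s)%:C * f s).
  apply: (@L1Mb _ _ _ 1) => //; first by meas; exact: meas_sgnR.
  move=> s; rewrite cabs_real /sgnR; case: ifP => _; rewrite ?mulr1 ?mulrN1 ?normrN ger0_norm ?invr_ge0 // invf_le1 ?ler1n //.
rewrite /pot -IntZ //.
have l1 := pot_integrand lf sf x; have l2 := pot_integrand lf sf 0.
rewrite -(IntB l1 l2) -IntD; [|exact: L1B|exact: L1Z].
congr Int; apply/funext => s; rewrite sub0r normrN v0E !rmorphD !rmorphN !rmorphM /=; ring.
Qed.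

Lemma cmf_volterra_rhs (k : R -> R -> C) (q w u : R -> C) (c : R) :
  cmf (fun p : R * R => k p.1 p.2) -> cmf q -> cmf w -> cmf u ->
  cmf (fun z : R => (ind (0 <= z <= c) * (c - z))%:C *
    (Int (fun t => k z t * w t) + q z * (u z + Int (fun t => k z t * u t)))).
Proof.
move=> mk mq mw mu'.
have kint (f : R -> C) : cmf f -> cmf (fun z : R => Int (fun t => k z t * f t)).
  by move=> mf; apply: cmf_Int; apply: cmfM; [exact: mk|meas].
apply: cmfM; first by meas.
by apply: cmfD; [exact: kint|apply: cmfM; [exact: mq|apply: cmfD; [exact: mu'|exact: kint]]].
Qed.

Section Kernel.
Variables (b M : R) (q : R -> C) (H : R -> R -> C).
Hypothesis b0 : 0 <= b.
Hypothesis L1q : L1 q.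
Hypothesis sq : supp_in b q.
Hypothesis mH : cmf (fun p : R * R => H p.1 p.2).
Hypothesis HM : forall u v, cabs (H u v) <= M.

Let M0 : 0 <= M. Proof. by apply: le_trans (HM 0 0); exact: cabs_ge0. Qed.

(** [sgnR x] is the orientation sign of the integral from [-x] to [x]; with it one kernel serves
    both half-lines. *)
Definition tker (x t : R) : C :=
  ind (`|t| <= `|x| <= b) * ((sgnR x)%:C * H ((x + t) / 2) ((x - t) / 2)).

(** The reflection of both variables of [K]: it satisfies Goursat's equation for the reflected [q]
    and reduces negative [x] to positive [x]. *)
Definition Hopp (u v : R) : C := - H (- u) (- v).

Lemma tker_pos x t : 0 <= x -> tker x t = kplus b H x t.
Proof. by move=> x0; rewrite /tker /kplus /sgnR x0 (ger0_norm x0) /= rmorph1 mul1r. Qed.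

Lemma tker_neg x t : x < 0 -> tker x t = kplus b Hopp (- x) (- t).
Proof.
move=> x0; rewrite /tker /kplus /sgnR /Hopp (leNgt 0 x) x0 /= (ltr0_norm x0) normrN; congr (_ * _).
rewrite rmorphN mulN1r; congr (- H _ _); lra.
Qed.

Lemma cmf_tker : cmf (fun p : R * R => tker p.1 p.2).
Proof.
rewrite /tker; apply: cmfM; first by meas.
by apply: cmfM; [apply: cmf_realC; apply: meas_sgnR|]; meas.
Qed.

Lemma tker_bound x t : cabs (tker x t) <= M * ind (`|t| <= `|x| <= b).
Proof.
rewrite /tker cabsM cabs_nat mulrC ler_wpM2r // cabsM cabs_real.
have -> : `|sgnR x| = 1 by rewrite /sgnR; case: ifP; rewrite ?normrN normr1.
by rewrite mul1r.
Qed.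

Let mk := cmf_tker.
Let kM := tker_bound.

Definition Top (u : R -> C) (x : R) : C := u x + kop tker u x.
Definition TopT (u : R -> C) (x : R) : C := u x + kopT tker u x.

Definition cutoff (u : R -> C) (x : R) : C := ind (`|x| <= b) * u x.

Lemma supp_cutoff u : supp_in b (cutoff u).
Proof. by move=> x h; rewrite /cutoff leNgt h mul0r. Qed.

Lemma kop_cutoff u : kop tker (cutoff u) = kop tker u.
Proof.
apply/funext => x; congr Int; apply/funext => t; rewrite /tker /cutoff.
have [/andP[h1 h2]|_] := boolP (_ <= _ <= _); last by rewrite !mul0r.
by rewrite (le_trans h1 h2) [ind true * u t]mul1r.
Qed.

Lemma kop_supp u : supp_in b (kop tker u).
Proof.
move=> x h; rewrite /kop -[RHS](@Int0 R); congr Int; apply/funext => t.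
by rewrite /tker (leNgt `|x|) h andbF !mul0r.
Qed.

Lemma kopT_supp u : supp_in b (kopT tker u).
Proof.
move=> t h; rewrite /kopT -[RHS](@Int0 R); congr Int; apply/funext => x; rewrite /tker.
have [/andP[h1 h2]|_] := boolP (_ <= _ <= _); last by rewrite !mul0r.
by have := lt_le_trans h (le_trans h1 h2); rewrite ltxx.
Qed.

Lemma L1_cutoff (u : R -> C) (D : R) : cmf u -> (forall x : R, `|x| <= b -> cabs (u x) <= D) -> L1 (cutoff u).
Proof.
move=> mu' uD; rewrite /cutoff; under eq_fun do rewrite norm_itv.
by apply: (@L1_itv_bounded _ _ _ D) => // x; rewrite -norm_itv; exact: uD.
Qed.

Hypothesis goursat : forall u v, 0 <= u -> 0 <= v -> u + v <= b ->
  H u v = 2^-1 * Int (fun s => ind (0 <= s <= u) * q s) +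
    Int (fun al => ind (0 <= al <= u) *
      Int (fun be => ind (0 <= be <= v) * (q (al + be) * H al be))).
Hypothesis goursat_opp : forall u v, 0 <= u -> 0 <= v -> u + v <= b ->
  Hopp u v = 2^-1 * Int (fun s => ind (0 <= s <= u) * q (- s)) +
    Int (fun al => ind (0 <= al <= u) *
      Int (fun be => ind (0 <= be <= v) * (q (- (al + be)) * Hopp al be))).

Section Equation.
Variables (w : R -> C) (c0 c1 : C).
Hypothesis lw : L1 w.
Hypothesis sw : supp_in b w.

Let u x : C := c0 + c1 * x%:C + V0 w x.

Lemma affineV0_bound x : `|x| <= b ->
  cabs (u x) <= cabs c0 + cabs c1 * b + b * \int[mu]_s cabs (w s).
Proof.
move=> xb; apply: le_trans (cabsD _ _) _; apply: lerD.
  apply: le_trans (cabsD _ _) _; rewrite lerD2l cabsM cabs_real.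
  by rewrite ler_wpM2l ?cabs_ge0.
have mw := L1_cmf lw; apply: le_trans (V0_le x lw) _; apply: ler_pM => //.
  by apply: Rintegral_ge0 => s _; rewrite mulr_ge0 ?cabs_ge0.
apply: Rint_le; last by move=> s; rewrite ler_piMl ?cabs_ge0 ?ind_le1.
  apply: (rL1_dom _ _ (L1_cabs lw)); first by meas.
  by move=> s; rewrite ger0_norm ?mulr_ge0 ?cabs_ge0 // ler_piMl ?cabs_ge0 ?ind_le1.
exact: L1_cabs.
Qed.

Lemma cmf_affineV0 : cmf u.
Proof. by have mw := cmf_V0 (L1_cmf lw); rewrite /u; meas. Qed.

Lemma L1_cutoff_affineV0 : L1 (cutoff u).
Proof. exact: (L1_cutoff cmf_affineV0 affineV0_bound). Qed.

Let lk : L1 (kop tker u).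
Proof. by rewrite -kop_cutoff; apply: (kop_L1 b0 mk kM); exact: L1_cutoff_affineV0. Qed.

Let lkw : L1 (kop tker w). Proof. exact: (kop_L1 b0 mk kM lw). Qed.

Let kuB x : cabs (kop tker u x) <=
  M * \int[mu]_s cabs (cutoff u s).
Proof.
rewrite -kop_cutoff; apply: le_trans (kop_le b0 mk kM x L1_cutoff_affineV0) _.
have mc := L1_cmf L1_cutoff_affineV0.
rewrite ler_wpM2l //; apply: Rint_le; last by move=> s; rewrite ler_piMl ?cabs_ge0 ?ind_le1.
  apply: (rL1_dom _ _ (L1_cabs L1_cutoff_affineV0)); first by meas.
  by move=> s; rewrite ger0_norm ?mulr_ge0 ?cabs_ge0 // ler_piMl ?cabs_ge0 ?ind_le1.
exact: L1_cabs L1_cutoff_affineV0.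
Qed.

Lemma L1_qTop : L1 (fun x => q x * Top u x).
Proof.
have lc := L1_cutoff_affineV0; have mu' := cmf_affineV0; have mku := L1_cmf lk.
apply: (L1_dom (g := fun x => (cabs c0 + cabs c1 * b + b * \int[mu]_s cabs (w s) +
    M * \int[mu]_s cabs (cutoff u s)) * cabs (q x))).
- by rewrite /Top; meas.
- move=> x; have [xb|xb] := leP `|x| b; last by rewrite sq // mul0r !cabs0 mulr0.
  rewrite cabsM mulrC ler_wpM2r ?cabs_ge0 //; apply: le_trans (cabsD _ _) _.
  by apply: lerD; [exact: affineV0_bound|exact: kuB].
- exact/rL1Z/L1_cabs.
Qed.

Let pot_form x : u x = (c0 - pot w 0) + (c1 + Int (fun s => (2^-1 * sgnR s)%:C * w s)) * x%:C + pot w x.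
Proof. by rewrite /u (V0_pot x lw sw); ring. Qed.

Lemma transmut_ode_kop x : `|x| <= b ->
  kop tker u x = V0 (fun z => kop tker w z + q z * Top u z) x.
Proof.
have uE : u = fun x => (c0 - pot w 0) + (c1 + Int (fun s => (2^-1 * sgnR s)%:C * w s)) * x%:C + pot w x.
  by apply/funext => y; exact: pot_form.
have [x0 xb|x0 xb] := leP 0 x.
  have kE z (f : R -> C) : 0 <= z -> kop tker f z = Int (fun t => kplus b H z t * f t).
    by move=> z0; congr Int; apply/funext => t; rewrite tker_pos.
  have hx : 0 <= x <= b by move: xb; rewrite ger0_norm // x0.
  have E : Int (fun t => kplus b H x t * u t) =
    Int (fun z => (ind (0 <= z <= x) * (x - z))%:C *
      (Int (fun t => kplus b H z t * w t) + q z * (u z + Int (fun t => kplus b H z t * u t)))).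
    by rewrite uE; exact: (half_equation b0 L1q mH HM goursat _ _ lw sw hx).
  rewrite (kE x u x0) E.
  congr Int; apply/funext => z; rewrite /v0 x0.
  have z1 (e1 : R) (e2 e3 : C) : (ind false * e1)%:C * e2 = (ind false * e1)%:C * e3.
    by rewrite !mul0r.
  have [/andP[z0 _]|_] := boolP (0 <= z <= x); last exact: z1.
  by rewrite /Top (kE z w z0) (kE z u z0).
(* Negative [x]: reflection leads to the half-line equation for [w'], [q'] and [Hopp H]. *)
pose w' x := w (- x); pose q' x := q (- x).
have lw' : L1 w' by exact: L1_opp.
have lq' : L1 q' by exact: L1_opp.
have sw' : supp_in b w' by move=> y; rewrite -normrN => /sw.
have mH' : cmf (fun p : R * R => Hopp p.1 p.2) by rewrite /Hopp; meas.
have HM' s v : cabs (Hopp s v) <= M by rewrite cabsN.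
have kE z (f : R -> C) : 0 < z -> L1 (fun t => tker (- z) t * f t) ->
    kop tker f (- z) = Int (fun t => kplus b Hopp z t * f (- t)).
  move=> z0 lf; rewrite /kop (Int_opp lf); congr Int; apply/funext => t.
  by rewrite tker_neg ?oppr_lt0 // !opprK.
have luk z : L1 (fun t => tker z t * u t).
  have := kop_integrand b0 mk kM z L1_cutoff_affineV0.
  congr L1; apply/funext => t; rewrite /tker /cutoff.
  have [/andP[h1 h2]|_] := boolP (_ <= _ <= _); last by rewrite !mul0r.
  by rewrite (le_trans h1 h2) [ind true * u t]mul1r.
have hx : 0 <= - x <= b by move: xb; rewrite ltr0_norm // => ->; rewrite oppr_ge0 ltW.
have potE y : pot w' y = pot w (- y).
  rewrite /pot (Int_opp (pot_integrand lw' sw' y)); congr Int; apply/funext => r.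
  by rewrite /w' opprK -normrN; congr ((_ * `|_|)%:C * _); ring.
pose d0 := c0 - pot w 0; pose d1 := - (c1 + Int (fun s => (2^-1 * sgnR s)%:C * w s)).
pose u' y := u (- y).
have u'E : u' = fun y => d0 + d1 * y%:C + pot w' y.
  by apply/funext => y; rewrite /u' uE potE rmorphN /d0 /d1; ring.
have E : Int (fun t => kplus b Hopp (- x) t * u' t) =
    Int (fun z => (ind (0 <= z <= - x) * (- x - z))%:C *
      (Int (fun t => kplus b Hopp z t * w' t) +
       q' z * (u' z + Int (fun t => kplus b Hopp z t * u' t)))).
  by rewrite u'E; exact: (half_equation b0 lq' mH' HM' goursat_opp _ _ lw' sw' hx).
have xp : 0 < - x by rewrite oppr_gt0.
rewrite -{1}[x]opprK (kE _ _ xp); last by rewrite opprK; exact: luk.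
rewrite -/(u' _) in E *; rewrite E; have lV : L1 (fun z => kop tker w z + q z * Top u z).
  by apply: L1D; [exact: lkw|exact: L1_qTop].
have VE : V0 (fun z => kop tker w z + q z * Top u z) x = Int (fun z => (v0 x (- z))%:C *
    (kop tker w (- z) + q (- z) * Top u (- z))).
  exact: (Int_opp (V0_integrand x lV)).
(* The two domains differ at [z = 0], which the half-open interval in [v0] excludes and the
   reflected closed interval contains. *)
rewrite VE; apply: Int_ae.
- have m1 := L1_cmf lw'; have m2 := L1_cmf lq'; have m3 := cmf_affineV0.
  have m4 : cmf (fun p : R * R => kplus b Hopp p.1 p.2) by exact: cmf_kplus.
  have m5 : cmf u' by rewrite /u'; meas.
  exact: cmf_volterra_rhs.
- exact: (L1_cmf (L1_opp (V0_integrand x lV))).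
apply: aeS (ae_neq 0) => z z0; rewrite /v0 (leNgt 0 x) x0.
have -> : (x <= - z) && (- z < 0) = (0 <= z <= - x).
  by rewrite oppr_lt0 lt_def z0 /=; apply/idP/idP; lra.
have z1 (e1 e1' : R) (e2 e3 : C) : (ind false * e1)%:C * e2 = (ind false * e1')%:C * e3.
  by rewrite !mul0r.
have [/andP[h1 h2]|_] := boolP (0 <= z <= - x); last exact: z1.
have zp : 0 < z by rewrite lt_def z0.
rewrite /Top -(kE z w zp (kop_integrand b0 mk kM _ lw)) -(kE z u zp (luk _)).
by have -> : - x - z = - z - x by ring.
Qed.

(* The integrated form of [(Tu)'' = T u'' + q T u], where [w] is [u'']. *)
Lemma transmut_ode x : `|x| <= b ->
  Top u x = c0 + c1 * x%:C + V0 (fun z => Top w z + q z * Top u z) x.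
Proof.
move=> xb; rewrite {1}/Top transmut_ode_kop // {1}/u -addrA; congr (_ + _).
rewrite -V0D; [|exact: lw|by apply: L1D; [exact: lkw|exact: L1_qTop]].
by congr V0; apply/funext => z; rewrite [Top w z]/Top addrA.
Qed.

End Equation.
End Kernel.
End TwoSided.

(** * Transposition of the second-order equation *)

Section Duality.
Context {R : realType}.
Local Notation C := (complex R).
Local Notation mu := (@lebesgue_measure R).

Lemma cmf_conj d (T : measurableType d) (f : T -> C) : cmf f -> cmf (fun x => (f x)^*).
Proof.
move=> [f1 f2]; split.
  by rewrite [X in measurable_fun _ X](_ : _ = fun x => complex.Re (f x)) //; apply/funext => x; case: (f x).
rewrite [X in measurable_fun _ X](_ : _ = fun x => - complex.Im (f x)); first exact: measN.
by apply/funext => x; case: (f x).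
Qed.

Lemma cabs_conj (z : C) : cabs z^* = cabs z.
Proof. by rewrite !cabsE; case: z => u v /=; rewrite sqrrN. Qed.

Lemma dual_eq0 (f : R -> C) : L1 f -> L1 (fun x => f x * (f x)^*) ->
  Int (fun x => f x * (f x)^*) = 0 -> {ae mu, forall x, f x = 0}.
Proof.
move=> lf lff; have E x : f x * (f x)^* = (cabs (f x) ^+ 2)%:C.
  rewrite cabsE sqr_sqrtr ?addr_ge0 ?sqr_ge0 //.
  by case: (f x) => u v; apply: cplxP; rewrite !CplxE /=; ring.
rewrite (funext E) Int_real in lff *.
move=> /(congr1 (@complex.Re R)) /= h.
have r2 : rL1 (fun x => cabs (f x) ^+ 2) by case: lff.
have := @Rint_norm_eq0 _ _ r2.
under eq_Rintegral do rewrite ger0_norm ?sqr_ge0 //.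
by rewrite h lexx => /(_ isT); apply: aeS => x /eqP; rewrite sqrf_eq0 cabs_eq0 => /eqP.
Qed.

Section Moments.
Variables (b : R) (h : R -> C).
Hypothesis b0 : 0 <= b.
Hypothesis lh : L1 h.
Hypothesis sh : supp_in b h.

Lemma L1_moment (p : R -> C) (D : R) : cmf p -> (forall x, `|x| <= b -> cabs (p x) <= D) ->
  L1 (fun x => h x * p x).
Proof.
move=> mp pD; have mh := L1_cmf lh; apply: (@L1_dom _ _ (fun x => D * cabs (h x))).
- by meas.
- move=> x; have [xb|/sh ->] := leP `|x| b; last by rewrite mul0r cabs0 mulr0.
  by rewrite cabsM mulrC ler_wpM2r ?cabs_ge0 // pD.
- exact/rL1Z/L1_cabs.
Qed.

Lemma L1_mulid : L1 (fun x => h x * x%:C).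
Proof. by apply: (@L1_moment _ b); [meas|move=> x; rewrite cabs_real]. Qed.

Hypothesis h0 : Int h = 0.
Hypothesis h1 : Int (fun x => h x * x%:C) = 0.

Lemma moment_affine (c0 c1 : C) : Int (fun x => h x * (c0 + c1 * x%:C)) = 0.
Proof.
under eq_fun do rewrite mulrDr.
rewrite IntD; [|apply: (@L1_moment _ (cabs c0))|apply: (@L1_moment _ (cabs c1 * b))]; [|by meas|by []|by meas|].
  rewrite IntZr // h0 mul0r add0r; under eq_fun do rewrite mulrCA.
  by rewrite IntZ ?h1 ?mulr0 //; exact: L1_mulid.
by move=> x xb; rewrite cabsM cabs_real ler_wpM2l ?cabs_ge0.
Qed.

(** For such [x] the kernel [|x - r|] is affine in [r] on the support of [h], and [h] is orthogonal
    to affine functions. *)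
Lemma pot_supp x : b <= `|x| -> pot h x = 0.
Proof.
move=> bx.
have [s hs] : exists s : R, forall r, `|r| <= b -> `|x - r| = s * (x - r).
  have [x0|x0] := leP 0 x.
    by exists 1 => r; rewrite ler_norml => hr; rewrite ger0_norm ?mul1r //; move: bx; rewrite ger0_norm //; lra.
  by exists (-1) => r; rewrite ler_norml => hr; rewrite ler0_norm ?mulN1r //; move: bx; rewrite ltr0_norm //; lra.
rewrite /pot -[RHS](moment_affine ((2^-1 * s * x)%:C) ((- (2^-1 * s))%:C)).
congr Int; apply/funext => r; have [rb|/sh ->] := leP `|r| b; last by rewrite mul0r mulr0.
rewrite hs // mulrC; congr (_ * _).
by rewrite -rmorphM -rmorphD; congr (_%:C); ring.
Qed.

Lemma cabs_pot_le x : cabs (pot h x) <= 2 * b * \int[mu]_r cabs (h r).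
Proof.
have i0 : 0 <= \int[mu]_r cabs (h r) by apply: Rintegral_ge0 => r _; exact: cabs_ge0.
have [xb|xb] := leP `|x| b; last by rewrite pot_supp ?cabs0 ?mulr_ge0 // ltW.
apply: le_trans (pot_le lh sh x) _; rewrite ler_wpM2r //; lra.
Qed.

Lemma L1_pot : L1 (pot h).
Proof.
have mp := cmf_pot lh.
suff -> : pot h = fun x => ind (`|x| <= b) * pot h x.
  under eq_fun do rewrite norm_itv.
  by apply: L1_itv_bounded => // x _; exact: cabs_pot_le.
apply/funext => x; have [xb|xb] := leP `|x| b; first by rewrite mul1r.
by rewrite mul0r pot_supp // ltW.
Qed.

(** Affine functions of [x] are annihilated by [h], so the kernel of [V0] may be replaced by
    [|x - s| / 2], which is symmetric. *)
Lemma pot_dual (c0 c1 : C) (g : R -> C) : L1 g -> supp_in b g ->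
  Int (fun x => h x * (c0 + c1 * x%:C + V0 g x)) = Int (fun s => pot h s * g s).
Proof.
move=> lg sg; have mg := L1_cmf lg; have mh := L1_cmf lh; have mV := cmf_V0 mg.
have i0 : 0 <= \int[mu]_r cabs (g r) by apply: Rintegral_ge0 => r _; exact: cabs_ge0.
have l1 : L1 (fun x => h x * (c0 + c1 * x%:C)).
  apply: (@L1_moment _ (cabs c0 + cabs c1 * b)); first by meas.
  by move=> x xb; apply: le_trans (cabsD _ _) _; rewrite lerD2l cabsM cabs_real ler_wpM2l ?cabs_ge0.
have l2 : L1 (fun x => h x * V0 g x).
  apply: (@L1_moment _ (b * \int[mu]_r cabs (g r))) => // x xb.
  apply: le_trans (V0_le x lg) _; apply: ler_pM => //.
    by apply: Rintegral_ge0 => s _; rewrite mulr_ge0 ?cabs_ge0.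
  apply: Rint_le; [|exact: L1_cabs|by move=> s; rewrite ler_piMl ?cabs_ge0 ?ind_le1].
  apply: (rL1_dom _ _ (L1_cabs lg)); first by meas.
  by move=> s; rewrite ger0_norm ?mulr_ge0 ?cabs_ge0 // ler_piMl ?cabs_ge0 ?ind_le1.
under eq_fun do rewrite mulrDr.
rewrite IntD // moment_affine add0r.
transitivity (Int (fun x => Int (fun s => h x * ((v0 x s)%:C * g s)))).
  by congr Int; apply/funext => x; rewrite -IntZ //; exact: V0_integrand.
rewrite (@Int_fubini _ _ (fun x => b * cabs (h x)) (fun s => cabs (g s))); first last.
- exact: L1_cabs.
- exact/rL1Z/L1_cabs.
- move=> x s; have [xb|/sh ->] := leP `|x| b; last by rewrite mul0r !cabs0 mulr0 mul0r.
  rewrite !cabsM cabs_real mulrCA mulrA ler_wpM2r ?cabs_ge0 // ler_wpM2r ?cabs_ge0 //.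
  exact: le_trans (v0_le x s) xb.
- by apply: cmfM; [meas|apply: cmfM; [apply: cmf_realC; apply: meas_v0|]]; meas.
congr Int; apply/funext => s.
transitivity (Int (fun x => h x * ((v0 x s)%:C)) * g s).
  rewrite -IntZr; first by congr Int; apply/funext => x; rewrite mulrA.
  apply: (@L1_moment _ b); first by apply: cmf_realC; apply: meas_v0; meas.
  by move=> x xb; rewrite cabs_real; exact: le_trans (v0_le x s) xb.
congr (_ * _).
have E x : h x * (v0 x s)%:C =
    (2^-1 * `|s - x|)%:C * h x + h x * ((- (2^-1 * `|s|))%:C + (2^-1 * sgnR s)%:C * x%:C).
  by rewrite v0E (distrC s x) !rmorphD !rmorphN !rmorphM /=; ring.
rewrite (funext E) IntD ?moment_affine ?addr0 //; first exact: (pot_integrand lh sh s).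
apply: (@L1_moment _ (`|2^-1 * `|s| | + `|2^-1 * sgnR s| * b)); first by meas.
move=> x xb; apply: le_trans (cabsD _ _) _; rewrite cabsM !cabs_real normrN lerD2l.
by rewrite ler_wpM2l.
Qed.

End Moments.

Section Transmutation.
Variables (b M : R) (q : R -> C) (H : R -> R -> C).
Hypothesis b0 : 0 <= b.
Hypothesis L1q : L1 q.
Hypothesis sq : supp_in b q.
Hypothesis mH : cmf (fun p : R * R => H p.1 p.2).
Hypothesis HM : forall u v, cabs (H u v) <= M.
Hypothesis goursat : forall u v, 0 <= u -> 0 <= v -> u + v <= b ->
  H u v = 2^-1 * Int (fun s => ind (0 <= s <= u) * q s) +
    Int (fun al => ind (0 <= al <= u) *
      Int (fun be => ind (0 <= be <= v) * (q (al + be) * H al be))).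
Hypothesis goursat_opp : forall u v, 0 <= u -> 0 <= v -> u + v <= b ->
  Hopp H u v = 2^-1 * Int (fun s => ind (0 <= s <= u) * q (- s)) +
    Int (fun al => ind (0 <= al <= u) *
      Int (fun be => ind (0 <= be <= v) * (q (- (al + be)) * Hopp H al be))).

Let mk : cmf (fun p : R * R => tker b H p.1 p.2). Proof. exact: cmf_tker. Qed.
Let kM := tker_bound b HM.
Local Notation kT := (tker b H).
Local Notation T := (Top b H).
Local Notation T' := (TopT b H).
Let M0 : 0 <= M. Proof. by apply: le_trans (HM 0 0); exact: cabs_ge0. Qed.

Lemma L1_Top u : L1 u -> L1 (T u).
Proof. by move=> lu; apply: L1D => //; exact: (kop_L1 b0 mk kM). Qed.

Lemma L1_TopT u : L1 u -> L1 (T' u).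
Proof. by move=> lu; apply: L1D => //; exact: (kopT_L1 b0 mk kM). Qed.

Lemma Top_supp u : supp_in b u -> supp_in b (T u).
Proof. by move=> su x h; rewrite /Top su // kop_supp // addr0. Qed.

Lemma TopT_supp u : supp_in b u -> supp_in b (T' u).
Proof. by move=> su x h; rewrite /TopT su // kopT_supp // addr0. Qed.

Lemma Top_cutoff (u : R -> C) (x : R) : `|x| <= b -> T (cutoff b u) x = T u x.
Proof. by move=> xb; rewrite /Top kop_cutoff /cutoff xb [ind true * _]mul1r. Qed.

(** Two forms of the duality are needed. Here [u] is bounded on the ball only, as for affine
    functions, and [m] is supported there; in [TopT_dual] the first function is bounded and the
    second merely integrable. *)
Lemma Top_dual (m u : R -> C) (D : R) : L1 m -> supp_in b m -> cmf u ->
  (forall x, `|x| <= b -> cabs (u x) <= D) ->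
  Int (fun x => T' m x * u x) = Int (fun x => m x * T u x).
Proof.
move=> lm sm mu' uD; have lu := L1_cutoff mu' uD.
have lk := kopT_L1 b0 mk kM lm.
have lmu := L1_moment lm sm mu' uD.
have lku := L1_moment lk (@kopT_supp _ b H m) mu' uD.
have mku := L1_cmf (kop_L1 b0 mk kM lu).
have lmk : L1 (fun x => m x * kop kT (cutoff b u) x).
  apply: (L1_moment lm sm mku (D := M * \int[mu]_s cabs (cutoff b u s))) => x _.
  apply: le_trans (kop_le b0 mk kM x lu) _; have mcu := L1_cmf lu.
  rewrite ler_wpM2l //; apply: Rint_le; last by move=> s; rewrite ler_piMl ?cabs_ge0 ?ind_le1.
    apply: (rL1_dom _ _ (L1_cabs lu)); first by meas.
    by move=> s; rewrite ger0_norm ?mulr_ge0 ?cabs_ge0 // ler_piMl ?cabs_ge0 ?ind_le1.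
  exact: L1_cabs.
have E1 x : T' m x * u x = m x * u x + kopT kT m x * u x by rewrite mulrDl.
have E2 x : m x * T u x = m x * u x + m x * kop kT (cutoff b u) x by rewrite kop_cutoff mulrDr.
rewrite (funext E1) (funext E2) (IntD lmu lku) (IntD lmu lmk); congr (_ + _).
rewrite (kop_dual b0 mk kM lm lu); congr Int; apply/funext => x; rewrite /cutoff.
have [xb|xb] := leP `|x| b; first by rewrite [ind true * _]mul1r.
by rewrite (@kopT_supp _ b H m x xb) !mul0r.
Qed.

Lemma TopT_dual (phi w : R -> C) (D : R) : L1 phi -> (forall x, cabs (phi x) <= D) -> L1 w ->
  Int (fun x => T' phi x * w x) = Int (fun x => phi x * T w x).
Proof.
move=> lphi phiD lw; have mphi := L1_cmf lphi.
have lkw := kop_L1 b0 mk kM lw; have lkp := kopT_L1 b0 mk kM lphi.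
have l1 : L1 (fun x => phi x * w x) by exact: (L1Mb mphi phiD).
have l2 : L1 (fun x => phi x * kop kT w x) by exact: (L1Mb mphi phiD).
have kD x : cabs (kopT kT phi x) <= M * \int[mu]_x cabs (phi x).
  apply: le_trans (kopT_le b0 mk kM x lphi) _.
  rewrite ler_wpM2r ?ler_piMr ?ind_le1 //; by apply: Rintegral_ge0 => r _; exact: cabs_ge0.
have l3 := L1Mb (L1_cmf lkp) kD lw.
have E3 x : phi x * T w x = phi x * w x + phi x * kop kT w x by rewrite mulrDr.
have E4 x : T' phi x * w x = phi x * w x + kopT kT phi x * w x by rewrite mulrDl.
by rewrite (funext E3) (funext E4) (IntD l1 l2) (IntD l1 l3) (kop_dual b0 mk kM lphi lw).
Qed.

Section Forward.
Variable h : R -> C.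
Hypothesis lh : L1 h.
Hypothesis sh : supp_in b h.
Hypothesis h0 : Int h = 0.
Hypothesis h1 : Int (fun x => h x * x%:C) = 0.

Let phi := pot h.
Let m x := h x - q x * phi x.

Lemma supp_pot : supp_in b phi.
Proof. by move=> x /ltW; exact: pot_supp. Qed.

Lemma L1_qpot : L1 (fun x => q x * phi x).
Proof. by apply: (L1_moment L1q sq (cmf_pot lh) (D := 2 * b * \int[mu]_r cabs (h r))) => x _; exact: cabs_pot_le. Qed.

Let lm : L1 m. Proof. exact: L1B lh L1_qpot. Qed.
Let sm : supp_in b m. Proof. by move=> x xb; rewrite /m sh // sq // mul0r subr0. Qed.
Let lphi : L1 phi. Proof. exact: (L1_pot b0 lh sh h0 h1). Qed.

(** This says, tested against every [u] with second derivative [w], that the second derivative of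
    [T' phi] is [T' m]. Transposition replaces [u] by [Tu], [transmut_ode] exhibits [Tu] as an
    affine function plus a double primitive, [pot_dual] moves [h] onto its potential, and the two
    terms with [q * Tu] cancel. *)
Lemma TopT_pot_pairing (w : R -> C) (c0 c1 : C) : L1 w -> supp_in b w ->
  Int (fun x => T' m x * (c0 + c1 * x%:C + V0 w x)) = Int (fun x => T' phi x * w x).
Proof.
move=> lw sw; set u := fun x => c0 + c1 * x%:C + V0 w x.
have mu' : cmf u by exact: cmf_affineV0.
have uD := affineV0_bound (b := b) c0 c1 lw.
rewrite (Top_dual lm sm mu' uD).
pose g x := T w x + q x * T u x.
have lqT : L1 (fun x => q x * T u x) by exact: (L1_qTop b0 L1q sq mH HM).
have lTw := L1_Top lw.
have lg : L1 g by exact: L1D.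
have sg : supp_in b g by move=> x xb; rewrite /g (Top_supp sw xb) sq // mul0r addr0.
have E x : m x * T u x = h x * (c0 + c1 * x%:C + V0 g x) - phi x * (q x * T u x).
  have [xb|xb] := leP `|x| b; last by rewrite sm // sh // sq // !(mul0r, mulr0) subr0.
  by rewrite /g -(transmut_ode b0 L1q sq mH HM goursat goursat_opp c0 c1 lw sw xb) mulrBl; ring.
have lhg : L1 (fun x => h x * (c0 + c1 * x%:C + V0 g x)).
  by apply: (L1_moment lh sh); [exact: cmf_affineV0|exact: affineV0_bound].
have lpT : L1 (fun x => phi x * T w x).
  exact: (L1Mb (cmf_pot lh) (cabs_pot_le b0 lh sh h0 h1)).
have lpq : L1 (fun x => phi x * (q x * T u x)).
  exact: (L1Mb (cmf_pot lh) (cabs_pot_le b0 lh sh h0 h1)).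
rewrite (funext E) (IntB lhg lpq) (pot_dual lh sh h0 h1 c0 c1 lg sg).
have E2 s : pot h s * g s = phi s * T w s + phi s * (q s * T u s) by rewrite mulrDr.
rewrite (funext E2) (IntD lpT lpq) addrK.
by rewrite (TopT_dual lphi (cabs_pot_le b0 lh sh h0 h1) lw).
Qed.

Let M_ := T' m.
Let lM : L1 M_. Proof. exact: L1_TopT. Qed.
Let sM : supp_in b M_. Proof. exact: TopT_supp. Qed.

(** The case [w = 0], which leaves the affine functions as test functions. *)
Lemma TopT_moments : Int M_ = 0 /\ Int (fun x => M_ x * x%:C) = 0.
Proof.
have V00 x : V0 (fun=> 0 : C) x = 0.
  by rewrite /V0 -[RHS](@Int0 R); congr Int; apply/funext => s; rewrite mulr0.
have Z (f : R -> C) : Int (fun x => f x * 0) = 0.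
  by rewrite -[RHS](@Int0 R); congr Int; apply/funext => s; rewrite mulr0.
have s0 : supp_in b (fun=> 0 : C) by [].
have P c0 c1 := TopT_pot_pairing c0 c1 (@L1_0 R) s0.
split.
  rewrite -(Z (T' phi)) -(P 1 0); congr Int; apply/funext => x.
  by rewrite V00 mul0r !addr0 mulr1.
rewrite -(Z (T' phi)) -(P 0 1); congr Int; apply/funext => x.
by rewrite V00 mul1r add0r addr0.
Qed.

(** In the pairing [w] is any integrable function on the ball; it may be the conjugate of the
    bounded difference [d] of the two sides. *)
Lemma TopT_pot : {ae mu, forall x, pot M_ x = T' phi x}.
Proof.
have [m0 m1] := TopT_moments.
have lP := L1_pot b0 lM sM m0 m1.
have lF := L1_TopT lphi.
pose d x := pot M_ x - T' phi x.
have ld : L1 d by exact: L1B.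
have sd : supp_in b d.
  by move=> x xb; rewrite /d (TopT_supp supp_pot xb) (pot_supp lM sM m0 m1 (ltW xb)) subr0.
have P w : L1 w -> supp_in b w -> Int (fun x => d x * w x) = 0.
  move=> lw sw; have mw := L1_cmf lw.
  have l1 : L1 (fun x => pot M_ x * w x).
    by apply: (L1Mb (cmf_pot lM)) => // x; exact: (cabs_pot_le b0 lM sM m0 m1).
  have l2 : L1 (fun x => T' phi x * w x).
    apply: (L1Mb (L1_cmf lF) (M := 2 * b * \int[mu]_r cabs (h r) + M * \int[mu]_x cabs (phi x))) => // x.
    apply: le_trans (cabsD _ _) _; apply: lerD; first exact: cabs_pot_le.
    apply: le_trans (kopT_le b0 mk kM x lphi) _.
    rewrite ler_wpM2r ?ler_piMr ?ind_le1 //; by apply: Rintegral_ge0 => r _; exact: cabs_ge0.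
  have E x : d x * w x = pot M_ x * w x - T' phi x * w x by rewrite mulrBl.
  rewrite (funext E) (IntB l1 l2) -(pot_dual lM sM m0 m1 0 0 lw sw).
  by rewrite -(TopT_pot_pairing 0 0 lw sw) subrr.
suff : {ae mu, forall x, d x = 0} by apply: aeS => x /eqP; rewrite subr_eq0 => /eqP.
have mc := cmf_conj (L1_cmf ld).
have lc : L1 (fun x => (d x)^*).
  by apply: L1_dom (L1_cabs ld) => // x; rewrite cabs_conj.
have sc : supp_in b (fun x => (d x)^*) by move=> x xb; rewrite sd // rmorph0.
have dD x : cabs (d x) <= 2 * b * \int[mu]_r cabs (M_ r) +
    (2 * b * \int[mu]_r cabs (h r) + M * \int[mu]_x cabs (phi x)).
  rewrite /d; apply: le_trans (cabsB _ _) _; apply: lerD; first exact: (cabs_pot_le b0 lM sM m0 m1).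
  apply: le_trans (cabsD _ _) _; apply: lerD; first exact: cabs_pot_le.
  apply: le_trans (kopT_le b0 mk kM x lphi) _.
  rewrite ler_wpM2r ?ler_piMr ?ind_le1 //; by apply: Rintegral_ge0 => r _; exact: cabs_ge0.
by apply: dual_eq0 => //; [exact: (L1Mb (L1_cmf ld) dD lc)|exact: P].
Qed.

End Forward.
Section Backward.
Variables (f2 phi m : R -> C) (D : R).
Hypothesis lf2 : L1 f2.
Hypothesis sf2 : supp_in b f2.
Hypothesis f20 : Int f2 = 0.
Hypothesis f21 : Int (fun x => f2 x * x%:C) = 0.
Hypothesis lphi : L1 phi.
Hypothesis sphi : supp_in b phi.
Hypothesis phiD : forall x, cabs (phi x) <= D.
Hypothesis lm : L1 m.
Hypothesis sm : supp_in b m.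
Hypothesis phiE : {ae mu, forall x, T' phi x = pot f2 x}.
Hypothesis mE : {ae mu, forall x, T' m x = f2 x}.

Let g x := m x + q x * phi x.

Let mphi := L1_cmf lphi.

Let lg : L1 g.
Proof. by apply: L1D => //; apply: (L1_moment L1q sq mphi (D := D)) => x _. Qed.

Let sg : supp_in b g. Proof. by move=> x xb; rewrite /g sm // sq // mul0r addr0. Qed.

Let N (w : R -> C) (x : R) := \int[mu]_t (ind (`|t| <= `|x| <= b) * cabs (w t)).

Let ND (w : R -> C) (x : R) : L1 w -> rL1 (fun t => ind (`|t| <= `|x| <= b) * cabs (w t)).
Proof.
move=> lw; have mw := L1_cmf lw; apply: (rL1_dom _ _ (L1_cabs lw)); first by meas.
by move=> s; rewrite ger0_norm ?mulr_ge0 ?cabs_ge0 // ler_piMl ?cabs_ge0 ?ind_le1.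
Qed.

Let V0N (w : R -> C) (t x : R) : L1 w -> `|t| <= `|x| <= b -> cabs (V0 w t) <= b * N w x.
Proof.
move=> lw /andP[tx xb]; have mw := L1_cmf lw; apply: le_trans (V0_le t lw) _; apply: ler_pM => //.
- by apply: Rintegral_ge0 => s _; rewrite mulr_ge0 ?cabs_ge0.
- exact: le_trans xb.
apply: Rint_le; [|exact: ND|].
  apply: (rL1_dom _ _ (L1_cabs lw)); first by meas.
  by move=> s; rewrite ger0_norm ?mulr_ge0 ?cabs_ge0 // ler_piMl ?cabs_ge0 ?ind_le1.
move=> s; rewrite ler_wpM2r ?cabs_ge0 // xb andbT ler_nat.
by have [st|//] := boolP (`|s| <= `|t|); rewrite (le_trans st tx).
Qed.

(** For [u = l + V0 w] with [l] affine, the equation [T w + q * Tu = h] reads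
    [w = h - q * T l - A w]. Its solution gives [Tu = l + V0 h] on the ball. *)
Let A (w : R -> C) (x : R) := kop kT w x + q x * T (V0 w) x.

Let V0a (w : R -> C) : V0 w = fun x => 0 + 0 * x%:C + V0 w x.
Proof. by apply/funext => x; rewrite mul0r !add0r. Qed.

Let lqTV (w : R -> C) : L1 w -> L1 (fun x => q x * T (V0 w) x).
Proof. by move=> lw; rewrite V0a; exact: (L1_qTop b0 L1q sq mH HM). Qed.

Let lV (w : R -> C) : L1 w -> L1 (cutoff b (V0 w)).
Proof. by move=> lw; rewrite V0a; exact: L1_cutoff_affineV0. Qed.

Let A_contraction : exists om, L1_contraction om A.
Proof.
(* Applying [V0] costs a factor [b]; the integral part of T then costs [M] times the length [2 * b]
   times that [b]. *)
pose rho x := M * ind (`|x| <= b) + (b + 2 * M * b ^+ 2) * cabs (q x).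
have mq := L1_cmf L1q.
have rho0 x : 0 <= rho x.
  by rewrite addr_ge0 ?mulr_ge0 ?cabs_ge0 // addr_ge0 ?mulr_ge0 ?sqr_ge0.
apply: (@volterra_contraction _ b rho) => //.
- by apply: rL1D; [exact: rL1_ball|exact/rL1Z/L1_cabs].
- move=> v w lv lw; apply/funext => x; rewrite /A.
  have -> : V0 (fun x => v x - w x) = fun x => V0 v x - V0 w x.
    apply/funext => y; rewrite /V0 -IntB; [|exact: V0_integrand|exact: V0_integrand].
    by congr Int; apply/funext => s; rewrite mulrBr.
  rewrite (kop_sub b0 mk kM lv lw) /Top -!(kop_cutoff b H (V0 _)) -(kop_cutoff b H (fun y => V0 v y - V0 w y)).
  have -> : cutoff b (fun y => V0 v y - V0 w y) = fun y => cutoff b (V0 v) y - cutoff b (V0 w) y.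
    by apply/funext => y; rewrite /cutoff mulrBr.
  have alg (a1 a2 z c1 c2 e1 e2 : C) : a1 - a2 + z * (c1 - c2 + (e1 - e2)) =
    a1 + z * (c1 + e1) - (a2 + z * (c2 + e2)) by ring.
  by rewrite (kop_sub b0 mk kM (lV lv) (lV lw)); exact: alg.
- by move=> w lw; apply: L1_cmf; apply: L1D; [exact: (kop_L1 b0 mk kM)|exact: lqTV].
move=> w x lw; rewrite -/(N w x).
have N0 : 0 <= N w x by apply: Rintegral_ge0 => s _; rewrite mulr_ge0 ?cabs_ge0.
have [xb|xb] := leP `|x| b; last first.
  by rewrite /A (@kop_supp _ b H w x xb) (sq xb) mul0r addr0 cabs0; apply: mulr_ge0 => //; exact: rho0.
rewrite /rho xb mulr1 mulrDl; apply: le_trans (cabsD _ _) _; apply: lerD; first exact: kop_le.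
rewrite cabsM mulrAC mulrC ler_wpM2r ?cabs_ge0 //.
rewrite /Top mulrDl; apply: le_trans (cabsD _ _) _; apply: lerD; first by apply: V0N => //; rewrite lexx.
rewrite -kop_cutoff; apply: le_trans (kop_le b0 mk kM x (lV lw)) _.
have alg (n : R) : 2 * M * b ^+ 2 * n = M * (2 * b * (b * n)) by ring.
rewrite (alg (N w x)); apply: (ler_wpM2l M0).
have r1 := rL1_itv (- b) b.
apply: (@le_trans _ _ (\int[mu]_t (b * N w x * ind (- b <= t <= b)))).
  apply: Rint_le; [exact: ND (lV lw)|exact: rL1Z|move=> t].
  have [tx|_] := boolP (`|t| <= `|x| <= b); last by rewrite mul0r !mulr_ge0.
  rewrite mul1r -norm_itv; have /andP[tx1 _] := tx; have tb := le_trans tx1 xb.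
  rewrite /cutoff tb mulr1 [ind true * _]mul1r; exact: V0N.
have alg2 (n : R) : b * n * (b - - b) = 2 * b * (b * n) by ring.
by rewrite (RintZ _ r1) Rint_itv1 ?(alg2 (N w x)) // ge0_cp.
Qed.

(** Counterpart of [TopT_pot_pairing] with [Tu] prescribed in place of [u]. After transposition the
    hypotheses on [phi] and [m] turn the left side into pairings of [f2] and its potential, which
    [pot_dual] compares. *)
Lemma TopT_inverse_pairing (h : R -> C) (c0 c1 : C) : L1 h -> supp_in b h ->
  Int (fun x => g x * (c0 + c1 * x%:C + V0 h x)) = Int (fun x => phi x * h x).
Proof.
move=> lh sh.
pose l x : C := c0 + c1 * x%:C.
have V00 x : V0 (fun=> 0 : C) x = 0.
  by rewrite /V0 -[RHS](@Int0 R); congr Int; apply/funext => s; rewrite mulr0.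
have lE : l = fun x => c0 + c1 * x%:C + V0 (fun=> 0) x.
  by apply/funext => x; rewrite V00 addr0.
have lql : L1 (fun x => q x * T l x).
  by rewrite lE; apply: (L1_qTop b0 L1q sq mH HM) => //; exact: L1_0.
have lr : L1 (fun x => h x - q x * T l x) by exact: L1B.
have [om hA] := A_contraction.
have [w0 [lw0 w0E]] := contraction_solve hA lr.
(* [w0] solves the equation only almost everywhere. Since [A] ignores null sets, redefining the
   solution by the equation makes it hold at every point. *)
pose w x := h x - q x * T l x - A w0 x.
have lA0 : L1 (A w0) := ctr_L1 hA lw0.
have lw : L1 w by exact: L1B.
have sw : supp_in b w by move=> x xb; rewrite /w /A sh // sq // kop_supp // !mul0r addr0 !subr0.
have AE : A w = A w0.
  have ae1 : {ae mu, forall x, w x = w0 x} by apply: aeS w0E => x ->.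
  have mw := L1_cmf lw; have mw0 := L1_cmf lw0.
  have I (p : R -> C) : cmf p -> Int (fun t => p t * w t) = Int (fun t => p t * w0 t).
    move=> mp; apply: Int_ae; [exact: cmfM|exact: cmfM|].
    by apply: aeS ae1 => x ->.
  have VE : V0 w = V0 w0.
    by apply/funext => x; apply: (I (fun s => (v0 x s)%:C)); apply: cmf_realC; apply: meas_v0; meas.
  apply/funext => x; rewrite /A VE; congr (_ + _); apply: (I (fun t => kT x t)).
  by apply: (cmf_comp2 mk); meas.
set u := fun x => c0 + c1 * x%:C + V0 w x.
have luE x : T u x = T l x + T (V0 w) x.
  suff K : kop kT u x = kop kT l x + kop kT (V0 w) x by rewrite /Top K /u /l; ring.
  rewrite -(kop_cutoff b H l) -(kop_cutoff b H (V0 w)) -(kop_cutoff b H u).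
  have lcl : L1 (cutoff b l).
    by rewrite lE; apply: L1_cutoff_affineV0; exact: L1_0.
  have i1 := kop_integrand b0 mk kM x lcl; have i2 := kop_integrand b0 mk kM x (lV lw).
  rewrite /kop -(IntD i1 i2); congr Int; apply/funext => t.
  by rewrite /cutoff -!mulrDr.
have eqw x : T w x + q x * T u x = h x.
  have : w x = h x - q x * T l x - A w x by rewrite AE.
  rewrite luE /A => E; rewrite [T w x]/Top E; ring.
have mu' : cmf u by exact: cmf_affineV0.
have uD := affineV0_bound (b := b) c0 c1 lw.
have E x : g x * (c0 + c1 * x%:C + V0 h x) = m x * T u x + phi x * (q x * T u x).
  have [xb|xb] := leP `|x| b; last first.
    have alg (z1 z2 z3 : C) : 0 * z1 = 0 * z2 + 0 * z3 by rewrite !mul0r addr0.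
    by rewrite (sg xb) (sm xb) (sphi xb); exact: alg.
  rewrite (transmut_ode b0 L1q sq mH HM goursat goursat_opp c0 c1 lw sw xb).
  by rewrite (funext eqw) /g; ring.
have lTw := L1_Top lw.
have lqT : L1 (fun x => q x * T u x) by exact: (L1_qTop b0 L1q sq mH HM).
have lpT : L1 (fun x => phi x * T w x) by exact: (L1Mb mphi phiD).
have lpq : L1 (fun x => phi x * (q x * T u x)) by exact: (L1Mb mphi phiD).
have lmT : L1 (fun x => m x * T u x).
  have lhg : L1 (fun x => g x * (c0 + c1 * x%:C + V0 h x)).
    by apply: (L1_moment lg sg); [exact: cmf_affineV0|exact: affineV0_bound].
  have -> : (fun x => m x * T u x) = fun x => g x * (c0 + c1 * x%:C + V0 h x) - phi x * (q x * T u x).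
    by apply/funext => x; rewrite E addrK.
  exact: L1B.
rewrite (funext E) (IntD lmT lpq) -(Top_dual lm sm mu' uD).
have mT := L1_cmf (L1_TopT lm); have mTp := L1_cmf (L1_TopT lphi).
have mf2 := L1_cmf lf2; have mpf := cmf_pot lf2.
have mw := L1_cmf lw.
have -> : Int (fun x => T' m x * u x) = Int (fun x => f2 x * u x).
  by apply: Int_ae; [exact: cmfM|exact: cmfM|apply: aeS mE => x ->].
rewrite (pot_dual lf2 sf2 f20 f21 c0 c1 lw sw).
have -> : Int (fun s => pot f2 s * w s) = Int (fun x => T' phi x * w x).
  by apply: Int_ae; [exact: cmfM|exact: cmfM|apply: aeS phiE => x ->].
rewrite (TopT_dual lphi phiD lw) -(IntD lpT lpq); congr Int; apply/funext => x.
by rewrite -mulrDr eqw.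
Qed.

Lemma TopT_inverse_moments : Int g = 0 /\ Int (fun x => g x * x%:C) = 0.
Proof.
have V00 x : V0 (fun=> 0 : C) x = 0.
  by rewrite /V0 -[RHS](@Int0 R); congr Int; apply/funext => s; rewrite mulr0.
have Z (f : R -> C) : Int (fun x => f x * 0) = 0.
  by rewrite -[RHS](@Int0 R); congr Int; apply/funext => s; rewrite mulr0.
have s0 : supp_in b (fun=> 0 : C) by [].
have P c0 c1 := TopT_inverse_pairing c0 c1 (@L1_0 R) s0.
split.
  rewrite -(Z phi) -(P 1 0); congr Int; apply/funext => x.
  by rewrite V00 mul0r !addr0 mulr1.
rewrite -(Z phi) -(P 0 1); congr Int; apply/funext => x.
by rewrite V00 mul1r add0r addr0.
Qed.

Lemma TopT_inverse_pot : {ae mu, forall x, pot g x = phi x}.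
Proof.
have [m0 m1] := TopT_inverse_moments.
pose d x := pot g x - phi x.
have ld : L1 d by apply: L1B => //; exact: (L1_pot b0 lg sg m0 m1).
have sd : supp_in b d.
  by move=> x xb; rewrite /d (pot_supp lg sg m0 m1 (ltW xb)) sphi // subr0.
have dD x : cabs (d x) <= 2 * b * \int[mu]_r cabs (g r) + D.
  apply: le_trans (cabsB _ _) _; apply: lerD => //; exact: (cabs_pot_le b0 lg sg m0 m1).
have lc : L1 (fun x => (d x)^*).
  by apply: L1_dom (L1_cabs ld) => [|x]; [exact: cmf_conj (L1_cmf ld)|rewrite cabs_conj].
have sc : supp_in b (fun x => (d x)^*) by move=> x xb; rewrite sd // rmorph0.
suff : {ae mu, forall x, d x = 0} by apply: aeS => x /eqP; rewrite subr_eq0 => /eqP.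
apply: dual_eq0 => //; first exact: (L1Mb (L1_cmf ld) dD lc).
have l1 : L1 (fun x => pot g x * (d x)^*).
  by apply: (L1Mb (cmf_pot lg)) => // x; exact: (cabs_pot_le b0 lg sg m0 m1).
have l2 : L1 (fun x => phi x * (d x)^*) by exact: (L1Mb mphi phiD).
have E x : d x * (d x)^* = pot g x * (d x)^* - phi x * (d x)^* by rewrite mulrBl.
rewrite (funext E) (IntB l1 l2) -(pot_dual lg sg m0 m1 0 0 lc sc).
by rewrite -(TopT_inverse_pairing 0 0 lc sc) subrr.
Qed.

End Backward.
End Transmutation.
End Duality.

(** * Test functions and weak derivatives *)

Section Bumps.
Context {R : realType}.
Local Notation C := (complex R).
Local Notation mu := (@lebesgue_measure R).

(* The square of the positive part of [r ^ 2 - (x - u) ^ 2], which is C^1. *)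
Definition hump (u r x : R) : R :=
  let y := r ^+ 2 - (x - u) ^+ 2 in (y * `|y| + y ^+ 2) / 2.

Definition dhump (u r x : R) : R :=
  let y := r ^+ 2 - (x - u) ^+ 2 in (`|y| + y) * (- 2 * (x - u)).

Lemma hump_off u r x : 0 <= r -> r <= `|x - u| -> hump u r x = 0.
Proof.
move=> r0 h; rewrite /hump; set y := r ^+ 2 - _.
have y0 : y <= 0.
  by rewrite subr_le0 -(real_normK (num_real (x - u))) lerXn2r ?nnegrE.
by rewrite ler0_norm //; ring.
Qed.

Lemma dhump_off u r x : 0 <= r -> r <= `|x - u| -> dhump u r x = 0.
Proof.
move=> r0 h; rewrite /dhump; set y := r ^+ 2 - _.
have y0 : y <= 0.
  by rewrite subr_le0 -(real_normK (num_real (x - u))) lerXn2r ?nnegrE.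
by rewrite ler0_norm // addNr mul0r.
Qed.

Lemma hump_ge0 u r x : 0 <= hump u r x.
Proof.
rewrite /hump; set y := r ^+ 2 - _; rewrite divr_ge0 //.
have [h|/ltW h] := leP 0 y; first by rewrite ger0_norm // addr_ge0 ?sqr_ge0 ?mulr_ge0.
by rewrite ler0_norm // mulrN addNr.
Qed.

Lemma hump_le u r x : 0 <= r -> hump u r x <= r ^+ 4.
Proof.
move=> r0; have [h|h] := leP r `|x - u|; first by rewrite hump_off // exprn_ge0.
rewrite /hump; set y := r ^+ 2 - _.
have y0 : 0 <= y.
  by rewrite subr_ge0 -(real_normK (num_real (x - u))) lerXn2r ?nnegrE // ltW.
have yr : y <= r ^+ 2 by rewrite gerBl sqr_ge0.
rewrite ger0_norm //; have -> : r ^+ 4 = (r ^+ 2) ^+ 2 by rewrite -exprM.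
have -> : (y * y + y ^+ 2) / 2 = y ^+ 2 by rewrite -expr2; lra.
by rewrite lerXn2r ?nnegrE ?sqr_ge0.
Qed.

Lemma hump_half u r x : 0 <= r -> `|x - u| <= r / 2 -> r ^+ 4 / 2 <= hump u r x.
Proof.
move=> r0 h; rewrite /hump; set y := r ^+ 2 - _.
have yr : 3 / 4 * r ^+ 2 <= y.
  have : `|x - u| ^+ 2 <= (r / 2) ^+ 2 by rewrite lerXn2r ?nnegrE // divr_ge0.
  rewrite real_normK ?num_real // expr_div_n /y; lra.
have y0 : 0 <= y by apply: le_trans yr; rewrite mulr_ge0 ?sqr_ge0.
rewrite ger0_norm //; have -> : r ^+ 4 = (r ^+ 2) ^+ 2 by rewrite -exprM.
have := sqr_ge0 r; nra.
Qed.

Lemma is_derive_hump (u r x : R) : is_derive x 1 (hump u r) (dhump u r x).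
Proof.
pose y x := r ^+ 2 - (x - u) ^+ 2.
have dy : is_derive x 1 y (- 2 * (x - u)).
  by apply: is_derive_eq; rewrite /GRing.scale /=; ring.
have dP (z : R) : is_derive z 1 (fun y : R => (y * `|y| + y ^+ 2) / 2) (`|z| + z).
  have E : (fun y : R => (y * `|y| + y ^+ 2) / 2) = (fun y => (y - 0) * `|y - 0| / 2) \+ (fun y => y ^+ 2 / 2).
    by apply/funext => t /=; rewrite subr0; ring.
  rewrite E; apply: is_deriveD.
    have [d1 d2] := derive_sqr_half 0 z.
    by have := derivableP d1; rewrite -derive1E d2 subr0.
  by apply: is_derive_eq; rewrite /GRing.scale /=; field.
have := @is_derive1_comp _ (fun y : R => (y * `|y| + y ^+ 2) / 2) y x _ _ (dP _) dy.
by [].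
Qed.

Lemma continuous_hump u r : continuous (hump u r).
Proof.
move=> x; apply: differentiable_continuous; apply/derivable1_diffP.
exact: (@ex_derive _ _ _ _ _ _ _ (is_derive_hump u r x)).
Qed.

Lemma continuous_dhump u r : continuous (dhump u r).
Proof.
move=> x; have cy : {for x, continuous (fun x => r ^+ 2 - (x - u) ^+ 2)}.
  apply: differentiable_continuous; apply/derivable1_diffP.
  have dy : is_derive x 1 (fun x => r ^+ 2 - (x - u) ^+ 2) (- 2 * (x - u)).
    by apply: is_derive_eq; rewrite /GRing.scale /=; ring.
  exact: (@ex_derive _ _ _ _ _ _ _ dy).
apply: cvgM.
  by apply: cvgD; [exact: cvg_norm|exact: cy].
by apply: cvgM; [exact: cvg_cst|apply: cvgB; [exact: cvg_id|exact: cvg_cst]].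
Qed.

Lemma meas_hump u r : measurable_fun setT (hump u r).
Proof. exact: continuous_measurable_fun (@continuous_hump u r). Qed.

Lemma hump_itv u r x : 0 <= r -> hump u r x = ind (u - r < x < u + r) * hump u r x.
Proof.
move=> r0; have [_|h] := boolP (u - r < x < u + r); first by rewrite mul1r.
rewrite mul0r hump_off // leNgt; apply: contra h; rewrite ltr_norml; lra.
Qed.

Lemma rL1_hump u r : 0 <= r -> rL1 (hump u r).
Proof.
move=> r0; rewrite (funext (fun x => hump_itv u x r0)).
apply: (@rL1_dom _ _ (fun x => r ^+ 4 * ind (u - r <= x <= u + r))); last exact/rL1Z/rL1_itv.
  by apply: measM; [meas|exact: meas_hump].
move=> x; have [h|_] := boolP (_ < _ < _); last by rewrite mul0r normr0 mulr_ge0 ?exprn_ge0.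
have -> : u - r <= x <= u + r by lra.
by rewrite mulr1 mul1r ger0_norm ?hump_ge0 // hump_le.
Qed.

Lemma hump_translate u r x : hump u r (1 * x + u) = hump 0 r x.
Proof. by rewrite /hump mul1r addrK subr0. Qed.

Lemma Rint_hump u r : 0 <= r -> \int[mu]_x hump u r x = \int[mu]_x hump 0 r x.
Proof.
move=> r0; rewrite (@Rint_affine _ 1 u) ?oner_eq0 ?normr1 ?mul1r //; last exact: rL1_hump.
by apply: eq_Rintegral => x _; exact: hump_translate.
Qed.

(** The hump is at least half of its height [r ^+ 4] on an interval of length [r]. *)
Lemma Rint_hump_ge r : 0 <= r -> r ^+ 5 / 2 <= \int[mu]_x hump 0 r x.
Proof.
move=> r0; have r1 := rL1_itv (- (r / 2)) (r / 2).
apply: (@le_trans _ _ (\int[mu]_x (r ^+ 4 / 2 * ind (- (r / 2) <= x <= r / 2)))).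
  rewrite RintZ // Rint_itv1; last lra.
  by rewrite le_eqVlt; apply/orP; left; apply/eqP; rewrite [r ^+ 5]exprSr; field.
apply: Rint_le; [exact: rL1Z|exact: rL1_hump|move=> x].
have [h|_] := boolP (_ <= _ <= _); last by rewrite mulr0 hump_ge0.
by rewrite mulr1 hump_half // subr0 norm_itv.
Qed.

(** The hump is at most [r ^+ 4] on an interval of length [2 * r], so Lebesgue's theorem for
    interval averages bounds the error; [r ^+ 5] is the order of the integral of the hump. *)
Lemma lebesgue_pt_hump (f : R -> R) : rL1 f -> {ae mu, forall u, forall e, 0 < e ->
  exists2 d, 0 < d & forall r, 0 < r < d ->
    `|\int[mu]_x (f x * hump u r x) - f u * \int[mu]_x hump 0 r x| <= e * r ^+ 5}.
Proof.
move=> lf; have mf := rL1_meas lf.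
have loc : locally_integrable setT f by apply: open_integrable_locally => //; exact: openT.
apply: aeS (lebesgue_differentiation loc) => u /fine_cvgP[fin /cvgrPdist_le h] e e0.
have e2 : 0 < e / 2 by rewrite divr_gt0.
have [d1 /= d10 H1] := fin; have [d2 /= d20 H2] := h _ e2.
exists (Num.min d1 d2) => [|r /andP[r0]]; first by rewrite lt_min d10.
rewrite lt_min => /andP[rd1 rd2].
have br : ball_ [eta @Num.norm R R] 0 d1 r by rewrite /= sub0r normrN gtr0_norm.
have br2 : ball_ [eta @Num.norm R R] 0 d2 r by rewrite /= sub0r normrN gtr0_norm.
have := H2 _ br2 r0; rewrite sub0r normrN => le2.
have lb : rL1 (hump u r) by apply: rL1_hump; exact: ltW.
have lfb : rL1 (fun x => f x * hump u r x).
  apply: (@rL1_dom _ _ (fun x => r ^+ 4 * `|f x|)); last exact/rL1Z/rL1_norm.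
    by apply: measM => //; exact: meas_hump.
  by move=> x; rewrite normrM mulrC ler_wpM2r // ger0_norm ?hump_ge0 // hump_le // ltW.
rewrite -(@Rint_hump u _ (ltW r0)) -RintZ // -RintB //; last exact: rL1Z.
have E x : f x * hump u r x - f u * hump u r x = (f x - f u) * hump u r x by rewrite mulrBl.
under eq_Rintegral do rewrite E.
have li : rL1 (fun x => ind (u - r < x < u + r)).
  apply: (rL1_dom _ _ (rL1_itv (u - r) (u + r))); first by meas.
  by move=> x; rewrite ger0_norm // ler_nat; have [h3|//] := boolP (u - r < x < u + r); have -> : u - r <= x <= u + r by lra.
have lball : rL1 (fun x => ind (u - r < x < u + r) * `|f x - f u|).
  have E2 x : ind (u - r < x < u + r) * `|f x - f u| = `|ind (u - r < x < u + r) * f x - f u * ind (u - r < x < u + r)|.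
    by case: (_ < _ < _); rewrite ?mul1r ?mulr1 // !mul0r mulr0 subr0 normr0.
  rewrite (funext E2).
  apply: rL1_norm; apply: rL1B; last exact: rL1Z.
  apply: (rL1_dom _ _ (rL1_norm lf)); first by meas.
  by move=> x; rewrite normrM ler_piMl // ger0_norm ?ind_le1.
have avg : \int[mu]_x (ind (u - r < x < u + r) * `|f x - f u|) <= e * r.
  have davgE : davg f u r = (((r *+ 2)%R%:E)^-1 * (\int[mu]_x (ind (u - r < x < u + r) * `|f x - f u|))%:E)%E.
    rewrite /davg /iavg lebesgue_measure_ball ?ltW //; congr (_ * _)%E.
    rewrite -rL1_fin // integral_mkcond; apply: eq_integral => x _.
    rewrite patchE [X in if X then _ else _](_ : _ = (u - r < x < u + r)); last first.
      by apply/idP/idP; rewrite inE /ball /= ltr_norml; lra.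
    by case: (_ < _ < _); rewrite ?mul1r ?mul0r.
  have r2 : r *+ 2 != 0 by rewrite mulrn_eq0 /= gt_eqF.
  move: le2; rewrite davgE inver (negbTE r2) -EFinM /=.
  set A := \int[mu]_x _ => h0; have A0 : 0 <= A by apply: Rintegral_ge0 => x _; rewrite mulr_ge0.
  move: h0; rewrite ger0_norm ?mulr_ge0 ?invr_ge0 ?mulrn_wge0 ?(ltW r0) // mulrC -mulr_natr.
  have r2' : 0 < r * 2 by lra.
  by rewrite ler_pdivrMr //; lra.
apply: (@le_trans _ _ (\int[mu]_x (r ^+ 4 * (ind (u - r < x < u + r) * `|f x - f u|)))).
  apply: le_trans (le_normr_Rintegral _ _) _ => //.
    under eq_fun => x do rewrite -E.
    by apply: rL1B => //; exact: rL1Z.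
  apply: Rint_le; [|exact: rL1Z|move=> x].
    apply: rL1_norm; under eq_fun => x do rewrite -E.
    by apply: rL1B => //; exact: rL1Z.
  rewrite (hump_itv _ _ (ltW r0)) normrM; have [_|_] := boolP (_ < _ < _); last by rewrite !mul0r normr0 !mulr0.
  by rewrite !mul1r mulrC ler_wpM2r // ger0_norm ?hump_ge0 // hump_le // ltW.
rewrite RintZ //; have -> : e * r ^+ 5 = r ^+ 4 * (e * r) by ring.
by rewrite ler_wpM2l // exprn_ge0 // ltW.
Qed.

Lemma ae_pick (P : R -> Prop) (c d : R) : c < d -> {ae mu, forall x, P x} ->
  exists2 x, c < x < d & P x.
Proof.
move=> cd hP; apply: contrapT => hn.
have : mu.-negligible [set` `]c, d[].
  apply: negligibleS hP => x /=; rewrite in_itv /= => xcd Px; apply: hn; by exists x.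
move=> hN; have : lebesgue_measure ([set` `]c, d[] : set R) = 0%E := proj1 (negligibleP mu (measurable_itv _)) hN.
rewrite lebesgue_measure_itv /= lte_fin cd; rewrite -EFinD => /eqP; rewrite eqe subr_eq0 => /eqP dc.
by move: cd; rewrite dc ltxx.
Qed.

Lemma hump_fundamental (f : R -> R) (c d : R) : rL1 f ->
  (forall u r, 0 < r -> c < u - r -> u + r < d -> \int[mu]_x (f x * hump u r x) = 0) ->
  {ae mu, forall x, c < x < d -> f x = 0}.
Proof.
move=> lf h; apply: aeS (lebesgue_pt_hump lf) => u hu /andP[cu ud].
apply/eqP; rewrite -normr_le0; apply/ler_addgt0Pr => e e0; rewrite add0r.
have [|D D0 hD] := hu (e / 2); first by rewrite divr_gt0.
pose r := Num.min (D / 2) (Num.min ((u - c) / 2) ((d - u) / 2)).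
have r0 : 0 < r by rewrite !lt_min !divr_gt0 // subr_gt0.
have [r1 r2 r3] : [/\ r <= D / 2, r <= (u - c) / 2 & r <= (d - u) / 2].
  by rewrite /r !ge_min !lexx !orbT.
have := hD r; rewrite r0 (h u r r0) ?sub0r ?normrN => [/(_ _)||]; [|lra|lra].
have -> : r < D by lra.
move=> /(_ isT); have B := Rint_hump_ge (ltW r0).
have r5 : 0 < r ^+ 5 by rewrite exprn_gt0.
rewrite normrM [X in _ * X]ger0_norm; last by apply: le_trans B; rewrite divr_ge0 ?exprn_ge0 // ltW.
move=> le1; have : `|f u| * (r ^+ 5 / 2) <= e / 2 * r ^+ 5.
  by apply: le_trans le1; rewrite ler_wpM2l.
have -> : `|f u| * (r ^+ 5 / 2) = `|f u| / 2 * r ^+ 5 by ring.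
by rewrite ler_pM2r // ler_pM2r ?invr_gt0.
Qed.

(** At two Lebesgue points the integrals against humps of equal radius are asymptotically [f u] and
    [f v] times the same mass, so their equality forces [f u = f v]; one point [v] is fixed once and
    for all. *)
Lemma hump_du_bois_reymond (f : R -> R) (c d : R) : c < d -> rL1 f ->
  (forall u v r, 0 < r -> c < u - r -> u + r < d -> c < v - r -> v + r < d ->
    \int[mu]_x (f x * hump u r x) = \int[mu]_x (f x * hump v r x)) ->
  exists k, {ae mu, forall x, c < x < d -> f x = k}.
Proof.
move=> cd lf h; have [v /andP[cv vd] hv] := ae_pick cd (lebesgue_pt_hump lf).
exists (f v); apply: aeS (lebesgue_pt_hump lf) => u hu /andP[cu ud].
apply/eqP; rewrite -subr_eq0 -normr_le0; apply/ler_addgt0Pr => e e0; rewrite add0r.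
have e4 : 0 < e / 4 by rewrite divr_gt0.
have [D D0 hD] := hu _ e4; have [D' D'0 hD'] := hv _ e4.
pose m := Num.min (Num.min (u - c) (d - u)) (Num.min (v - c) (d - v)).
pose r := Num.min (Num.min D D') m / 2.
have m0 : 0 < Num.min (Num.min D D') m by rewrite !lt_min D0 D'0 !subr_gt0 cu ud cv vd.
have r0 : 0 < r by rewrite divr_gt0.
have [[r1 r2] [r3 r4 r5 r6]] : (r * 2 <= D /\ r * 2 <= D') /\
    [/\ r * 2 <= u - c, r * 2 <= d - u, r * 2 <= v - c & r * 2 <= d - v].
  by rewrite /r /m mulfVK ?pnatr_eq0 // !ge_min !lexx !orbT.
have le1 := hD r; have le2 := hD' r; move: le1 le2.
rewrite r0 /= (h u v r r0) //; [|lra..].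
have -> : r < D by lra.
have -> : r < D' by lra.
move=> /(_ isT) le1 /(_ isT) le2; have B := Rint_hump_ge (ltW r0).
set X := \int[mu]_x (f x * hump v r x) in le1 le2; set Y := \int[mu]_x hump 0 r x in le1 le2 B.
have p5 : 0 < r ^+ 5 by rewrite exprn_gt0.
have le3 : `|f u - f v| * (r ^+ 5 / 2) <= e / 2 * r ^+ 5.
  apply: (@le_trans _ _ (`|f u - f v| * Y)); first by rewrite ler_wpM2l.
  rewrite -[Y]ger0_norm -?normrM; last by apply: le_trans B; rewrite divr_ge0 ?exprn_ge0 // ltW.
  have -> : (f u - f v) * Y = (X - f v * Y) - (X - f u * Y) by ring.
  by apply: le_trans (ler_normB _ _) _; lra.
have : `|f u - f v| * r ^+ 5 <= e * r ^+ 5 by lra.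
by rewrite ler_pM2r.
Qed.

Lemma primitive_derive (f : R -> R) (x : R) : rL1 f -> {for x, continuous f} ->
  derivable (fun y => \int[mu]_t (ind (t <= y) * f t)) x 1 /\
  derive1 (fun y => \int[mu]_t (ind (t <= y) * f t)) x = f x.
Proof.
move=> lf cf; have E y : \int[mu]_t (ind (t <= y) * f t) = \int[mu]_(t in [set` `]-oo, y]]) f t.
  rewrite [RHS]Rintegral_mkcond; apply: eq_Rintegral => t _; rewrite patchE.
  rewrite [X in if X then _ else _](_ : _ = (t <= y)); last by apply/idP/idP; rewrite inE /= in_itv.
  by case: (t <= y); rewrite ?mul1r ?mul0r.
rewrite (funext E); apply: (@continuous_FTC1 _ f -oo%O x (x + 1)) => //; first by rewrite ltrDl.
  exact: integrableS lf.
by rewrite ltNyr.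
Qed.

Section Tests.
Variables (c d : R).
Local Notation I := [set` `]c, d[].

Lemma inC1_real (p p' : R -> R) : (forall x, derivable p x 1 /\ derive1 p x = p' x) ->
  continuous p' -> inCk 1 I (fun x => (p x)%:C) /\
    cderiv (fun x => (p x)%:C) = fun x => (p' x)%:C.
Proof.
move=> dp cp; have E : cderiv (fun x => (p x)%:C) = fun x => (p' x)%:C.
  apply/funext => x; apply: cplxP => /=; first by case: (dp x).
  by rewrite /im /= derive1_cst.
split=> //; split.
  move=> [|//] x _ _ /=; split; first by case: (dp x).
  by rewrite /im /=; exact: derivable_cst.
move=> x _ /=; rewrite E; apply/cvgC_split; split; first exact: cp.
exact: cvg_cst.
Qed.

Lemma hump_test u r : 0 < r -> c < u - r -> u + r < d ->
  [/\ inCk 1 I (fun x => (hump u r x)%:C), compact_support I (fun x => (hump u r x)%:C)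
    & cderiv (fun x => (hump u r x)%:C) = fun x => (dhump u r x)%:C].
Proof.
move=> r0 cu ud.
have [|h1 h2] := @inC1_real (hump u r) (dhump u r) _ (@continuous_dhump u r).
  move=> x; have H := is_derive_hump u r x; split; first exact: ex_derive.
  by rewrite derive1E derive_val.
split=> //; exists [set` `[u - r, u + r]]; split; first exact: segment_compact.
  by move=> x /=; rewrite !in_itv /=; lra.
move=> x /= /negP; rewrite in_itv /= => h; rewrite hump_off ?(ltW r0) //.
by rewrite leNgt; apply: contra h; rewrite ltr_norml; lra.
Qed.

(** A test function whose derivative is a difference of humps: the two masses are equal, so the
    primitive vanishes again to the right of both. *)
Definition step (u v r x : R) : R := \int[mu]_t (ind (t <= x) * (hump u r t - hump v r t)).

Lemma step_test u v r : 0 < r -> c < u - r -> u + r < d -> c < v - r -> v + r < d ->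
  [/\ inCk 1 I (fun x => (step u v r x)%:C), compact_support I (fun x => (step u v r x)%:C)
    & cderiv (fun x => (step u v r x)%:C) = fun x => (hump u r x - hump v r x)%:C].
Proof.
move=> r0 cu ud cv vd.
have lu := rL1_hump u (ltW r0); have lv := rL1_hump v (ltW r0).
have lB : rL1 (fun t => hump u r t - hump v r t) by exact: rL1B.
have cB : continuous (fun t => hump u r t - hump v r t).
  by move=> x; apply: cvgB; exact: continuous_hump.
have [|h1 h2] := @inC1_real (step u v r) (fun x => hump u r x - hump v r x) _ cB.
  by move=> x; exact: (primitive_derive lB (cB x)).
split=> //; exists [set` `[Num.min u v - r, Num.max u v + r]]; split; first exact: segment_compact.
  move=> x /=; rewrite !in_itv /= => /andP[x1 x2]; apply/andP; split.
    by apply: lt_le_trans x1; case: (leP u v).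
  by apply: le_lt_trans x2 _; case: (leP u v).
move=> x /= /negP; rewrite in_itv /= negb_and -!ltNge => /orP[h|h]; congr (_%:C).
  rewrite /step -[RHS](mul0r (fine (mu setT))) -(Rintegral_cst _ measurableT); apply: eq_Rintegral => t _.
  have [tx|_] := leP t x; last by rewrite mul0r.
  rewrite !hump_off ?subrr ?mulr0 ?(ltW r0) //.
    have : t < v - r by apply: le_lt_trans tx (lt_le_trans h _); rewrite lerD2r ge_min lexx orbT.
    by rewrite ltrBrDr => ?; rewrite ler_normr; apply/orP; right; lra.
  have : t < u - r by apply: le_lt_trans tx (lt_le_trans h _); rewrite lerD2r ge_min lexx.
  by rewrite ltrBrDr => ?; rewrite ler_normr; apply/orP; right; lra.
have -> : step u v r x = \int[mu]_t (hump u r t - hump v r t).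
  apply: eq_Rintegral => t _; have [tx|tx] := leP t x; first by rewrite mul1r.
  rewrite mul0r !hump_off ?subrr ?(ltW r0) //.
    have : v + r < t by apply: le_lt_trans (lt_trans h tx); rewrite lerD2r le_max lexx orbT.
    by move=> ?; rewrite ler_normr; apply/orP; left; lra.
  have : u + r < t by apply: le_lt_trans (lt_trans h tx); rewrite lerD2r le_max lexx.
  by move=> ?; rewrite ler_normr; apply/orP; left; lra.
by rewrite RintB // (Rint_hump u) ?(Rint_hump v) ?subrr // (ltW r0).
Qed.

End Tests.

Lemma Int_mul_real (f : R -> C) (p : R -> R) :
  Int (fun x => f x * (p x)%:C) =
  Complex (\int[mu]_x (re f x * p x)) (\int[mu]_x (im f x * p x)).
Proof.
by apply: cplxP => /=; apply: eq_Rintegral => x _; rewrite /re /im CplxE /= ?mulr0 ?subr0 ?add0r ?addr0.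
Qed.

Lemma fundamental_lemma (f : R -> C) (c d : R) : L1 f ->
  (forall u r, 0 < r -> c < u - r -> u + r < d -> Int (fun x => f x * (hump u r x)%:C) = 0) ->
  {ae mu, forall x, c < x < d -> f x = 0}.
Proof.
move=> [f1 f2] h; have H u r (r0 : 0 < r) (cu : c < u - r) (ud : u + r < d) := h u r r0 cu ud.
have a1 := @hump_fundamental (re f) c d f1; have a2 := @hump_fundamental (im f) c d f2.
apply: aeS (aeI (a1 _) (a2 _)) => [x [e1 e2] xcd|u r r0 cu ud|u r r0 cu ud].
- by apply: cplxP; [exact: e1|exact: e2].
- by have := H u r r0 cu ud; rewrite Int_mul_real => -[].
- by have := H u r r0 cu ud; rewrite Int_mul_real => -[].
Qed.

Lemma du_bois_reymond (f : R -> C) (c d : R) : c < d -> L1 f ->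
  (forall u v r, 0 < r -> c < u - r -> u + r < d -> c < v - r -> v + r < d ->
    Int (fun x => f x * (hump u r x - hump v r x)%:C) = 0) ->
  exists k, {ae mu, forall x, c < x < d -> f x = k}.
Proof.
move=> cd [f1 f2] h.
have P (g : R -> R) u v r : rL1 g -> 0 < r -> \int[mu]_x (g x * (hump u r x - hump v r x)) = 0 ->
    \int[mu]_x (g x * hump u r x) = \int[mu]_x (g x * hump v r x).
  move=> lg r0; have mg := rL1_meas lg.
  have l w : rL1 (fun x => g x * hump w r x).
    apply: (@rL1_dom _ _ (fun x => r ^+ 4 * `|g x|)); last exact/rL1Z/rL1_norm.
      by apply: measM => //; exact: meas_hump.
    by move=> x; rewrite normrM mulrC ler_wpM2r // ger0_norm ?hump_ge0 // hump_le // ltW.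
  under eq_Rintegral do rewrite mulrBr.
  by rewrite RintB // => /eqP; rewrite subr_eq0 => /eqP.
have [|k1 h1] := @hump_du_bois_reymond (re f) c d cd f1.
  move=> u v r r0 cu ud cv vd; apply: P => //.
  by have := h u v r r0 cu ud cv vd; rewrite Int_mul_real => -[].
have [|k2 h2] := @hump_du_bois_reymond (im f) c d cd f2.
  move=> u v r r0 cu ud cv vd; apply: P => //.
  by have := h u v r r0 cu ud cv vd; rewrite Int_mul_real => -[].
exists (Complex k1 k2); apply: aeS (aeI h1 h2) => x [e1 e2] xcd.
by apply: cplxP; [exact: e1|exact: e2].
Qed.

End Bumps.

(** * Primitives and potentials *)

Section Primitives.
Context {R : realType}.
Local Notation C := (complex R).
Local Notation mu := (@lebesgue_measure R).

Definition prim (f : R -> C) (x : R) : C := Int (fun t => ind (t <= x) * f t).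

Lemma prim_integrand (f : R -> C) (x : R) : L1 f -> L1 (fun t => ind (t <= x) * f t).
Proof. by move=> lf; apply: L1bool => //; meas. Qed.

Lemma cmf_prim f : cmf f -> cmf (prim f).
Proof. by move=> mf; apply: cmf_Int; apply: cmfM; meas. Qed.

Lemma prim_le f x : L1 f -> cabs (prim f x) <= \int[mu]_t cabs (f t).
Proof.
move=> lf; apply: le_trans (cabs_Int (prim_integrand x lf)) _.
apply: Rint_le; [exact/L1_cabs/prim_integrand|exact: L1_cabs|move=> t].
by rewrite cabsM cabs_nat ler_piMl ?cabs_ge0 ?ind_le1.
Qed.

Lemma prim_derive f x : L1 f -> {for x, continuous (f : R -> C^o)} ->
  [/\ derivable (re (prim f)) x 1, derivable (im (prim f)) x 1 & cderiv (prim f) x = f x].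
Proof.
move=> [f1 f2] /cvgC_split[c1 c2].
have E1 : re (prim f) = fun y => \int[mu]_t (ind (t <= y) * re f t).
  apply/funext => y; rewrite {1}/re /=; apply: eq_Rintegral => t _.
  by rewrite {1}/re natC CplxE /= mul0r subr0.
have E2 : im (prim f) = fun y => \int[mu]_t (ind (t <= y) * im f t).
  apply/funext => y; rewrite {1}/im /=; apply: eq_Rintegral => t _.
  by rewrite {1}/im natC CplxE /= mul0r addr0.
have [d1 e1] := primitive_derive f1 c1; have [d2 e2] := primitive_derive f2 c2.
by rewrite /cderiv E1 E2; split; [exact: d1|exact: d2|apply: cplxP; [exact: e1|exact: e2]].
Qed.

Section Support.
Variables (b : R) (h : R -> C).
Hypothesis b0 : 0 <= b.
Hypothesis lh : L1 h.
Hypothesis sh : supp_in b h.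

Lemma prim_left x : x < - b -> prim h x = 0.
Proof.
move=> xb; rewrite /prim -[RHS](@Int0 R); congr Int; apply/funext => t.
have [tx|_] := leP t x; last by rewrite mul0r.
by rewrite sh ?mulr0 // ltr_normr; apply/orP; right; lra.
Qed.

Lemma prim_right x : b <= x -> prim h x = Int h.
Proof.
move=> xb; congr Int; apply/funext => t.
have [tx|tx] := leP t x; first by rewrite mul1r.
by rewrite sh ?mulr0 // ltr_normr; apply/orP; left; lra.
Qed.

Hypothesis h0 : Int h = 0.

Lemma prim_supp : supp_in b (prim h).
Proof. by move=> x; rewrite ltr_normr => /orP[/ltW/prim_right-> //|xb]; apply: prim_left; lra. Qed.

Lemma L1_prim : L1 (prim h).
Proof.
have mp := cmf_prim (L1_cmf lh).
suff -> : prim h = fun x => ind (- b <= x <= b) * prim h x.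
  by apply: (@L1_itv_bounded _ _ _ (\int[mu]_t cabs (h t))) => // x _; exact: prim_le.
apply/funext => x; rewrite -norm_itv; have [xb|/prim_supp ->] := leP `|x| b; last by rewrite mulr0.
by rewrite mul1r.
Qed.

(** The double primitive has kernel the positive part of [x - s], which is
    [|x - s| / 2 + (x - s) / 2]; the zero mean of [h] removes the term in [x]. *)
Lemma prim_prim x : `|x| <= b -> prim (prim h) x =
  pot h x - 2^-1 * Int (fun s => h s * s%:C).
Proof.
move=> xb; have mh := L1_cmf lh.
transitivity (Int (fun t => Int (fun s => ind (- b <= t <= b) * (ind (t <= x) * (ind (s <= t) * h s))))).
  congr Int; apply/funext => t; have [tb|tb] := boolP (- b <= t <= b).
    rewrite /prim -IntZ; last exact: prim_integrand.
    by congr Int; apply/funext => s; rewrite mul1r.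
  rewrite prim_supp ?mulr0; last by rewrite ltNge norm_itv.
  by rewrite -[LHS](@Int0 R); congr Int; apply/funext => s; rewrite mul0r.
rewrite (@Int_fubini _ _ (fun t => ind (- b <= t <= b)) (fun s => cabs (h s))); first last.
- exact: L1_cabs.
- exact: rL1_itv.
- move=> t s; rewrite !cabsM !cabs_nat ler_wpM2l //.
  by rewrite mulrA ler_piMl ?cabs_ge0 // -[leRHS]mulr1 ler_pM ?ind_le1.
- by meas.
have lq : L1 (fun s => h s * s%:C) by exact: (L1_mulid lh sh).
have lp := pot_integrand lh sh x.
transitivity (Int (fun s => (2^-1 * `|x - s|)%:C * h s + (2^-1 * x%:C * h s - 2^-1 * (h s * s%:C)))); last first.
  have l1 : L1 (fun s => 2^-1 * x%:C * h s) by exact: L1Z.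
  have l2 : L1 (fun s => 2^-1 * (h s * s%:C)) by exact: L1Z.
  by rewrite (IntD lp (L1B l1 l2)) (IntB l1 l2) (IntZ _ lh) (IntZ _ lq) h0 mulr0 sub0r.
congr Int; apply/funext => s; have [sb|/sh ->] := leP `|s| b; last first.
  rewrite !(mulr0, mul0r) subr0 addr0 -[RHS](@Int0 R); congr Int; apply/funext => t.
  by rewrite !mulr0.
transitivity ((\int[mu]_t ind (s <= t <= x))%:C * h s).
  rewrite -Int_real -IntZr; last by split=> /=; [exact: rL1_itv|by case: (@L1_0 R)].
  congr Int; apply/funext => t; rewrite -natC !mulrA -!natrM !mulnb; congr (_%:R * _).
  congr nat_of_bool; move: xb sb; rewrite !norm_itv => xb sb; apply/idP/idP; lra.
have -> : (\int[mu]_t ind (s <= t <= x)) = 2^-1 * `|x - s| + 2^-1 * (x - s).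
  have [sx|sx] := leP s x; first by rewrite Rint_itv1 // ger0_norm ?subr_ge0 //; lra.
  rewrite ltr0_norm ?subr_lt0 //; transitivity (0 : R); last by lra.
  have r0 : \int[mu]_t (0 : R) = 0 by rewrite Rintegral_cst ?mul0r.
  rewrite -[RHS]r0; apply: eq_Rintegral => t _.
  by have -> : (s <= t <= x) = false by lra.
rewrite rmorphD !rmorphM rmorphB realC_inv2; ring.
Qed.

Lemma Int_prim : Int (prim h) = - Int (fun s => h s * s%:C).
Proof.
have -> : Int (prim h) = prim (prim h) b.
  congr Int; apply/funext => t; have [tb|tb] := leP t b; first by rewrite mul1r.
  by rewrite mul0r prim_supp // ltr_normr tb.
have lq : L1 (fun s => h s * s%:C) by exact: (L1_mulid lh sh).
rewrite prim_prim ?ger0_norm //.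
have -> : pot h b = Int (fun s => 2^-1 * b%:C * h s - 2^-1 * (h s * s%:C)).
  congr Int; apply/funext => s; have [|/sh ->] := leP `|s| b; last by rewrite !(mulr0, mul0r) subr0.
  rewrite norm_itv => sb; rewrite ger0_norm; last by lra.
  by rewrite !rmorphM /= rmorphD rmorphN realC_inv2; ring.
have l1 : L1 (fun s => 2^-1 * b%:C * h s) by exact: L1Z.
have l2 : L1 (fun s => 2^-1 * (h s * s%:C)) by exact: L1Z.
rewrite (IntB l1 l2) (IntZ _ lh) (IntZ _ lq) h0 mulr0 sub0r -opprD -mulrDl.
by rewrite -mulr2n -(mulr_natr 2^-1) mulVf ?mul1r // pnatr_eq0.
Qed.

Hypothesis h1 : Int (fun x => h x * x%:C) = 0.

Lemma pot_prim : pot h = prim (prim h).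
Proof.
have p0 : Int (prim h) = 0 by rewrite Int_prim h1 oppr0.
apply/funext => x; have [xb|xb] := leP `|x| b; first by rewrite prim_prim // h1 mulr0 subr0.
rewrite (pot_supp lh sh h0 h1 (ltW xb)).
move: xb; rewrite ltr_normr => /orP[/ltW xb|xb].
  rewrite -p0; congr Int; apply/funext => t; have [//|tx] := leP t x; first by rewrite mul1r.
  by rewrite prim_supp ?mulr0 // ltr_normr (le_lt_trans xb tx).
rewrite /prim -[LHS](@Int0 R); congr Int; apply/funext => t.
have [tx|_] := leP t x; last by rewrite mul0r.
by rewrite -/(prim h t) prim_left ?mulr0 //; lra.
Qed.

End Support.
End Primitives.

(** * Weak derivatives on the interval *)

Section WeakDerivatives.
Context {R : realType}.
Local Notation C := (complex R).
Local Notation mu := (@lebesgue_measure R).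
Variable a : R.
Hypothesis a0 : 0 < a.
Local Notation I := [set` `](- a), a[].

Lemma compact_in_ball (J : set R) : compact J -> J `<=` I ->
  exists2 b, 0 < b < a & forall x, J x -> `|x| <= b.
Proof.
move=> cJ JI; have [[y Jy]|J0] := pselect (J !=set0); last first.
  have a2 : 0 < a / 2 < a by rewrite divr_gt0 //= ltr_pdivrMr // ltr_pMr // ltr1n.
  by exists (a / 2) => // x Jx; case: J0; exists x.
have [|c] := @compact_EVT_max R R (@Num.norm R R) J (ex_intro _ y Jy) cJ.
  by apply: continuous_subspaceT; exact: norm_continuous.
rewrite inE => Jc cmax; have ca : `|c| < a by move: (JI _ Jc); rewrite /= in_itv /= -ltr_norml.
exists ((`|c| + a) / 2); first by have := normr_ge0 c; lra.
by move=> x Jx; apply: le_trans (cmax x _) _; rewrite ?inE //; lra.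
Qed.

Lemma compact_support_ball (f : R -> C) : compact_support I f ->
  exists2 b, 0 < b < a & supp_in b f.
Proof.
move=> [J [cJ JI Jf]]; have [b b0 Jb] := compact_in_ball cJ JI; exists b => // x xb.
by apply: Jf => /Jb; rewrite leNgt xb.
Qed.

Lemma supp_compact_support b (f : R -> C) : b < a -> supp_in b f -> compact_support I f.
Proof.
move=> ba sf; exists [set` `[- b, b]]; split; first exact: segment_compact.
  by move=> x /=; rewrite !in_itv /=; lra.
by move=> x /= /negP; rewrite in_itv /= -norm_itv -ltNge => /sf.
Qed.

Lemma norm_gt_near (c x : R) : c < `|x| -> \near x, c < `|x|.
Proof.
move=> cx; apply/nbhs_ballP; exists (`|x| - c); first by rewrite /= subr_gt0.
move=> y; rewrite /ball /= => h; have := ler_normB (x - y) x.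
by rewrite addrAC subrr sub0r normrN; have := ler_normD (x - y) y; rewrite subrK; lra.
Qed.

Lemma cderiv_supp b (f : R -> C) : supp_in b f -> supp_in b (cderiv f).
Proof.
move=> sf x xb.
have nf (p : C -> R) : p 0 = 0 -> \near x, p (f x) = 0.
  move=> p0; near=> y; rewrite sf //; near: y; exact: norm_gt_near.
apply: cplxP => /=; rewrite derive1E.
  by rewrite (@near_eq_derive _ _ _ _ (fun=> 0)) ?derive_cst //; exact: (nf (@complex.Re R)).
by rewrite (@near_eq_derive _ _ _ _ (fun=> 0)) ?derive_cst //; exact: (nf (@complex.Im R)).
Unshelve. all: by end_near. Qed.

Definition test (eta : R -> C) := inCk 1 I eta /\ compact_support I eta.

(** [inCk 1 I] says nothing outside [I]; compact support in [I] makes the regularity global and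
    gives bounds for the function and its derivative. *)
Lemma test_facts eta : test eta -> exists c D, [/\ 0 < c < a,
  supp_in c eta /\ supp_in c (cderiv eta),
  forall x, derivable (re eta) x 1 /\ derivable (im eta) x 1,
  continuous (re (cderiv eta)) /\ continuous (im (cderiv eta))
  & forall x, cabs (eta x) <= D /\ cabs (cderiv eta x) <= D].
Proof.
move=> [[d1 d2] /compact_support_ball[c ca sc]].
have sd := cderiv_supp sc.
have Iabs x : `|x| <= c -> I x by move=> xc; rewrite /= in_itv /= -ltr_norml; lra.
have nearx x : ~ I x -> \near x, c < `|x|.
  move=> nx; have xc : c < `|x| by rewrite ltNge; apply/negP => /Iabs.
  exact: norm_gt_near.
have der x : derivable (re eta) x 1 /\ derivable (im eta) x 1.
  have [xI|xI] := pselect (I x); first exact: (d1 0%N x).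
  split.
    apply: (@near_eq_derivable _ _ _ (fun=> 0)); last exact: derivable_cst.
    by apply: filterS (nearx x xI) => y /sc; rewrite /re => ->.
  apply: (@near_eq_derivable _ _ _ (fun=> 0)); last exact: derivable_cst.
  by apply: filterS (nearx x xI) => y /sc; rewrite /im => ->.
have con x : {for x, continuous (cderiv eta : R -> C^o)}.
  have [xI|xI] := pselect (I x); first exact: (d2 x).
  rewrite /prop_for /continuous_at sd; last by rewrite ltNge; apply/negP => /Iabs.
  apply: cvg_near_cst.
  by apply: filterS (nearx x xI) => y /sd ->.
have [cr ci] : continuous (re (cderiv eta)) /\ continuous (im (cderiv eta)).
  by split => x; have /cvgC_split[] := con x.
have bnd (f : R -> R) : continuous f -> (forall x, c < `|x| -> f x = 0) -> exists D, forall x, `|f x| <= D.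
  move=> cf sf; have [|||y _ hy] := @compact_EVT_max R R (fun x => `|f x|) [set` `[- c, c]].
  - by exists 0; rewrite /= in_itv /=; lra.
  - exact: segment_compact.
  - by apply: continuous_subspaceT => x; apply: cvg_norm; exact: cf.
  exists `|f y| => x; have [xc|/sf ->] := leP `|x| c; last by rewrite normr0.
  by apply: hy; rewrite inE /= in_itv /= -norm_itv.
have der_cont (f : R -> R) : (forall x, derivable f x 1) -> continuous f.
  by move=> df x; apply: differentiable_continuous; apply/derivable1_diffP; exact: df.
have [D1 h1] := bnd _ cr (fun x xc => congr1 (@complex.Re R) (sd x xc)).
have [D2 h2] := bnd _ ci (fun x xc => congr1 (@complex.Im R) (sd x xc)).
have [D3 h3] := bnd _ (der_cont _ (fun x => proj1 (der x))) (fun x xc => congr1 (@complex.Re R) (sc x xc)).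
have [D4 h4] := bnd _ (der_cont _ (fun x => proj2 (der x))) (fun x xc => congr1 (@complex.Im R) (sc x xc)).
exists c, (Num.max (D3 + D4) (D1 + D2)); split=> // x; split.
  by apply: le_trans (cabs_leD _) _; rewrite le_max (lerD (h3 x) (h4 x)).
by apply: le_trans (cabs_leD _) _; rewrite le_max (lerD (h1 x) (h2 x)) orbT.
Qed.

Lemma cmf_test eta : test eta -> cmf eta /\ cmf (cderiv eta).
Proof.
move=> /test_facts[c [D [_ _ der [c1 c2] _]]]; split; split.
- apply: continuous_measurable_fun => x; apply: differentiable_continuous.
  by apply/derivable1_diffP; case: (der x).
- apply: continuous_measurable_fun => x; apply: differentiable_continuous.
  by apply/derivable1_diffP; case: (der x).
- exact: continuous_measurable_fun.
- exact: continuous_measurable_fun.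
Qed.

Lemma cint_supp b (f : R -> C) : b < a -> supp_in b f -> cint I f = Int f.
Proof.
move=> ba sf; rewrite cintE; congr Int; apply/funext => x.
have [xI|xI] := boolP (x \in I); first by rewrite mul1r.
rewrite sf ?mulr0 // ltNge; apply: contra xI => xb.
by rewrite inE /= in_itv /= -ltr_norml; lra.
Qed.

Lemma test_tail eta s : test eta -> Int (fun x => ind (s <= x) * cderiv eta x) = - eta s.
Proof.
move=> te; have [c [D [c0 [s1 s2] der [c1 c2] _]]] := test_facts te.
pose N := Num.max s c + 1; have sN : s <= N by rewrite ler_wpDr // le_max lexx.
have cN : c < N by rewrite ltr_pwDr // le_max lexx orbT.
have EN : eta N = 0 by apply: s1; rewrite ltr_normr cN.
transitivity (Int (fun x => ind (s <= x <= N) * cderiv eta x)).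
  congr Int; apply/funext => x; have [xN|xN] := leP x N; first by rewrite andbT.
  by rewrite s2 ?mulr0 // ltr_normr (lt_trans cN xN).
have P (f : R -> R) : (forall x, derivable f x 1) -> continuous (derive1 f) ->
    \int[mu]_x (ind (s <= x <= N) * derive1 f x) = f N - f s.
  by move=> df cf; apply: FTC_itv => // x _; exact: cf.
have := P (re eta) (fun x => proj1 (der x)) c1; have := P (im eta) (fun x => proj2 (der x)) c2.
rewrite [im eta N]/im [re eta N]/re EN /= !sub0r => E2 E1; apply: cplxP; rewrite !CplxE /=.
  by rewrite -[RHS]E1; apply: eq_Rintegral => x _; rewrite /re natC CplxE /= mul0r subr0.
by rewrite -[RHS]E2; apply: eq_Rintegral => x _; rewrite /im natC CplxE /= mul0r addr0.
Qed.

Lemma prim_ibp (h eta : R -> C) : L1 h -> test eta ->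
  Int (fun x => prim h x * cderiv eta x) = - Int (fun x => h x * eta x).
Proof.
move=> lh te; have [c [D [c0 [s1 s2] _ _ bD]]] := test_facts te.
have [m1 m2] := cmf_test te; have mh := L1_cmf lh.
have D0 : 0 <= D by have [h1 _] := bD 0; apply: le_trans h1; exact: cabs_ge0.
have lhe : L1 (fun x => h x * eta x).
  have -> : (fun x => h x * eta x) = fun x => eta x * h x by apply/funext => x; rewrite mulrC.
  by apply: (@L1Mb _ _ _ D) => // x; case: (bD x).
transitivity (Int (fun x => Int (fun s => ind (s <= x) * h s * cderiv eta x))).
  by congr Int; apply/funext => x; rewrite -IntZr //; exact: prim_integrand.
rewrite (@Int_fubini _ _ (fun x => D * ind (- c <= x <= c)) (fun s => cabs (h s))); first last.
- exact: L1_cabs.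
- exact/rL1Z/rL1_itv.
- move=> x s; rewrite -norm_itv; have [xc|/s2 ->] := leP `|x| c; last by rewrite mulr0 cabs0 mulr0 mul0r.
  rewrite !cabsM cabs_nat mulr1 mulrC ler_pM ?mulr_ge0 ?cabs_ge0 //; first by case: (bD x).
  by rewrite ler_piMl ?cabs_ge0 ?ind_le1.
- by meas.
rewrite -IntN //; congr Int; apply/funext => s.
rewrite -mulrN -(test_tail s te) -IntZ; last first.
  apply: L1bool; first by meas.
  suff -> : cderiv eta = fun x => ind (- c <= x <= c) * cderiv eta x.
    by apply: (@L1_itv_bounded _ _ _ D) => // x _; case: (bD x).
  apply/funext => x; rewrite -norm_itv; have [xc|/s2 ->] := leP `|x| c; last by rewrite mulr0.
  by rewrite mul1r.
by congr Int; apply/funext => x; ring.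
Qed.

Definition locL1 (f : R -> C) := forall b, 0 < b < a -> L1 (cutoff b f).

Lemma L1_locL1 (f : R -> C) : L1 f -> locL1 f.
Proof. by move=> lf b _; rewrite /cutoff; apply: L1bool => //; meas. Qed.

Lemma Int_cutoff_test (f eta : R -> C) c : supp_in c eta ->
  (fun x => cutoff c f x * eta x) = (fun x => f x * eta x).
Proof.
move=> se; apply/funext => x; rewrite /cutoff; have [_|/se ->] := leP `|x| c; last by rewrite !mulr0.
by rewrite [ind true * _]mul1r.
Qed.

Lemma locL1_test (f eta : R -> C) c D : locL1 f -> 0 < c < a -> supp_in c eta -> cmf eta ->
  (forall x, cabs (eta x) <= D) -> L1 (fun x => f x * eta x).
Proof.
move=> lf ca se me eD; rewrite -(Int_cutoff_test f se).
have -> : (fun x => cutoff c f x * eta x) = fun x => eta x * cutoff c f x.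
  by apply/funext => x; rewrite mulrC.
by apply: (L1Mb me eD); exact: lf.
Qed.

Lemma is_wderiv_test (f g eta : R -> C) : is_wderiv I f g -> test eta ->
  Int (fun x => f x * cderiv eta x) = - Int (fun x => g x * eta x).
Proof.
move=> fg te; have [e1 e2] := te; have := fg _ e1 e2.
have [c [D [/andP[c0 ca] [s1 s2] _ _ _]]] := test_facts te.
rewrite (@cint_supp c) //; last by move=> x xc; rewrite s2 // mulr0.
by rewrite (@cint_supp c) // => x xc; rewrite s1 // mulr0.
Qed.

Lemma test_is_wderiv (f g : R -> C) : (forall eta, test eta ->
    Int (fun x => f x * cderiv eta x) = - Int (fun x => g x * eta x)) -> is_wderiv I f g.
Proof.
move=> fg eta e1 e2; have te : test eta by [].
have [c [D [/andP[c0 ca] [s1 s2] _ _ _]]] := test_facts te.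
rewrite (@cint_supp c) //; last by move=> x xc; rewrite s2 // mulr0.
rewrite (@cint_supp c) //; first exact: fg.
by move=> x xc; rewrite s1 // mulr0.
Qed.

Lemma ae_forall_nat (P : nat -> R -> Prop) : (forall n, {ae mu, forall x, P n x}) ->
  {ae mu, forall x, forall n, P n x}.
Proof. by move=> h; apply/ae_foralln. Qed.

Lemma fundamental_loc (f : R -> C) (c d : R) : - a <= c -> d <= a -> locL1 f ->
  (forall u r, 0 < r -> c < u - r -> u + r < d -> Int (fun x => f x * (hump u r x)%:C) = 0) ->
  {ae mu, forall x, c < x < d -> f x = 0}.
Proof.
move=> ac da lf h.
(* Countably many balls exhaust the interval, so their exceptional sets can be united; the shift by
   2 keeps every radius positive. *)
pose b n := a - a / n.+2%:R.
have bn n : 0 < b n < a.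
  have n0 : (0 : R) < n.+2%:R by rewrite ltr0n.
  rewrite /b subr_gt0 gtrBl divr_gt0 // ltr_pdivrMr // ltr_pMr // andbT.
  by rewrite ltr1n.
have H n : {ae mu, forall x, Num.max c (- b n) < x < Num.min d (b n) -> cutoff (b n) f x = 0}.
  apply: fundamental_lemma; first exact: lf.
  move=> u r r0; rewrite gt_max lt_min => /andP[cu bu] /andP[ud ub].
  rewrite (Int_cutoff_test f (eta := fun x => (hump u r x)%:C)); first exact: h.
  move=> x; rewrite ltr_normr => hx; rewrite hump_off ?(ltW r0) // ler_normr; apply/orP.
  by case/orP: hx => hx; [left|right]; lra.
apply: aeS (ae_forall_nat H) => x hx /andP[cx xd].
have xa : `|x| < a by rewrite ltr_norml; lra.
pose n := Num.trunc (a / (a - `|x|)).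
have xb : `|x| < b n.
  rewrite /b ltrBrDl -ltrBrDr ltr_pdivrMr ?ltr0n // mulrC -ltr_pdivrMr ?subr_gt0 //.
  apply: lt_trans (truncnS_gt _) _.
  by rewrite ltr_nat.
have := hx n; rewrite /cutoff (ltW xb) [ind true * _]mul1r => -> //.
by move: xb; rewrite ltr_norml gt_max lt_min cx xd.
Qed.

Lemma wderiv_unique (f g g' : R -> C) : is_wderiv I f g -> is_wderiv I f g' ->
  locL1 g -> locL1 g' -> {ae mu, forall x, I x -> g x = g' x}.
Proof.
move=> fg fg' lg lg'.
have lB : locL1 (fun x => g x - g' x).
  move=> b ba; have -> : cutoff b (fun x => g x - g' x) = fun x => cutoff b g x - cutoff b g' x.
    by apply/funext => x; rewrite /cutoff mulrBr.
  by apply: L1B; [exact: lg|exact: lg'].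
apply: aeS (fundamental_loc (lexx _) (lexx _) lB _) => [x h|u r r0 cu ud].
  by rewrite /= in_itv /= => /h /eqP; rewrite subr_eq0 => /eqP.
have [t1 t2 _] := hump_test r0 cu ud; have te : test (fun x => (hump u r x)%:C) by [].
have := is_wderiv_test fg te; rewrite (is_wderiv_test fg' te) => /oppr_inj E.
have [c [D [c0 [s1 _] _ _ bD]]] := test_facts te; have [m1 _] := cmf_test te.
have l1 := locL1_test lg c0 s1 m1 (fun x => proj1 (bD x)).
have l2 := locL1_test lg' c0 s1 m1 (fun x => proj1 (bD x)).
under eq_fun do rewrite mulrBl.
by rewrite (IntB l1 l2) E subrr.
Qed.

(** Du Bois-Reymond for [f - prim g], tested with the derivatives of [step]. Since [prim g] need not
    decay, it is cut off at [a] to be integrable on the line. *)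
Lemma wderiv_prim (f g : R -> C) : L1 f -> L1 g ->
  (forall eta, test eta -> Int (fun x => f x * cderiv eta x) = - Int (fun x => g x * eta x)) ->
  exists k, {ae mu, forall x, I x -> f x = prim g x + k}.
Proof.
move=> lf lg fg.
have aa : - a < a by rewrite gt0_cp.
have lp : L1 (fun x => ind (- a <= x <= a) * prim g x).
  apply: (@L1_itv_bounded _ _ _ (\int[mu]_t cabs (g t))); first exact/cmf_prim/L1_cmf.
  by move=> x _; exact: prim_le.
have lB : L1 (fun x => f x - ind (- a <= x <= a) * prim g x) by exact: L1B.
have [|k hk] := du_bois_reymond aa lB; last first.
  exists k; apply: aeS hk => x; rewrite /= in_itv /= => h /andP[x1 x2].
  have : - a <= x <= a by rewrite !ltW.
  by move=> xa; have := h; rewrite x1 x2 xa mul1r => /(_ isT) <-; rewrite addrC subrK.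
move=> u v r r0 cu ud cv vd.
have [t1 t2 t3] := step_test r0 cu ud cv vd.
have te : test (fun x => (step u v r x)%:C) by [].
have := fg _ te; have := prim_ibp lg te; rewrite t3 => E1 E2.
have [c [D [c0 [s1 s2] _ _ bD]]] := test_facts te; have [m1 m2] := cmf_test te.
rewrite t3 in s2 m2; have bD2 x : cabs (hump u r x - hump v r x)%:C <= D.
  by have [_] := bD x; rewrite t3.
have l1 := locL1_test (L1_locL1 lf) c0 s2 m2 bD2.
have E x : (f x - ind (- a <= x <= a) * prim g x) * (hump u r x - hump v r x)%:C =
    f x * (hump u r x - hump v r x)%:C - prim g x * (hump u r x - hump v r x)%:C.
  have [xa|xa] := boolP (- a <= x <= a); first by rewrite mul1r mulrBl.
  rewrite s2 ?mulr0 ?subr0 // ltNge norm_itv; apply: contra xa; lra.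
have l2 : L1 (fun x => prim g x * (hump u r x - hump v r x)%:C).
  have := locL1_test (L1_locL1 lp) c0 s2 m2 bD2; congr L1; apply/funext => x.
  have [xa|xa] := boolP (- a <= x <= a); first by rewrite mul1r.
  rewrite s2 ?mulr0 // ltNge norm_itv; apply: contra xa; lra.
by rewrite (funext E) (IntB l1 l2) E2 E1 subrr.
Qed.

Section Second.
Variables (b : R) (phi g1 g2 : R -> C).
Hypothesis b0 : 0 < b < a.
Hypothesis sphi : supp_in b phi.
Hypothesis lphi : L1 phi.
Hypothesis lg1 : L1 g1.
Hypothesis lg2 : locL1 g2.
Hypothesis w1 : is_wderiv I phi g1.
Hypothesis w2 : is_wderiv I g1 g2.

Let b0' : 0 <= b. Proof. by case/andP: b0 => /ltW. Qed.

(** Humps inside the two outer intervals are test functions that do not meet the ball, so the weak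
    derivative vanishes there together with [f]. *)
Let outside (f g : R -> C) : L1 f -> is_wderiv I f g -> locL1 g ->
  {ae mu, forall x, I x -> b < `|x| -> f x = 0} -> {ae mu, forall x, I x -> b < `|x| -> g x = 0}.
Proof.
move=> lf fg lg f0; have /andP[b1 ba] := b0.
have P c d : - a <= c -> d <= a -> (forall x, c < x < d -> b < `|x|) ->
    {ae mu, forall x, c < x < d -> g x = 0}.
  move=> ac da h; apply: (fundamental_loc ac da lg) => u r r0 cu ud.
  have [t1 t2 t3] := hump_test r0 (le_lt_trans ac cu) (lt_le_trans ud da).
  have te : test (fun x => (hump u r x)%:C) by [].
  apply: oppr_inj; rewrite -(is_wderiv_test fg te) oppr0.
  have [e [D [e0 [s1 s2] _ _ bD]]] := test_facts te; have [m1 m2] := cmf_test te.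
  rewrite -[RHS](@Int0 R) t3; rewrite t3 in s2 m2 bD.
  apply: Int_ae; [|exact: cmf_cst|].
    exact: L1_cmf (locL1_test (L1_locL1 lf) e0 s2 m2 (fun x => proj2 (bD x))).
  apply: aeS f0 => x fx; have [xr|xr] := leP r `|x - u|.
    by rewrite dhump_off ?mulr0 // ltW.
  move: xr; rewrite ltr_norml => /andP[x1 x2].
  have xcd : c < x < d by lra.
  by rewrite fx ?mul0r ?h // /= in_itv /=; lra.
have h1 := P b a _ (lexx a) _; have h2 := P (- a) (- b) (lexx _) _ _.
apply: aeS (aeI (h1 _ _) (h2 _ _)) => [x [e1 e2]||x||x].
- rewrite /= in_itv /= ltr_normr => /andP[x1 x2] /orP[xb|xb]; [apply: e1|apply: e2]; lra.
- lra.
- by rewrite ltr_normr => /andP[-> _].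
- lra.
- by rewrite ltr_normr => /andP[_ xb]; apply/orP; right; lra.
Qed.

Let h := cutoff b g2.

Let lh : L1 h. Proof. exact: lg2. Qed.
Let sh : supp_in b h. Proof. exact: supp_cutoff. Qed.

Lemma second_weak_supp : {ae mu, forall x, I x -> b < `|x| -> g1 x = 0} /\
  {ae mu, forall x, I x -> g2 x = h x}.
Proof.
have z1 : {ae mu, forall x, I x -> b < `|x| -> g1 x = 0}.
  by apply: (outside lphi w1 (L1_locL1 lg1)); apply: aeT => x _; exact: sphi.
split=> //; have z2 := outside lg1 w2 lg2 z1.
apply: aeS z2 => x e xI; rewrite /h /cutoff; have [xb|xb] := leP `|x| b.
  by rewrite [ind true * _]mul1r.
by rewrite e // mulr0.
Qed.

(** This turns compact support into vanishing moments: to the left of the ball [prim g] is 0, so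
    [k = 0]; to the right it is [Int g], so [Int g = 0]. *)
Let extract (f g : R -> C) k : L1 g -> supp_in b g ->
  {ae mu, forall x, I x -> b < `|x| -> f x = 0} ->
  {ae mu, forall x, I x -> f x = prim g x + k} -> k = 0 /\ Int g = 0.
Proof.
move=> lg sg f0 fE; have /andP[b1 ba] := b0.
have k0 : k = 0.
  have [|x xab [z e]] := @ae_pick R _ (- a) (- b) _ (aeI f0 fE); first lra.
  have xI : I x by rewrite /= in_itv /=; lra.
  have xb : b < `|x| by rewrite ltr_normr; apply/orP; right; lra.
  by have := e xI; rewrite z // (prim_left sg) ?add0r //; lra.
split=> //; have [|x xab [z e]] := @ae_pick R _ b a _ (aeI f0 fE); first lra.
have xI : I x by rewrite /= in_itv /=; lra.
have xb : b < `|x| by rewrite ltr_normr; apply/orP; left; lra.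
by have := e xI; rewrite z // k0 addr0 (prim_right sg) //; lra.
Qed.

(** Two integrations, each losing its constant by [extract]. The first gives [h] zero mean; the
    second gives its primitive zero mean, which is the vanishing of the first moment. *)
Lemma second_weak : [/\ Int h = 0, Int (fun x => h x * x%:C) = 0,
  {ae mu, forall x, I x -> g1 x = prim h x} & {ae mu, forall x, I x -> phi x = pot h x}].
Proof.
have [z1 z2] := second_weak_supp.
have [|k hk] := wderiv_prim lg1 lh.
  move=> eta te; rewrite (is_wderiv_test w2 te); congr (- _).
  have [c [D [c0 [s1 s2] _ _ bD]]] := test_facts te; have [m1 m2] := cmf_test te.
  apply: Int_ae.
  - exact: L1_cmf (locL1_test lg2 c0 s1 m1 (fun x => proj1 (bD x))).
  - exact: L1_cmf (locL1_test (L1_locL1 lh) c0 s1 m1 (fun x => proj1 (bD x))).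
  apply: aeS z2 => x e; have [xc|/s1 ->] := leP `|x| c; last by rewrite !mulr0.
  by rewrite e // /= in_itv /= -ltr_norml; lra.
have [k0 h0] := extract lh sh z1 hk.
have lp := L1_prim lh sh h0; have sp := prim_supp sh h0.
have g1E : {ae mu, forall x, I x -> g1 x = prim h x}.
  by apply: aeS hk => x e xI; rewrite e // k0 addr0.
have [|k' hk'] := wderiv_prim lphi lp.
  move=> eta te; rewrite (is_wderiv_test w1 te); congr (- _).
  have [c [D [c0 [s1 s2] _ _ bD]]] := test_facts te; have [m1 m2] := cmf_test te.
  apply: Int_ae.
  - exact: L1_cmf (locL1_test (L1_locL1 lg1) c0 s1 m1 (fun x => proj1 (bD x))).
  - exact: L1_cmf (locL1_test (L1_locL1 lp) c0 s1 m1 (fun x => proj1 (bD x))).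
  apply: aeS g1E => x e; have [xc|/s1 ->] := leP `|x| c; last by rewrite !mulr0.
  by rewrite e // /= in_itv /= -ltr_norml; lra.
have [k'0 p0] := extract lp sp (aeT (fun x _ => @sphi x)) hk'.
have h1 : Int (fun x => h x * x%:C) = 0.
  by have := Int_prim b0' lh sh h0; rewrite p0 => /eqP; rewrite eq_sym oppr_eq0 => /eqP.
split=> //; apply: aeS hk' => x e xI.
by rewrite (pot_prim b0' lh sh h0 h1) e // k'0 addr0.
Qed.

End Second.

Lemma pot_is_wderiv b (h : R -> C) : 0 <= b -> L1 h -> supp_in b h -> Int h = 0 ->
  Int (fun x => h x * x%:C) = 0 -> is_wderiv I (pot h) (prim h) /\ is_wderiv I (prim h) h.
Proof.
move=> b0 lh sh h0 h1; split; apply: test_is_wderiv => eta te; last exact: prim_ibp.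
by rewrite (pot_prim b0 lh sh h0 h1); apply: prim_ibp => //; exact: (L1_prim lh sh h0).
Qed.

End WeakDerivatives.

(** * The continuous kernel *)

Section Caratheodory.
Context {R : realType}.
Local Notation C := (complex R).
Local Notation mu := (@lebesgue_measure R).

Fixpoint grid (c d : R) (m : nat) (t : R) : R :=
  if m is m'.+1 then (if c + m%:R * d <= t then c + m%:R * d else grid c d m' t) else c.

Lemma gridP (c d : R) m t : 0 < d -> c <= t < c + m.+1%:R * d ->
  grid c d m t <= t < grid c d m t + d.
Proof.
move=> d0; elim: m => [|m IH] /andP[ct tm]; first by rewrite /= ct -[d in X in _ < _ + X]mul1r.
rewrite /=; have [h|h] := leP (c + m.+1%:R * d) t; last by apply: IH; rewrite ct.
by rewrite h /=; apply: lt_le_trans tm _; rewrite -addrA lerD2l [in leLHS]mulrSr mulrDl mul1r.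
Qed.

Lemma cmf_grid (G : R -> R -> C) c d m : (forall t, cmf (fun x : R => G x t)) ->
  cmf (fun p : R * R => G p.1 (grid c d m p.2)).
Proof.
move=> mG; have mG1 t : cmf (fun p : R * R => G p.1 t).
  by apply: (cmf_comp (mG t)); meas.
elim: m => [|m IH] /=; first exact: mG1.
pose z := c + m.+1%:R * d.
have -> : (fun p : R * R => G p.1 (if z <= p.2 then z else grid c d m p.2)) =
    fun p => ind (z <= p.2) * G p.1 z + ind (~~ (z <= p.2)) * G p.1 (grid c d m p.2).
  by apply/funext => p; case: (z <= p.2); rewrite /= ?mul0r ?mul1r ?addr0 ?add0r.
by apply: cmfD; apply: cmfM => //; meas.
Qed.

(** Caratheodory's argument: rounding [t] down to finer and finer grids gives jointly measurable
    functions that converge pointwise by continuity in [t]. *)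
Lemma cmf_caratheodory (G : R -> R -> C) : (forall t, cmf (fun x : R => G x t)) ->
  (forall x t, {for t, continuous (G x : R -> C^o)}) ->
  cmf (fun p : R * R => G p.1 p.2).
Proof.
move=> mG cG.
(* From [-n], this many steps of length [1 / (n + 1)] cover [[-n, n]]. *)
have [m mE] : exists m : nat -> nat, forall n, m n = (2 * n.+1 ^ 2)%N.
  by exists (fun n => 2 * n.+1 ^ 2)%N.
apply: (@cmf_lim _ _ _ (fun n p => G p.1 (grid (- n%:R) n.+1%:R^-1 (m n) p.2))).
  by move=> n; exact: cmf_grid.
move=> [x t] /=; apply: (@cvg_comp _ _ _ (fun n => grid (- n%:R) n.+1%:R^-1 (m n) t) (G x : R -> C^o) _ (nbhs t)); last exact: cG.
apply/cvgrPdist_lt => e e0.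
pose N := Num.trunc (`|t| + e^-1).
exists N.+1 => // n /= Nn.
have h : `|t| + e^-1 < n%:R.
  by apply: lt_le_trans (truncnS_gt _) _; rewrite ler_nat.
have ei : 0 < e^-1 by rewrite invr_gt0.
have tn : - n%:R < t < n%:R by rewrite -ltr_norml; lra.
have n1 : (0 : R) < n.+1%:R by rewrite ltr0n.
have d0 : (0 : R) < n.+1%:R^-1 by rewrite invr_gt0.
have ed : n.+1%:R^-1 < e.
  rewrite -[e]invrK ltf_pV2 ?posrE //; apply: (@lt_trans _ _ n%:R); last by rewrite ltr_nat.
  by have := normr_ge0 t; lra.
have [/andP[t1 t2]] : - n%:R <= t < - n%:R + (m n).+1%:R * n.+1%:R^-1 /\ True.
  split=> //; apply/andP; split; first by case/andP: tn => /ltW.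
  rewrite mE [(2 * _).+1%:R]mulrS natrM natrX mulrDl mul1r expr2 mulrA mulfK ?gt_eqF //.
  have -> : (n.+1%:R : R) = n%:R + 1 by rewrite -natr1.
  by case/andP: tn => _; rewrite -natr1 in d0 *; lra.
move=> _; have /andP[g1 g2] := gridP d0 (introT andP (conj t1 t2)).
by rewrite ger0_norm ?subr_ge0 //; apply: lt_trans ed; rewrite ltrBlDr addrC.
Qed.

End Caratheodory.

Lemma pair_continuous {R : realType} (T : topologicalType) (f g : T -> R) (p : T) :
  {for p, continuous f} -> {for p, continuous g} -> {for p, continuous (fun t => (f t, g t))}.
Proof. by move=> cf cg; exact: (cvg_pair cf cg). Qed.

(** * The kernel on a square *)

Section Goursat.
Context {R : realType}.
Local Notation C := (complex R).
Local Notation mu := (@lebesgue_measure R).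
Variables (a b : R) (q : R -> C) (H : R * R -> C).
Hypothesis b0 : 0 < b < a.
Hypothesis HG : goursat_solution a q H.
Hypothesis lq : L1 (cutoff b q).

Definition clamp (x : R) : R := Num.max (- b) (Num.min b x).

(* [kernel_of H] restricted to the square [-b, b]^2 and extended by constants. *)
Definition Kc (x t : R) : C := kernel_of H (clamp x) (clamp t).

(** Read off from [Kc] in the rotated coordinates: bounded on the plane, and equal to [H] wherever
    both [u + v] and [u - v] lie in [[-b, b]]. *)
Definition Hc (u v : R) : C := Kc (u + v) (u - v).

Let b1 : 0 < b. Proof. by case/andP: b0. Qed.

Lemma clampE x : `|x| <= b -> clamp x = x.
Proof. by rewrite ler_norml => /andP[h1 h2]; rewrite /clamp (min_r h2) (max_r h1). Qed.

Lemma clamp_le x : `|clamp x| <= b.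
Proof.
rewrite ler_norml /clamp le_max lexx /= ge_max ge_min lexx /= andbT.
by have := b1; lra.
Qed.

Lemma continuous_clamp : continuous clamp.
Proof.
move=> x; have c1 : {for x, continuous (fun y : R => Num.min b y : R^o)}.
  by apply: (@continuous_min R R (fun=> b) id); [exact: cvg_cst|exact: cvg_id].
exact: (@continuous_max R R (fun=> - b) (fun y : R => Num.min b y : R^o) x (cvg_cst _) c1).
Qed.

Lemma KcE x t : `|x| <= b -> `|t| <= b -> Kc x t = kernel_of H x t.
Proof. by move=> xb tb; rewrite /Kc !clampE. Qed.

Lemma HcE u v : `|u + v| <= b -> `|u - v| <= b -> Hc u v = H (u, v).
Proof.
move=> h1 h2; rewrite /Hc KcE // /kernel_of; by congr (H (_, _)); field.
Qed.

Lemma Hc_kernel x t : Hc ((x + t) / 2) ((x - t) / 2) = Kc x t.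
Proof. by rewrite /Hc; congr Kc; field. Qed.

(** In the rotated coordinates [|u| + |v|] is the maximum of [|x|] and [|t|]. *)
Lemma in_domain x t : `|x| <= b -> `|t| <= b -> goursat_domain a ((x + t) / 2, (x - t) / 2).
Proof.
rewrite !ler_norml => /andP[x1 x2] /andP[t1 t2]; rewrite /goursat_domain /=.
have [_ ba] := andP b0; rewrite !normrM !(@ger0_norm _ 2^-1) ?invr_ge0 // -mulrDl ltr_pdivrMr //.
have [h1|h1] := leP 0 (x + t); have [h2|h2] := leP 0 (x - t).
- by rewrite (ger0_norm h1) (ger0_norm h2); lra.
- by rewrite (ger0_norm h1) (ltr0_norm h2); lra.
- by rewrite (ltr0_norm h1) (ger0_norm h2); lra.
- by rewrite (ltr0_norm h1) (ltr0_norm h2); lra.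
Qed.

Lemma continuous_Kc : continuous (fun p : R * R => Kc p.1 p.2 : C^o).
Proof.
move=> p; rewrite /Kc /kernel_of.
have dom := in_domain (clamp_le p.1) (clamp_le p.2).
apply: (@continuous_comp _ _ _ (fun p : R * R => ((clamp p.1 + clamp p.2) / 2, (clamp p.1 - clamp p.2) / 2)) (H : R * R -> C^o)).
  have c1 : (fun p : R * R => clamp p.1) @ p --> clamp p.1.
    by apply: continuous_comp; [exact: cvg_fst|exact: continuous_clamp].
  have c2 : (fun p : R * R => clamp p.2) @ p --> clamp p.2.
    by apply: continuous_comp; [exact: cvg_snd|exact: continuous_clamp].
  by apply: pair_continuous; apply: cvgMl; [exact: cvgD|exact: cvgB].
exact: (proj1 HG).
Qed.

Lemma continuous_Kc2 x t : {for t, continuous (Kc x : R -> C^o)}.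
Proof.
apply: (@continuous_comp _ _ _ (fun t => (x, t)) (fun p : R * R => Kc p.1 p.2 : C^o)).
  by apply: pair_continuous; [exact: cvg_cst|exact: cvg_id].
exact: continuous_Kc.
Qed.

Lemma continuous_Kc1 x t : {for x, continuous (Kc ^~ t : R -> C^o)}.
Proof.
apply: (@continuous_comp _ _ _ (fun x => (x, t)) (fun p : R * R => Kc p.1 p.2 : C^o)).
  by apply: pair_continuous; [exact: cvg_id|exact: cvg_cst].
exact: continuous_Kc.
Qed.

Lemma continuous_cmf (f : R -> C) : (forall x, {for x, continuous (f : R -> C^o)}) -> cmf f.
Proof.
move=> cf; split; apply: continuous_measurable_fun => x; by have /cvgC_split[] := cf x.
Qed.

Lemma cmf_Kc : cmf (fun p : R * R => Kc p.1 p.2).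
Proof.
apply: cmf_caratheodory => [t|]; last exact: continuous_Kc2.
by apply: continuous_cmf => x; exact: continuous_Kc1.
Qed.

Lemma cmf_Hc : cmf (fun p : R * R => Hc p.1 p.2).
Proof. by apply: (cmf_comp2 cmf_Kc); meas. Qed.

Lemma Kc_bounded : exists M, forall x t, cabs (Kc x t) <= M.
Proof.
pose S : set (R * R) := [set` `[- b, b]] `*` [set` `[- b, b]].
have cS : compact S by apply: compact_setX; exact: segment_compact.
have S0 : S !=set0 by exists (0, 0); split; rewrite /= in_itv /=; have := b1; lra.
have bnd (f : R * R -> R) : continuous f -> exists D, forall p, S p -> `|f p| <= D.
  move=> cf; have [|c _ hc] := @compact_EVT_max _ R (fun p => `|f p|) S S0 cS.
    by apply: continuous_subspaceT => x; apply: cvg_norm; exact: cf.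
  by exists `|f c| => p Sp; apply: hc; rewrite inE.
have [|D1 h1] := bnd (fun p => complex.Re (Kc p.1 p.2)).
  by move=> p; have /cvgC_split[] := @continuous_Kc p.
have [|D2 h2] := bnd (fun p => complex.Im (Kc p.1 p.2)).
  by move=> p; have /cvgC_split[] := @continuous_Kc p.
exists (D1 + D2) => x t.
have KE : Kc x t = Kc (clamp x) (clamp t) by rewrite [RHS]KcE ?clamp_le.
have Sp : S (clamp x, clamp t).
  by split; rewrite /= in_itv /= -norm_itv clamp_le.
by rewrite KE; apply: le_trans (cabs_leD _) _; apply: lerD; [exact: (h1 _ Sp)|exact: (h2 _ Sp)].
Qed.

Lemma Hc_bounded : exists M, forall u v, cabs (Hc u v) <= M.
Proof. by have [M hM] := Kc_bounded; exists M => u v; exact: hM. Qed.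

Let qb := cutoff b q.

Lemma oint_pos (u : R) (f : R -> C) : 0 <= u -> oint 0 u f = Int (fun s => ind (0 <= s <= u) * f s).
Proof. by move=> u0; rewrite /oint u0 cint_itvE. Qed.

Lemma oint_neg (u : R) (f : R -> C) : 0 <= u -> L1 (fun s => ind (- u <= s <= 0) * f s) ->
  oint 0 (- u) f = - Int (fun s => ind (0 <= s <= u) * f (- s)).
Proof.
move=> u0 lf; have E : Int (fun s => ind (- u <= s <= 0) * f s) = Int (fun s => ind (0 <= s <= u) * f (- s)).
  rewrite (Int_opp lf); congr Int; apply/funext => s; congr (_%:R * _); congr nat_of_bool.
  by apply/idP/idP; lra.
(* The test [0 <= - u] succeeds only for [u = 0], where both integrals are over a point. *)
rewrite -E /oint; case: ifP => h; last by rewrite cint_itvE.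
have u00 : u = 0 by lra.
have Z (g : R -> C) : Int (fun s => ind (0 <= s <= 0) * g s) = 0.
  by rewrite -cint_itvE set_itv1; apply: cplxP; rewrite /= Rintegral_set1.
by rewrite cint_itvE u00 oppr0 !Z oppr0.
Qed.

Lemma goursat_pos u v : 0 <= u -> 0 <= v -> u + v <= b ->
  Hc u v = 2^-1 * Int (fun s => ind (0 <= s <= u) * qb s) +
    Int (fun al => ind (0 <= al <= u) *
      Int (fun be => ind (0 <= be <= v) * (qb (al + be) * Hc al be))).
Proof.
move=> u0 v0 uv; have ba := andP b0.
rewrite HcE; [|rewrite ler_norml; lra..].
have dom : goursat_domain a (u, v) by rewrite /goursat_domain /= !ger0_norm //; lra.
rewrite (proj2 HG _ _ dom) !oint_pos //; congr (_ * _ + _).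
  congr Int; apply/funext => s; have [h|_] := boolP (0 <= s <= u); last by rewrite !mul0r.
  rewrite /qb /cutoff; have -> : `|s| <= b by rewrite ler_norml; lra.
  by rewrite /= !mul1r.
congr Int; apply/funext => al; have [h|_] := boolP (0 <= al <= u); last by rewrite !mul0r.
rewrite oint_pos //; congr (_ * Int _); apply/funext => be.
have [h'|_] := boolP (0 <= be <= v); last by rewrite !mul0r.
rewrite HcE; [|rewrite ler_norml; lra..].
rewrite /qb /cutoff; have -> : `|al + be| <= b by rewrite ler_norml; lra.
by rewrite [ind true * q _]mul1r.
Qed.

(** Reversing orientation gives one sign in the single integral, which the sign of [Hopp]
    compensates, and two in the double integral, where the sign of [Hopp] passes under the
    integrals. *)
Lemma goursat_neg u v : 0 <= u -> 0 <= v -> u + v <= b ->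
  Hopp Hc u v = 2^-1 * Int (fun s => ind (0 <= s <= u) * qb (- s)) +
    Int (fun al => ind (0 <= al <= u) *
      Int (fun be => ind (0 <= be <= v) * (qb (- (al + be)) * Hopp Hc al be))).
Proof.
move=> u0 v0 uv; have ba := andP b0; have [M hM] := Hc_bounded.
have mHc := cmf_Hc; have mq := L1_cmf lq.
rewrite /Hopp HcE; [|rewrite ler_norml; lra..].
have dom : goursat_domain a (- u, - v) by rewrite /goursat_domain /= !normrN !ger0_norm //; lra.
rewrite (proj2 HG _ _ dom).
have qE (f : R -> C) (s : R) : `|s| <= b -> q s = qb s.
  by move=> sb; rewrite /qb /cutoff sb [ind true * q s]mul1r.
have l1 : L1 (fun s => ind (- u <= s <= 0) * q s).
  have -> : (fun s => ind (- u <= s <= 0) * q s) = fun s => ind (- u <= s <= 0) * qb s.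
    apply/funext => s; have [h|_] := boolP (- u <= s <= 0); last by rewrite !mul0r.
    by rewrite (qE q) // ler_norml; lra.
  by apply: L1bool => //; meas.
have lQ al : L1 (fun be => qb (al + be) * Hc al be).
  have -> : (fun be => qb (al + be) * Hc al be) = fun be => Hc al be * qb (1 * be + al).
    by apply/funext => be; rewrite mulrC mul1r addrC.
  apply: (@L1Mb _ _ _ M); [by apply: (cmf_comp2 mHc); meas|by move=> be; exact: hM|].
  exact: L1_affine (oner_neq0 _) lq.
have inner al : - u <= al <= 0 ->
    oint 0 (- v) (fun be => q (al + be) * H (al, be)) =
    - Int (fun be => ind (0 <= be <= v) * (qb (al - be) * Hc al (- be))).
  move=> alu.
  have -> : oint 0 (- v) (fun be => q (al + be) * H (al, be)) = oint 0 (- v) (fun be => qb (al + be) * Hc al be).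
    rewrite /oint; case: ifP => hv; rewrite !cint_itvE; [congr Int|congr (- Int _)]; apply/funext => be.
      have [h|_] := boolP (0 <= be <= - v); last by rewrite !mul0r.
      by rewrite HcE ?(qE q) // ler_norml; lra.
    have [h|_] := boolP (- v <= be <= 0); last by rewrite !mul0r.
    by rewrite HcE ?(qE q) // ler_norml; lra.
  by rewrite oint_neg //; apply: L1bool; [meas|exact: lQ].
pose In al := - Int (fun be => ind (0 <= be <= v) * (qb (al - be) * Hc al (- be))).
have -> : oint 0 (- u) (fun al => oint 0 (- v) (fun be => q (al + be) * H (al, be))) = oint 0 (- u) In.
  rewrite /oint; case: ifP => hu; rewrite !cint_itvE; [congr Int|congr (- Int _)]; apply/funext => al.
    have [h|_] := boolP (0 <= al <= - u); last by rewrite !mul0r.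
    by rewrite -/(oint 0 (- v) _) inner //; lra.
  have [h|_] := boolP (- u <= al <= 0); last by rewrite !mul0r.
  by rewrite -/(oint 0 (- v) _) inner.
have mIn : cmf In.
  by apply: cmfN; apply: cmf_Int; apply: cmfM; [meas|apply: cmfM; [meas|apply: (cmf_comp2 mHc); meas]].
have InM al : cabs (In al) <= M * \int[mu]_s cabs (qb s).
  rewrite /In cabsN.
  have l2 : L1 (fun be => ind (0 <= be <= v) * (qb (al - be) * Hc al (- be))).
    by apply: L1bool; [meas|exact: L1_opp (lQ al)].
  apply: le_trans (cabs_Int l2) _.
  have n1 : (-1 : R) != 0 by rewrite oppr_eq0 oner_eq0.
  rewrite (@Rint_affine _ (-1) al (fun s => cabs (qb s)) n1 (L1_cabs lq)) normrN1 mul1r -RintZ; last first.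
    exact: L1_cabs (L1_affine al n1 lq).
  apply: Rint_le; [exact: L1_cabs|apply: rL1Z; exact: L1_cabs (L1_affine al n1 lq)|move=> be].
  rewrite cabsM cabs_nat cabsM mulN1r [- be + al]addrC.
  apply: (@le_trans _ _ (cabs (qb (al - be)) * cabs (Hc al (- be)))).
    by rewrite ler_piMl ?mulr_ge0 ?cabs_ge0 ?ind_le1.
  by rewrite mulrC ler_wpM2r ?cabs_ge0.
have lIn : L1 (fun al => ind (- u <= al <= 0) * In al).
  by apply: (@L1_itv_bounded _ _ _ _ _ mIn) => al _; exact: InM.
rewrite !oint_neg // opprD mulrN !opprK; congr (_ * _ + _).
  congr Int; apply/funext => s; have [h|_] := boolP (0 <= s <= u); last by rewrite !mul0r.
  by rewrite (qE q) // normrN ler_norml; lra.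
congr Int; apply/funext => al; congr (_ * _).
rewrite /In -IntN; last by apply: L1bool; [meas|exact: L1_opp (lQ (- al))].
congr Int; apply/funext => be; rewrite opprD; ring.
Qed.

Let k := tker b Hc.

Lemma transmut_integrand u x : L1 (cutoff b u) -> L1 (fun t => k x t * u t).
Proof.
move=> lu; have [M hM] := Hc_bounded.
have := kop_integrand (ltW b1) (cmf_tker b cmf_Hc) (tker_bound b hM) x lu.
congr L1; apply/funext => t; rewrite /k /tker /cutoff.
have [/andP[h1 h2]|_] := boolP (_ <= _ <= _); last by rewrite !mul0r.
by rewrite (le_trans h1 h2) [ind true * u t]mul1r.
Qed.

Lemma transmutE u x : L1 (cutoff b u) -> `|x| <= b ->
  transmut (kernel_of H) u x = Top b Hc u x.
Proof.
move=> lu xb; have l := transmut_integrand x lu.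
rewrite /transmut /Top; congr (_ + _); rewrite /oint /kop.
have [x0|x0] := leP 0 x.
  have -> : - x <= x by lra.
  rewrite cint_itvE; congr Int; apply/funext => t.
  rewrite /tker (ger0_norm x0) norm_itv /sgnR x0.
  have [h|_] := boolP (- x <= t <= x); last by rewrite !mul0r.
  have -> : x <= b by move: xb; rewrite ger0_norm.
  rewrite rmorph1 Hc_kernel KcE ?mul1r //.
  by move: xb; rewrite !ler_norml; lra.
have -> : (- x <= x) = false by lra.
have E t : ind (x <= t <= - x) * (kernel_of H x t * u t) = - (k x t * u t).
  rewrite /k /tker (ltr0_norm x0) norm_itv opprK /sgnR (leNgt 0 x) x0 /=.
  have [h|_] := boolP (x <= t <= - x); last by rewrite !mul0r oppr0.
  have -> : - x <= b by move: xb; rewrite ltr0_norm.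
  rewrite rmorphN rmorph1 /= !mul1r mulN1r mulNr opprK Hc_kernel KcE //.
  by move: xb; rewrite !ler_norml; lra.
by rewrite cint_itvE (funext E) IntN // opprK.
Qed.

Lemma transmutTE psi x : L1 psi -> supp_in b psi ->
  transmutT a (kernel_of H) psi x = TopT b Hc psi x.
Proof.
move=> lpsi spsi; have [M hM] := Hc_bounded; have ba := andP b0.
have mpsi := L1_cmf lpsi.
have lK : L1 (fun t => Kc t x * psi t).
  have [M' hM'] := Kc_bounded; apply: (@L1Mb _ _ _ M') => //.
  by apply: (cmf_comp2 cmf_Kc); meas.
(* Beyond the ball [psi] vanishes on both ranges of integration, including the reversed ones that
   occur when [|x| > a]. *)
have [xb|xb] := leP `|x| b; last first.
  rewrite /TopT kopT_supp // addr0 /transmutT.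
  have Z u v (f : R -> C) : (forall t, u <= t <= v -> f t = 0) -> Int (fun t => ind (u <= t <= v) * f t) = 0.
    move=> h; rewrite -[RHS](@Int0 R); congr Int; apply/funext => t.
    by have [/h ->|_] := boolP (u <= t <= v); rewrite ?mul0r ?mulr0.
  have P t : b < `|t| -> kernel_of H t x * psi t = 0 by move=> tb; rewrite spsi // mulr0.
  rewrite /oint; case: ifP => h1; case: ifP => h2; rewrite !cint_itvE !Z ?oppr0 ?subr0 ?addr0 //;
    move=> t ht; apply: P; rewrite ltr_normr; apply/orP; by [left; lra|right; lra].
have xa : `|x| <= a by lra.
rewrite /transmutT /TopT -addrA; congr (_ + _); rewrite /oint xa.
have -> : - a <= - `|x| by lra.
rewrite !cint_itvE.
have KE t : `|x| <= `|t| -> kernel_of H t x * psi t = Kc t x * psi t.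
  move=> xt; have [tb|/spsi ->] := leP `|t| b; last by rewrite !mulr0.
  by rewrite KcE.
have E1 : (fun t => ind (- a <= t <= - `|x|) * (kernel_of H t x * psi t)) =
    fun t => ind (- a <= t <= - `|x|) * (Kc t x * psi t).
  apply/funext => t; have [h|_] := boolP (- a <= t <= - `|x|); last by rewrite !mul0r.
  rewrite KE // ler_normr; apply/orP; right; lra.
have E2 : (fun t => ind (`|x| <= t <= a) * (kernel_of H t x * psi t)) =
    fun t => ind (`|x| <= t <= a) * (Kc t x * psi t).
  apply/funext => t; have [h|_] := boolP (`|x| <= t <= a); last by rewrite !mul0r.
  rewrite KE // ler_normr; apply/orP; left; lra.
have l1 : L1 (fun t => ind (- a <= t <= - `|x|) * (Kc t x * psi t)) by apply: L1bool => //; meas.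
have l2 : L1 (fun t => ind (`|x| <= t <= a) * (Kc t x * psi t)) by apply: L1bool => //; meas.
rewrite E1 E2 addrC -(IntB l2 l1) /kopT; apply: Int_ae.
- exact: L1_cmf (L1B l2 l1).
- exact: L1_cmf (kopT_integrand (ltW b1) (cmf_tker b cmf_Hc) (tker_bound b hM) x lpsi).
(* For [x = 0] both closed intervals contain [t = 0], while [tker] assigns that point to one
   side. *)
apply: aeS (ae_neq 0) => t t0; rewrite /tker Hc_kernel.
have [tb|/spsi ->] := leP `|t| b; last by rewrite !mulr0 subrr.
rewrite andbT /sgnR; have x0 := normr_ge0 x.
have [tp|tn] := leP 0 t.
  have tp' : 0 < t by rewrite lt_def t0.
  have -> : (- a <= t <= - `|x|) = false by lra.
  rewrite (ger0_norm tp) mul0r subr0 rmorph1 mul1r mulrA.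
  have -> : t <= a by move: tb; rewrite ger0_norm //; lra.
  by rewrite andbT.
have -> : (`|x| <= t <= a) = false by lra.
rewrite mul0r sub0r (ltr0_norm tn) rmorphN rmorph1 /=.
have -> : (- a <= t <= - `|x|) = (`|x| <= - t) by move: tb; rewrite ltr0_norm // => tb; apply/idP/idP; lra.
by rewrite mulrA mulN1r mulrN mulNr.
Qed.

End Goursat.

(** * Continuity of parameter integrals *)

Section ContinuousIntegral.
Context {R : realType}.
Local Notation C := (complex R).
Local Notation mu := (@lebesgue_measure R).

(** The exceptional null set may depend on [t0], which admits kernels that jump along the lines
    [x = t] and [x = - t]. *)
Lemma Rint_continuous (f : R -> R -> R) (g : R -> R) (t0 : R) :
  (forall t, measurable_fun setT (f t)) -> rL1 g -> (forall t x, `|f t x| <= g x) ->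
  {ae mu, forall x, {for t0, continuous (f ^~ x)}} ->
  {for t0, continuous (fun t => \int[mu]_x f t x)}.
Proof.
move=> mf lg fg cf; apply/(@cvg_nbhsP _ R^o) => w wt.
have lf t : rL1 (f t) by exact: rL1_dom lg.
have [] := @dominated_convergence _ _ _ mu setT measurableT
  (fun n x => (f (w n) x)%:E) (fun x => (f t0 x)%:E) (fun x => (g x)%:E).
- by move=> n; apply/measurable_EFinP; exact: (mf (w n)).
- by apply/measurable_EFinP; exact: (mf t0).
- apply: aeS cf => x cx _; apply: cvg_EFin; first exact: nearW.
  by move: cx => /(@cvg_nbhsP _ R^o) /(_ w wt).
- exact: lg.
- by apply: aeT => x n _; rewrite lee_fin.
move=> _ _; rewrite (rL1_fin (lf t0)) => h.
exact: fine_cvg h.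
Qed.

Lemma Int_continuous (f : R -> R -> C) (g : R -> R) (t0 : R) :
  (forall t, cmf (f t)) -> rL1 g -> (forall t x, cabs (f t x) <= g x) ->
  {ae mu, forall x, {for t0, continuous (f ^~ x : R -> C^o)}} ->
  {for t0, continuous (fun t => Int (f t) : C^o)}.
Proof.
move=> mf lg fg cf; apply/cvgC_split; split.
  apply: (@Rint_continuous (fun t => re (f t)) g) => //.
  - by move=> t; case: (mf t).
  - by move=> t x; apply: le_trans (fg t x); exact: normRe_le.
  - by apply: aeS cf => x /cvgC_split[].
apply: (@Rint_continuous (fun t => im (f t)) g) => //.
- by move=> t; case: (mf t).
- by move=> t x; apply: le_trans (fg t x); exact: normIm_le.
- by apply: aeS cf => x /cvgC_split[].
Qed.

Lemma continuousCD (f g : R -> C) t : {for t, continuous (f : R -> C^o)} ->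
  {for t, continuous (g : R -> C^o)} -> {for t, continuous (fun x => f x + g x : C^o)}.
Proof.
move=> /cvgC_split[f1 f2] /cvgC_split[g1 g2]; apply/cvgC_split; rewrite cReD cImD; split.
  by under eq_fun do rewrite cReD; exact: cvgD.
by under eq_fun do rewrite cImD; exact: cvgD.
Qed.

Lemma continuousCN (f : R -> C) t : {for t, continuous (f : R -> C^o)} ->
  {for t, continuous (fun x => - f x : C^o)}.
Proof.
move=> /cvgC_split[f1 f2]; apply/cvgC_split; rewrite cReN cImN; split.
  by under eq_fun do rewrite cReN; exact: cvgN.
by under eq_fun do rewrite cImN; exact: cvgN.
Qed.

Lemma continuousCM (f g : R -> C) t : {for t, continuous (f : R -> C^o)} ->
  {for t, continuous (g : R -> C^o)} -> {for t, continuous (fun x => f x * g x : C^o)}.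
Proof.
move=> /cvgC_split[f1 f2] /cvgC_split[g1 g2]; apply/cvgC_split; rewrite cReM cImM; split.
  by under eq_fun do rewrite cReM; apply: cvgB; exact: cvgM.
by under eq_fun do rewrite cImM; apply: cvgD; exact: cvgM.
Qed.

Lemma continuousC_cst (z : C) (t : R) : {for t, continuous (fun=> z : C^o)}.
Proof. exact: cvg_cst. Qed.

Lemma continuousC_near (f g : R -> C) t : (\near t, f t = g t) ->
  {for t, continuous (f : R -> C^o)} -> {for t, continuous (g : R -> C^o)}.
Proof.
move=> fg; rewrite /prop_for /continuous_at (nbhs_singleton fg); apply: cvg_trans.
by apply: near_eq_cvg; apply: filterS fg => x.
Qed.

Lemma near_all (P : R -> Prop) (t : R) : (forall x, P x) -> \near t, P t.
Proof. by move=> h; apply/nbhs_ballP; exists 1 => //= y _; exact: h. Qed.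

Lemma near_lt (f g : R -> R) t : {for t, continuous f} -> {for t, continuous g} ->
  f t < g t -> \near t, f t < g t.
Proof.
move=> cf cg fg.
have c : (fun x => g x - f x) @ t --> g t - f t by exact: cvgB.
have := @cvgr_gt _ _ _ _ (fun x => g x - f x) (g t - f t) c 0; rewrite subr_gt0 => /(_ _ fg).
by apply: filterS => x; rewrite subr_gt0.
Qed.

End ContinuousIntegral.

(** * First derivatives of the solution of Goursat's equation *)

Section HalfKernel.
Context {R : realType}.
Local Notation C := (complex R).
Local Notation mu := (@lebesgue_measure R).
Variables (b M Q : R) (q : R -> C) (H : R -> R -> C).
Hypothesis b0 : 0 <= b.
Hypothesis mq : cmf q.
Hypothesis qQ : forall s, cabs (q s) <= Q.
Hypothesis mH : cmf (fun p : R * R => H p.1 p.2).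
Hypothesis HM : forall u v, cabs (H u v) <= M.
Hypothesis goursat : forall u v, 0 <= u -> 0 <= v -> u + v <= b ->
  H u v = 2^-1 * Int (fun s => ind (0 <= s <= u) * q s) +
    Int (fun al => ind (0 <= al <= u) *
      Int (fun be => ind (0 <= be <= v) * (q (al + be) * H al be))).

Let M0 : 0 <= M. Proof. by apply: le_trans (HM 0 0); exact: cabs_ge0. Qed.
Let Q0 : 0 <= Q. Proof. by apply: le_trans (qQ 0); exact: cabs_ge0. Qed.

(** The partial derivatives of [H] obtained by formally differentiating Goursat's equation. Their
    difference [dH] is the derivative along the lines where [u + v] is constant, hence twice the
    derivative of [K] in its second variable. *)
Definition dHu (u v : R) : C :=
  2^-1 * q u + Int (fun be => ind (0 <= be <= v) * (q (u + be) * H u be)).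
Definition dHv (u v : R) : C := Int (fun al => ind (0 <= al <= u) * (q (al + v) * H al v)).
Definition dH (u v : R) : C := dHu u v - dHv u v.

Let G (al be : R) : C := q (al + be) * H al be.

Let GM al be : cabs (G al be) <= Q * M.
Proof. by rewrite cabsM ler_pM ?cabs_ge0. Qed.

Let mG : cmf (fun p : R * R => G p.1 p.2).
Proof. by rewrite /G; apply: cmfM; [meas|exact: mH]. Qed.

Let lG al u v : L1 (fun be => ind (u <= be <= v) * G al be).
Proof.
apply: (@L1_itv_bounded _ _ _ (Q * M)) => [|be _]; last exact: GM.
by apply: (cmf_comp2 mG); meas.
Qed.

Let lG' be u v : L1 (fun al => ind (u <= al <= v) * G al be).
Proof.
apply: (@L1_itv_bounded _ _ _ (Q * M)) => [|al _]; last exact: GM.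
by apply: (cmf_comp2 mG); meas.
Qed.

Let Gint_le al u v : 0 <= u -> u <= v -> cabs (Int (fun be => ind (u <= be <= v) * G al be)) <= Q * M * (v - u).
Proof.
move=> u0 uv; apply: le_trans (cabs_Int (lG al u v)) _.
rewrite -(Rint_itv1 uv) -RintZ; last exact: rL1_itv.
apply: Rint_le; [exact/L1_cabs/lG|exact/rL1Z/rL1_itv|move=> be].
by rewrite cabsM cabs_nat mulrC ler_wpM2r // GM.
Qed.

Lemma cmf_dHu : cmf (fun p : R * R => dHu p.1 p.2).
Proof.
apply: cmfD; first by meas.
apply: cmf_Int; apply: cmfM; first by meas.
by apply: cmfM; [meas|apply: (cmf_comp2 mH); meas].
Qed.

Lemma cmf_dHv : cmf (fun p : R * R => dHv p.1 p.2).
Proof.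
apply: cmf_Int; apply: cmfM; first by meas.
by apply: cmfM; [meas|apply: (cmf_comp2 mH); meas].
Qed.

Lemma cmf_dH : cmf (fun p : R * R => dH p.1 p.2).
Proof. by apply: cmfB; [exact: cmf_dHu|exact: cmf_dHv]. Qed.

Lemma dH_bound u v : 0 <= u -> 0 <= v -> u + v <= b -> cabs (dH u v) <= Q + Q * M * b.
Proof.
move=> u0 v0 uv; apply: le_trans (cabsB _ _) _.
have h1 : cabs (dHu u v) <= Q + Q * M * v.
  apply: le_trans (cabsD _ _) _; apply: lerD.
    rewrite cabsM realC_inv2 cabs_real ger0_norm ?invr_ge0 //.
    by apply: le_trans (qQ u); rewrite ler_piMl ?cabs_ge0 // invf_le1 ?ler1n.
  by have := Gint_le u (lexx 0) v0; rewrite subr0.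
have h2 : cabs (dHv u v) <= Q * M * u.
  apply: le_trans (cabs_Int (lG' v 0 u)) _.
  rewrite -[u in leRHS]subr0 -(Rint_itv1 u0) -RintZ; last exact: rL1_itv.
  apply: Rint_le; [exact/L1_cabs/lG'|exact/rL1Z/rL1_itv|move=> al].
  by rewrite cabsM cabs_nat mulrC ler_wpM2r // GM.
have : Q * M * (u + v) <= Q * M * b by rewrite ler_wpM2l // mulr_ge0.
lra.
Qed.

(** [H] vanishes at [(0, x)], so it is the integral of [dH] along the line [u + v = x]. The proof is
    an exchange of integrals, valid for bounded measurable [q]; continuity of [q] enters only when
    [dH] is to be continuous. *)
Lemma goursat_primitive u x : 0 <= u <= x -> x <= b ->
  H u (x - u) = Int (fun s => ind (0 <= s <= u) * dH s (x - s)).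
Proof.
move=> /andP[u0 ux] xb.
have h0x : 0 <= x by lra.
rewrite goursat //; [|lra..].
have lq : L1 (fun s => ind (0 <= s <= u) * q s) by apply: (@L1_itv_bounded _ _ _ Q).
pose P v al := Int (fun be => ind (0 <= be <= v) * G al be).
pose B1 s := ind (0 <= s <= u) * P (x - s) s.
pose B2 s := ind (0 <= s <= u) * dHv s (x - s).
pose Es al := Int (fun be => ind (x - u <= be <= x - al) * G al be).
have mP (f : R -> R) : measurable_fun setT f -> cmf (fun al => P (f al) al).
  move=> mf; apply: cmf_Int; apply: cmfM; first by meas.
  by apply: (cmf_comp2 mG); meas.
have mE : cmf Es.
  by apply: cmf_Int; apply: cmfM; [meas|apply: (cmf_comp2 mG); meas].
have lB1 : L1 B1.
  apply: (@L1_itv_bounded _ _ _ (Q * M * x)); first by apply: mP; meas.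
  move=> s /andP[s0 su]; apply: le_trans (Gint_le s (lexx 0) _) _; first by lra.
  by rewrite ler_wpM2l ?mulr_ge0 //; lra.
have lA : L1 (fun al => ind (0 <= al <= u) * P (x - u) al).
  apply: (@L1_itv_bounded _ _ _ (Q * M * x)); first by apply: mP; meas.
  move=> s /andP[s0 su]; apply: le_trans (Gint_le s (lexx 0) _) _; first by lra.
  by rewrite ler_wpM2l ?mulr_ge0 //; lra.
have lE : L1 (fun al => ind (0 <= al <= u) * Es al).
  apply: (@L1_itv_bounded _ _ _ (Q * M * x)); first exact: mE.
  move=> s /andP[s0 su]; apply: le_trans (Gint_le s _ _) _; [lra|lra|].
  by rewrite ler_wpM2l ?mulr_ge0 //; lra.
have lB2 : L1 B2.
  apply: (@L1_itv_bounded _ _ _ (Q * M * x)); first by apply: (cmf_comp2 cmf_dHv); meas.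
  move=> s /andP[s0 su]; apply: le_trans (cabs_Int (lG' _ 0 s)) _.
  apply: (@le_trans _ _ (Q * M * (s - 0))); last by rewrite ler_wpM2l ?mulr_ge0 //; lra.
  rewrite -(Rint_itv1 s0) -RintZ; last exact: rL1_itv.
  apply: Rint_le; [exact/L1_cabs/lG'|exact/rL1Z/rL1_itv|move=> al].
  by rewrite cabsM cabs_nat mulrC ler_wpM2r // GM.
have E1 s : ind (0 <= s <= u) * dH s (x - s) =
    2^-1 * (ind (0 <= s <= u) * q s) + (B1 s - B2 s).
  by rewrite /dH /dHu -/(P (x - s) s) /B1 /B2; ring.
have lq2 : L1 (fun s => 2^-1 * (ind (0 <= s <= u) * q s)) by exact: L1Z.
rewrite (funext E1) (IntD lq2 (L1B lB1 lB2)) (IntB lB1 lB2) (IntZ _ lq); congr (_ + _).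
(* For each [al] the range [[0, x - al]] splits at [x - u]: the rectangle of Goursat's equation and
   a remaining triangle. *)
have B1E : Int B1 = Int (fun al => ind (0 <= al <= u) * P (x - u) al) + Int (fun al => ind (0 <= al <= u) * Es al).
  rewrite -(IntD lA lE); congr Int; apply/funext => al; rewrite -mulrDr /B1.
  have [/andP[al0 alu]|_] := boolP (0 <= al <= u); last by rewrite !mul0r.
  congr (_ * _); rewrite /P /Es -(IntD (lG al 0 (x - u)) (lG al (x - u) (x - al))).
  apply: Int_ae; [exact: L1_cmf (lG al _ _)|exact: L1_cmf (L1D (lG al _ _) (lG al _ _))|].
  apply: aeS (ae_neq (x - u)) => be bx; rewrite -mulrDl -natrD; congr (_%:R * _).
  have : be < x - u \/ x - u < be by move: bx; rewrite neq_lt => /orP.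
  case=> hb.
    have -> : (x - u <= be <= x - al) = false by lra.
    by rewrite addn0; congr nat_of_bool; apply/idP/idP; lra.
  have -> : (0 <= be <= x - u) = false by lra.
  by rewrite add0n; congr nat_of_bool; apply/idP/idP; lra.
(* The triangle cancels against the [dHv] term: integrate it in the other order and substitute
   [be = x - s]. *)
suff EB2 : Int (fun al => ind (0 <= al <= u) * Es al) = Int B2.
  have alg (y z : C) : y = y + z - z by rewrite addrK.
  by rewrite B1E EB2; exact: alg.
transitivity (Int (fun al => Int (fun be => ind (0 <= al <= u) * (ind (x - u <= be <= x - al) * G al be)))).
  by congr Int; apply/funext => al; rewrite -IntZ.
have mJ : cmf (fun p : R * R => ind (0 <= p.1 <= u) * (ind (x - u <= p.2 <= x - p.1) * G p.1 p.2)).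
  by apply: cmfM; [meas|apply: cmfM; [meas|exact: mG]].
have JM al be : cabs (ind (0 <= al <= u) * (ind (x - u <= be <= x - al) * G al be)) <=
    (Q * M * ind (0 <= al <= u)) * ind (0 <= be <= x).
  rewrite !cabsM !cabs_nat -cabsM.
  have [/andP[al0 alu]|_] := boolP (0 <= al <= u); last by rewrite mul0r mulr0 mul0r.
  rewrite mulr1 mul1r; have [hb|_] := boolP (x - u <= be <= x - al); last first.
    by rewrite mul0r !mulr_ge0.
  have -> : 0 <= be <= x by lra.
  by rewrite mulr1 mul1r; exact: GM.
have r1 : rL1 (fun al => Q * M * ind (0 <= al <= u)) by exact/rL1Z/rL1_itv.
have r2 := rL1_itv (0 : R) x.
rewrite (Int_fubini mJ JM r1 r2).
pose J be := Int (fun al => ind (0 <= al <= u) * (ind (x - u <= be <= x - al) * G al be)).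
have lJ : L1 J.
  pose F (be al : R) := ind (0 <= al <= u) * (ind (x - u <= be <= x - al) * G al be).
  apply: (@L1_Int _ F (fun be => ind (0 <= be <= x)) (fun al => Q * M * ind (0 <= al <= u))) => //.
    apply: cmfM; first by meas.
    by apply: cmfM; [meas|apply: (cmf_comp2 mG); meas].
  by move=> be al; rewrite mulrC; exact: JM.
have n1 : (-1 : R) != 0 by rewrite oppr_eq0 oner_eq0.
rewrite (@Int_affine _ (-1) x J n1 lJ) normrN1 mul1r; congr Int; apply/funext => s.
rewrite /B2 /J -IntZ; last exact: lG'.
congr Int; apply/funext => al; rewrite mulN1r (addrC (- s)).
have ba : (0 <= al <= u) && (x - u <= x - s <= x - al) = (0 <= s <= u) && (0 <= al <= s).
  by apply/idP/idP; lra.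
by rewrite [LHS]mulrA [RHS]mulrA -!natrM !mulnb ba.
Qed.

Hypothesis cq : forall s, `|s| < b -> {for s, continuous (q : R -> C^o)}.
Hypothesis cH1 : forall u v, {for u, continuous (H ^~ v : R -> C^o)}.
Hypothesis cH2 : forall u v, {for v, continuous (H u : R -> C^o)}.

Lemma continuous_ind_near (f g : R -> R) (F : R -> C) (s : R) :
  {for s, continuous f} -> {for s, continuous g} -> f s != g s ->
  (f s < g s -> {for s, continuous (F : R -> C^o)}) ->
  {for s, continuous (fun t => ind (f t <= g t) * F t : C^o)}.
Proof.
move=> cf cg; rewrite neq_lt => /orP[h|h] cF.
  apply: (@continuousC_near _ F); last exact: cF.
  by apply: filterS (near_lt cf cg h) => t /ltW ->; rewrite mul1r.
apply: (@continuousC_near _ (fun=> 0)); last exact: continuousC_cst.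
by apply: filterS (near_lt cg cf h) => t; rewrite ltNge => /negbTE ->; rewrite mul0r.
Qed.

Lemma continuous_dH x s : `|s| < x -> x <= b ->
  {for s, continuous (fun s => dH ((x + s) / 2) ((x - s) / 2) : C^o)}.
Proof.
have mq1 (u : R) : cmf (fun be : R => q (u + be)).
  exact: (cmf_comp mq (measD (measurable_cst u) (@measurable_id _ _ setT))).
have mq2 (u : R) : cmf (fun al : R => q (al + u)).
  exact: (cmf_comp mq (measD (@measurable_id _ _ setT) (measurable_cst u))).
have mH1 u : cmf (H u) by apply: (@cmf_comp2 _ _ _ H (fun=> u) id mH); meas.
have mH2 v : cmf (H ^~ v) by apply: (@cmf_comp2 _ _ _ H id (fun=> v) mH); meas.
rewrite ltr_norml => /andP[s1 s2] xb.
have cu : {for s, continuous (fun s => (x + s) / 2)}.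
  by apply: cvgMl; apply: cvgD; [exact: cvg_cst|exact: cvg_id].
have cv : {for s, continuous (fun s => (x - s) / 2)}.
  by apply: cvgMl; apply: cvgB; [exact: cvg_cst|exact: cvg_id].
have cc (z : R) : {for s, continuous (fun=> z : R)} by exact: cvg_cst.
have ce (f : R -> C) (u : R -> R) t : {for t, continuous u} -> {for u t, continuous (f : R -> C^o)} ->
    {for t, continuous (fun t => f (u t) : C^o)}.
  by move=> c1 c2; exact: (@continuous_comp _ _ _ u (f : R -> C^o) t c1 c2).
have cm (f : R -> R) : {for s, continuous f} -> {for s, continuous (fun t => Num.min (f t) x)}.
  by move=> cf; exact: (@continuous_min R R f (fun=> x) s cf (cc x)).
(* As [f s < x], replacing the upper limit by [Num.min (f t) x] changes nothing near [s] and gives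
   an integrable majorant independent of [t]. *)
have small (f : R -> R) (F : R -> R -> C) : {for s, continuous f} -> f s < x ->
    (forall t, cmf (F t)) -> (forall t r, cabs (F t r) <= Q * M) ->
    (forall r, 0 <= r < f s -> {for s, continuous (F ^~ r : R -> C^o)}) ->
    {for s, continuous (fun t => Int (fun r => ind (0 <= r <= f t) * F t r) : C^o)}.
  move=> cf fx mF FM cF.
  apply: (@continuousC_near _ (fun t => Int (fun r => ind (0 <= r <= Num.min (f t) x) * F t r))).
    by apply: filterS (near_lt cf (cc x) fx) => t /ltW tx; rewrite min_l.
  apply: (@Int_continuous _ _ (fun r => Q * M * ind (0 <= r <= x))).
  - move=> t; have mFt := mF t; apply: cmfM => //; by meas.
  - exact/rL1Z/rL1_itv.
  - move=> t r; rewrite cabsM cabs_nat le_min; have [h|h] := boolP (0 <= r <= x); last first.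
      have -> : [&& 0 <= r, r <= f t & r <= x] = false by apply: contraNF h => /and3P[-> _ ->].
      by rewrite mul0r mulr0.
    by rewrite mulr1; apply: le_trans (FM t r); rewrite ler_piMl ?cabs_ge0 ?ind_le1.
  apply: aeS (ae_neq (f s)) => r rf.
  have [r0|r0] := leP 0 r; last first.
    apply: (@continuousC_near _ (fun=> 0)); last exact: continuousC_cst.
    by apply: near_all => t; rewrite mul0r.
  rewrite /=; apply: (@continuous_ind_near (fun=> r) (fun t => Num.min (f t) x)) => //; first exact: cm.
    by rewrite min_l ?ltW.
  by rewrite min_l ?ltW // => rfs; apply: cF; rewrite r0.
apply: continuousCD; last apply: continuousCN.
  apply: continuousCD.
    apply: continuousCM; first exact: continuousC_cst.
    by apply: (ce _ _ _ cu); apply: cq; rewrite ltr_norml; lra.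
  apply: (small (fun s => (x - s) / 2) (fun s be => q ((x + s) / 2 + be) * H ((x + s) / 2) be)) => //; first by lra.
  - by move=> t; apply: cmfM; [exact: mq1|exact: mH1].
  - by move=> t r; rewrite cabsM ler_pM ?cabs_ge0.
  move=> r /andP[r0 rv].
  apply: (@continuousCM _ (fun t => q ((x + t) / 2 + r)) (fun t => H ((x + t) / 2) r)); last first.
    by apply: (ce (H ^~ r) (fun t => (x + t) / 2) s cu); exact: cH1.
  apply: (ce q (fun t => (x + t) / 2 + r)); first by apply: cvgD; [exact: cu|exact: cvg_cst].
  by apply: cq; rewrite ltr_norml; lra.
apply: (small (fun s => (x + s) / 2) (fun s al => q (al + (x - s) / 2) * H al ((x - s) / 2))) => //; first by lra.
- by move=> t; apply: cmfM; [exact: mq2|exact: mH2].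
- by move=> t r; rewrite cabsM ler_pM ?cabs_ge0.
move=> r /andP[r0 rv].
apply: (@continuousCM _ (fun t => q (r + (x - t) / 2)) (fun t => H r ((x - t) / 2))); last first.
  by apply: (ce (H r) (fun t => (x - t) / 2) s cv); exact: cH2.
apply: (ce q (fun t => r + (x - t) / 2)); first by apply: cvgD; [exact: cvg_cst|exact: cv].
by apply: cq; rewrite ltr_norml; lra.
Qed.

End HalfKernel.

(** * The derivative of the kernel in its second variable *)

Section TriangularKernel.
Context {R : realType}.
Local Notation C := (complex R).
Local Notation mu := (@lebesgue_measure R).

(** The kernel jumps only on [|t| = |x|]; for given [t0] these are the two points [x = t0] and
    [x = - t0], a null set. *)
Lemma kopT_continuous (b M : R) (D : R -> R -> C) (f : R -> C) (t0 : R) :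
  let k x t := ind (`|t| <= `|x| <= b) * D x t in
  0 <= b -> cmf (fun p : R * R => D p.1 p.2) -> (forall x t, cabs (k x t) <= M * ind (`|t| <= `|x| <= b)) ->
  (forall x t, `|t| < `|x| -> `|x| <= b -> {for t, continuous (D x : R -> C^o)}) ->
  L1 f -> {for t0, continuous (kopT k f : R -> C^o)}.
Proof.
move=> k b0 mD kM cD lf; have mf := L1_cmf lf.
have M0 : 0 <= M.
  have := kM 0 0; rewrite normr0 lexx b0 mulr1; apply: le_trans; exact: cabs_ge0.
apply: (@Int_continuous _ (fun t x => k x t * f x) (fun x => M * cabs (f x))).
- by move=> t; apply: cmfM => //; apply: cmfM; [meas|apply: (cmf_comp2 mD); meas].
- exact/rL1Z/L1_cabs.
- move=> t x; rewrite cabsM ler_wpM2r ?cabs_ge0 //.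
  by apply: le_trans (kM x t) _; rewrite ler_piMr ?ind_le1.
apply: aeS (aeI (ae_neq t0) (ae_neq (- t0))) => x [n1 n2].
apply: continuousCM; last exact: continuousC_cst.
have [xb|xb] := leP `|x| b; last first.
  apply: (@continuousC_near _ (fun=> 0)); last exact: continuousC_cst.
  by apply: near_all => t; rewrite /k (leNgt `|x|) xb andbF mul0r.
apply: (@continuousC_near _ (fun t => ind (`|t| <= `|x|) * D x t)).
  by apply: near_all => t; rewrite /k xb andbT.
apply: (@continuous_ind_near _ (fun t => `|t|) (fun=> `|x|)).
- exact: norm_continuous.
- exact: cvg_cst.
- apply/negP => /eqP h; have [t1|t1] := leP 0 t0; move: h; [rewrite (ger0_norm t1)|rewrite (ltr0_norm t1)] => /eqP;
    rewrite eq_sym eqr_norml => /andP[/orP[]/eqP e _]; by move: n1 n2; rewrite e ?opprK eqxx.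
- by move=> h; exact: cD.
Qed.

Section Derivative.
Variables (a b M Q : R) (q : R -> C) (H : R * R -> C).
Hypothesis b0 : 0 < b < a.
Hypothesis HG : goursat_solution a q H.
Hypothesis lq : L1 (cutoff b q).
Hypothesis KM : forall x t, cabs (Kc b H x t) <= M.

Local Notation Kc := (Kc b H).
Local Notation Hc := (Hc b H).
Local Notation k := (tker b Hc).

Let b1 : 0 < b. Proof. by case/andP: b0. Qed.
Let bn : 0 <= b. Proof. exact: ltW. Qed.
Let M0 : 0 <= M. Proof. by apply: le_trans (KM 0 0); exact: cabs_ge0. Qed.
Let HM u v : cabs (Hc u v) <= M. Proof. exact: KM. Qed.
Let mK := cmf_Kc b0 HG.
Let mH := cmf_Hc b0 HG.
Let cK1 := continuous_Kc1 b0 HG.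
Let cK2 := continuous_Kc2 b0 HG.

Lemma tkerE : k = fun x t => ind (`|t| <= `|x| <= b) * ((sgnR x)%:C * Kc x t).
Proof. by apply/funext => x; apply/funext => t; rewrite /tker Hc_kernel. Qed.

Lemma kopT_tker_continuous (f : R -> C) t : L1 f -> {for t, continuous (kopT k f : R -> C^o)}.
Proof.
move=> lf; rewrite tkerE; apply: (@kopT_continuous _ M) => //.
- by apply: cmfM; [apply: cmf_realC; apply: meas_sgnR|]; meas.
- by move=> x s; have := tker_bound b HM x s; rewrite tkerE.
- by move=> x s _ _; apply: continuousCM; [exact: continuousC_cst|exact: cK2].
Qed.

Let qb := cutoff b q.
Hypothesis qQ : forall s, cabs (qb s) <= Q.
Hypothesis cq : forall s, `|s| < b -> {for s, continuous (q : R -> C^o)}.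

Let cqb s : `|s| < b -> {for s, continuous (qb : R -> C^o)}.
Proof.
move=> sb; apply: (@continuousC_near _ q); last exact: cq.
have : \near s, `|s| < b.
  by apply: (@near_lt _ (fun s => `|s|) (fun=> b)) => //; [exact: norm_continuous|exact: cvg_cst].
by apply: filterS => y /ltW yb; rewrite /qb /cutoff yb [ind true * q y]mul1r.
Qed.

Let mq : cmf qb := L1_cmf lq.
Let qo s := qb (- s).
Let Ho := Hopp Hc.
Let mqo : cmf qo. Proof. by rewrite /qo; meas. Qed.
Let mHo : cmf (fun p : R * R => Ho p.1 p.2). Proof. by rewrite /Ho /Hopp; meas. Qed.
Let qoQ s : cabs (qo s) <= Q. Proof. exact: qQ. Qed.
Let HoM u v : cabs (Ho u v) <= M. Proof. by rewrite cabsN; exact: HM. Qed.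
Let gp := goursat_pos b0 HG.
Let gn := goursat_neg b0 HG lq.

(* The derivative of [K x s] in [s], by differentiating Goursat's equation. *)
Definition dker (x s : R) : C := 2^-1 *
  (if 0 <= x then dH qb Hc ((x + s) / 2) ((x - s) / 2) else dH qo Ho ((- x - s) / 2) ((- x + s) / 2)).

Definition tker' (x s : R) : C := ind (`|s| <= `|x| <= b) * ((sgnR x)%:C * dker x s).

Let cmf_if (f g : R * R -> C) (c : R * R -> bool) : measurable_fun setT c -> cmf f -> cmf g ->
  cmf (fun p => if c p then f p else g p).
Proof.
move=> mc [f1 f2] [g1 g2]; split.
  by under eq_fun do rewrite (fun_if (@complex.Re R)); exact: meas_if.
by under eq_fun do rewrite (fun_if (@complex.Im R)); exact: meas_if.
Qed.

Lemma cmf_dker : cmf (fun p : R * R => dker p.1 p.2).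
Proof.
apply: cmfM; first exact: cmf_cst.
apply: cmf_if; first by meas.
  by apply: (cmf_comp2 (cmf_dH mq mH)); meas.
by apply: (cmf_comp2 (cmf_dH mqo mHo)); meas.
Qed.

Let MD := Q + Q * M * b.

Let MD0 : 0 <= MD.
Proof.
have Q0 : 0 <= Q by apply: le_trans (qQ 0); exact: cabs_ge0.
by rewrite addr_ge0 // !mulr_ge0.
Qed.

Lemma tker'_bound x s : cabs (tker' x s) <= MD * ind (`|s| <= `|x| <= b).
Proof.
rewrite /tker' cabsM cabs_nat mulrC; have [/andP[h1 h2]|_] := boolP (_ <= _ <= _); last by rewrite !mulr0.
rewrite !mulr1 cabsM cabs_real.
have -> : `|sgnR x| = 1 by rewrite /sgnR; case: ifP; rewrite ?normrN normr1.
rewrite mul1r cabsM realC_inv2 cabs_real ger0_norm ?invr_ge0 //.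
suff h : cabs (if 0 <= x then dH qb Hc ((x + s) / 2) ((x - s) / 2) else dH qo Ho ((- x - s) / 2) ((- x + s) / 2)) <= MD.
  by apply: le_trans h; rewrite ler_piMl ?cabs_ge0 // invf_le1 ?ler1n.
have [x0|x0] := leP 0 x.
  move: h1 h2; rewrite (ger0_norm x0) ler_norml => /andP[h1 h1'] h2.
  by apply: (dH_bound mq qQ mH HM); lra.
move: h1 h2; rewrite (ltr0_norm x0) ler_norml => /andP[h1 h1'] h2.
by apply: (dH_bound mqo qoQ mHo HoM); lra.
Qed.

Lemma kopT_tker'_continuous (f : R -> C) t : L1 f -> {for t, continuous (kopT tker' f : R -> C^o)}.
Proof.
move=> lf; apply: (@kopT_continuous _ MD) => //.
- by apply: cmfM; [apply: cmf_realC; apply: meas_sgnR; meas|exact: cmf_dker].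
- exact: tker'_bound.
move=> x s sx xb; apply: continuousCM; first exact: continuousC_cst.
apply: continuousCM; first exact: continuousC_cst.
have cK := continuous_Kc b0 HG.
have cc (z r : R) : {for r, continuous (fun=> z : R)} by exact: cvg_cst.
have ci (r : R) : {for r, continuous (fun y : R => y)} by exact: cvg_id.
have cN (r : R) : {for r, continuous (fun y : R => - y)} by apply: cvgN; exact: cvg_id.
have cKf (p1 p2 : R -> R) r : {for r, continuous p1} -> {for r, continuous p2} ->
    {for r, continuous (fun y => Kc (p1 y) (p2 y) : C^o)}.
  move=> cf cg; have cp := pair_continuous cf cg.
  exact: (@continuous_comp _ _ _ (fun y => (p1 y, p2 y)) (fun p : R * R => Kc p.1 p.2 : C^o) r cp (cK _)).
have cH1 u v : {for u, continuous (Hc ^~ v : R -> C^o)}.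
  by apply: (cKf (fun y => y + v) (fun y => y - v)); [apply: cvgD; [exact: ci|exact: cc]|apply: cvgB; [exact: ci|exact: cc]].
have cH2 u v : {for v, continuous (Hc u : R -> C^o)}.
  by apply: (cKf (fun y => u + y) (fun y => u - y)); [apply: cvgD; [exact: cc|exact: ci]|apply: cvgB; [exact: cc|exact: ci]].
have cHo1 u v : {for u, continuous (Ho ^~ v : R -> C^o)}.
  apply: continuousCN; apply: (cKf (fun y => - y + - v) (fun y => - y - - v)).
    by apply: cvgD; [exact: cN|exact: cc].
  by apply: cvgB; [exact: cN|exact: cc].
have cHo2 u v : {for v, continuous (Ho u : R -> C^o)}.
  apply: continuousCN; apply: (cKf (fun y => - u + - y) (fun y => - u - - y)).
    by apply: cvgD; [exact: cc|exact: cN].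
  by apply: cvgB; [exact: cc|exact: cN].
have cqo r : `|r| < b -> {for r, continuous (qo : R -> C^o)}.
  move=> rb; apply: (@continuous_comp _ _ _ (fun y : R => - y) (qb : R -> C^o) r (cN r)).
  by apply: cqb; rewrite normrN.
have [x0|x0] := leP 0 x.
  move: sx xb; rewrite (ger0_norm x0) => sx xb.
  exact: (continuous_dH mq qQ mH HM cqb cH1 cH2 sx xb).
move: sx xb; rewrite (ltr0_norm x0) => sx xb.
have sx' : `|- s| < - x by rewrite normrN.
have c1 := continuous_dH mqo qoQ mHo HoM cqo cHo1 cHo2 sx' xb.
have := @continuous_comp _ _ _ (fun y : R => - y) (fun s => dH qo Ho ((- x + s) / 2) ((- x - s) / 2) : C^o) s (cN s) c1.
by apply: continuousC_near; apply: near_all => y /=; rewrite opprK.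
Qed.

(** [K x (- x)] is [H 0 x], which is 0, so no boundary term appears at [- x]. The substitution
    [2 * s - x] into [goursat_primitive] absorbs the factor [2^-1] of [dker]. *)
Lemma dker_pos x t : 0 <= x <= b -> - x <= t <= x ->
  Kc x t = Int (fun s => ind (- x <= s <= t) * dker x s).
Proof.
move=> /andP[x0 xb] /andP[t1 t2].
have hu : 0 <= (x + t) / 2 <= x by lra.
have := goursat_primitive mq qQ mH HM gp hu xb.
have -> : x - (x + t) / 2 = (x - t) / 2 by field.
rewrite Hc_kernel => ->.
pose F s := ind (- x <= s <= t) * dker x s.
have lF : L1 F.
  apply: (@L1_itv_bounded _ _ _ MD); first by apply: (cmf_comp2 cmf_dker); meas.
  move=> s hs; have := tker'_bound x s; rewrite /tker' (ger0_norm x0).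
  have -> : `|s| <= x <= b by rewrite ler_norml; lra.
  by rewrite !mulr1 mul1r /sgnR x0 rmorph1 mul1r.
have two0 : (2 : R) != 0 by rewrite pnatr_eq0.
rewrite -/(Int F) (@Int_affine _ 2 (- x) F two0 lF) ger0_norm // -IntZ; last exact: L1_affine.
congr Int; apply/funext => s; rewrite /F /dker x0.
have -> : (- x <= 2 * s + - x <= t) = (0 <= s <= (x + t) / 2) by apply/idP/idP; lra.
have -> : (x + (2 * s + - x)) / 2 = s by field.
have -> : (x - (2 * s + - x)) / 2 = x - s by field.
have alg (z w : C) : z * w = 2%:C * (z * (2^-1 * w)).
  by rewrite rmorph_nat; field.
exact: alg.
Qed.

Lemma dker_neg x t : x < 0 -> - x <= b -> x <= t <= - x ->
  - Kc x t = Int (fun s => ind (t <= s <= - x) * dker x s).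
Proof.
move=> x0 xb /andP[t1 t2].
have hu : 0 <= (- x - t) / 2 <= - x by lra.
have := goursat_primitive mqo qoQ mHo HoM gn hu xb.
have -> : - x - (- x - t) / 2 = (- x + t) / 2 by field.
have -> : Ho ((- x - t) / 2) ((- x + t) / 2) = - Kc x t.
  by rewrite /Ho /Hopp -Hc_kernel; congr (- Hc _ _); field.
move=> ->.
pose F s := ind (t <= s <= - x) * dker x s.
have xN : (0 <= x) = false by lra.
have lF : L1 F.
  apply: (@L1_itv_bounded _ _ _ MD); first by apply: (cmf_comp2 cmf_dker); meas.
  move=> s hs; have := tker'_bound x s; rewrite /tker' (ltr0_norm x0).
  have -> : `|s| <= - x <= b by rewrite ler_norml; lra.
  by rewrite !mulr1 mul1r /sgnR xN rmorphN rmorph1 mulN1r cabsN.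
have two0 : (-2 : R) != 0 by rewrite oppr_eq0 pnatr_eq0.
rewrite -/(Int F) (@Int_affine _ (-2) (- x) F two0 lF) normrN ger0_norm // -IntZ; last exact: L1_affine.
congr Int; apply/funext => s; rewrite /F /dker xN.
have -> : (t <= -2 * s + - x <= - x) = (0 <= s <= (- x - t) / 2) by apply/idP/idP; lra.
have -> : (- x - (-2 * s + - x)) / 2 = s by field.
have -> : (- x + (-2 * s + - x)) / 2 = - x - s by field.
have alg (z w : C) : z * w = 2%:C * (z * (2^-1 * w)).
  by rewrite rmorph_nat; field.
exact: alg.
Qed.

Let diag (f : R -> C) (s : R) : C := ind (`|s| <= b) * (Kc s s * f s).

(** The distributional derivative of [tker x] in [t]: besides [tker' x] there is a point mass at
    [t = x] with weight [- K x x], for either sign of [x]. At [t = - x] there is none, since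
    [K x (- x) = 0]. *)
Lemma tker_primitive x t : x != 0 -> x != t -> x != - t -> `|x| <= b ->
  Int (fun s => ind (s <= t) * tker' x s) - ind (x <= t) * Kc x x = k x t.
Proof.
move=> x0 xt xt' xb; rewrite tkerE.
have [xp|xn] := leP 0 x.
  have {x0} xp' : 0 < x by rewrite lt_def x0.
  move: (xb); rewrite (ger0_norm xp) => xb'.
  have E c d : (forall s, (s <= t) && (- x <= s <= x) = (c <= s <= d)) ->
      Int (fun s => ind (s <= t) * tker' x s) = Int (fun s => ind (c <= s <= d) * dker x s).
    move=> h; congr Int; apply/funext => s; rewrite /tker' (ger0_norm xp) xb' andbT norm_itv /sgnR xp rmorph1 mul1r.
    by rewrite mulrA -natrM mulnb h.
  have [h|h] := ltP t x; last first.
    have {}h : x < t by rewrite lt_def eq_sym xt.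
    rewrite (E (- x) x) => [|s]; last by apply/idP/idP; lra.
    rewrite -dker_pos ?xp //; [|lra].
    have -> : (`|t| <= x) = false by apply/negbTE; rewrite -ltNge; exact: lt_le_trans h (ler_norm t).
    by rewrite mul1r subrr mul0r.
  rewrite mul0r subr0; have [h2|h2] := leP (- x) t.
    rewrite (E (- x) t) => [|s]; last by apply/idP/idP; lra.
    rewrite -dker_pos ?xp //; [|lra].
    have -> : `|t| <= x by rewrite ler_norml; lra.
    by rewrite xb' /sgnR xp rmorph1 !mul1r.
  have -> : (`|t| <= x) = false.
    by apply/negbTE; rewrite -ltNge ltr_normr; apply/orP; right; lra.
  rewrite mul0r -[RHS](@Int0 R); congr Int; apply/funext => s.
  rewrite /tker' (ger0_norm xp) norm_itv mulrA -natrM mulnb.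
  have -> : [&& s <= t, - x <= s <= x & x <= b] = false by lra.
  by rewrite mul0r.
move: (xb); rewrite (ltr0_norm xn) => xb'.
have xN : (0 <= x) = false by lra.
have E c d : (forall s, (s <= t) && (x <= s <= - x) = (c <= s <= d)) ->
    Int (fun s => ind (s <= t) * tker' x s) = Int (fun s => - (ind (c <= s <= d) * dker x s)).
  move=> h; congr Int; apply/funext => s.
  rewrite /tker' (ltr0_norm xn) xb' andbT norm_itv opprK /sgnR xN rmorphN rmorph1 mulN1r.
  by rewrite !mulrN mulrA -natrM mulnb h.
have lI c d : x <= c -> d <= - x -> L1 (fun s => ind (c <= s <= d) * dker x s).
  move=> xc dx; apply: (@L1_itv_bounded _ _ _ MD); first by apply: (cmf_comp2 cmf_dker); meas.
  move=> s hs; have := tker'_bound x s; rewrite /tker' (ltr0_norm xn).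
  have -> : `|s| <= - x <= b by rewrite ler_norml; lra.
  by rewrite !mulr1 mul1r /sgnR xN rmorphN rmorph1 mulN1r cabsN.
have [h|h] := ltP t x.
  have -> : (`|t| <= - x) = false.
    by apply/negbTE; rewrite -ltNge ltr_normr; apply/orP; right; lra.
  rewrite !mul0r subr0 -[RHS](@Int0 R); congr Int; apply/funext => s.
  rewrite /tker' (ltr0_norm xn) norm_itv opprK mulrA -natrM mulnb.
  have -> : [&& s <= t, x <= s <= - x & - x <= b] = false by lra.
  by rewrite mul0r.
rewrite mul1r /sgnR xN rmorphN rmorph1 mulN1r.
have xx : x <= x <= - x by lra.
have [h2|h2] := leP (- x) t.
  have {}h2 : - x < t by rewrite lt_def h2 andbT; apply: contra xt' => /eqP ->; rewrite opprK.
  rewrite (E x (- x)) => [|s]; last by apply/idP/idP; lra.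
  rewrite IntN; last exact: lI.
  rewrite -(dker_neg xn xb' xx) opprK subrr.
  have -> : (`|t| <= - x) = false by apply/negbTE; rewrite -ltNge; exact: lt_le_trans h2 (ler_norm t).
  by rewrite mul0r.
have xt1 : x <= t <= - x by lra.
have -> : `|t| <= - x by rewrite ler_norml opprK.
rewrite xb' mul1r (E x t) => [|s]; last by apply/idP/idP; lra.
have lx := lI x t (lexx _) (ltW h2).
rewrite IntN // (dker_neg xn xb' xt1).
have := dker_neg xn xb' xx.
have -> : Int (fun s => ind (x <= s <= - x) * dker x s) =
    Int (fun s => ind (x <= s <= t) * dker x s) + Int (fun s => ind (t <= s <= - x) * dker x s).
  have lt' := lI t (- x) h (lexx _).
  rewrite -(IntD lx lt'); apply: Int_ae; [exact: L1_cmf (lI _ _ (lexx _) (lexx _))|exact: L1_cmf (L1D lx lt')|].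
  apply: aeS (ae_neq t) => s st; rewrite -mulrDl -natrD; congr (_%:R * _).
  move: st; rewrite neq_lt => /orP[st|st].
    have -> : (t <= s <= - x) = false by lra.
    by rewrite addn0; congr nat_of_bool; apply/idP/idP; lra.
  have -> : (x <= s <= t) = false by lra.
  by rewrite add0n; congr nat_of_bool; apply/idP/idP; lra.
move=> /eqP; rewrite eqr_oppLR => /eqP ->; rewrite opprD; ring.
Qed.

(** Integrating [tker_primitive] against [f], the point masses become the local term [diag f]. The
    integral operator therefore gains one derivative over continuous data. *)
Lemma kopT_primitive (f : R -> C) t : L1 f -> supp_in b f ->
  kopT k f t = prim (fun s => kopT tker' f s - diag f s) t.
Proof.
move=> lf sf; have mf := L1_cmf lf.
have mk' : cmf (fun p : R * R => tker' p.1 p.2).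
  by apply: cmfM; [meas|apply: cmfM; [apply: cmf_realC; apply: meas_sgnR; meas|exact: cmf_dker]].
have l1 := kopT_L1 bn mk' tker'_bound lf.
have ld : L1 (diag f).
  have -> : diag f = fun s => ind (`|s| <= b) * Kc s s * f s by apply/funext => s; rewrite /diag mulrA.
  apply: (@L1Mb _ _ _ M) => //; first by apply: cmfM; [meas|apply: (cmf_comp2 mK); meas].
  by move=> s; rewrite cabsM cabs_nat; apply: le_trans (KM s s); rewrite ler_piMl ?cabs_ge0 ?ind_le1.
rewrite /prim.
have l3 := prim_integrand t l1; have l4 := prim_integrand t ld.
transitivity (Int (fun s => ind (s <= t) * kopT tker' f s - ind (s <= t) * diag f s)); last first.
  by congr Int; apply/funext => s; rewrite mulrBr.
rewrite (IntB l3 l4).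
have -> : Int (fun s => ind (s <= t) * kopT tker' f s) =
    Int (fun x => Int (fun s => ind (s <= t) * tker' x s) * f x).
  transitivity (Int (fun s => Int (fun x => ind (s <= t) * tker' x s * f x))).
    congr Int; apply/funext => s; rewrite -IntZ; last exact: (kopT_integrand bn mk' tker'_bound s lf).
    by congr Int; apply/funext => x; rewrite mulrA.
  rewrite (@Int_fubini _ _ (fun s => MD * ind (- b <= s <= b)) (fun x => cabs (f x))); first last.
  - exact: L1_cabs.
  - exact/rL1Z/rL1_itv.
  - move=> s x; rewrite (cabsM _ (f x)) (cabsM _ (tker' x s)) cabs_nat ler_wpM2r ?cabs_ge0 //.
    apply: le_trans (_ : cabs (tker' x s) <= _); first by rewrite ler_piMl ?cabs_ge0 ?ind_le1.
    by rewrite -norm_itv; exact: (kernel_boundT bn tker'_bound).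
  - apply: cmfM; last by meas.
    by apply: cmfM; [meas|apply: (cmf_comp2 mk'); meas].
  congr Int; apply/funext => x; rewrite -IntZr //.
  apply: (@L1_dom _ _ (fun s => MD * ind (- b <= s <= b))); last exact/rL1Z/rL1_itv.
    by apply: cmfM; [meas|apply: (cmf_comp2 mk'); meas].
  move=> s; rewrite cabsM cabs_nat; apply: le_trans (_ : cabs (tker' x s) <= _); first by rewrite ler_piMl ?cabs_ge0 ?ind_le1.
  by rewrite -norm_itv; exact: (kernel_boundT bn tker'_bound).
have l5 : L1 (fun x => Int (fun s => ind (s <= t) * tker' x s) * f x).
  apply: (@L1Mb _ _ _ (\int[mu]_s (MD * ind (- b <= s <= b)))) => //.
    by apply: cmf_Int; apply: cmfM; [meas|exact: mk'].
  move=> x.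
  have l6 : L1 (fun s => ind (s <= t) * tker' x s).
    apply: (@L1_dom _ _ (fun s => MD * ind (- b <= s <= b))); last exact/rL1Z/rL1_itv.
      by apply: cmfM; [meas|apply: (cmf_comp2 mk'); meas].
    move=> s; rewrite cabsM cabs_nat; apply: le_trans (_ : cabs (tker' x s) <= _); first by rewrite ler_piMl ?cabs_ge0 ?ind_le1.
    by rewrite -norm_itv; exact: (kernel_boundT bn tker'_bound).
  apply: le_trans (cabs_Int l6) _; apply: Rint_le; [exact: L1_cabs|exact/rL1Z/rL1_itv|move=> s].
  rewrite cabsM cabs_nat; apply: le_trans (_ : cabs (tker' x s) <= _); first by rewrite ler_piMl ?cabs_ge0 ?ind_le1.
  by rewrite -norm_itv; exact: (kernel_boundT bn tker'_bound).
rewrite -(IntB l5 l4); apply: Int_ae.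
- exact: L1_cmf (kopT_integrand bn (cmf_tker b mH) (tker_bound b HM) t lf).
- exact: L1_cmf (L1B l5 l4).
apply: aeS (aeI (ae_neq 0) (aeI (ae_neq t) (ae_neq (- t)))) => x [x0 [xt xt']].
have [xb|/sf fx] := leP `|x| b; last first.
  have alg (z1 z2 z3 z4 : C) : z1 * 0 = z2 * 0 - z3 * (z4 * 0) by rewrite !mulr0 subrr.
  by rewrite /diag fx (mulrA _ (Kc x x)); exact: alg.
rewrite -(tker_primitive x0 xt xt' xb) /diag xb [ind true * _]mul1r.
by rewrite (mulrA _ (Kc x x)) -mulrBl.
Qed.

End Derivative.
End TriangularKernel.

(** * Spaces of smooth functions *)

Section SmoothFunctions.
Context {R : realType}.
Local Notation C := (complex R).
Local Notation mu := (@lebesgue_measure R).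

Definition cderivable (f : R -> C) (x : R) := derivable (re f) x 1 /\ derivable (im f) x 1.

Lemma cderivable_continuous (f : R -> C) (x : R) : cderivable f x ->
  {for x, continuous (f : R -> C^o)}.
Proof.
move=> [d1 d2]; apply/cvgC_split; split; apply: differentiable_continuous.
  exact: (proj1 (derivable1_diffP _ _) d1).
exact: (proj1 (derivable1_diffP _ _) d2).
Qed.

Lemma cderivD (f g : R -> C) (x : R) : cderivable f x -> cderivable g x ->
  cderivable (fun x => f x + g x) x /\ cderiv (fun x => f x + g x) x = cderiv f x + cderiv g x.
Proof.
move=> [f1 f2] [g1 g2].
have E1 : re (fun x => f x + g x) = re f \+ re g by apply/funext => y; exact: cReD.
have E2 : im (fun x => f x + g x) = im f \+ im g by apply/funext => y; exact: cImD.
rewrite /cderivable /cderiv E1 E2; split; first by split; exact: derivableD.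
by apply: cplxP => /=; rewrite !derive1E; [exact: (deriveD f1 g1)|exact: (deriveD f2 g2)].
Qed.

Lemma cderivM (f g : R -> C) (x : R) : cderivable f x -> cderivable g x ->
  cderivable (fun x => f x * g x) x /\
  cderiv (fun x => f x * g x) x = cderiv f x * g x + f x * cderiv g x.
Proof.
move=> [f1 f2] [g1 g2].
have E1 : re (fun x => f x * g x) = (re f * re g) - (im f * im g).
  by apply/funext => y; exact: cReM.
have E2 : im (fun x => f x * g x) = (re f * im g) + (im f * re g).
  by apply/funext => y; exact: cImM.
have m1 := derivableM f1 g1; have m2 := derivableM f2 g2.
have m3 := derivableM f1 g2; have m4 := derivableM f2 g1.
rewrite /cderivable /cderiv E1 E2; split.
  by split; [exact: (derivableB m1 m2)|exact: (derivableD m3 m4)].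
apply: cplxP => /=; rewrite ?cReD ?cImD ?cReM ?cImM /= !derive1E.
  rewrite (deriveB m1 m2) (deriveM f1 g1) (deriveM f2 g2).
  move: ('D_1 (re f) x) ('D_1 (re g) x) ('D_1 (im f) x) ('D_1 (im g) x) => d1 d2 d3 d4.
  rewrite /GRing.scale /= /re /im; ring.
rewrite (deriveD m3 m4) (deriveM f1 g2) (deriveM f2 g1).
move: ('D_1 (re f) x) ('D_1 (re g) x) ('D_1 (im f) x) ('D_1 (im g) x) => d1 d2 d3 d4.
rewrite /GRing.scale /= /re /im; ring.
Qed.

Lemma cderiv_near (f g : R -> C) (x : R) : (\near x, f x = g x) -> cderivable f x ->
  cderivable g x /\ cderiv g x = cderiv f x.
Proof.
move=> fg [d1 d2].
have h1 : \near x, re f x = re g x by apply: filterS fg => y; rewrite /re => ->.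
have h2 : \near x, im f x = im g x by apply: filterS fg => y; rewrite /im => ->.
split; first by split; [exact: near_eq_derivable d1|exact: near_eq_derivable d2].
by apply: cplxP; rewrite /= !derive1E; apply/esym; exact: near_eq_derive.
Qed.

Lemma cderiv_cst (z : C) (x : R) : cderivable (fun=> z) x /\ cderiv (fun=> z) x = 0.
Proof.
split; first by split; exact: derivable_cst.
by apply: cplxP; rewrite /= derive1_cst.
Qed.

(** Global on the line and recursive in the derivative, unlike [inCk]; [inCk_bound] shows the two
    agree for functions supported in a smaller ball. *)
Fixpoint Ck_bound (k : nat) (f : R -> C) (c : R) : Prop :=
  match k with
  | 0 => (forall x, {for x, continuous (f : R -> C^o)}) /\ (forall x, cabs (f x) <= c)
  | k'.+1 => (forall x, cderivable f x) /\ (forall x, cabs (f x) <= c) /\ Ck_bound k' (cderiv f) c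
  end.

Lemma Ck_bound_le k f c x : Ck_bound k f c -> cabs (f x) <= c.
Proof. by case: k => [[_ h]|k [_ [h _]]]. Qed.

Lemma Ck_bound_ge0 k f c : Ck_bound k f c -> 0 <= c.
Proof. by move=> /(Ck_bound_le 0); apply: le_trans; exact: cabs_ge0. Qed.

Lemma Ck_bound_continuous k f c x : Ck_bound k f c -> {for x, continuous (f : R -> C^o)}.
Proof. by case: k => [[h _]|k [h _]]; [exact: h|exact/cderivable_continuous/h]. Qed.

Lemma Ck_bound_mono k f c d : c <= d -> Ck_bound k f c -> Ck_bound k f d.
Proof.
move=> cd; elim: k f => [|k IH] f /=; first by move=> [h1 h2]; split=> // x; exact: le_trans cd.
by move=> [h1 [h2 h3]]; split=> //; split; [move=> x; exact: le_trans cd|exact: IH].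
Qed.

Lemma Ck_bound_pred k f c : Ck_bound k.+1 f c -> Ck_bound k f c.
Proof.
elim: k f => [|k IH] f [h1 [h2 h3]]; first by split=> // x; exact/cderivable_continuous/h1.
by split=> //; split=> //; exact: IH.
Qed.

Lemma Ck_bound0 k f c : Ck_bound k f c -> Ck_bound 0 f c.
Proof. by elim: k f => // k IH f /Ck_bound_pred; exact: IH. Qed.

Lemma Ck_boundD k f g c d : Ck_bound k f c -> Ck_bound k g d ->
  Ck_bound k (fun x => f x + g x) (c + d).
Proof.
elim: k f g => [|k IH] f g.
  move=> [f1 f2] [g1 g2]; split=> x; first exact: (continuousCD (f1 x) (g1 x)).
  by apply: le_trans (cabsD _ _) _; exact: lerD.
move=> [f1 [f2 f3]] [g1 [g2 g3]]; have D x := cderivD (f1 x) (g1 x).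
split; first by move=> x; case: (D x).
split; first by move=> x; apply: le_trans (cabsD _ _) _; exact: lerD.
have -> : cderiv (fun x => f x + g x) = fun x => cderiv f x + cderiv g x.
  by apply/funext => x; case: (D x).
exact: IH.
Qed.

Lemma Ck_boundZ k z f c : Ck_bound k f c -> Ck_bound k (fun x => z * f x) (cabs z * c).
Proof.
elim: k f => [|k IH] f.
  move=> [f1 f2]; split=> x; first exact: (continuousCM (@continuousC_cst _ z x) (f1 x)).
  by rewrite cabsM ler_wpM2l ?cabs_ge0.
move=> [f1 [f2 f3]]; have D x := cderivM (proj1 (cderiv_cst z x)) (f1 x).
split; first by move=> x; case: (D x).
split; first by move=> x; rewrite cabsM ler_wpM2l ?cabs_ge0.
have -> : cderiv (fun x => z * f x) = fun x => z * cderiv f x.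
  by apply/funext => x; case: (D x) => _ ->; rewrite (proj2 (cderiv_cst z x)) mul0r add0r.
exact: IH.
Qed.

Lemma Ck_boundB k f g c d : Ck_bound k f c -> Ck_bound k g d ->
  Ck_bound k (fun x => f x - g x) (c + d).
Proof.
have c1 : cabs (-1 : C) = 1 by rewrite cabsN -[1 : C]/(1%:R) cabs_nat.
move=> hf /(Ck_boundZ (-1)); rewrite c1 mul1r => hg.
have -> : (fun x => f x - g x) = fun x => f x + -1 * g x by apply/funext => x; rewrite mulN1r.
exact: Ck_boundD.
Qed.

Lemma Ck_bound_prim k f c : L1 f -> Ck_bound k f c -> (forall x, cabs (prim f x) <= c) ->
  Ck_bound k.+1 (prim f) c.
Proof.
move=> lf hf hp; have D x := prim_derive lf (@Ck_bound_continuous k f c x hf).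
split; first by move=> x; case: (D x).
split=> //; have -> // : cderiv (prim f) = f by apply/funext => x; case: (D x).
Qed.

Lemma Ck_bound_L1 b f c : 0 <= b -> supp_in b f -> Ck_bound 0 f c ->
  L1 f /\ \int[mu]_x cabs (f x) <= 2 * b * c.
Proof.
move=> b0 sf [cf fc]; have mf := continuous_cmf cf.
have E x : cabs (f x) <= c * ind (- b <= x <= b).
  rewrite -norm_itv; have [xb|/sf ->] := leP `|x| b; first by rewrite mulr1.
  by rewrite cabs0 mulr0.
have lf : L1 f by apply: (L1_dom mf E); exact/rL1Z/rL1_itv.
split=> //; apply: le_trans (_ : \int[mu]_x (c * ind (- b <= x <= b)) <= _).
  by apply: Rint_le; [exact: L1_cabs|exact/rL1Z/rL1_itv|].
rewrite RintZ ?Rint_itv1; [|lra|exact: rL1_itv].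
by rewrite le_eqVlt; apply/orP; left; apply/eqP; ring.
Qed.

Section Supported.
Variable b : R.
Hypothesis b0 : 0 <= b.

Lemma supp_near (f : R -> C) (x : R) : supp_in b f -> b < `|x| -> \near x, 0 = f x.
Proof. by move=> sf xb; apply: filterS (norm_gt_near xb) => y /sf ->. Qed.

Lemma C1_prim f c : supp_in b f -> Ck_bound 1 f c ->
  f = prim (cderiv f) /\ Int (cderiv f) = 0.
Proof.
move=> sf [f1 [f2 f3]]; have sd := cderiv_supp sf.
have [ld _] := Ck_bound_L1 b0 sd f3.
have E x : prim (cderiv f) x = f x.
  pose N := Num.max b `|x| + 1; have bN : b < N by rewrite ltr_pwDr // le_max lexx.
  have xN : `|x| < N by rewrite ltr_pwDr // le_max lexx orbT.
  have Nx : - N <= x by move: xN; rewrite ltr_norml => /andP[/ltW].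
  have fN : f (- N) = 0 by apply: sf; rewrite ltr_normr opprK bN orbT.
  have P (g : R -> R) : (forall x, derivable g x 1) -> continuous (derive1 g) ->
      \int[mu]_t (ind (- N <= t <= x) * derive1 g t) = g x - g (- N).
    by move=> dg cg; apply: FTC_itv => // t _; exact: cg.
  transitivity (Int (fun t => ind (- N <= t <= x) * cderiv f t)).
    congr Int; apply/funext => t; have [tN|tN] := leP (- N) t; first by [].
    by rewrite sd ?mulr0 // ltr_normr; apply/orP; right; lra.
  have c1 : continuous (derive1 (re f)) by move=> y; have [h _] := f3; have /cvgC_split[] := h y.
  have c2 : continuous (derive1 (im f)) by move=> y; have [h _] := f3; have /cvgC_split[] := h y.
  have := P (re f) (fun y => proj1 (f1 y)) c1; have := P (im f) (fun y => proj2 (f1 y)) c2.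
  rewrite [im f (- N)]/im [re f (- N)]/re fN /= !subr0 => e2 e1; apply: cplxP.
    by rewrite -[RHS]/(re f x) -e1; apply: eq_Rintegral => t _; rewrite /re natC CplxE /= mul0r subr0.
  by rewrite -[RHS]/(im f x) -e2; apply: eq_Rintegral => t _; rewrite /im natC CplxE /= mul0r addr0.
split; first by apply/funext => x; rewrite E.
have := E (b + 1); rewrite (prim_right sd); last by lra.
by rewrite sf // ltr_normr; apply/orP; left; lra.
Qed.

Lemma C2_pot f c : supp_in b f -> Ck_bound 2 f c ->
  let h := cderiv (cderiv f) in
  [/\ f = pot h, Int h = 0 & Int (fun x => h x * x%:C) = 0].
Proof.
move=> sf [f1 [f2 f3]] h; have sd := cderiv_supp sf; have sh := cderiv_supp sd.
have fb1 : Ck_bound 1 f c := @Ck_bound_pred 1 f c (conj f1 (conj f2 f3)).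
have [E1 I1] := C1_prim sf fb1; have [E2 h0] := C1_prim sd f3.
have hb0 : Ck_bound 0 h c by case: f3 => _ [].
have [lh _] := Ck_bound_L1 b0 sh hb0.
have h1 : Int (fun x => h x * x%:C) = 0.
  by have := Int_prim b0 lh sh h0; rewrite -E2 I1 => /eqP; rewrite eq_sym oppr_eq0 => /eqP.
by split; [rewrite (pot_prim b0 lh sh h0 h1) -E2; exact: E1|exact: h0|exact: h1].
Qed.

(** Each of the two primitives costs at most the factor [1 + 2 * b]: the length of the ball for the
    values, 1 for the derivatives. *)
Lemma Ck_bound_pot k h c : supp_in b h -> Ck_bound k h c -> Int h = 0 ->
  Int (fun x => h x * x%:C) = 0 -> Ck_bound k.+2 (pot h) ((1 + 2 * b) ^+ 2 * c).
Proof.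
move=> sh hc h0 h1; have [lh ih] := Ck_bound_L1 b0 sh (Ck_bound0 hc).
have c0 := Ck_bound_ge0 hc.
have bb : 0 <= 2 * b by rewrite mulr_ge0.
have cb : c <= (1 + 2 * b) * c by rewrite ler_peMl // lerDl.
have b2 : 2 * b * c <= (1 + 2 * b) * c by rewrite ler_wpM2r // lerDr.
have hp : Ck_bound k.+1 (prim h) ((1 + 2 * b) * c).
  apply: Ck_bound_prim => //; first exact: Ck_bound_mono hc.
  by move=> x; apply: le_trans (prim_le x lh) _; exact: le_trans ih b2.
have sp := prim_supp sh h0; have [lp ip] := Ck_bound_L1 b0 sp (Ck_bound0 hp).
rewrite (pot_prim b0 lh sh h0 h1) expr2 -mulrA; set d := (1 + 2 * b) * c in hp ip cb b2 *.
have d0 : 0 <= d by exact: le_trans cb.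
apply: Ck_bound_prim => //; first by apply: Ck_bound_mono hp; rewrite ler_peMl // lerDl.
move=> x; apply: le_trans (prim_le x lp) _; apply: le_trans ip _.
by rewrite ler_wpM2r // lerDr.
Qed.

End Supported.

Section Multiplication.
Variables (a b : R).
Hypothesis b0 : 0 < b < a.
Local Notation I := [set` `](- a), a[].

Lemma inCkS k f : inCk k.+1 I f <-> (forall x, I x -> cderivable f x) /\ inCk k I (cderiv f).
Proof.
split=> [[h1 h2]|[h0 [h1 h2]]].
  split; first by move=> x xI; exact: (h1 0%N x (ltn0Sn _) xI).
  split=> [j x jk xI|x xI]; first by have := h1 j.+1 x jk xI; rewrite iterSr.
  by have := h2 x xI; rewrite iterSr.
split=> [[|j] x jk xI|x xI]; first exact: h0.
  by rewrite iterSr; exact: h1.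
by rewrite iterSr; exact: h2.
Qed.

Lemma inCk_pred k f : inCk k.+1 I f -> inCk k I f.
Proof.
elim: k f => [|k IH] f /inCkS[h1 h2]; last first.
  by apply/inCkS; split; [exact: h1|exact: IH _ h2].
by split=> [//|x xI]; exact: cderivable_continuous (h1 x xI).
Qed.

Lemma inCk0 k f : inCk k I f -> inCk 0 I f.
Proof. elim: k => [h|k IH h]; [exact: h|exact: IH (inCk_pred h)]. Qed.

Lemma continuous_bounded (q : R -> C) : inCk 0 I q -> exists Q, forall x, `|x| <= b -> cabs (q x) <= Q.
Proof.
move=> [_ cq]; have [b1 ba] := andP b0.
have bnd (f : R -> R) : (forall x, I x -> {for x, continuous f}) -> exists D, forall x, `|x| <= b -> `|f x| <= D.
  move=> cf; have [|||y _ hy] := @compact_EVT_max R R (fun x => `|f x|) [set` `[- b, b]].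
  - by exists 0; rewrite /= in_itv /=; lra.
  - exact: segment_compact.
  - apply: continuous_in_subspaceT => x; rewrite inE /= in_itv /= => xb.
    by apply: cvg_norm; apply: cf; rewrite /= in_itv /=; lra.
  by exists `|f y| => x xb; apply: hy; rewrite inE /= in_itv /= -norm_itv.
have [|D1 h1] := bnd (re q); first by move=> x xI; have /cvgC_split[] := cq x xI.
have [|D2 h2] := bnd (im q); first by move=> x xI; have /cvgC_split[] := cq x xI.
exists (D1 + D2) => x xb; apply: le_trans (cabs_leD _) _; apply: lerD; [exact: h1|exact: h2].
Qed.

Lemma in_or_out (x : R) : I x \/ b < `|x|.
Proof.
have [b1 ba] := andP b0; have [xb|] := leP `|x| b; [left|by right].
by move: xb; rewrite ler_norml /= in_itv /=; lra.
Qed.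

Lemma Ck_bound_mul k (q : R -> C) : inCk k I q -> exists2 D, 0 <= D & forall f c,
  supp_in b f -> Ck_bound k f c -> Ck_bound k (fun x => q x * f x) (D * c).
Proof.
have sq (p f : R -> C) : supp_in b f -> supp_in b (fun x => p x * f x).
  by move=> sf x xb; rewrite sf // mulr0.
elim: k q => [|k IH] q hq.
  have [Q hQ] := continuous_bounded (inCk0 hq).
  exists Q; first by apply: le_trans (hQ 0 _); rewrite ?cabs_ge0 // normr0 ltW //; case/andP: b0.
  move=> f c sf [cf fc]; split=> x.
    have [xI|xb] := in_or_out x; first exact: (continuousCM (proj2 hq x xI) (cf x)).
    by apply: (continuousC_near (supp_near (sq q f sf) xb)); exact: continuousC_cst.
  have [xb|xb] := leP `|x| b; first by rewrite cabsM ler_pM ?cabs_ge0 // hQ.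
  rewrite sf // mulr0 cabs0 mulr_ge0 //; last by apply: le_trans (fc 0); exact: cabs_ge0.
  by apply: le_trans (hQ 0 _); rewrite ?cabs_ge0 // normr0 ltW //; case/andP: b0.
have [D1 D10 h1] := IH _ (inCk_pred hq).
have [h2 hq'] := (proj1 (inCkS k q)) hq; have [D2 D20 h3] := IH _ hq'.
exists (D1 + D2); first exact: addr_ge0.
move=> f c sf hf; have [f1 [f2 f3]] := hf; have c0 := Ck_bound_ge0 hf.
have D x : cderivable (fun x => q x * f x) x /\
    cderiv (fun x => q x * f x) x = cderiv q x * f x + q x * cderiv f x.
  have [xI|xb] := in_or_out x; first by apply: cderivM => //; exact: h2.
  have [d1 d2] := cderiv_near (supp_near (sq q f sf) xb) (proj1 (cderiv_cst 0 x)).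
  split=> //; rewrite d2 (proj2 (cderiv_cst 0 x)) (sf _ xb) (cderiv_supp sf xb).
  by rewrite !mulr0 addr0.
split; first by move=> x; case: (D x).
split.
  move=> x; apply: le_trans (Ck_bound_le x (h1 _ _ sf (Ck_bound_pred hf))) _.
  by rewrite ler_wpM2r // lerDl.
have -> : cderiv (fun x => q x * f x) = fun x => q x * cderiv f x + cderiv q x * f x.
  by apply/funext => x; case: (D x) => _ ->; rewrite addrC.
rewrite mulrDl; apply: Ck_boundD; first exact: h1 (cderiv_supp sf) f3.
exact: h3 sf (Ck_bound_pred hf).
Qed.

Lemma inCk_bound k f c : 0 <= c -> supp_in b f ->
  Ck_bound k f c <-> inCk k I f /\ (forall j x, (j <= k)%N -> `|x| <= b -> cabs (iter j (@cderiv R) f x) <= c).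
Proof.
move=> c0; elim: k f => [|k IH] f sf.
  split=> [[h1 h2]|[[_ h2] h3]].
    by split=> [|j x]; [split=> // x _; exact: h1|rewrite leqn0 => /eqP -> _; exact: h2].
  split=> x.
    have [xI|xb] := in_or_out x; first exact: h2.
    by apply: (continuousC_near (supp_near sf xb)); exact: continuousC_cst.
  by have [xb|/sf ->] := leP `|x| b; [exact: (h3 0%N)|rewrite cabs0].
have IH' := IH _ (cderiv_supp sf).
split=> [[h1 [h2 /IH'[h3 h4]]]|[/inCkS[h1 h2] h3]].
  split; first by apply/inCkS; split=> // x _; exact: h1.
  by move=> [|j] x jk xb; [exact: h2|rewrite iterSr; exact: h4].
split.
  move=> x; have [xI|xb] := in_or_out x; first exact: h1.
  by have [] := cderiv_near (supp_near sf xb) (proj1 (cderiv_cst 0 x)).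
split; first by move=> x; have [xb|/sf ->] := leP `|x| b; [exact: (h3 0%N)|rewrite cabs0].
by apply/IH'; split=> // j x jk xb; have := h3 j.+1 x jk xb; rewrite iterSr.
Qed.

End Multiplication.
End SmoothFunctions.

(** * The transpose on a fixed ball *)

Section Ball.
Context {R : realType}.
Local Notation C := (complex R).
Local Notation mu := (@lebesgue_measure R).

Lemma continuous_ae_eq (f g : R -> C) : (forall x, {for x, continuous (f : R -> C^o)}) ->
  (forall x, {for x, continuous (g : R -> C^o)}) -> {ae mu, forall x, f x = g x} -> f = g.
Proof.
move=> cf cg fg; apply/funext => x; apply/eqP; rewrite -subr_eq0 -cabs_eq0.
apply: contrapT => /negP h.
have cd := continuousCD (cf x) (continuousCN (cg x)).
have n0 : 0 < cabs (f x - g x) by rewrite lt_def h cabs_ge0.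
have /cvgrPdist_lt/(_ (cabs (f x - g x))%:C) := cd.
rewrite ltcR => /(_ n0) /nbhs_ballP[e /= e0 he].
have [|y xy e1] := @ae_pick R _ x (x + e) _ fg; first by rewrite ltrDl.
have : ball x e y by rewrite /ball /= ltr_norml; lra.
by move=> /he /=; rewrite e1 subrr subr0 normC_cabs ltcR ltxx.
Qed.

(** The kernel is Lipschitz in [x], so the potential is too, with the L^1 norm of [h] as a
    constant. *)
Lemma pot_continuous b (h : R -> C) x : L1 h -> supp_in b h ->
  {for x, continuous (pot h : R -> C^o)}.
Proof.
move=> lh sh; set D := \int[mu]_r cabs (h r).
have D0 : 0 <= D by apply: Rintegral_ge0 => r _; exact: cabs_ge0.
have lip y : cabs (pot h x - pot h y) <= `|x - y| * D.
  have l1 := pot_integrand lh sh x; have l2 := pot_integrand lh sh y.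
  rewrite -(IntB l1 l2); apply: le_trans (cabs_Int (L1B l1 l2)) _.
  rewrite -RintZ; last exact: L1_cabs.
  apply: Rint_le; [exact/L1_cabs/L1B|exact/rL1Z/L1_cabs|move=> r].
  rewrite -mulrBl cabsM ler_wpM2r ?cabs_ge0 // -rmorphB cabs_real -mulrBr normrM ger0_norm ?invr_ge0 //.
  apply: (@le_trans _ _ (`| `|x - r| - `|y - r| |)); first by rewrite ler_piMl // invf_le1 ?ler1n.
  by apply: le_trans (ler_dist_dist _ _) _; rewrite opprB addrA subrK.
apply/cvgrPdist_lt => e e0.
have [er0 eE] : 0 < complex.Re e /\ e = (complex.Re e)%:C.
  by case: e e0 => u v; rewrite ltcE /= => /andP[/eqP -> ?].
set d := complex.Re e in er0 eE; rewrite eE.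
have d0 : 0 < d / (D + 1) by rewrite divr_gt0 // ltr_wpDl.
apply/nbhs_ballP; exists (d / (D + 1)) => // y; rewrite /ball /= => xy.
rewrite normC_cabs ltcR; apply: le_lt_trans (lip y) _.
move: xy; rewrite ltr_pdivlMr ?ltr_wpDl // mulrDr mulr1 => xy.
by apply: le_lt_trans xy; rewrite lerDl.
Qed.

Variables (a b : R) (q : R -> C) (H : R * R -> C).
Hypothesis b0 : 0 < b < a.
Hypothesis HG : goursat_solution a q H.
Hypothesis lq : L1 (cutoff b q).
Local Notation I := [set` `](- a), a[].
Local Notation k := (tker b (Hc b H)).
Local Notation T := (TopT b (Hc b H)).

Let bn : 0 <= b. Proof. by case/andP: b0 => /ltW. Qed.
Let mH := cmf_Hc b0 HG.
Let mk : cmf (fun p : R * R => k p.1 p.2) := cmf_tker b mH.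

Let q_cutoff (f : R -> C) : supp_in b f -> (fun x => cutoff b q x * f x) = (fun x => q x * f x).
Proof.
move=> sf; apply/funext => x; have [xb|/sf ->] := leP `|x| b; last by rewrite !mulr0.
by rewrite /cutoff xb [ind true * q x]mul1r.
Qed.

Lemma ball_L1 psi : L1 psi -> L1 (T psi).
Proof. by have [M hM] := Hc_bounded b0 HG; exact: L1_TopT. Qed.

Lemma ball_lin c f g : L1 f -> L1 g -> T (fun x => c * f x + g x) = fun x => c * T f x + T g x.
Proof.
move=> lf lg; have [M hM] := Hc_bounded b0 HG.
apply/funext => x; rewrite /TopT (kopT_lin bn mk (tker_bound b hM) c lf lg); ring.
Qed.

Let kopT_ae (f g : R -> C) : L1 f -> L1 g -> {ae mu, forall x, f x = g x} -> kopT k f = kopT k g.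
Proof.
move=> lf lg fg; have [M hM] := Hc_bounded b0 HG; have kM := tker_bound b hM.
apply/funext => t; apply: Int_ae.
- exact: L1_cmf (kopT_integrand bn mk kM t lf).
- exact: L1_cmf (kopT_integrand bn mk kM t lg).
by apply: aeS fg => x ->.
Qed.

Lemma ball_inverse : exists2 D, 0 < D & forall f, L1 f -> supp_in b f ->
  (exists psi, [/\ L1 psi, supp_in b psi & T psi = f]) /\
  (forall psi, L1 psi -> supp_in b psi -> T psi = f ->
    \int[mu]_x cabs (psi x) <= D * \int[mu]_x cabs (f x)).
Proof.
have [M hM] := Hc_bounded b0 HG; have kM := tker_bound b hM.
have [om hA] := kopT_contraction bn mk kM.
have [D D0 hD] := contraction_bound hA.
exists D => // f lf sf; split.
  have [w [lw wE]] := contraction_solve hA lf.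
  (* [w] solves the equation almost everywhere. As [kopT] ignores null sets, this modification
     solves it at every point. *)
  pose psi x := f x - kopT k w x.
  have lk := kopT_L1 bn mk kM lw.
  have lp : L1 psi by exact: L1B.
  exists psi; split=> //.
    by move=> x xb; rewrite /psi sf // (@kopT_supp _ b _ w x xb) subr0.
  have E : kopT k psi = kopT k w by apply: kopT_ae => //; apply: aeS wE => x ->.
  by apply/funext => x; rewrite /TopT E /psi subrK.
move=> psi lp sp E; apply: hD => //; apply: aeT => x.
by rewrite -E /TopT addrK.
Qed.

Lemma ball_injective psi : L1 psi -> supp_in b psi -> T psi = (fun=> 0) -> psi = fun=> 0.
Proof.
move=> lp sp E; have [M hM] := Hc_bounded b0 HG; have kM := tker_bound b hM.
have [om hA] := kopT_contraction bn mk kM.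
have E1 x : psi x = - kopT k psi x.
  by apply/eqP; rewrite -addr_eq0; apply/eqP; exact: (congr1 (fun g => g x) E).
have Z := contraction_eq0 hA lp (aeT E1).
(* Vanishing almost everywhere already kills the integral term at every point, hence [psi]
   itself. *)
have E2 : kopT k psi = kopT k (fun=> 0) by apply: kopT_ae => //; exact: L1_0.
apply/funext => x; rewrite E1 E2 /kopT (_ : (fun x => _) = fun=> 0) ?Int0 ?oppr0 //.
by apply/funext => y; rewrite mulr0.
Qed.

Let T_cont (f : R -> C) x : L1 f -> {for x, continuous (f : R -> C^o)} ->
  {for x, continuous (T f : R -> C^o)}.
Proof.
move=> lf cf; have [M hM] := Kc_bounded b0 HG.
have ck := kopT_tker_continuous b0 HG hM lf.
exact: (continuousCD cf (ck x)).
Qed.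

Section Potential.
Variable h : R -> C.
Hypothesis lh : L1 h.
Hypothesis sh : supp_in b h.
Hypothesis h0 : Int h = 0.
Hypothesis h1 : Int (fun x => h x * x%:C) = 0.

Let sp : supp_in b (pot h). Proof. by move=> x /ltW; exact: (pot_supp lh sh h0 h1). Qed.
Let lp : L1 (pot h). Proof. exact: (L1_pot bn lh sh h0 h1). Qed.

Lemma L1_q_pot : L1 (fun x => q x * pot h x).
Proof. by rewrite -(q_cutoff sp); exact: (L1_qpot bn lq (@supp_cutoff _ b q) lh sh h0 h1). Qed.

(** The identity of [TopT_pot] becomes exact because both of its sides are continuous. *)
Lemma ball_pot : let m := T (fun x => h x - q x * pot h x) in
  [/\ L1 m, supp_in b m, Int m = 0, Int (fun x => m x * x%:C) = 0 & T (pot h) = pot m].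
Proof.
move=> m; have [M hM] := Hc_bounded b0 HG.
have gp := goursat_pos b0 HG; have gn := goursat_neg b0 HG lq.
have sq := @supp_cutoff _ b q.
have mE : m = T (fun x => h x - cutoff b q x * pot h x).
  congr T; apply/funext => x; congr (_ - _); exact/esym/(congr1 (fun g => g x) (q_cutoff sp)).
have lm : L1 m by apply: ball_L1; apply: L1B => //; exact: L1_q_pot.
have sm : supp_in b m.
  by apply: (@TopT_supp _ b (Hc b H)) => x xb; rewrite sh // sp // mulr0 subr0.
have [m0 m1] := TopT_moments bn lq sq mH hM gp gn lh sh h0 h1.
have P := TopT_pot bn lq sq mH hM gp gn lh sh h0 h1.
rewrite -mE in m0 m1 P; split=> //.
apply: continuous_ae_eq => [x|x|]; last by apply: aeS P => x ->.
- exact: (T_cont lp (pot_continuous lh sh)).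
- exact: (pot_continuous lm sm).
Qed.

Lemma ball_inverse_pot psi m : L1 psi -> supp_in b psi -> T psi = pot h ->
  L1 m -> supp_in b m -> T m = h -> let g x := m x + q x * psi x in
  [/\ L1 g, supp_in b g, Int g = 0, Int (fun x => g x * x%:C) = 0 & psi = pot g].
Proof.
move=> lpsi spsi psiE lm sm mE g.
have [M hM] := Hc_bounded b0 HG; have kM := tker_bound b hM.
have gp := goursat_pos b0 HG; have gn := goursat_neg b0 HG lq.
have sq := @supp_cutoff _ b q.
(* [psi] is only assumed integrable; its equation bounds it by the potential and the integral
   part. *)
pose D := 2 * b * \int[mu]_r cabs (h r) + M * \int[mu]_r cabs (psi r).
have psi_eq x : psi x = pot h x - kopT k psi x by rewrite -psiE /TopT addrK.
have psiD x : cabs (psi x) <= D.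
  rewrite psi_eq; apply: le_trans (cabsB _ _) _; apply: lerD; first exact: (cabs_pot_le bn lh sh h0 h1).
  have M0 : 0 <= M by apply: le_trans (hM 0 0); exact: cabs_ge0.
  apply: le_trans (kopT_le bn mk kM x lpsi) _; rewrite ler_wpM2r ?ler_piMr ?ind_le1 //.
  by apply: Rintegral_ge0 => r _; exact: cabs_ge0.
have e1 : {ae mu, forall x, T psi x = pot h x} by apply: aeT => x; rewrite psiE.
have e2 : {ae mu, forall x, T m x = h x} by apply: aeT => x; rewrite mE.
have [g0 g1] := TopT_inverse_moments bn lq sq mH hM gp gn lh sh h0 h1 lpsi spsi psiD lm sm e1 e2.
have P := TopT_inverse_pot bn lq sq mH hM gp gn lh sh h0 h1 lpsi spsi psiD lm sm e1 e2.
have gE : (fun x => m x + cutoff b q x * psi x) = g.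
  apply/funext => x; congr (_ + _); exact: (congr1 (fun g => g x) (q_cutoff spsi)).
rewrite gE in g0 P.
have {}g1 : Int (fun x => g x * x%:C) = 0 by rewrite -gE.
have lg : L1 g.
  rewrite -gE; apply: L1D => //.
  by apply: (L1_moment lq sq (L1_cmf lpsi) (D := D)) => x _; exact: psiD.
have sg : supp_in b g by move=> x xb; rewrite /g sm // spsi // mulr0 addr0.
split=> //; apply: continuous_ae_eq => [x|x|]; last by apply: aeS P => x ->.
- have [K hK] := Kc_bounded b0 HG.
  rewrite (_ : psi = fun x => pot h x - kopT k psi x); last by apply/funext.
  apply: (continuousCD (pot_continuous lh sh)); apply: continuousCN.
  exact: (kopT_tker_continuous b0 HG hK lpsi).
- exact: (pot_continuous lg sg).
Qed.

End Potential.

Section Smooth.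

Let kopT_C0 : exists2 D, 0 <= D & forall f, L1 f ->
  Ck_bound 0 (kopT k f) (D * \int[mu]_x cabs (f x)).
Proof.
have [K hK] := Kc_bounded b0 HG; have [M hM] := Hc_bounded b0 HG; have kM := tker_bound b hM.
have M0 : 0 <= M by apply: le_trans (hM 0 0); exact: cabs_ge0.
exists M => // f lf; split=> x; first exact: (kopT_tker_continuous b0 HG hK lf).
apply: le_trans (kopT_le bn mk kM x lf) _; rewrite ler_wpM2r ?ler_piMr ?ind_le1 //.
by apply: Rintegral_ge0 => r _; exact: cabs_ge0.
Qed.

(** By [kopT_primitive] the derivative is [g]; continuity of [q] makes the derivative kernel, and
    hence [g], continuous. *)
Let kopT_C1 : inCk 0 I q -> exists2 D, 0 <= D & forall f c, supp_in b f -> Ck_bound 0 f c ->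
  Ck_bound 1 (kopT k f) (D * c).
Proof.
move=> hq; have [b1 ba] := andP b0.
have [Q hQ] := continuous_bounded b0 hq.
have Q0 : 0 <= Q by apply: le_trans (hQ 0 _); rewrite ?cabs_ge0 // normr0.
have qQ s : cabs (cutoff b q s) <= Q.
  rewrite /cutoff; have [sb|_] := leP `|s| b; last by rewrite mul0r cabs0.
  by rewrite [ind true * q s]mul1r; exact: hQ.
have cq s : `|s| < b -> {for s, continuous (q : R -> C^o)}.
  by rewrite ltr_norml => sb; apply: (proj2 hq); rewrite /= in_itv /=; lra.
have [K hK] := Kc_bounded b0 HG; have [D0 D00 hD0] := kopT_C0.
have K0 : 0 <= K by apply: le_trans (hK 0 0); exact: cabs_ge0.
pose MD := Q + Q * K * b.
have MD0 : 0 <= MD by rewrite addr_ge0 // !mulr_ge0.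
exists (D0 * (2 * b) + (MD * (2 * b) + K)); first by rewrite !addr_ge0 ?mulr_ge0.
move=> f c sf fc; have c0 := Ck_bound_ge0 fc; have [lf intf] := Ck_bound_L1 bn sf fc.
pose g s := kopT (tker' b q H) f s - ind (`|s| <= b) * (Kc b H s s * f s).
have E : kopT k f = prim g by apply/funext => t; exact: (kopT_primitive b0 HG lq hK qQ t lf sf).
have mt : cmf (fun p : R * R => tker' b q H p.1 p.2).
  apply: cmfM; first by meas.
  by apply: cmfM; [apply: cmf_realC; apply: meas_sgnR; meas|exact: (cmf_dker b0 HG lq)].
have tM := tker'_bound b0 HG lq hK qQ.
have gE : g = fun s => kopT (tker' b q H) f s - Kc b H s s * f s.
  apply/funext => s; congr (_ - _); have [sb|/sf ->] := leP `|s| b; last by rewrite !mulr0.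
  by rewrite mul1r.
have g1 : Ck_bound 0 g ((MD * (2 * b) + K) * c).
  rewrite gE; split=> s.
    apply: continuousCD; first exact: (kopT_tker'_continuous b0 HG lq hK qQ cq lf).
    apply: continuousCN; apply: continuousCM; last exact: (Ck_bound_continuous fc).
    have cp := @pair_continuous _ _ id id s (@cvg_id _ _) (@cvg_id _ _).
    have cK := continuous_Kc b0 HG.
    exact: (@continuous_comp _ _ _ (fun y : R => (y, y)) (fun p : R * R => Kc b H p.1 p.2 : C^o) s cp (cK _)).
  rewrite mulrDl; apply: le_trans (cabsB _ _) _; apply: lerD.
    have i0 : 0 <= \int[mu]_x cabs (f x) by apply: Rintegral_ge0 => r _; exact: cabs_ge0.
    apply: (@le_trans _ _ (MD * \int[mu]_x cabs (f x))).
      by apply: le_trans (kopT_le bn mt tM s lf) _; rewrite ler_wpM2r // ler_piMr ?ind_le1.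
    by rewrite -(mulrA MD) ler_wpM2l.
  by rewrite cabsM ler_pM ?cabs_ge0 //; exact: (Ck_bound_le s fc).
have lg : L1 g.
  have sg : supp_in b g.
    move=> s sb; rewrite gE (sf s sb) mulr0 subr0 /kopT -[RHS](@Int0 R); congr Int; apply/funext => x.
    rewrite /tker'; have [/andP[h3 h4]|_] := boolP (_ <= _ <= _); last by rewrite !mul0r.
    by have := lt_le_trans sb (le_trans h3 h4); rewrite ltxx.
  by case: (Ck_bound_L1 bn sg g1).
rewrite E; apply: Ck_bound_prim => //.
  by apply: Ck_bound_mono g1; rewrite ler_wpM2r // lerDr mulr_ge0 // mulr_ge0.
move=> x; rewrite -E; have [_ /(_ x) h] := hD0 f lf; apply: le_trans h _.
rewrite mulrDl; apply: le_trans (_ : D0 * (2 * b) * c <= _); first by rewrite -mulrA ler_wpM2l.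
by rewrite lerDl !mulr_ge0 // addr_ge0 ?mulr_ge0.
Qed.

Lemma ball_Ck n : inCk n I q -> exists2 D, 0 <= D & forall f c, supp_in b f ->
  Ck_bound n f c -> Ck_bound n (T f) (D * c).
Proof.
(* Generalised to all [j <= n], because the step from [j] to [j.+2] skips an index; hence also two
   base cases. *)
move: {-2}n (leqnn n) => j; elim: n j => [|n IH] [|[|j]] jn hq.
- have [D D0 hD] := kopT_C0; exists (1 + D * (2 * b)); first by rewrite addr_ge0 // !mulr_ge0.
  move=> f c sf fc; have [lf intf] := Ck_bound_L1 bn sf fc.
  rewrite mulrDl mul1r; apply: Ck_boundD => //; apply: Ck_bound_mono (hD f lf).
  by rewrite -mulrA ler_wpM2l.
- by [].
- by [].
- have [D D0 hD] := IH 0%N (leq0n _) hq; by exists D.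
- have [D D0 hD] := kopT_C1 (inCk0 hq); exists (1 + D); first exact: addr_ge0.
  move=> f c sf fc; rewrite mulrDl mul1r; apply: Ck_boundD => //.
  by apply: hD => //; exact: Ck_bound0 fc.
have [D D0 hD] := IH j (ltnW jn) (inCk_pred (inCk_pred hq)).
have [E E0 hE] := Ck_bound_mul b0 (inCk_pred (inCk_pred hq)).
(* [1 + E] bounds the second derivative of [f] minus [q * f], [D] the operator on C^j, and the
   square the two integrations back. *)
exists ((1 + 2 * b) ^+ 2 * (D * (1 + E))); first by rewrite mulr_ge0 ?sqr_ge0 // mulr_ge0 // addr_ge0.
move=> f c sf fc.
have fc2 : Ck_bound 2 f c.
  by elim: j fc {IH jn hq D D0 hD E E0 hE} => // j IHj /Ck_bound_pred; exact: IHj.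
have [fE h0 h1] := C2_pot bn sf fc2.
set h := cderiv (cderiv f) in fE h0 h1.
have sh : supp_in b h by exact/cderiv_supp/cderiv_supp.
have hc : Ck_bound j h c by case: fc => _ [_ [_ []]].
have [lh _] := Ck_bound_L1 bn sh (Ck_bound0 hc).
have [lm sm m0 m1 TE] := ball_pot lh sh h0 h1.
rewrite fE TE -mulrA; apply: Ck_bound_pot => //.
rewrite -mulrA; apply: hD.
  by move=> x xb; rewrite sh // -fE sf // mulr0 subr0.
rewrite -fE mulrDl mul1r; apply: Ck_boundB => //.
by apply: hE => //; exact/Ck_bound_pred/Ck_bound_pred.
Qed.

Lemma ball_inverse_Ck n : inCk n I q -> exists2 D, 0 <= D & forall psi f c, L1 psi -> supp_in b psi ->
  T psi = f -> supp_in b f -> Ck_bound n f c -> Ck_bound n psi (D * c).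
Proof.
have [D1 D10 inv] := ball_inverse.
move: {-2}n (leqnn n) => j; elim: n j => [|n IH] [|[|j]] jn hq.
- have [D D0 hD] := kopT_C0; exists (1 + D * (D1 * (2 * b))); first by rewrite addr_ge0 // !mulr_ge0 // ltW.
  move=> psi f c lp sp E sf fc; have [lf intf] := Ck_bound_L1 bn sf fc.
  have -> : psi = fun x => f x - kopT k psi x by apply/funext => x; rewrite -E /TopT addrK.
  rewrite mulrDl mul1r; apply: Ck_boundB => //; apply: Ck_bound_mono (hD psi lp).
  have [_ /(_ psi lp sp E) h] := inv f lf sf.
  rewrite -mulrA ler_wpM2l //; apply: le_trans h _; rewrite -mulrA ler_wpM2l //; exact: ltW.
- by [].
- by [].
- have [D D0 hD] := IH 0%N (leq0n _) hq; by exists D.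
- have [D D0 hD] := kopT_C1 (inCk0 hq); have [E E0 hE] := IH 0%N (leq0n _) (inCk_pred hq).
  exists (1 + D * E); first by rewrite addr_ge0 // mulr_ge0.
  move=> psi f c lp sp TE sf fc.
  have pc := hE psi f c lp sp TE sf (Ck_bound0 fc).
  have psiE : psi = fun x => f x - kopT k psi x by apply/funext => x; rewrite -TE /TopT addrK.
  rewrite [X in Ck_bound _ X _]psiE mulrDl mul1r -mulrA; apply: Ck_boundB => //.
  exact: hD.
have [D D0 hD] := IH j (ltnW jn) (inCk_pred (inCk_pred hq)).
have [E E0 hE] := Ck_bound_mul b0 (inCk_pred (inCk_pred hq)).
(* The second derivative of [psi] is [m + q * psi], where [m] is the preimage of that of [f]. The
   induction hypothesis is applied twice, to [m] and, at the lower order [j], to [psi] itself. *)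
exists ((1 + 2 * b) ^+ 2 * (D + E * D)); first by rewrite mulr_ge0 ?sqr_ge0 // addr_ge0 // mulr_ge0.
move=> psi f c lp sp TE sf fc.
have fc2 : Ck_bound 2 f c.
  by elim: j fc {IH jn hq D D0 hD E E0 hE} => // j IHj /Ck_bound_pred; exact: IHj.
have [fE h0 h1] := C2_pot bn sf fc2.
set h := cderiv (cderiv f) in fE h0 h1.
have sh : supp_in b h by exact/cderiv_supp/cderiv_supp.
have hc : Ck_bound j h c by case: fc => _ [_ [_ []]].
have [lh _] := Ck_bound_L1 bn sh (Ck_bound0 hc).
have [[m [lm sm mE]] _] := inv h lh sh.
have TE' : T psi = pot h by rewrite TE.
have [lg sg g0 g1 pE] := ball_inverse_pot lh sh h0 h1 lp sp TE' lm sm mE.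
rewrite pE -mulrA; apply: Ck_bound_pot => //.
rewrite mulrDl; apply: Ck_boundD; first exact: (hD m h).
rewrite -mulrA; apply: hE => //.
by apply: (hD psi f) => //; exact/Ck_bound_pred/Ck_bound_pred.
Qed.

End Smooth.
End Ball.

(** * L^p norms *)

Section LebesgueNorm.
Context {R : realType}.
Local Notation C := (complex R).
Local Notation mu := (@lebesgue_measure R).
Local Notation N p u := ('N[mu]_p [EFin \o u])%E.
Implicit Types (p : \bar R) (u v : R -> R) (f : R -> C).

Let mu_gt0 : (0 < mu [set: R])%E.
Proof. by rewrite -set_itvNyy lebesgue_measure_itv /= ltry. Qed.

Let meas_power (r : R) u : measurable_fun setT u ->
  measurable_fun setT (fun x => `|(EFin \o u) x| `^ r)%E.
Proof.
move=> mu'; apply: (@measurableT_comp _ _ _ _ _ _ (fun x => x `^ r)%E) => //=.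
  exact: measurable_poweR.
by apply/measurable_EFinP; exact: measurableT_comp.
Qed.

Lemma le_ae_Lnorm p u v : (1 <= p)%E -> measurable_fun setT u -> measurable_fun setT v ->
  {ae mu, forall x, `|u x| <= `|v x|} -> (N p u <= N p v)%E.
Proof.
rewrite unlock /Lnorm; case: p => [r|_ _ _ uv|]; [|by rewrite mu_gt0; apply: le_ess_sup; apply: aeS uv|by []].
rewrite lee_fin => r1 mu' mv uv; have r0 : 0 <= r by lra.
apply: gt0_ler_poweR; [by rewrite invr_ge0|by rewrite in_itv /= integral_ge0 // leey|
  by rewrite in_itv /= integral_ge0 // leey|].
apply: ae_ge0_le_integral => //; [by move=> x _; exact: poweR_ge0|exact: meas_power|by move=> x _; exact: poweR_ge0|exact: meas_power|].
by apply: aeS uv => x uv _; rewrite /= lee_fin ge0_ler_powR // ?nnegrE.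
Qed.

Lemma LnormMl p (c : R) u : (1 <= p)%E -> 0 <= c -> measurable_fun setT u ->
  N p (fun x => (c * u x)%R) = (c%:E * N p u)%E.
Proof.
rewrite unlock /Lnorm; case: p => [r|_ c0 mu'|]; [| |by []]; last first.
  rewrite mu_gt0 -(ess_supZl _ mu_gt0 c0); congr ess_sup; apply/funext => x /=.
  by rewrite normrM EFinM (ger0_norm c0).
rewrite lee_fin => r1 c0 mu'; have r0 : 0 < r by lra.
transitivity ((\int[mu]_x ((c `^ r)%:E * `|(EFin \o u) x| `^ r)) `^ r^-1)%E.
  congr (_ `^ _)%E; apply: eq_integral => x _ /=.
  by rewrite normrM (ger0_norm c0) powRM // EFinM.
rewrite ge0_integralZl //; [|exact: meas_power|by move=> x _; exact: poweR_ge0|by rewrite lee_fin powR_ge0].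
rewrite poweRM ?lee_fin ?powR_ge0 //; last by apply: integral_ge0 => x _; exact: poweR_ge0.
by rewrite poweR_EFin -powRrM divff ?gt_eqF // powRr1.
Qed.

Lemma Lnorm_itv p (b : R) : (1 <= p)%E -> 0 <= b ->
  (N p (fun x : R => (ind (- b <= x <= b)%R)%R : R) < +oo)%E.
Proof.
move=> p1 b0; rewrite unlock /Lnorm; case: p p1 => [r||]; [|move=> _|by []]; last first.
  rewrite mu_gt0; apply: (@le_lt_trans _ _ 1%:E); last exact: ltry.
  by apply/ess_supP; apply: aeT => x /=; rewrite lee_fin ger0_norm // ind_le1.
rewrite lee_fin => r1; have r0 : r != 0 by apply/eqP; lra.
apply: poweR_lty.
rewrite (_ : (\int[mu]_x _)%E = (\int[mu]_x (ind (- b <= x <= b) : R)%:E)%E).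
  by rewrite rL1_fin ?ltry //; exact: rL1_itv.
apply: eq_integral => x _ /=; congr (_%:E); case: (- b <= x <= b) => /=.
  by rewrite normr1 powR1.
by rewrite normr0 powR0.
Qed.

Lemma L1_Lnorm p (b : R) : (1 <= p)%E -> 0 <= b -> exists2 D : R, 0 <= D &
  forall f (c : R), cmf f -> supp_in b f -> (N p (fun x => cabs (f x)) <= c%:E)%E ->
  L1 f /\ \int[mu]_x cabs (f x) <= D * c.
Proof.
move=> p1 b0.
have mI : measurable_fun setT (fun x : R => ind (- b <= x <= b) : R) by exact: (rL1_meas (rL1_itv _ _)).
have E f x : supp_in b f -> cabs (f x) = cabs (f x) * ind (- b <= x <= b).
  by move=> sf; rewrite -norm_itv; have [xb|/sf ->] := leP `|x| b; rewrite ?mulr1 // cabs0 mul0r.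
have [D D0 hD] : exists2 D : R, 0 <= D & forall f (c : R), cmf f -> supp_in b f ->
    (N p (fun x => cabs (f x)) <= c%:E)%E -> (\int[mu]_x (cabs (f x))%:E <= (D * c)%:E)%E.
  have I1 f : (\int[mu]_x (cabs (f x))%:E)%E = N 1%:E (fun x => cabs (f x)).
    by rewrite Lnorm1; apply: eq_integral => x _ /=; rewrite ger0_norm ?cabs_ge0.
  case: p p1 => [r||//]; last first.
    move=> _; exists (2 * b); first by rewrite mulr_ge0.
    move=> f c mf sf; rewrite unlock /Lnorm mu_gt0 => /ess_supP fc.
    apply: (@le_trans _ _ (\int[mu]_x (c * ind (- b <= x <= b))%:E)%E); last first.
      rewrite rL1_fin; last exact/rL1Z/rL1_itv.
      rewrite RintZ ?Rint_itv1; [|lra|exact: rL1_itv].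
      by rewrite lee_fin le_eqVlt; apply/orP; left; apply/eqP; ring.
    have c0 : 0 <= c.
      by have [x _] := @ae_pick R _ 0 1 ltr01 fc; rewrite /= lee_fin; exact/le_trans.
    apply: ae_ge0_le_integral => //.
    - by move=> x _; rewrite lee_fin cabs_ge0.
    - by apply/measurable_EFinP; exact: cmf_cabs.
    - by move=> x _; rewrite lee_fin mulr_ge0.
    - by apply/measurable_EFinP; apply: measurable_funM.
    apply: aeS fc => x /= + _; rewrite !lee_fin ger0_norm ?cabs_ge0 // => fc.
    by rewrite [leLHS](E f x sf) ler_wpM2r.
  rewrite lee_fin le_eqVlt => /predU1P[<-|r1].
    by exists 1 => // f c mf sf; rewrite mul1r I1.
  have r0 : 0 < r by lra.
  (* The exponent conjugate to [r], for Hoelder's inequality against the indicator of the ball; the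
     end points [r = 1] and infinity have been treated apart. *)
  pose s := (1 - r^-1)^-1.
  have s1 : 1 <= s by rewrite /s invf_ge1 ?subr_gt0 ?invf_lt1 // gerBl invr_ge0 ltW.
  have s0 : 0 < s by lra.
  have S := @Lnorm_itv s%:E b s1 b0.
  set NS := N s%:E _ in S.
  have SE : NS = (fine NS)%:E by rewrite fineK // ge0_fin_numE ?Lnorm_ge0.
  exists (fine NS); first by rewrite fine_ge0 ?Lnorm_ge0.
  move=> f c mf sf fc; rewrite I1.
  have -> : N 1%:E (fun x => cabs (f x)) = N 1%:E ((fun x => cabs (f x)) \* (fun x : R => ind (- b <= x <= b) : R))%R.
    by apply: eq_Lnorm => x /=; rewrite -(E f x sf).
  apply: le_trans (hoelder mu (cmf_cabs mf) mI r0 s0 _) _; first by rewrite /s invrK addrC subrK.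
  by rewrite -/NS SE mulrC EFinM; apply: lee_wpmul2r => //; rewrite lee_fin fine_ge0 ?Lnorm_ge0.
exists D => // f c mf sf fc.
have h := hD f c mf sf fc.
have rf : rL1 (fun x => cabs (f x)).
  by apply: rL1E; [exact: cmf_cabs|move=> x; exact: cabs_ge0|exact: le_lt_trans h (ltry _)].
split; first exact/L1P.
by rewrite -lee_fin -rL1_fin.
Qed.

End LebesgueNorm.

(** * Norm bounds for functions supported in a ball *)

Section FunctionSpace.
Context {R : realType}.
Local Notation C := (complex R).
Local Notation mu := (@lebesgue_measure R).
Variables (a : R) (F : fspace R).
Local Notation I := [set` `](- a), a[].
Local Notation N p u := ('N[mu]_p [EFin \o u])%E.

(** Working with a real bound in place of an extended norm lets L^p and C^k share their estimates,
    and the bound certifies membership at the same time. *)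
Definition bounded_in b (f : R -> C) (c : R) : Prop :=
  match F with
  | Lp p _ => [/\ cmf f, supp_in b f & (N p (fun x => cabs (f x)) <= c%:E)%E]
  | Ck k => supp_in b f /\ Ck_bound k f c
  end.

(* The multipliers of [F]: bounded functions for L^p. *)
Definition multiplier_in b (f : R -> C) (c : R) : Prop :=
  match F with
  | Lp p _ => [/\ cmf f, supp_in b f & forall x, cabs (f x) <= c]
  | Ck k => supp_in b f /\ Ck_bound k f c
  end.

Lemma cLnorm_off (p : \bar R) D (f : R -> C) : vanishes_off D f ->
  cLnorm p D f = N p (fun x => cabs (f x)).
Proof.
move=> fD; apply: eq_Lnorm => x /=; congr (_%:E); rewrite patchE.
by case: ifPn => // /negP xD; rewrite fD ?cabs0 // => Dx; apply: xD; rewrite inE.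
Qed.

Lemma vanishes_offE b (f : R -> C) : vanishes_off [set` `[- b, b]] f <-> supp_in b f.
Proof.
split=> h x xb; apply: h; first by rewrite /= in_itv /= -norm_itv; apply/negP; rewrite -ltNge.
by rewrite ltNge norm_itv; apply/negP => xb'; apply: xb; rewrite /= in_itv.
Qed.

Lemma cmf_off D (f : R -> C) : measurable D -> cmeasurable D f -> vanishes_off D f -> cmf f.
Proof.
move=> mD [m1 m2] fD.
have E (g : R -> R) : (forall x, ~ D x -> g x = 0) -> g \_ D = g.
  move=> gD; apply/funext => x; rewrite patchE; case: ifPn => // /negP xD.
  by rewrite gD // => Dx; apply: xD; rewrite inE.
split.
  rewrite -[X in measurable_fun _ X]/(re f) -(E (re f)); first exact/(measurable_restrictT _ mD).
  by move=> x /fD; rewrite /re => ->.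
rewrite -[X in measurable_fun _ X]/(im f) -(E (im f)); first exact/(measurable_restrictT _ mD).
by move=> x /fD; rewrite /im => ->.
Qed.

Lemma iter_cderiv_off J (f : R -> C) j : closed J -> vanishes_off J f ->
  vanishes_off J (iter j (@cderiv R) f).
Proof.
move=> cJ; elim: j => //= j IH fJ x Jx.
have h : \near x, 0 = iter j (@cderiv R) f x.
  have := open_nbhs_nbhs (conj (closed_openC cJ) Jx).
  by apply: filterS => y /(IH fJ).
have [c1 c2] := cderiv_cst (0 : C) x.
by have [_ ->] := cderiv_near h c1.
Qed.

Lemma bounded_in_supp b f c : bounded_in b f c -> supp_in b f.
Proof. by rewrite /bounded_in; case: F => [p p1 []|k []]. Qed.

Lemma bounded_in_ge0 b f c : bounded_in b f c -> 0 <= c.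
Proof.
rewrite /bounded_in; case: F => [p p1 [_ _ fc]|k [_ /Ck_bound_ge0]] //.
by rewrite -lee_fin; apply: le_trans fc; exact: Lnorm_ge0.
Qed.

Lemma bounded_in_mono b b' f c d : b <= b' -> c <= d -> bounded_in b f c -> bounded_in b' f d.
Proof.
move=> bb cd; have S : supp_in b f -> supp_in b' f by move=> sf x /(le_lt_trans bb); exact: sf.
rewrite /bounded_in; case: F => [p p1 [mf /S sf fc]|k [/S sf]]; last by move=> /(Ck_bound_mono cd).
by split=> //; apply: le_trans fc _; rewrite lee_fin.
Qed.

Lemma bounded_inZ b z f c : bounded_in b f c -> bounded_in b (fun x => z * f x) (cabs z * c).
Proof.
have S : supp_in b f -> supp_in b (fun x => z * f x) by move=> sf x /sf ->; rewrite mulr0.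
rewrite /bounded_in; case: F => [p p1 [mf sf fc]|k [sf fc]].
  split; [by apply: cmfM => //; exact: cmf_cst|exact: S|].
  under eq_fun do rewrite cabsM.
  rewrite LnormMl ?cabs_ge0 //; last exact: cmf_cabs.
  by rewrite EFinM lee_wpmul2l // lee_fin cabs_ge0.
by split; [exact: S|exact: Ck_boundZ].
Qed.

Lemma bounded_inD b f g c d : bounded_in b f c -> bounded_in b g d ->
  bounded_in b (fun x => f x + g x) (c + d).
Proof.
have S : supp_in b f -> supp_in b g -> supp_in b (fun x => f x + g x).
  by move=> sf sg x xb; rewrite sf // sg // addr0.
rewrite /bounded_in; case: F => [p p1 [mf sf fc] [mg sg gd]|k [sf fc] [sg gd]]; last first.
  by split; [exact: S|exact: Ck_boundD].
have m1 := cmf_cabs mf; have m2 := cmf_cabs mg; have mfg := cmfD mf mg.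
split=> //; first exact: S.
rewrite EFinD; apply: le_trans (leeD fc gd); apply: le_trans (eminkowski mu m1 m2 p1).
apply: le_ae_Lnorm => //; [exact: cmf_cabs|exact: measurable_funD|].
by apply: aeT => x /=; rewrite !ger0_norm ?addr_ge0 ?cabs_ge0 // cabsD.
Qed.

Lemma bounded_inB b f g c d : bounded_in b f c -> bounded_in b g d ->
  bounded_in b (fun x => f x - g x) (c + d).
Proof.
move=> hf /(bounded_inZ (-1)) hg; have := bounded_inD hf hg.
rewrite cabsN (_ : cabs (1 : C) = 1) ?mul1r; last by rewrite (cabs_nat R 1).
by under eq_fun do rewrite mulN1r.
Qed.

Lemma bounded_in_L1 b : 0 <= b -> exists2 D, 0 <= D & forall f c, bounded_in b f c ->
  L1 f /\ \int[mu]_x cabs (f x) <= D * c.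
Proof.
move=> b0; rewrite /bounded_in; case: F => [p p1|k].
  by have [D D0 h] := L1_Lnorm p1 b0; exists D => // f c [mf sf fc]; exact: h.
exists (2 * b); first by rewrite mulr_ge0.
by move=> f c [sf /Ck_bound0]; exact: Ck_bound_L1.
Qed.

Lemma multiplier_in_L1 b : 0 <= b -> forall f c, multiplier_in b f c ->
  L1 f /\ \int[mu]_x cabs (f x) <= 2 * b * c.
Proof.
move=> b0 f c; rewrite /multiplier_in; case: F => [p p1 [mf sf fc]|k [sf /Ck_bound0]]; last exact: Ck_bound_L1.
have E x : cabs (f x) <= c * ind (- b <= x <= b).
  by rewrite -norm_itv; have [xb|/sf ->] := leP `|x| b; rewrite ?mulr1 // cabs0 mulr0.
have lf : L1 f by apply: (L1_dom mf E); exact/rL1Z/rL1_itv.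
split=> //; apply: (@le_trans _ _ (\int[mu]_x (c * ind (- b <= x <= b)))).
  by apply: Rint_le; [exact: L1_cabs|exact/rL1Z/rL1_itv|].
rewrite RintZ ?Rint_itv1; [|lra|exact: rL1_itv].
by rewrite le_eqVlt; apply/orP; left; apply/eqP; ring.
Qed.

Lemma multiplier_in_bounded b : 0 <= b -> exists2 D, 0 <= D & forall f c, multiplier_in b f c ->
  bounded_in b f (D * c).
Proof.
move=> b0; rewrite /multiplier_in /bounded_in; case: F => [p p1|k]; last first.
  by exists 1 => // f c; rewrite mul1r.
have S := Lnorm_itv p1 b0; set NS := N p _ in S.
have SE : NS = (fine NS)%:E by rewrite fineK // ge0_fin_numE ?Lnorm_ge0.
exists (fine NS); first by rewrite fine_ge0 ?Lnorm_ge0.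
move=> f c [mf sf fc]; have c0 : 0 <= c by apply: le_trans (fc 0); exact: cabs_ge0.
have mI : measurable_fun setT (fun x : R => ind (- b <= x <= b) : R) by exact: (rL1_meas (rL1_itv _ _)).
split=> //; rewrite mulrC EFinM -SE -LnormMl //; apply: le_ae_Lnorm => //.
- exact: cmf_cabs.
- by apply: measurable_funM.
apply: aeT => x; rewrite -norm_itv ger0_norm ?cabs_ge0 //.
have [xb|/sf ->] := leP `|x| b; last by rewrite cabs0.
by rewrite mulr1 ger0_norm.
Qed.

End FunctionSpace.

(** * Comparison with the test space and bounds for the transpose *)

Section FcBounds.
Context {R : realType}.
Local Notation C := (complex R).
Local Notation mu := (@lebesgue_measure R).
Variables (a : R) (F : fspace R).
Hypothesis a0 : 0 < a.
Local Notation I := [set` `](- a), a[].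

Let mI : measurable (I : set R). Proof. exact: measurable_itv. Qed.

Section FixedBall.
Variable b : R.
Hypothesis b0 : 0 < b < a.

Let ballI x : `|x| <= b -> I x.
Proof. by rewrite ler_norml /= in_itv /=; have := b0; lra. Qed.

Let supp_off f : supp_in b f -> vanishes_off I f.
Proof. by move=> sf x Ix; apply: sf; rewrite ltNge; apply/negP => /ballI. Qed.

Lemma inCk_iter_bounded k (f : R -> C) : inCk k I f -> exists2 c, 0 <= c &
  forall j x, (j <= k)%N -> `|x| <= b -> cabs (iter j (@cderiv R) f x) <= c.
Proof.
have [b1 ba] := andP b0.
have B (f' : R -> C) k' : inCk k' I f' -> exists2 c, 0 <= c & forall x, `|x| <= b -> cabs (f' x) <= c.
  move=> /inCk0 hf; have [Q hQ] := continuous_bounded b0 hf.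
  by exists Q => //; apply: le_trans (hQ 0 _); rewrite ?cabs_ge0 // normr0 ltW.
elim: k f => [|k IH] f hf.
  have [c c0 hc] := B _ _ hf; exists c => // j x; rewrite leqn0 => /eqP ->; exact: hc.
have [c c0 hc] := B _ _ hf; have [_ /IH[d d0 hd]] := (proj1 (inCkS _ _ _)) hf.
exists (c + d); first exact: addr_ge0.
move=> [|j] x jk xb; first by apply: le_trans (hc x xb) _; rewrite lerDl.
by rewrite iterSr; apply: le_trans (hd j x jk xb) _; rewrite lerDr.
Qed.

Lemma bounded_in_Fc f c : bounded_in F b f c ->
  test_fun (Fc I F) f /\ (normF F [set` `[(- b)%R, b]] f <= c%:E)%E.
Proof.
have [b1 ba] := andP b0.
rewrite /bounded_in /=; case: F => [p p1 [mf sf fc]|k [sf fc]].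
  have E := cLnorm_off p (proj2 (vanishes_offE b f) sf).
  split; last by rewrite /= E.
  split; last exact: supp_compact_support sf.
  split; last by rewrite (cLnorm_off p (supp_off sf)); exact: le_lt_trans fc (ltry _).
  by case: mf => m1 m2; split; exact: measurable_funTS.
have c0 := Ck_bound_ge0 fc; have [f1 f2] := proj1 (inCk_bound b0 k c0 sf) fc.
split; first by split=> //; exact: supp_compact_support sf.
rewrite /= bigmax_le ?lee_fin // => j _.
apply: ub_ereal_sup => _ [x /= xb <-]; rewrite lee_fin; apply: f2; first by case: j.
by rewrite norm_itv; rewrite in_itv in xb.
Qed.

Lemma Fc_bounded_in f J c : test_fun (Fc I F) f -> compact J -> vanishes_off J f ->
  (forall x, J x -> `|x| <= b) -> (normF F J f <= c%:E)%E -> bounded_in F b f c.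
Proof.
move=> [] + _ cJ fJ Jb; have sf : supp_in b f.
  by move=> x xb; apply: fJ => /Jb; rewrite leNgt xb.
rewrite /bounded_in /=; case: F => [p p1 [mf _] fc|k fI fc] /=.
  rewrite -(cLnorm_off p fJ); split=> //; exact: cmf_off mI mf (supp_off sf).
have c0 : 0 <= c by rewrite -lee_fin; apply: le_trans fc; exact: bigmax_ge_id.
split=> //; apply/(inCk_bound b0 k c0 sf); split=> // j x jk xb.
(* The norm is taken over [J] only. As [J] is closed, [f] vanishes on an open complement, and so do
   its derivatives. *)
have [Jx|Jx] := pselect (J x); last first.
  by rewrite (iter_cderiv_off j (compact_closed (@norm_hausdorff _ _) cJ) fJ Jx) cabs0.
rewrite -lee_fin; apply: le_trans fc.
apply: (bigmax_sup (Ordinal (jk : (j < k.+1)%N))) => //.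
by apply: ereal_sup_ubound; exists x.
Qed.

Lemma Fc_ex_bounded f : test_fun (Fc I F) f -> supp_in b f -> exists c, bounded_in F b f c.
Proof.
move=> [] + _ sf; rewrite /bounded_in /=; case: F => [p p1 [mf fp]|k fI] /=.
  move: fp; rewrite (cLnorm_off p (supp_off sf)); set N := Lnorm _ _ _ => fp.
  exists (fine N); split=> //; first exact: cmf_off mI mf (supp_off sf).
  by rewrite fineK // ge0_fin_numE // Lnorm_ge0.
have [c c0 hc] := inCk_iter_bounded fI.
by exists c; split=> //; apply/(inCk_bound b0 k c0 sf).
Qed.

End FixedBall.

Lemma inFloc_locL1 (q : R -> C) : inFloc I F q -> locL1 a q.
Proof.
move=> hq b b0; have [b1 ba] := andP b0; have bn := ltW b1.
have ballI : [set` `[- b, b]] `<=` I by move=> x; rewrite /= !in_itv /=; lra.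
have off : vanishes_off [set` `[- b, b]] (cutoff b q) by apply/vanishes_offE; exact: supp_cutoff.
move: hq; case: F => [p p1 /(_ _ (@segment_compact _ (- b) b) ballI)[mq Nq]|k /inCk0 {}hq].
  have E x : [set` `[- b, b]] x -> q x = cutoff b q x.
    by rewrite /= in_itv /= -norm_itv /cutoff => ->; rewrite mul1r.
  have mc : cmf (cutoff b q).
    apply: (@cmf_off R _ _ (measurable_itv `[- b, b]) _ off).
    by case: mq => m1 m2; split; [apply: eq_measurable_fun m1|apply: eq_measurable_fun m2] => x;
      rewrite inE => /E; rewrite /re /im => ->.
  have [D D0 hD] := L1_Lnorm p1 bn.
  set N := cLnorm _ _ _ in Nq.
  have := hD (cutoff b q) (fine N) mc (@supp_cutoff _ b q); case=> //.
  rewrite fineK; last by rewrite ge0_fin_numE // Lnorm_ge0.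
  rewrite -(cLnorm_off p off) le_eqVlt; apply/orP; left; apply/eqP; apply: eq_Lnorm => x /=.
  by congr (_%:E); rewrite !patchE; case: ifPn => //; rewrite inE /= => /E ->.
have [Q hQ] := continuous_bounded b0 hq.
(* Nothing is known about [q] off [I]; composing with [clamp] gives a function continuous on the
   line with the same cut-off. *)
have E : cutoff b q = cutoff b (q \o clamp b).
  apply/funext => x; rewrite /cutoff /=; have [xb|] := leP `|x| b; last by rewrite !mul0r.
  by rewrite clampE.
rewrite E; apply: (@L1_cutoff _ _ _ Q); last by move=> x xb /=; apply: hQ; exact: clamp_le b0 _.
apply: continuous_cmf => x; apply: (@continuous_comp _ _ _ (clamp b) (q : R -> C^o)).
  exact: (@continuous_clamp R b x).
apply: (proj2 hq); apply: ballI; rewrite /= in_itv /= -norm_itv; exact: clamp_le b0 _.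
Qed.

Section Transmuted.
Variables (q : R -> C) (H : R * R -> C) (b : R).
Hypothesis b0 : 0 < b < a.
Hypothesis hq : inFloc I F q.
Hypothesis HG : goursat_solution a q H.
Local Notation k := (tker b (Hc b H)).
Local Notation T := (TopT b (Hc b H)).

Let bn : 0 <= b. Proof. by case/andP: b0 => /ltW. Qed.
Let lq : L1 (cutoff b q). Proof. exact: inFloc_locL1 b0. Qed.
Let mH := cmf_Hc b0 HG.
Let mk : cmf (fun p : R * R => k p.1 p.2) := cmf_tker b mH.

Let kopT_nice : exists2 M : R, 0 <= M & forall f, L1 f ->
  cmf (kopT k f) /\ forall x, cabs (kopT k f x) <= M * \int[mu]_x cabs (f x).
Proof.
have [M hM] := Hc_bounded b0 HG; have kM := tker_bound b hM.
have M0 : 0 <= M by apply: le_trans (hM 0 0); exact: cabs_ge0.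
exists M => // f lf; split; first exact: L1_cmf (kopT_L1 bn mk kM lf).
move=> x; apply: le_trans (kopT_le bn mk kM x lf) _; rewrite ler_wpM2r ?ler_piMr ?ind_le1 //.
by apply: Rintegral_ge0 => r _; exact: cabs_ge0.
Qed.

Lemma bounded_inT : exists2 D, 0 <= D & forall f c, bounded_in F b f c -> bounded_in F b (T f) (D * c).
Proof.
move: hq; case: F => [p p1 _|n hqn].
  have [M M0 hM] := kopT_nice; have [D D0 hD] := bounded_in_L1 (Lp p p1) bn.
  have [E E0 hE] := multiplier_in_bounded (Lp p p1) bn.
  exists (1 + E * (M * D)); first by rewrite addr_ge0 // !mulr_ge0.
  move=> f c fc; have [lf intf] := hD f c fc; have [m1 m2] := hM f lf.
  rewrite mulrDl mul1r -mulrA -mulrA; apply: bounded_inD => //; apply: hE; split=> //.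
    exact: kopT_supp.
  by move=> x; apply: le_trans (m2 x) _; rewrite ler_wpM2l.
have [D D0 hD] := ball_Ck b0 HG lq hqn; exists D => // f c [sf fc].
by split; [exact: TopT_supp|exact: hD].
Qed.

Lemma bounded_in_inverse : exists2 D, 0 <= D & forall psi f c, L1 psi -> supp_in b psi ->
  T psi = f -> bounded_in F b f c -> bounded_in F b psi (D * c).
Proof.
have [D1 D10 inv] := ball_inverse b0 HG.
move: hq; case: F => [p p1 _|n hqn].
  have [M M0 hM] := kopT_nice; have [D D0 hD] := bounded_in_L1 (Lp p p1) bn.
  have [E E0 hE] := multiplier_in_bounded (Lp p p1) bn.
  exists (1 + E * (M * (D1 * D))); first by rewrite addr_ge0 // !mulr_ge0 // ltW.
  move=> psi f c lp sp TE fc; have [lf intf] := hD f c fc; have [m1 m2] := hM psi lp.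
  have [_ /(_ psi lp sp TE) h] := inv f lf (bounded_in_supp fc).
  have -> : psi = fun x => f x - kopT k psi x by apply/funext => x; rewrite -TE /TopT addrK.
  rewrite mulrDl mul1r -mulrA -mulrA -mulrA; apply: bounded_inB => //; apply: hE; split=> //.
    exact: kopT_supp.
  move=> x; apply: le_trans (m2 x) _; rewrite ler_wpM2l //; apply: le_trans h _.
  by rewrite ler_wpM2l // ltW.
have [D D0 hD] := ball_inverse_Ck b0 HG lq hqn; exists D => // psi f c lp sp TE [sf fc].
by split=> //; exact: (hD psi f).
Qed.

(** The term [q * psi] in the second derivative of [psi] has to lie in [F]. For L^p this requires a
    bounded [psi], so an L^p bound on it would not do. *)
Lemma multiplier_in_inverse : exists2 D, 0 <= D & forall psi f c, L1 psi -> supp_in b psi ->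
  T psi = f -> multiplier_in F b f c -> multiplier_in F b psi (D * c).
Proof.
have [D1 D10 inv] := ball_inverse b0 HG.
move: hq; case: F => [p p1 _|n hqn].
  have [M M0 hM] := kopT_nice.
  exists (1 + M * (D1 * (2 * b))); first by rewrite addr_ge0 // !mulr_ge0 // ltW.
  move=> psi f c lp sp TE fc; have [lf intf] := multiplier_in_L1 bn fc; have [m1 m2] := hM psi lp.
  have [mf sf fx] := fc; have [_ /(_ psi lp sp TE) h] := inv f lf sf.
  split=> //; first exact: L1_cmf.
  move=> x; have -> : psi x = f x - kopT k psi x by rewrite -TE /TopT addrK.
  rewrite mulrDl mul1r -mulrA -mulrA; apply: le_trans (cabsB _ _) _; apply: lerD => //.
  apply: le_trans (m2 x) _; rewrite ler_wpM2l //; apply: le_trans h _.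
  by rewrite ler_wpM2l // ltW.
have [D D0 hD] := ball_inverse_Ck b0 HG lq hqn; exists D => // psi f c lp sp TE [sf fc].
by split=> //; exact: (hD psi f).
Qed.

Lemma multiplier_in_pot : exists2 D, 0 <= D & forall h c, bounded_in F b h c ->
  Int h = 0 -> Int (fun x => h x * x%:C) = 0 -> multiplier_in F b (pot h) (D * c).
Proof.
case: F => [p p1|n].
  have [D D0 hD] := bounded_in_L1 (Lp p p1) bn; exists (2 * b * D); first by rewrite !mulr_ge0.
  move=> h c hc h0 h1; have [lh inth] := hD h c hc; have sh := bounded_in_supp hc.
  split; [exact: L1_cmf (L1_pot bn lh sh h0 h1)|by move=> x /ltW; exact: (pot_supp lh sh h0 h1)|].
  move=> x; apply: le_trans (cabs_pot_le bn lh sh h0 h1 x) _.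
  by rewrite -(mulrA (2 * b)) ler_wpM2l // mulr_ge0.
exists ((1 + 2 * b) ^+ 2); first exact: sqr_ge0.
move=> h c [sh hc] h0 h1; have [lh _] := Ck_bound_L1 bn sh (Ck_bound0 hc).
split; first by move=> x /ltW; exact: (pot_supp lh sh h0 h1).
by apply: Ck_bound_pred; apply: Ck_bound_pred; exact: Ck_bound_pot.
Qed.

Lemma bounded_in_mul : exists2 D, 0 <= D & forall f c, multiplier_in F b f c ->
  bounded_in F b (fun x => q x * f x) (D * c).
Proof.
have S f : supp_in b f -> supp_in b (fun x => q x * f x) by move=> sf x /sf ->; rewrite mulr0.
have [b1 ba] := andP b0.
have off : vanishes_off [set` `[- b, b]] (cutoff b q) by apply/vanishes_offE; exact: supp_cutoff.
move: hq; case: F => [p p1|n hqn]; last first.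
  have [D D0 hD] := Ck_bound_mul b0 hqn; exists D => // f c [sf fc].
  by split; [exact: S|exact: hD].
have ballI : [set` `[- b, b]] `<=` I by move=> x; rewrite /= !in_itv /=; lra.
move=> /(_ _ (@segment_compact _ (- b) b) ballI)[mq Nq].
set N := cLnorm _ _ _ in Nq.
have NE : cLnorm p setT (cutoff b q) = (fine N)%:E.
  rewrite fineK; last by rewrite ge0_fin_numE // Lnorm_ge0.
  apply: eq_Lnorm => x /=; congr (_%:E); rewrite !patchE in_setT /cutoff.
  case: ifPn; first by rewrite inE /= in_itv /= -norm_itv => ->; rewrite mul1r.
  move=> /negP; rewrite inE /= in_itv /= -norm_itv => /negP/negbTE ->.
  by rewrite mul0r cabs0.
exists (fine N); first by rewrite fine_ge0 ?Lnorm_ge0.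
move=> f c [mf sf fc]; have c0 : 0 <= c by apply: le_trans (fc 0); exact: cabs_ge0.
have E : (fun x => q x * f x) = (fun x => cutoff b q x * f x).
  apply/funext => x; have [xb|/sf ->] := leP `|x| b; last by rewrite !mulr0.
  by rewrite /cutoff xb [ind true * q x]mul1r.
have mc := L1_cmf lq.
rewrite E; split; [exact: cmfM|by rewrite -E; exact: S|].
have -> : (fine N * c)%:E = ('N[mu]_p [EFin \o (fun x => (c * cabs (cutoff b q x))%R)])%E.
  rewrite LnormMl //; last exact: cmf_cabs.
  by rewrite mulrC EFinM -NE (@cLnorm_off R p setT) // => x [].
apply: le_ae_Lnorm => //; first by exact: cmf_cabs (cmfM _ _).
  by apply: measurable_funM => //; exact: cmf_cabs.
apply: aeT => x; rewrite !ger0_norm ?mulr_ge0 ?cabs_ge0 // cabsM mulrC.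
by rewrite ler_wpM2r ?cabs_ge0.
Qed.

End Transmuted.
End FcBounds.

(** * Functions with a second weak derivative *)

Section SecondOrder.
Context {R : realType}.
Local Notation C := (complex R).
Local Notation mu := (@lebesgue_measure R).

Lemma ae_cderiv_prim (f : R -> C) : L1 f -> {ae mu, forall x, cderiv (prim f) x = f x}.
Proof.
have P (g : R -> R) : rL1 g -> {ae mu, forall x, derive1 (fun y => \int[mu]_t (ind (t <= y) * g t)) x = g x}.
  move=> lg; have E y : \int[mu]_t (ind (t <= y) * g t) = \int[mu]_(t in [set` `]-oo, y]]) g t.
    rewrite [RHS]Rintegral_mkcond; apply: eq_Rintegral => t _; rewrite patchE.
    rewrite [X in if X then _ else _](_ : _ = (t <= y)); last by apply/idP/idP; rewrite inE /= in_itv.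
    by case: (t <= y); rewrite ?mul1r ?mul0r.
  rewrite (funext E); apply: aeS (@FTC1Ny _ g _ _) => [x []//|y|].
    exact: integrableS lg.
  by apply: (open_integrable_locally openT); exact: integrableS lg.
move=> [f1 f2]; apply: aeS (aeI (P _ f1) (P _ f2)) => x [e1 e2].
have [E1 E2] : re (prim f) = (fun y => \int[mu]_t (ind (t <= y) * re f t)) /\
    im (prim f) = (fun y => \int[mu]_t (ind (t <= y) * im f t)).
  by split; apply/funext => y; rewrite /re /im /prim /Int /=; apply: eq_Rintegral => t _;
    rewrite /re /im natC CplxE /= mul0r ?subr0 ?addr0.
by apply: cplxP; rewrite /= ?E1 ?E2.
Qed.

Lemma continuous_prim (f : R -> C) x : L1 f -> {for x, continuous (prim f : R -> C^o)}.
Proof.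
move=> lf; apply: (@Int_continuous _ (fun x t => ind (t <= x) * f t) (fun t => cabs (f t))).
- by move=> y; exact: L1_cmf (prim_integrand y lf).
- exact: L1_cabs.
- move=> y t; case: (t <= y); last by rewrite mul0r cabs0 cabs_ge0.
  by rewrite [ind true * _]mul1r.
apply: aeS (ae_neq x) => t tx; have [xt|xt|xt] := ltgtP t x; last by rewrite xt eqxx in tx.
  apply: (@continuousC_near _ (fun=> f t)); last exact: continuousC_cst.
  have := lt_nbhsr xt; apply: filterS => y ty.
  by rewrite (ltW ty) [ind true * _]mul1r.
apply: (@continuousC_near _ (fun=> 0)); last exact: continuousC_cst.
have := lt_nbhsl xt; apply: filterS => y ty.
by rewrite leNgt ty mul0r.
Qed.

Lemma cmeasurable_cabs D (f : R -> C) : measurable D -> cmeasurable D f ->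
  measurable_fun setT ((@cabs R \o f) \_ D).
Proof.
move=> mD [m1 m2]; apply/(measurable_restrictT _ mD).
rewrite (_ : @cabs R \o f = (fun x => Num.sqrt (re f x ^+ 2 + im f x ^+ 2))); last first.
  by apply/funext => x; rewrite /= cabsE.
apply: (@measurableT_comp _ _ _ _ _ _ (@Num.sqrt R)).
  by apply: continuous_measurable_fun; exact: sqrt_continuous.
by apply: measurable_funD; apply: measurable_funX.
Qed.

Lemma cLnorm_subset (p : \bar R) J D (f : R -> C) : (1 <= p)%E -> measurable J -> measurable D ->
  J `<=` D -> cmeasurable D f -> (cLnorm p J f <= cLnorm p D f)%E.
Proof.
move=> p1 mJ mD JD mf; have [m1 m2] := mf.
have mf' : cmeasurable J f by split; exact: measurable_funS JD _.
apply: le_ae_Lnorm => //; [exact: cmeasurable_cabs|exact: cmeasurable_cabs|].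
apply: aeT => x; rewrite !patchE; case: ifPn => [|_]; last by rewrite normr0.
by rewrite inE => /JD xD; rewrite mem_set.
Qed.

Variables (a : R) (F : fspace R).
Hypothesis a0 : 0 < a.
Local Notation I := [set` `](- a), a[].

Let mI : measurable (I : set R). Proof. exact: measurable_itv. Qed.

Lemma is_wderiv_eq_on (f f' g g' : R -> C) : (forall x, I x -> f x = f' x) ->
  (forall x, I x -> g x = g' x) -> is_wderiv I f g -> is_wderiv I f' g'.
Proof.
move=> ff gg h eta e1 e2; have := h eta e1 e2.
have E (u u' : R -> C) : (forall x, I x -> u x = u' x) -> cint I u = cint I u'.
  move=> uu; rewrite !cintE; congr Int; apply/funext => x.
  have [xI|xI] := boolP (x \in I); last by rewrite !mul0r.
  by rewrite uu //; rewrite inE in xI.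
rewrite (E _ (fun x => f' x * cderiv eta x)); last by move=> x /ff ->.
by rewrite (E (fun x => g x * eta x) (fun x => g' x * eta x)) // => x /gg ->.
Qed.

Lemma is_wderiv_ae (f f' g g' : R -> C) : locL1 a f -> locL1 a f' -> locL1 a g -> locL1 a g' ->
  {ae mu, forall x, I x -> f x = f' x} -> {ae mu, forall x, I x -> g x = g' x} ->
  is_wderiv I f g -> is_wderiv I f' g'.
Proof.
move=> lf lf' lg lg' ff gg h; apply: (test_is_wderiv a0) => eta te.
have := is_wderiv_test a0 h te.
have [c [D [c0 [s1 s2] m1 m2 bD]]] := test_facts a0 te.
have E (u u' e : R -> C) : locL1 a u -> locL1 a u' -> {ae mu, forall x, I x -> u x = u' x} ->
    supp_in c e -> cmf e -> (forall x, cabs (e x) <= D) ->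
    Int (fun x => u x * e x) = Int (fun x => u' x * e x).
  move=> lu lu' uu se me eD; apply: Int_ae.
  - exact: L1_cmf (locL1_test lu c0 se me eD).
  - exact: L1_cmf (locL1_test lu' c0 se me eD).
  apply: aeS uu => x e1; have [xI|xb] := in_or_out c0 x; first by rewrite e1.
  by rewrite (se x xb) !mulr0.
have [me me'] := cmf_test a0 te.
rewrite (E f f') //; last by move=> x; case: (bD x).
by rewrite (E g g') // => x; case: (bD x).
Qed.

Lemma inLp1_L1 (g : R -> C) : inLp 1%E I g -> exists2 g', L1 g' & forall x, I x -> g x = g' x.
Proof.
move=> [mg Ng]; pose g' x : C := if x \in I then g x else 0.
have E x : I x -> g x = g' x by move=> xI; rewrite /g' mem_set.
exists g' => //.
have off : vanishes_off I g' by move=> x xI; rewrite /g' memNset.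
have mg' : cmf g'.
  apply: cmf_off mI _ off.
  by case: mg => m1 m2; split; [apply: eq_measurable_fun m1|apply: eq_measurable_fun m2] => x;
    rewrite inE => /E; rewrite /re /im => ->.
have sg : supp_in a g'.
  by move=> x xa; apply: off; rewrite /= in_itv /= -ltr_norml => /(lt_trans xa); rewrite ltxx.
have [D D0 hD] := L1_Lnorm (lexx 1%E) (ltW a0).
case: (hD g' (fine (cLnorm 1%E I g)) mg' sg) => //.
rewrite fineK; last by rewrite ge0_fin_numE // Lnorm_ge0.
rewrite -(cLnorm_off 1%E off) le_eqVlt; apply/orP; left; apply/eqP; apply: eq_Lnorm => x /=.
by congr (_%:E); rewrite !patchE; case: ifPn => //; rewrite inE /= => /E ->.
Qed.

Lemma L1_inLp1 (g : R -> C) : L1 g -> inLp 1%E I g.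
Proof.
move=> lg; have [m1 m2] := L1_cmf lg; split; first by split; exact: measurable_funTS.
apply: le_lt_trans (_ : 'N[mu]_1[EFin \o (fun x => cabs (g x))] < +oo)%E; last first.
  rewrite Lnorm1 (_ : (\int[mu]_x _)%E = (\int[mu]_x (cabs (g x))%:E)%E).
    by rewrite (rL1_fin (L1_cabs lg)) ltry.
  by apply: eq_integral => x _ /=; rewrite ger0_norm ?cabs_ge0.
have mc := cmf_cabs (L1_cmf lg).
apply: le_ae_Lnorm => //; first by apply/(measurable_restrictT _ mI); exact: measurable_funTS.
apply: aeT => x; rewrite patchE; case: ifPn => //= _; by rewrite normr0.
Qed.

Let nearI x : I x -> \near x, I x.
Proof. by move=> xI; exact: (near_in_itvoo xI). Qed.

Lemma inCk_eq_on k (f g : R -> C) : (forall x, I x -> f x = g x) -> inCk k I f -> inCk k I g.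
Proof.
elim: k f g => [|k IH] f g fg.
  move=> [_ cf]; split=> [j x|x xI]; first by rewrite ltn0.
  apply: continuousC_near (cf x xI).
  by apply: filterS (nearI xI).
move=> /inCkS[d1 d2]; apply/inCkS.
have D x : I x -> cderivable g x /\ cderiv g x = cderiv f x.
  by move=> xI; apply: cderiv_near (d1 x xI); apply: filterS (nearI xI).
split; first by move=> x /D[].
by apply: IH d2 => x /D[].
Qed.

Lemma Fc_ball (f : R -> C) : test_fun (Fc I F) f -> exists2 b, 0 < b < a & supp_in b f.
Proof. by move=> [_ /(compact_support_ball a0)]. Qed.

Lemma Fc_L1 (f : R -> C) : test_fun (Fc I F) f -> L1 f.
Proof.
move=> hf; have [b b0 sf] := Fc_ball hf; have [c fc] := Fc_ex_bounded b0 hf sf.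
have [b1 ba] := andP b0.
by have [D D0 hD] := bounded_in_L1 F (ltW b1); case: (hD _ _ fc).
Qed.

(** [wderiv2] is a choice known only up to a null set; this makes every norm independent of that
    choice. For C^k, continuity gives equality of the functions. *)
Lemma Fc_ae_eq (f g : R -> C) : test_fun (Fc I F) f -> test_fun (Fc I F) g ->
  {ae mu, forall x, I x -> f x = g x} ->
  (forall J, measurable J -> normF F J (fun x => f x - g x) = 0%E) /\
  (forall J, measurable J -> normF F J f = normF F J g).
Proof.
move=> hf hg fg.
have [b1 b10 sf] := Fc_ball hf; have [b2 b20 sg] := Fc_ball hg.
have mf := L1_cmf (Fc_L1 hf); have mg := L1_cmf (Fc_L1 hg).
have {}fg : {ae mu, forall x, f x = g x}.
  apply: aeS fg => x e; have [xI|x1] := in_or_out b10 x; first exact: e.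
  have [xI|x2] := in_or_out b20 x; first exact: e.
  by rewrite sf // sg.
have [c1 fc] := Fc_ex_bounded b10 hf sf; have [c2 gc] := Fc_ex_bounded b20 hg sg.
move: fc gc; rewrite /bounded_in /normF; case: F => [p p1 _ _|k [_ fc] [_ gc]]; last first.
  have -> : f = g.
    by apply: continuous_ae_eq => // x; [exact: Ck_bound_continuous fc|exact: Ck_bound_continuous gc].
  split=> // J mJ; apply/eqP; rewrite eq_le; apply/andP; split; last exact: bigmax_ge_id.
  apply: bigmax_le => // j _; apply: ub_ereal_sup => _ [x Jx <-]; rewrite lee_fin.
  have -> : (fun x => g x - g x) = fun=> 0 by apply/funext => y; rewrite subrr.
  suff -> : iter j (@cderiv R) (fun=> 0) x = 0 by rewrite cabs0.
  by apply: (@iter_cderiv_off R set0 (fun=> 0) j closed0) => // y.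
have mc (u : R -> C) J : measurable J -> cmf u -> measurable_fun setT ((@cabs R \o u) \_ J).
  by move=> mJ mu'; apply/(measurable_restrictT _ mJ); apply: measurable_funTS; exact: cmf_cabs.
have ae_le (u v : R -> C) J : measurable J -> cmf u -> cmf v -> {ae mu, forall x, u x = v x} ->
    (cLnorm p J u <= cLnorm p J v)%E.
  move=> mJ mu' mv uv; apply: le_ae_Lnorm => //; [exact: mc|exact: mc|].
  by apply: aeS uv => x e; rewrite !patchE /= e.
have ae_eq (u v : R -> C) J : measurable J -> cmf u -> cmf v -> {ae mu, forall x, u x = v x} ->
    cLnorm p J u = cLnorm p J v.
  move=> mJ mu' mv uv; apply/eqP; rewrite eq_le !ae_le //; by apply: aeS uv => x ->.
split=> J mJ; last exact: ae_eq.
have fg0 : {ae mu, forall x, f x - g x = 0} by apply: aeS fg => x ->; rewrite subrr.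
rewrite (ae_eq (fun x => f x - g x) (fun=> 0) J mJ (cmfB mf mg) (cmf_cst 0) fg0).
rewrite -[RHS](@Lnorm0 _ _ _ mu p); last by apply/eqP => p0; move: p1; rewrite p0 lee_fin ler10.
by apply: eq_Lnorm => x /=; rewrite patchE /= cabs0; case: ifP.
Qed.

(* [h] is the second derivative of [phi]; its vanishing moments say that [phi]
   vanishes off [-b, b]. *)
Definition potential_of b (phi h : R -> C) : Prop :=
  [/\ L1 h, supp_in b h, Int h = 0, Int (fun x => h x * x%:C) = 0 & phi = pot h].

Section Potential.
Variables (b : R) (phi h : R -> C).
Hypothesis b0 : 0 < b < a.
Hypothesis ph : potential_of b phi h.

Let bn : 0 <= b. Proof. by case/andP: b0 => /ltW. Qed.
Let ba : b < a. Proof. by case/andP: b0. Qed.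

Lemma potential_supp : supp_in b phi.
Proof. by case: ph => lh sh h0 h1 -> x /ltW; exact: (pot_supp lh sh h0 h1). Qed.

Lemma potential_continuous x : {for x, continuous (phi : R -> C^o)}.
Proof. by case: ph => lh sh h0 h1 ->; exact: pot_continuous lh sh. Qed.

Lemma potential_L1 : L1 phi /\ L1 (prim h).
Proof. by case: ph => lh sh h0 h1 ->; split; [exact: L1_pot bn lh sh h0 h1|exact: L1_prim lh sh h0]. Qed.

(** [wderiv] is an arbitrary choice among the weak derivatives; uniqueness identifies it on [I] with
    [prim h] up to a null set. *)
Lemma potential_wderiv : [/\ inLp 1%E I (wderiv I phi), is_wderiv I phi (wderiv I phi)
  & {ae mu, forall x, I x -> wderiv I phi x = prim h x}].
Proof.
have [lh sh h0 h1 pE] := ph; have [w1 w2] := pot_is_wderiv a0 bn lh sh h0 h1.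
have [lp lpr] := potential_L1.
have [|g1 g2] := @xgetPex _ (fun=> 0) [set g | inLp 1%E I g /\ is_wderiv I phi g].
  by exists (prim h); split; [exact: L1_inLp1|rewrite pE].
split=> //; rewrite -/(wderiv I phi) in g1 g2.
have [g lg gE] := inLp1_L1 g1.
have w3 : is_wderiv I phi g by apply: is_wderiv_eq_on g2.
have w1' : is_wderiv I phi (prim h) by rewrite pE.
have := wderiv_unique a0 w3 w1' (L1_locL1 lg) (L1_locL1 lpr).
by apply: aeS => x e xI; rewrite gE // e.
Qed.

Hypothesis hF : test_fun (Fc I F) h.

Lemma potential_wderiv2 : [/\ inW2 I F phi, test_fun (Fc I F) (wderiv2 I F phi)
  & {ae mu, forall x, I x -> wderiv2 I F phi x = h x}].
Proof.
have [lh sh h0 h1 pE] := ph; have [w1 w2] := pot_is_wderiv a0 bn lh sh h0 h1.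
have [lp lpr] := potential_L1; have [g1 g2 g3] := potential_wderiv.
have [g lg gE] := inLp1_L1 g1.
have w3 : is_wderiv I (wderiv I phi) h.
  have w4 : is_wderiv I g h.
    apply: is_wderiv_ae w2; [exact: L1_locL1 lpr|exact: L1_locL1 lg|exact: L1_locL1 lh|exact: L1_locL1 lh| |exact: aeT].
    by apply: aeS g3 => x e xI; rewrite -gE // e.
  by apply: is_wderiv_eq_on w4 => // x xI; rewrite gE.
have [|d1 d2] := @xgetPex _ (fun=> 0) [set h | test_fun (Fc I F) h /\ is_wderiv I (wderiv I phi) h].
  by exists h.
rewrite -/(wderiv2 I F phi) in d1 d2; split=> //; last first.
  exact: (wderiv_unique a0 d2 w3 (L1_locL1 (Fc_L1 d1)) (L1_locL1 lh)).
split; last by exists h; split=> //; case: hF.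
split; [by move=> x _; exact: potential_continuous|exact: L1_inLp1|].
by exists (wderiv I phi).
Qed.

Lemma potential_W2c : test_fun (W2c I F) phi.
Proof.
by have [w _ _] := potential_wderiv2; split=> //; exact: supp_compact_support ba potential_supp.
Qed.

(** The norm is given over an arbitrary compact [J] that carries [phi], but [h] must be bounded on
    the line. Off the closed set [J] the derivative [prim h] vanishes with [phi], and then so does
    [h], almost everywhere for L^p and everywhere for C^k. *)
Lemma potential_bounded J c : compact J -> J `<=` I -> (forall x, J x -> `|x| <= b) ->
  vanishes_off J phi -> (normW2 I F J phi <= c%:E)%E -> bounded_in F b h c.
Proof.
move=> cJ JI Jb pJ Nc; have [lh sh h0 h1 pE] := ph.
have closedJ := compact_closed (@norm_hausdorff _ R) cJ.
have mJ : measurable J by exact: closed_measurable.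
have dphi : cderiv phi = prim h.
  rewrite pE (pot_prim bn lh sh h0 h1); apply/funext => x.
  have [_ lpr] := potential_L1.
  have cp : {for x, continuous (prim h : R -> C^o)} by exact: continuous_prim.
  by have [_ _] := prim_derive lpr cp.
have prJ : vanishes_off J (prim h).
  by rewrite -dphi; exact: (iter_cderiv_off 1 closedJ pJ).
have ddJ : vanishes_off J (cderiv (prim h)) by exact: (iter_cderiv_off 1 closedJ prJ).
have [_ w2F w2h] := potential_wderiv2.
have [_ NE] := Fc_ae_eq w2F hF w2h.
have Nh : (normF F J h <= c%:E)%E.
  by rewrite -NE //; apply: le_trans Nc; rewrite /normW2 leeDr // adde_ge0 // Lnorm_ge0.
have [d hd] := Fc_ex_bounded b0 hF sh.
move: (hF) Nh hd; rewrite /bounded_in /=; case: F => [p p1 _ Nh [mh _ _]|k hk Nh [_ hd]]; last first.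
  have hJ : vanishes_off J h.
    by move=> x /ddJ; have [_ _ ->] := prim_derive lh (Ck_bound_continuous (x := x) hd).
  exact: (Fc_bounded_in b0 hk cJ hJ Jb Nh).
split=> //; apply: le_trans Nh.
apply: le_ae_Lnorm => //; first exact: cmf_cabs.
  by apply/(measurable_restrictT _ mJ); apply: measurable_funTS; exact: cmf_cabs.
apply: aeS (ae_cderiv_prim lh) => x e; rewrite patchE; case: ifPn => // /negP xJ.
by rewrite -e ddJ ?cabs0 // => Jx; apply: xJ; rewrite inE.
Qed.

End Potential.

Lemma potential_normW2 b : 0 < b < a -> exists2 D, 0 <= D & forall phi h c,
  potential_of b phi h -> bounded_in F b h c -> (normW2 I F [set` `[(- b)%R, b]] phi <= (D * c)%:E)%E.
Proof.
move=> b0; have [b1 ba] := andP b0; have bn := ltW b1.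
have [D D0 hD] := bounded_in_L1 F bn.
have mB : measurable ([set` `[- b, b]] : set R) by exact: measurable_itv.
have BI : [set` `[- b, b]] `<=` I by move=> x; rewrite /= !in_itv /=; lra.
have L (g g' : R -> C) (M : R) : cmf g -> {ae mu, forall x, I x -> g' x = g x} -> cmeasurable I g' ->
    0 <= M -> (forall x, cabs (g x) <= M) -> (cLnorm 1%E [set` `[(- b)%R, b]] g' <= (2 * b * M)%:E)%E.
  move=> mg gg [m1 m2] M0 gM.
  have l1 : rL1 (fun x => M * ind (- b <= x <= b)) by exact/rL1Z/rL1_itv.
  have -> : (2 * b * M)%:E = ('N[mu]_1[EFin \o (fun x : R => (M * ind (- b <= x <= b)%R)%R)])%E.
    rewrite Lnorm1 (_ : (\int[mu]_x _)%E = (\int[mu]_x (M * ind (- b <= x <= b))%:E)%E); last first.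
      by apply: eq_integral => x _ /=; rewrite ger0_norm // mulr_ge0.
    rewrite (rL1_fin l1) RintZ ?Rint_itv1; [|lra|exact: rL1_itv].
    congr (_%:E); ring.
  apply: le_ae_Lnorm => //; last 2 first.
    exact: rL1_meas l1.
  - apply: aeS gg => x e; rewrite patchE; case: ifPn; last by rewrite normr0.
    rewrite inE => xB; rewrite /= e; last exact: BI.
    by move: xB; rewrite /= in_itv /= => ->; rewrite mulr1 !ger0_norm ?cabs_ge0.
  apply: cmeasurable_cabs => //; split; [exact: measurable_funS m1|exact: measurable_funS m2].
(* [D] compares the L^1 norm of [h] with its norm in [F]. The potential is at most [2 * b] times the
   L^1 norm and the primitive at most that norm; both are integrated over a length [2 * b]. *)
exists (2 * b * (2 * b * D) + 2 * b * D + 1); first by rewrite !addr_ge0 // !mulr_ge0.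
move=> phi h c ph hc; have [hF Nh] := bounded_in_Fc b0 hc; have [_ intE] := hD h c hc.
have c0 := bounded_in_ge0 hc.
have [lh sh h0 h1 pE] := ph; have [lp lpr] := potential_L1 b0 ph.
have i0 : 0 <= \int[mu]_x cabs (h x) by apply: Rintegral_ge0 => r _; exact: cabs_ge0.
have [[g1 _] _ g3] := potential_wderiv b0 ph; have [_ w2F w2h] := potential_wderiv2 b0 ph hF.
have [_ NE] := Fc_ae_eq w2F hF w2h.
have -> : (2 * b * (2 * b * D) + 2 * b * D + 1) * c = 2 * b * (2 * b * (D * c)) + 2 * b * (D * c) + c by ring.
rewrite /normW2 !EFinD; apply: leeD; first apply: leeD.
- apply: L; [exact: L1_cmf lp|exact: aeT| | |].
  + by have [m1 m2] := L1_cmf lp; split; exact: measurable_funTS.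
  + by rewrite !mulr_ge0.
  + move=> x; rewrite pE; apply: le_trans (cabs_pot_le bn lh sh h0 h1 x) _.
    by rewrite ler_wpM2l // mulr_ge0.
- apply: (L (prim h)) => //; [exact: L1_cmf lpr|exact: mulr_ge0|].
  by move=> x; apply: le_trans (prim_le x lh) _.
by rewrite NE.
Qed.

(** The second weak derivative is cut off at [b]; [second_weak] gives its moments and the potential
    formula almost everywhere, and continuity of [phi] makes the formula exact. From here on W^2_c
    is handled through the pairs [phi], [h]. *)
Lemma W2c_potential phi b : 0 < b < a -> test_fun (W2c I F) phi -> supp_in b phi ->
  exists2 h, potential_of b phi h & test_fun (Fc I F) h.
Proof.
move=> b0 [[w11 [g2 [g2F w2]]] cs] sp; have [b1 ba] := andP b0; have bn := ltW b1.
have [cphi lphi [g [gl wg]]] := w11.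
have [|g1 wg1] := @xgetPex _ (fun=> 0) [set g | inLp 1%E I g /\ is_wderiv I phi g]; first by exists g.
rewrite -/(wderiv I phi) in g1 wg1.
have [g' lg' gE] := inLp1_L1 g1.
have lp : L1 phi.
  (* [phi] is viewed in the test space of L^1, whatever [F] is. *)
  have hF : test_fun (Fc I (Lp 1%E (lexx _))) phi by [].
  have [c fc] := Fc_ex_bounded b0 hF sp.
  by have [D D0 hD] := bounded_in_L1 (Lp 1%E (lexx _)) bn; case: (hD _ _ fc).
have w1' : is_wderiv I phi g' by apply: is_wderiv_eq_on wg1.
have w2' : is_wderiv I g' g2 by apply: is_wderiv_eq_on w2.
have g2loc : inFloc I F g2.
  move: g2F; rewrite /inF /inFloc; case: F => [p p1 [[m1 m2] N2]|//] J cJ JI.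
  have mJ : measurable J.
    by apply: closed_measurable; exact: compact_closed (@norm_hausdorff _ R) cJ.
  split; first by split; exact: measurable_funS JI _.
  by apply: le_lt_trans N2; exact: cLnorm_subset.
have lg2 := inFloc_locL1 g2loc.
have [h0 h1 e1 e2] := second_weak a0 b0 sp lp lg' lg2 w1' w2'.
have [_ e3] := second_weak_supp a0 b0 sp lp lg' lg2 w1' w2'.
set h := cutoff b g2 in h0 h1 e1 e2 e3.
have lh : L1 h by exact: lg2.
have sh : supp_in b h by exact: supp_cutoff.
exists h; last first.
  split; last exact: supp_compact_support ba sh.
  move: g2F; rewrite /inF; case: F => [p p1 [[m1 m2] N2]|k hk].
    have [mh1 mh2] := L1_cmf lh; have mh : cmeasurable I h by split; exact: measurable_funTS.
    split=> //; apply: le_lt_trans N2; apply: le_ae_Lnorm => //; [exact: cmeasurable_cabs|exact: cmeasurable_cabs|].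
    apply: aeT => x; rewrite !patchE; case: ifPn => _; last by rewrite normr0.
    rewrite /= /h /cutoff; have [xb|xb] := leP `|x| b; first by rewrite [ind true * _]mul1r.
    by rewrite mul0r cabs0 normr0.
  apply: inCk_eq_on (hk) => x xI; rewrite /h /cutoff; have [xb|xb] := leP `|x| b.
    by rewrite [ind true * _]mul1r.
  (* Off the ball [g2] is known to vanish only almost everywhere; by continuity a nonzero value
     would persist on an interval. *)
  rewrite mul0r; apply/eqP; rewrite -cabs_eq0; apply: contrapT => /negP n.
  have n0 : 0 < cabs (g2 x) by rewrite lt_def n cabs_ge0.
  have /cvgrPdist_lt/(_ (cabs (g2 x))%:C) := proj2 (inCk0 hk) x xI.
  rewrite ltcR => /(_ n0) /(filterI (filterI (nearI xI) (norm_gt_near xb))) /nbhs_ballP[e /= ep he].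
  have [|y xy e4] := @ae_pick R _ x (x + e) _ e3; first by rewrite ltrDl.
  have : ball x e y by rewrite /ball /= ltr_norml; lra.
  move=> /he /= [[yI yb]]; rewrite e4 // sh // subr0 normC_cabs ltcR ltxx //.
split=> //; apply: continuous_ae_eq => [x|x|].
- have [xI|xb] := in_or_out b0 x; first exact: cphi.
  by apply: (continuousC_near (supp_near sp xb)); exact: continuousC_cst.
- exact: pot_continuous lh sh.
apply: aeS e2 => x e; have [xI|xb] := in_or_out b0 x; first exact: e.
by rewrite sp // (pot_supp lh sh h0 h1) // ltW.
Qed.

End SecondOrder.

(** * Dual spaces *)

Section GradedDual.
Context {R : realType}.
Local Notation C := (complex R).
Variable a : R.
Hypothesis a0 : 0 < a.
Local Notation I := [set` `](- a), a[].

Lemma cvgC_sub0 (u : nat -> C) (v : C) : (fun n => u n - v : C^o) @ \oo --> (0 : C^o) ->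
  (fun n => u n : C^o) @ \oo --> (v : C^o).
Proof.
move=> /cvgrPdist_lt h; apply/cvgrPdist_lt => e e0.
by apply: filterS (h e e0) => n; rewrite sub0r opprB.
Qed.

Lemma pairing_val (E : test_space R) (l : E -> C) (phi : E) : pairing l (val phi) = l phi.
Proof. by rewrite /pairing valK. Qed.

Lemma test_sub (E : test_space R) (f : R -> C) : test_fun E f -> exists phi : E, val phi = f.
Proof. by move=> Ef; exists (Sub f (mem_set Ef)); rewrite SubK. Qed.

Lemma pairing_fun (E : test_space R) (m : (R -> C) -> C) f : test_fun E f ->
  pairing (fun phi : E => m (val phi)) f = m f.
Proof. by move=> /test_sub[phi <-]; rewrite pairing_val. Qed.

(* [bd b f c] stands for "supp f is in [-b, b] and the norm of f is at most c". *)
Record graded (E : test_space R) (bd : R -> (R -> C) -> R -> Prop) : Prop := Graded {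
  graded_lin : forall z f g, test_fun E f -> test_fun E g -> test_fun E (fun x => z * f x + g x);
  graded_fun : forall b f c, 0 < b < a -> bd b f c -> test_fun E f /\ supp_in b f;
  graded_norm : forall b, 0 < b < a -> exists D : R, forall f c, bd b f c ->
    (test_norm E [set` `[(- b)%R, b]] f <= (D * c)%:E)%E;
  graded_bd : forall b f J c, 0 < b < a -> test_fun E f -> compact J -> J `<=` I ->
    (forall x, J x -> `|x| <= b) -> vanishes_off J f -> (test_norm E J f <= c%:E)%E -> bd b f c;
  graded_ex : forall f, test_fun E f -> exists2 b0, 0 < b0 < a &
    forall b, b0 <= b -> b < a -> exists c, bd b f c;
  graded_ge0 : forall J f, (0 <= test_norm E J f)%E }.

Section OneSpace.
Variables (E : test_space R) (bd : R -> (R -> C) -> R -> Prop).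
Hypothesis GE : graded E bd.
Implicit Types l : {ptws E -> C^o}.

Let ballI b : b < a -> [set` `[- b, b]] `<=` I.
Proof. by move=> ba x; rewrite /= !in_itv /=; lra. Qed.

Lemma graded_B f g : test_fun E f -> test_fun E g -> test_fun E (fun x => f x - g x).
Proof.
move=> Ef Eg; have := graded_lin GE (-1) Eg Ef.
by under eq_fun do rewrite mulN1r addrC.
Qed.

Lemma graded_0 f : test_fun E f -> test_fun E (fun=> 0).
Proof. by move=> Ef; have := graded_B Ef Ef; under eq_fun do rewrite subrr. Qed.

Lemma pairing_B l f g : linear_functional l -> test_fun E f -> test_fun E g ->
  pairing l (fun x => f x - g x) = pairing l f - pairing l g.
Proof.
move=> ll Ef Eg; rewrite -[X in X - _]mul1r addrC -mulN1r mul1r -(ll (-1) g f Eg Ef).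
by congr pairing; apply/funext => x; rewrite mulN1r addrC.
Qed.

Lemma dual_cvg0 l b psi c : test_dual I E l -> 0 < b < a -> (forall n, bd b (psi n) (c n)) ->
  c @ \oo --> (0 : R) -> (fun n => pairing l (psi n) : C^o) @ \oo --> (0 : C^o).
Proof.
move=> [ll lc] b0 hb c0; have [b1 ba] := andP b0.
have E0 : test_fun E (fun=> 0) by have [/graded_0] := graded_fun GE b0 (hb 0%N).
have p0 : pairing l (fun=> 0) = 0.
  by have := pairing_B ll E0 E0; under eq_fun do rewrite subrr; rewrite subrr.
rewrite -[X in _ --> X]p0; apply: lc => //; first by move=> n; case: (graded_fun GE b0 (hb n)).
exists [set` `[- b, b]]; split; [exact: segment_compact|exact: ballI| | |] => //.
  by move=> n; apply/vanishes_offE; case: (graded_fun GE b0 (hb n)).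
have [D hD] := graded_norm GE b0.
apply: (@squeeze_cvge _ _ _ _ (fun=> 0%E) _ (fun n => (D * c n)%:E)).
- apply: nearW => n; rewrite (graded_ge0 GE) /=.
  have -> : (fun x => psi n x - 0) = psi n by apply/funext => x; rewrite subr0.
  exact: hD (hb n).
- exact: cvg_cst.
apply/fine_cvgP; split; first exact: nearW.
rewrite -(mulr0 D); apply: cvgM => //; exact: cvg_cst.
Qed.

(** Subtracting the limit reduces sequential continuity to sequences on one fixed ball whose bounds
    tend to 0. *)
Lemma dual_intro l : linear_functional l ->
  (forall b psi c, 0 < b < a -> (forall n, bd b (psi n) (c n)) -> c @ \oo --> (0 : R) ->
    (fun n => pairing l (psi n) : C^o) @ \oo --> (0 : C^o)) -> test_dual I E l.
Proof.
move=> ll hl; split=> // psi psi0 Epsi Epsi0 [J [cJ JI J0 Jn nJ]].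
have [b b0 Jb] := compact_in_ball a0 cJ JI.
(* Extended norms that converge to 0 are finite from some rank [N] on; the sequence is shifted by
   [N] to get real bounds. *)
have /fine_cvgP[[N _ fin] f0] := nJ.
pose c n := fine (test_norm E J (fun x => psi (n + N)%N x - psi0 x)).
have c0 : c @ \oo --> (0 : R) by move: f0; rewrite -(cvg_shiftn N).
have hb n : bd b (fun x => psi (n + N)%N x - psi0 x) (c n).
  apply: (graded_bd GE b0 _ cJ JI Jb); first exact: graded_B.
    by move=> x xJ; rewrite Jn // J0 // subrr.
  by rewrite /c fineK //; apply: fin; exact: leq_addl.
have := hl b _ c b0 hb c0.
have EB n : pairing l (fun x => psi (n + N)%N x - psi0 x) = pairing l (psi (n + N)%N) - pairing l psi0.
  exact: pairing_B.
rewrite (funext EB) => h.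
rewrite -(cvg_shiftn N (fun n => pairing l (psi n) : C^o)).
exact: cvgC_sub0.
Qed.

(** A constant sequence with bound 0 converges to 0, so a continuous functional does not see
    differences of norm 0. This makes its values independent of representatives. *)
Lemma dual_eq l b f g : test_dual I E l -> 0 < b < a -> test_fun E f -> test_fun E g ->
  supp_in b f -> supp_in b g ->
  test_norm E [set` `[(- b)%R, b]] (fun x => f x - g x) = 0%E -> pairing l f = pairing l g.
Proof.
move=> hl b0 Ef Eg sf sg N0; have [b1 ba] := andP b0.
have hb : bd b (fun x => f x - g x) 0.
  apply: (graded_bd GE b0 _ (@segment_compact _ (- b) b) (ballI ba)).
  - exact: graded_B.
  - by move=> x /=; rewrite in_itv /= -norm_itv.
  - by apply/vanishes_offE => x xb; rewrite sf // sg // subrr.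
  - by rewrite N0.
have hz : (fun _ : nat => 0 : R) @ \oo --> (0 : R) by exact: cvg_cst.
have h0 := @dual_cvg0 l b (fun=> _) (fun=> 0) hl b0 (fun=> hb) hz.
have hc : (fun _ : nat => pairing l (fun x => f x - g x) : C^o) @ \oo --> (pairing l (fun x => f x - g x) : C^o).
  exact: cvg_cst.
have := cvg_unique (@norm_hausdorff _ C^o) hc h0.
rewrite (pairing_B (proj1 hl)) // => /(_ _) e; apply/eqP; rewrite -subr_eq0; apply/eqP; exact: e.

Qed.

End OneSpace.

(** Composition with a linear map that is bounded on each ball preserves continuity. The map is a
    relation [Rl], since inverses and second derivatives are given by representatives and not by
    explicit formulas. *)
Lemma dual_transfer (E E' : test_space R) bd bd' (l : {ptws E' -> C^o}) (m : {ptws E -> C^o})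
    (Rl : R -> (R -> C) -> (R -> C) -> Prop) :
  graded E bd -> graded E' bd' -> test_dual I E' l ->
  (forall b, 0 < b < a -> exists D : R, forall f c, bd b f c -> exists2 g, Rl b f g & bd' b g (D * c)) ->
  (forall b z f g f' g', 0 < b < a -> Rl b f f' -> Rl b g g' ->
    Rl b (fun x => z * f x + g x) (fun x => z * f' x + g' x)) ->
  (forall b f f', 0 < b < a -> Rl b f f' -> test_fun E f -> test_fun E' f' ->
    pairing m f = pairing l f') ->
  test_dual I E m.
Proof.
move=> GE GE' hl hD hlin hm; apply: (dual_intro GE) => [z f g Ef Eg|b psi c b0 hb c0].
  have [b1 b10 h1] := graded_ex GE Ef; have [b2 b20 h2] := graded_ex GE Eg.
  pose b := Num.max b1 b2.
  have b0 : 0 < b < a by rewrite /b; case: (leP b1 b2).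
  have ba : b < a by case/andP: b0.
  have [c1 fc1] : exists c, bd b f c by apply: h1 => //; rewrite le_max lexx.
  have [c2 gc2] : exists c, bd b g c by apply: h2 => //; rewrite le_max lexx orbT.
  have [D hDb] := hD b b0.
  have [f' ff' /(graded_fun GE' b0)[Ef' _]] := hDb _ _ fc1.
  have [g' gg' /(graded_fun GE' b0)[Eg' _]] := hDb _ _ gc2.
  rewrite (hm b _ _ b0 (hlin b z _ _ _ _ b0 ff' gg')); last 2 first.
  - exact: (graded_lin GE).
  - exact: (graded_lin GE').
  rewrite (hm b _ _ b0 ff') // (hm b _ _ b0 gg') //; exact: (proj1 hl).
have [D hDb] := hD b b0.
have /choice[psi' hpsi'] : forall n, exists g, Rl b (psi n) g /\ bd' b g (D * c n).
  by move=> n; have [g h1 h2] := hDb _ _ (hb n); exists g.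
have E1 n : pairing m (psi n) = pairing l (psi' n).
  have [h1 h2] := hpsi' n; apply: hm h1 _ _ => //; first by case: (graded_fun GE b0 (hb n)).
  by case: (graded_fun GE' b0 h2).
rewrite (funext E1); apply: (dual_cvg0 GE' (c := fun n => D * c n) hl b0).
  by move=> n; case: (hpsi' n).
by rewrite -(mulr0 D); apply: cvgM => //; exact: cvg_cst.
Qed.

End GradedDual.

(** * The topology of pointwise convergence *)

Section Pointwise.

Lemma ptws_continuous (X : topologicalType) (U : Type) (V : topologicalType) (f : X -> {ptws U -> V}) :
  (forall u, continuous (fun x => f x u)) -> continuous f.
Proof.
move=> cf x; apply/cvg_sup => u; apply/cvg_image.
  by rewrite eqEsubset; split=> v // _; exists (cst v).
move=> W nW; have := cf u x W nW => h; exists (@^~ u @^-1` W) => //.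
by rewrite eqEsubset; split => [j [? + <-//]|j Wj]; exists (fun _ => j).
Qed.

Lemma ptws_eval_continuous (U : choiceType) (V : topologicalType) (u : U) :
  continuous (fun l : {ptws U -> V} => l u).
Proof. exact: (@proj_continuous U (fun=> V) u). Qed.

End Pointwise.

(** * The operator and its inverse on functionals *)

Section TransmutedDual.
Context {R : realType}.
Local Notation C := (complex R).
Local Notation mu := (@lebesgue_measure R).
Variables (a : R) (q : R -> C) (H : R * R -> C).
Hypothesis a0 : 0 < a.
Hypothesis HG : goursat_solution a q H.
Local Notation I := [set` `](- a), a[].
Local Notation K := (kernel_of H).
Local Notation tT := (transmutT a K).
Local Notation T b := (TopT b (Hc b H)).

Lemma transmutT_ball b psi : 0 < b < a -> L1 psi -> supp_in b psi -> tT psi = T b psi.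
Proof. by move=> b0 lp sp; apply/funext => x; exact: (transmutTE b0 HG x lp sp). Qed.

Lemma transmutT_inj b b' psi psi' : 0 < b < a -> 0 < b' < a -> L1 psi -> supp_in b psi ->
  L1 psi' -> supp_in b' psi' -> tT psi = tT psi' -> psi = psi'.
Proof.
move=> b0 b0' lp sp lp' sp' E; pose d := Num.max b b'.
have d0 : 0 < d < a by rewrite /d; case: (leP b b').
have sd : supp_in d psi by move=> x; rewrite gt_max => /andP[h _]; exact: sp.
have sd' : supp_in d psi' by move=> x; rewrite gt_max => /andP[_ h]; exact: sp'.
have lB : L1 (fun x => -1 * psi' x + psi x) by apply: L1D => //; exact: L1Z.
have sB : supp_in d (fun x => -1 * psi' x + psi x) by move=> x xd; rewrite sd // sd' // mulr0 addr0.
have : T d (fun x => -1 * psi' x + psi x) = fun=> 0.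
  rewrite (ball_lin d0 HG) // -(transmutT_ball d0 lp sd) -(transmutT_ball d0 lp' sd') E.
  by apply/funext => x; rewrite mulN1r addNr.
move=> /(ball_injective d0 HG lB sB) Z; apply/funext => x; apply/eqP; rewrite -subr_eq0; apply/eqP.
by have := congr1 (fun g => g x) Z; rewrite /= mulN1r addrC.
Qed.

(** Chosen without reference to a ball; injectivity across balls makes the choice agree with the
    inverse on each of them. *)
Definition inverseT (f : R -> C) : R -> C := xget (fun=> 0)
  [set psi | [/\ L1 psi, exists2 b, 0 < b < a & supp_in b psi & tT psi = f]].

Lemma inverseTK b psi : 0 < b < a -> L1 psi -> supp_in b psi -> inverseT (tT psi) = psi.
Proof.
move=> b0 lp sp; have [|l1 [b' b0' s'] E] := @xgetPex _ (fun=> 0)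
    [set psi' | [/\ L1 psi', exists2 b, 0 < b < a & supp_in b psi' & tT psi' = tT psi]].
  by exists psi; split=> //; exists b.
exact: transmutT_inj b0' b0 l1 s' lp sp E.
Qed.

Section Space.
Variables (E : test_space R) (bd : R -> (R -> C) -> R -> Prop).
Hypothesis GE : graded a E bd.
Hypothesis bd_L1 : forall b f c, 0 < b < a -> bd b f c -> L1 f.
Hypothesis bd_T : forall b, 0 < b < a -> exists D : R, forall f c, bd b f c -> bd b (T b f) (D * c).
Hypothesis bd_R : forall b, 0 < b < a -> exists D : R, forall f c, bd b f c ->
  exists psi, [/\ L1 psi, supp_in b psi, T b psi = f & bd b psi (D * c)].

Lemma graded_pick f : test_fun E f -> exists b c, [/\ 0 < b < a, bd b f c, L1 f & supp_in b f].
Proof.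
move=> Ef; have [b b0 h] := graded_ex GE Ef; have [b1 ba] := andP b0.
have [c fc] := h b (lexx _) ba; have [_ sf] := graded_fun GE b0 fc.
by exists b, c; split=> //; exact: bd_L1 fc.
Qed.

Lemma transmutT_test f : test_fun E f -> test_fun E (tT f).
Proof.
move=> /graded_pick[b [c [b0 fc lf sf]]]; rewrite (transmutT_ball b0) //.
by have [D /(_ _ _ fc) /(graded_fun GE b0)[]] := bd_T b0.
Qed.

Lemma inverseT_test f : test_fun E f -> [/\ test_fun E (inverseT f), tT (inverseT f) = f & inverseT (tT f) = f].
Proof.
move=> /graded_pick[b [c [b0 fc lf sf]]].
have [D /(_ _ _ fc) [psi [lp sp TE pc]]] := bd_R b0.
have E1 : tT psi = f by rewrite (transmutT_ball b0).
have [Ep _] := graded_fun GE b0 pc.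
rewrite -{1 2}E1 (inverseTK b0 lp sp) (inverseTK b0 lf sf); by split.
Qed.

Definition inverse_dual (l : {ptws E -> C^o}) : {ptws E -> C^o} :=
  fun phi => pairing l (inverseT (val phi)).

Lemma transmut_dual_dual l : test_dual I E l -> test_dual I E (transmut_dual a K l).
Proof.
move=> hl; apply: (@dual_transfer _ a a0 E E bd bd l _ (fun b f g => [/\ L1 f, supp_in b f & g = T b f]) GE GE hl).
- move=> b b0; have [D hD] := bd_T b0; exists D => f c fc; exists (T b f); last exact: hD.
  by have [_ sf] := graded_fun GE b0 fc; split=> //; exact: bd_L1 fc.
- move=> b z f g f' g' b0 [lf sf ->] [lg sg ->]; split.
  + by apply: L1D => //; exact: L1Z.
  + by move=> x xb; rewrite sf // sg // mulr0 addr0.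
  + by rewrite (ball_lin b0 HG).
- move=> b f f' b0 [lf sf ->] Ef _.
  by rewrite (pairing_fun (fun f => pairing l (tT f))) // (transmutT_ball b0).
Qed.

Lemma inverse_dual_dual l : test_dual I E l -> test_dual I E (inverse_dual l).
Proof.
move=> hl; apply: (@dual_transfer _ a a0 E E bd bd l _ (fun b f g => [/\ L1 g, supp_in b g & T b g = f]) GE GE hl).
- move=> b b0; have [D hD] := bd_R b0; exists D => f c /hD[psi [h1 h2 h3 h4]].
  by exists psi.
- move=> b z f g f' g' b0 [lf sf <-] [lg sg <-]; split.
  + by apply: L1D => //; exact: L1Z.
  + by move=> x xb; rewrite sf // sg // mulr0 addr0.
  + by rewrite (ball_lin b0 HG).
- move=> b f f' b0 [lf sf fE] Ef _.
  rewrite (pairing_fun (fun f => pairing l (inverseT f))) //.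
  by rewrite -fE -(transmutT_ball b0 lf sf) (inverseTK b0 lf sf).
Qed.

(** Pointwise convergence involves only the evaluation at [G (val phi)]; if that function is outside
    [E], the pairing is the constant 0. *)
Lemma continuous_pairing (G : (R -> C) -> (R -> C)) :
  continuous (fun l : {ptws E -> C^o} => (fun phi => pairing l (G (val phi))) : {ptws E -> C^o}).
Proof.
apply: ptws_continuous => phi; rewrite /pairing; case: (insub _) => [psi|] /=.
  exact: ptws_eval_continuous.
exact: cst_continuous.
Qed.

Lemma transmut_dual_invertible : continuous_invertible I (@transmut_dual R a K E).
Proof.
split; [by move=> l; exact: transmut_dual_dual|apply: continuous_subspaceT; exact: (@continuous_pairing tT)|].
exists inverse_dual; split.
- by move=> l; exact: inverse_dual_dual.
- by apply: continuous_subspaceT; exact: (@continuous_pairing inverseT).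
- move=> l hl; apply/funext => phi; rewrite /inverse_dual.
  have Ephi : test_fun E (val phi) := set_mem (valP phi).
  have [Ei Ti iT] := inverseT_test Ephi.
  rewrite (pairing_fun (fun f => pairing l (tT f))) // Ti; exact: pairing_val.
- move=> l hl; apply/funext => phi; rewrite /transmut_dual.
  have Ephi : test_fun E (val phi) := set_mem (valP phi).
  have [Ei Ti iT] := inverseT_test Ephi.
  rewrite (pairing_fun (fun f => pairing l (inverseT f))) ?iT; last exact: transmutT_test.
  exact: pairing_val.
Qed.

(** For a functional given by [f] the transposition formula is Fubini on the ball. The product
    [f * phi] is integrable by assumption; the kernel terms are integrable because each integral
    operator produces a bounded function. *)
Lemma transmut_dual_extends : extends_to_functionals a K I E.
Proof.
split; first exact: transmutT_test.
move=> f floc fE; apply/funext => phi.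
have Ephi : test_fun E (val phi) := set_mem (valP phi).
set ph := val phi in Ephi; have [b [c [b0 fc lp sp]]] := graded_pick Ephi.
have [b1 ba] := andP b0; have bn := ltW b1.
have BI : [set` `[- b, b]] `<=` I by move=> x; rewrite /= !in_itv /=; lra.
have locf : L1 (cutoff b f).
  exact: (@inFloc_locL1 R a (Lp 1%E (lexx _)) f floc b b0).
have cutE (u g : R -> C) : supp_in b g -> (fun x => cutoff b u x * g x) = (fun x => u x * g x).
  move=> sg; apply/funext => x; have [xb|/sg ->] := leP `|x| b; last by rewrite !mulr0.
  by rewrite /cutoff xb [ind true * _]mul1r.
have [M hM] := Hc_bounded b0 HG; have kM := tker_bound b hM; have mk := cmf_tker b (cmf_Hc b0 HG).
set k := tker b (Hc b H) in kM mk.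
have sT : supp_in b (T b ph) by exact: TopT_supp.
have sk : supp_in b (kopT k ph) by exact: kopT_supp.
have lfp : L1 (fun x => f x * ph x).
  have [g lg gE] := inLp1_L1 a0 (fE _ Ephi).
  suff -> : (fun x => f x * ph x) = fun x => ind (- b <= x <= b) * g x.
    by apply: L1bool => //; meas.
  apply/funext => x; rewrite -norm_itv; have [xb|/sp ->] := leP `|x| b; last by rewrite mulr0 mul0r.
  by rewrite mul1r gE //; apply: BI; rewrite /= in_itv /= -norm_itv.
have lkf := kop_L1 bn mk kM locf.
have E1 : regular I f = (fun phi : E => cint I (fun x => f x * val phi x)) by [].
have -> : transmut_dual a K (regular I f) phi = Int (fun x => f x * T b ph x).
  rewrite /transmut_dual E1 (pairing_fun (fun g => cint I (fun x => f x * g x))); last exact: transmutT_test.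
  rewrite -/ph (transmutT_ball b0 lp sp) (cint_supp ba) // => x xb; by rewrite sT // mulr0.
have -> : regular I (transmut K f) phi = Int (fun x => Top b (Hc b H) (cutoff b f) x * ph x).
  rewrite /regular -/ph (cint_supp ba); last by move=> x xb; rewrite sp // mulr0.
  congr Int; apply/funext => x; have [xb|/sp ->] := leP `|x| b; last by rewrite !mulr0.
  by rewrite (transmutE b0 HG locf xb) Top_cutoff.
have l1 : L1 (fun x => f x * kopT k ph x).
  rewrite -(cutE f) //; under eq_fun do rewrite mulrC.
  apply: (L1Mb (M := M * \int[mu]_x cabs (ph x))) => //; first exact: L1_cmf (kopT_L1 bn mk kM lp).
  move=> x; apply: le_trans (kopT_le bn mk kM x lp) _; rewrite ler_wpM2r ?ler_piMr ?ind_le1 //.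
    by apply: Rintegral_ge0 => r _; exact: cabs_ge0.
  by apply: le_trans (hM 0 0); exact: cabs_ge0.
have D := kop_dual bn mk kM lp locf.
have l2 : L1 (fun x => kop k (cutoff b f) x * ph x).
  apply: (L1Mb (M := M * \int[mu]_x cabs (cutoff b f x))) => //; first exact: L1_cmf lkf.
  move=> x; apply: le_trans (kop_le bn mk kM x locf) _.
  rewrite ler_wpM2l //; first by apply: le_trans (hM 0 0); exact: cabs_ge0.
  have mc := L1_cmf locf; have lc := L1_cabs locf.
  have le1 t : ind (`|t| <= `|x| <= b) * cabs (cutoff b f t) <= cabs (cutoff b f t).
    by rewrite ler_piMl ?cabs_ge0 ?ind_le1.
  apply: Rint_le => //; apply: (rL1_dom _ _ lc); first by meas.
  by move=> t; rewrite ger0_norm ?mulr_ge0 ?cabs_ge0.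
transitivity (Int (fun x => f x * ph x) + Int (fun x => f x * kopT k ph x)).
  by rewrite -(IntD lfp l1); congr Int; apply/funext => x; rewrite /TopT mulrDr.
transitivity (Int (fun x => f x * ph x) + Int (fun x => kop k (cutoff b f) x * ph x)).
  congr (_ + _); transitivity (Int (fun x => kopT k ph x * cutoff b f x)).
    by congr Int; rewrite -(cutE f) //; apply/funext => x; rewrite mulrC.
  by rewrite -D; congr Int; apply/funext => x; rewrite mulrC.
rewrite -(IntD lfp l2); congr Int; apply/funext => x; rewrite /Top mulrDl; congr (_ + _).
exact: (congr1 (fun g => g x) (esym (cutE f ph sp))).
Qed.

End Space.
End TransmutedDual.

(** * The two test spaces and the transmutation identity *)

Section Instances.
Context {R : realType}.
Local Notation C := (complex R).
Local Notation mu := (@lebesgue_measure R).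
Variables (a : R) (F : fspace R).
Hypothesis a0 : 0 < a.
Local Notation I := [set` `](- a), a[].

Lemma graded_Fc : graded a (Fc I F) (bounded_in F).
Proof.
split.
- move=> z f g Ef Eg; have [b1 b10 sf] := Fc_ball a0 Ef; have [b2 b20 sg] := Fc_ball a0 Eg.
  have [c1 fc] := Fc_ex_bounded b10 Ef sf; have [c2 gc] := Fc_ex_bounded b20 Eg sg.
  have b0 : 0 < Num.max b1 b2 < a by case: (leP b1 b2).
  have h1 : bounded_in F (Num.max b1 b2) f c1 by apply: bounded_in_mono fc; rewrite ?le_max ?lexx.
  have h2 : bounded_in F (Num.max b1 b2) g c2 by apply: bounded_in_mono gc; rewrite ?le_max ?lexx ?orbT.
  by case: (bounded_in_Fc b0 (bounded_inD (bounded_inZ z h1) h2)).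
- by move=> b f c b0 fc; have [Ef _] := bounded_in_Fc b0 fc; split=> //; exact: bounded_in_supp fc.
- by move=> b b0; exists 1 => f c /(bounded_in_Fc b0)[_]; rewrite mul1r.
- by move=> b f J c b0 Ef cJ JI Jb fJ; exact: (Fc_bounded_in b0 Ef cJ fJ Jb).
- move=> f Ef; have [b b0 sf] := Fc_ball a0 Ef; exists b => // b' bb ba.
  have b0' : 0 < b' < a by rewrite (lt_le_trans _ bb) //; case/andP: b0.
  by apply: (Fc_ex_bounded b0' Ef) => x /(le_lt_trans bb); exact: sf.
- move=> J f; rewrite /= /normF; case: F => [p p1|k]; first exact: Lnorm_ge0.
  exact: bigmax_ge_id.
Qed.

(** On a fixed ball the norm of W^2 is equivalent to the norm in [F] of the second derivative,
    because [phi] is the potential of [h]; only the latter is recorded. *)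
Definition potential_bd b (phi : R -> C) (c : R) : Prop :=
  exists2 h, potential_of b phi h & bounded_in F b h c.

Lemma potential_ofD b z (phi psi h m : R -> C) : potential_of b phi h -> potential_of b psi m ->
  potential_of b (fun x => z * phi x + psi x) (fun x => z * h x + m x).
Proof.
move=> [lh sh h0 h1 ->] [lm sm m0 m1 ->].
have lhx : L1 (fun x => h x * x%:C) by exact: L1_mulid lh sh.
have lmx : L1 (fun x => m x * x%:C) by exact: L1_mulid lm sm.
split.
- by apply: L1D => //; exact: L1Z.
- by move=> x xb; rewrite sh // sm // mulr0 addr0.
- by rewrite IntD ?IntZ // ?h0 ?m0 ?mulr0 ?addr0 //; exact: L1Z.
- have -> : (fun x => (z * h x + m x) * x%:C) = fun x => z * (h x * x%:C) + m x * x%:C.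
    by apply/funext => x; rewrite mulrDl mulrA.
  by rewrite IntD ?IntZ // ?h1 ?m1 ?mulr0 ?addr0 //; exact: L1Z.
apply/funext => x; have p1 := pot_integrand lh sh x; have p2 := pot_integrand lm sm x.
rewrite /pot -IntZ // -(IntD (L1Z z p1) p2); congr Int; apply/funext => r; ring.
Qed.

Lemma W2c_ball phi : test_fun (W2c I F) phi -> exists2 b, 0 < b < a & supp_in b phi.
Proof. by move=> [_ /(compact_support_ball a0)]. Qed.

Lemma graded_W2c : graded a (W2c I F) potential_bd.
Proof.
split.
- move=> z f g Ef Eg; have [b1 b10 sf] := W2c_ball Ef; have [b2 b20 sg] := W2c_ball Eg.
  have b0 : 0 < Num.max b1 b2 < a by case: (leP b1 b2).
  have sf' : supp_in (Num.max b1 b2) f by move=> x; rewrite gt_max => /andP[h _]; exact: sf.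
  have sg' : supp_in (Num.max b1 b2) g by move=> x; rewrite gt_max => /andP[_ h]; exact: sg.
  have [h ph hF] := W2c_potential a0 b0 Ef sf'; have [m pm mF] := W2c_potential a0 b0 Eg sg'.
  apply: (potential_W2c a0 b0 (potential_ofD z ph pm)); exact: (graded_lin graded_Fc).
- move=> b phi c b0 [h ph hc]; have [hF _] := bounded_in_Fc b0 hc.
  split; first exact: (potential_W2c a0 b0 ph hF).
  exact: potential_supp ph.
- move=> b b0; have [D D0 hD] := potential_normW2 F a0 b0; exists D => f c [h ph hc]; exact: hD hc.
- move=> b phi J c b0 Ep cJ JI Jb pJ Nc.
  have sp : supp_in b phi by move=> x xb; apply: pJ => /Jb; rewrite leNgt xb.
  have [h ph hF] := W2c_potential a0 b0 Ep sp; exists h => //.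
  exact: (potential_bounded a0 b0 ph hF cJ JI Jb pJ Nc).
- move=> phi Ep; have [b b0 sp] := W2c_ball Ep; exists b => // b' bb ba.
  have b0' : 0 < b' < a by rewrite (lt_le_trans _ bb) //; case/andP: b0.
  have sp' : supp_in b' phi by move=> x /(le_lt_trans bb); exact: sp.
  have [h ph hF] := W2c_potential a0 b0' Ep sp'.
  have sh : supp_in b' h by case: ph.
  by have [c hc] := Fc_ex_bounded b0' hF sh; exists c; exists h.
- move=> J f; rewrite /= /normW2 !adde_ge0 ?Lnorm_ge0 //; exact: (graded_ge0 graded_Fc).
Qed.

Variables (q : R -> C) (H : R * R -> C).
Hypothesis hq : inFloc I F q.
Hypothesis HG : goursat_solution a q H.
Local Notation T b := (TopT b (Hc b H)).
Local Notation tT := (transmutT a (kernel_of H)).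

Let lq := inFloc_locL1 hq.

Lemma Fc_bd_L1 b f c : 0 < b < a -> bounded_in F b f c -> L1 f.
Proof.
by move=> /andP[/ltW bn _] fc; have [D _ /(_ _ _ fc)[]] := bounded_in_L1 F bn.
Qed.

Lemma Fc_bd_T b : 0 < b < a -> exists D : R, forall f c, bounded_in F b f c -> bounded_in F b (T b f) (D * c).
Proof. by move=> b0; have [D _ hD] := bounded_inT b0 hq HG; exists D. Qed.

Lemma Fc_bd_R b : 0 < b < a -> exists D : R, forall f c, bounded_in F b f c ->
  exists psi, [/\ L1 psi, supp_in b psi, T b psi = f & bounded_in F b psi (D * c)].
Proof.
move=> b0; have [D _ hD] := bounded_in_inverse b0 hq HG; exists D => f c fc.
have [E _ inv] := ball_inverse b0 HG.
have [[psi [lp sp TE]] _] := inv f (Fc_bd_L1 b0 fc) (bounded_in_supp fc).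
by exists psi; split=> //; exact: (hD psi f).
Qed.

Lemma potential_bd_L1 b phi c : 0 < b < a -> potential_bd b phi c -> L1 phi.
Proof. by move=> b0 [h ph _]; have [] := potential_L1 b0 ph. Qed.

(* The second derivative of [T phi] is [T (phi'' - q phi)]. *)
Lemma potential_transmutT b phi h : 0 < b < a -> potential_of b phi h ->
  potential_of b (T b phi) (T b (fun x => h x - q x * phi x)).
Proof.
move=> b0 [lh sh h0 h1 ->].
by have [m1 m2 m3 m4 m5] := ball_pot b0 HG (lq b0) lh sh h0 h1.
Qed.

Lemma mul_potential_bd b : 0 < b < a -> exists D : R, forall phi h c, potential_of b phi h ->
  bounded_in F b h c -> bounded_in F b (fun x => q x * phi x) (D * c).
Proof.
move=> b0; have [D1 _ h1] := multiplier_in_pot F b0; have [D2 _ h2] := bounded_in_mul b0 hq.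
by exists (D2 * D1) => phi h c [lh sh e0 e1 ->] hc; rewrite -mulrA; apply: h2; exact: h1.
Qed.

Lemma potential_bd_T b : 0 < b < a -> exists D : R, forall phi c, potential_bd b phi c ->
  potential_bd b (T b phi) (D * c).
Proof.
move=> b0; have [D1 h1] := mul_potential_bd b0; have [D2 h2] := Fc_bd_T b0.
exists (D2 * (1 + D1)) => phi c [h ph hc]; exists (T b (fun x => h x - q x * phi x)).
  exact: potential_transmutT.
by rewrite -mulrA mulrDl mul1r; apply: h2; apply: bounded_inB => //; exact: h1 ph hc.
Qed.

Lemma potential_bd_R b : 0 < b < a -> exists D : R, forall phi c, potential_bd b phi c ->
  exists psi, [/\ L1 psi, supp_in b psi, T b psi = phi & potential_bd b psi (D * c)].
Proof.
move=> b0; have [D1 h1] := Fc_bd_R b0; have [D2 _ h2] := multiplier_in_pot F b0.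
have [D3 _ h3] := multiplier_in_inverse b0 hq HG; have [D4 _ h4] := bounded_in_mul b0 hq.
have [E _ inv] := ball_inverse b0 HG.
(* [D1] bounds the preimage [m] of [h], [D2] bounds [phi] as a multiplier, [D3] its preimage [psi],
   and [D4] multiplication by [q]; the second derivative is [m + q * psi]. *)
exists (D1 + D4 * (D3 * D2)) => phi c [h ph hc].
have [lp _] := potential_L1 b0 ph; have sp := potential_supp ph.
have [[psi [lpsi spsi TE]] _] := inv phi lp sp.
have [m [lm sm mE mc]] := h1 h c hc.
have [lh sh e0 e1 pE] := ph; rewrite pE in TE.
have [g1 g2 g3 g4 g5] := ball_inverse_pot b0 HG (lq b0) lh sh e0 e1 lpsi spsi TE lm sm mE.
exists psi; split=> //; first by rewrite TE.
exists (fun x => m x + q x * psi x) => //.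
rewrite mulrDl; apply: bounded_inD => //; rewrite -mulrA -mulrA; apply: h4.
by apply: (h3 psi (pot h)) => //; exact: h2.
Qed.

Let Fc_dual := transmut_dual_dual a0 HG graded_Fc Fc_bd_L1 Fc_bd_T.

(** [dual_eq] and the uniqueness of weak derivatives allow the second derivative of a functional to
    be computed with any representative [h]. *)
Lemma dual_deriv2_pairing (u : {ptws Fc I F -> C^o}) b phi h : test_dual I (Fc I F) u ->
  0 < b < a -> potential_of b phi h -> test_fun (Fc I F) h ->
  pairing u (wderiv2 I F phi) = pairing u h.
Proof.
move=> hu b0 ph hF; have [_ wF wh] := potential_wderiv2 a0 b0 ph hF.
have [b1 b10 sw] := Fc_ball a0 wF; have [lh sh _ _ _] := ph.
pose d := Num.max b b1.
have d0 : 0 < d < a by rewrite /d; case: (leP b b1).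
apply: (dual_eq graded_Fc hu d0 wF hF).
- by move=> x; rewrite gt_max => /andP[_]; exact: sw.
- by move=> x; rewrite gt_max => /andP[h' _]; exact: sh.
have [N0 _] := Fc_ae_eq a0 wF hF wh; apply: N0; exact: measurable_itv.
Qed.

Lemma dual_deriv2_dual u : test_dual I (Fc I F) u -> test_dual I (W2c I F) (dual_deriv2 u).
Proof.
move=> hu; apply: (@dual_transfer _ a a0 _ _ potential_bd (bounded_in F) u _ (@potential_of R) graded_W2c graded_Fc hu).
- by move=> b b0; exists 1 => phi c [h ph hc]; exists h => //; rewrite mul1r.
- by move=> b z f g f' g' b0; exact: potential_ofD.
- move=> b phi h b0 ph Ep hF.
  by rewrite (pairing_fun (fun phi => pairing u (wderiv2 I F phi))) // (dual_deriv2_pairing hu b0 ph hF).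
Qed.

Lemma dual_mul_dual u : test_dual I (Fc I F) u -> test_dual I (W2c I F) (dual_mul q u).
Proof.
move=> hu; apply: (@dual_transfer _ a a0 _ _ potential_bd (bounded_in F) u _
  (fun b phi g => g = fun x => q x * phi x) graded_W2c graded_Fc hu).
- move=> b b0; have [D hD] := mul_potential_bd b0; exists D => phi c [h ph hc].
  by exists (fun x => q x * phi x) => //; exact: hD ph hc.
- by move=> b z f g f' g' b0 -> ->; apply/funext => x; ring.
- by move=> b phi g b0 -> Ep _; rewrite (pairing_fun (fun phi => pairing u (fun x => q x * phi x))).
Qed.

(** Both sides are values of [u]: the left one at [T' h - T' (q phi)], the right one at the chosen
    second derivative of [T' phi], which [potential_transmutT] and [dual_deriv2_pairing] replace by
    [T' (h - q phi)]. *)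
Lemma transmutation u (phi : W2c I F) : test_dual I (Fc I F) u ->
  dual_deriv2 (transmut_dual a (kernel_of H) u) phi
    - dual_mul q (transmut_dual a (kernel_of H) u) phi
  = transmut_dual a (kernel_of H) (dual_deriv2 u) phi.
Proof.
move=> hu; have hTu := Fc_dual hu.
have Ephi : test_fun (W2c I F) (val phi) := set_mem (valP phi).
set ph := val phi in Ephi.
have [b b0 sp] := W2c_ball Ephi; have [h hp hF] := W2c_potential a0 b0 Ephi sp.
have [lp _] := potential_L1 b0 hp; have [lh sh _ _ _] := hp.
have [c hc] := Fc_ex_bounded b0 hF sh.
have [D /(_ _ _ _ hp hc) /(bounded_in_Fc b0)[qF _]] := mul_potential_bd b0.
have sq : supp_in b (fun x => q x * ph x) by move=> x xb; rewrite sp // mulr0.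
have lqp := Fc_L1 a0 qF.
have T_Fc := transmutT_test HG graded_Fc Fc_bd_L1 Fc_bd_T.
have TE g : test_fun (Fc I F) g -> pairing (transmut_dual a (kernel_of H) u) g = pairing u (tT g).
  by move=> gF; rewrite (pairing_fun (fun g => pairing u (tT g))).
have -> : dual_deriv2 (transmut_dual a (kernel_of H) u) phi = pairing u (tT h).
  by rewrite /dual_deriv2 (dual_deriv2_pairing hTu b0 hp hF) TE.
have -> : dual_mul q (transmut_dual a (kernel_of H) u) phi = pairing u (tT (fun x => q x * ph x)).
  by rewrite /dual_mul TE.
have Tp := potential_transmutT b0 hp.
have EB : T b (fun x => h x - q x * ph x) = fun x => tT h x - tT (fun x => q x * ph x) x.
  rewrite (transmutT_ball HG b0 lh sh) (transmutT_ball HG b0 lqp sq).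
  have := ball_lin b0 HG (-1) lqp lh; rewrite (_ : (fun x => -1 * _ + _) = fun x => h x - q x * ph x); last first.
    by apply/funext => x; rewrite mulN1r addrC.
  by move=> ->; apply/funext => x; rewrite mulN1r addrC.
have TF : test_fun (Fc I F) (T b (fun x => h x - q x * ph x)).
  by rewrite EB; apply: (graded_B graded_Fc); exact: T_Fc.
rewrite /transmut_dual.
have EW : test_fun (W2c I F) (tT ph).
  by rewrite (transmutT_ball HG b0 lp sp); exact: (potential_W2c a0 b0 Tp TF).
rewrite (pairing_fun (fun phi => pairing u (wderiv2 I F phi))) //.
rewrite (transmutT_ball HG b0 lp sp) (dual_deriv2_pairing hu b0 Tp TF) EB.
exact: esym (pairing_B (proj1 hu) (T_Fc _ hF) (T_Fc _ qF)).
Qed.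

End Instances.

Local Close Scope complex_scope.

Theorem proposition30 (R : realType) (a : R) (F : fspace R)
    (q : R -> complex R) (H : R * R -> complex R) :
  let I : set R := [set` `](- a), a[] in
  let K := kernel_of H in
  0 < a -> inFloc I F q -> goursat_solution a q H ->
  [/\ extends_to_functionals a K I (W2c I F) /\
      extends_to_functionals a K I (Fc I F),
      continuous_invertible I (@transmut_dual R a K (W2c I F)),
      continuous_invertible I (@transmut_dual R a K (Fc I F))
    & forall u, test_dual I (Fc I F) u ->
      [/\ test_dual I (W2c I F) (dual_deriv2 u) /\
          test_dual I (W2c I F) (dual_deriv2 (transmut_dual a K u)),
          test_dual I (W2c I F) (dual_mul q (transmut_dual a K u))
        & forall phi : W2c I F,
            dual_deriv2 (transmut_dual a K u) phi
              - dual_mul q (transmut_dual a K u) phi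
            = transmut_dual a K (dual_deriv2 u) phi]].
Proof.
move=> I K a0 hq HG.
have GF := graded_Fc F a0; have GW := graded_W2c F a0.
have TF := Fc_bd_T hq HG; have RF := Fc_bd_R hq HG.
have TW := potential_bd_T hq HG; have RW := potential_bd_R hq HG.
have LF := @Fc_bd_L1 R a F; have LW := @potential_bd_L1 R a F.
split.
- split; [apply: (transmut_dual_extends a0 HG GW); [exact: LW|exact: TW]|].
  by apply: (transmut_dual_extends a0 HG GF); [exact: LF|exact: TF].
- by apply: (transmut_dual_invertible a0 HG GW); [exact: LW|exact: TW|exact: RW].
- by apply: (transmut_dual_invertible a0 HG GF); [exact: LF|exact: TF|exact: RF].
move=> u hu; have hTu := transmut_dual_dual a0 HG GF LF TF hu.
split.
- by split; [exact: (dual_deriv2_dual a0 hu)|exact: (dual_deriv2_dual a0 hTu)].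
- exact: (dual_mul_dual a0 hq hTu).
by move=> phi; exact: (transmutation a0 hq HG phi hu).
Qed.
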